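(* Let $\mathbb{H}^n$ be the Heisenberg group with homogeneous dimension $Q=2n+2$, let $\alpha$ be an even integer with $0<\alpha<Q$, and let $p\ge1$. Put $$A_\alpha=\frac1Q\int_\Sigma|g_\alpha(\theta)|^{\frac Q{Q-\alpha}}dx^*.$$ There exists a constant $C$ such that for every $u\in W^{\alpha,\frac Q\alpha,p}(\mathbb{H}^n)$ with $\|\mathcal{L}^{\alpha/2}u\|_{Q/\alpha}\le1$ we have $$\int_{\mathbb{H}^n}\frac{\exp_{\lceil p\frac{Q-\alpha}Q-1\rceil}\Big[\frac1{A_\alpha}|u|^{\frac Q{Q-\alpha}}\Big]}{1+|u|^{\frac{p\alpha}{Q-\alpha}}}\,dx\le C\|u\|_p^p. \qquad( * )$$ Moreover, there is a constant $C$ such that for every $u\in W^{\alpha,\frac Q\alpha}(\mathbb{H}^n)$ with $\|u\|_{Q/\alpha}^{Q/\alpha}+\|\mathcal{L}^{\alpha/2}u\|_{Q/\alpha}^{Q/\alpha}\le1$ we have $$\int_{\mathbb{H}^n}\exp_{\lceil\frac Q\alpha-2\rceil}\Big[\frac1{A_\alpha}|u|^{\frac Q{Q-\alpha}}\Big]dx\le C. \qquad( ** )$$ The exponential constant $A_\alpha^{-1}$ in $( * )$ and $( ** )$ is sharp, i.e. it cannot be replaced by any larger number.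
   Context: $\mathbb{H}^n=\mathbb{C}^n\times\mathbb{R}$ with elements $x=(z,t)$, $z=(x_j+iy_j)_{j=1}^n$, group law $(z,t)(z',t')=(z+z',\,t+t'+2\,\mathrm{Im}\,z\cdot\overline{z'})$, Haar measure $dx=dz\,dt$, dilations $(z,t)\mapsto(\lambda z,\lambda^2t)$, and homogeneous norm $|(z,t)|=(|z|^4+t^2)^{1/4}$. $X_j=\partial_{x_j}+2y_j\partial_t$, $Y_j=\partial_{y_j}-2x_j\partial_t$ ($j=1,\dots,n$) are left-invariant vector fields, and $\mathcal{L}=-\frac14\sum_{j=1}^n(X_j^2+Y_j^2)$ is the sublaplacian. $\Sigma=\{|x|=1\}$ is the unit sphere, and $dx^*$ is the measure on $\Sigma$ with $\int_{\mathbb{H}^n}h\,dx=\int_0^\infty\int_\Sigma h(rx^* )\,r^{Q-1}dx^*dr$, where $rx^*$ is the dilate of $x^*$; for functions of $\theta$, $\int_\Sigma\phi\,dx^*=\omega_{2n-1}\int_{-\pi/2}^{\pi/2}\phi(\theta)(\cos\theta)^{n-1}d\theta$, with $\omega_{2n-1}$ the surface measure of the unit sphere in $\mathbb{R}^{2n}$. For $0<\alpha<Q$ even, the fundamental solution of $\mathcal{L}^{\alpha/2}$ with pole at $0$ is homogeneous of degree $\alpha-Q$ and smooth away from $0$, and can be written as $\mathcal{L}^{-\alpha/2}(x,0)=g_\alpha(\theta)|x|^{\alpha-Q}$, where $\theta=\arg\frac{|z|^2+it}{|x|^2}\in[-\frac\pi2,\frac\pi2]$; this defines the (bounded) function $g_\alpha$.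 $W^{\alpha,q,p}(\mathbb{H}^n)=\{u\in L^p(\mathbb{H}^n):\mathcal{L}^{\alpha/2}u\in L^q(\mathbb{H}^n)\}$, and $W^{\alpha,q}(\mathbb{H}^n)=W^{\alpha,q,q}(\mathbb{H}^n)$. $\exp_N(t)=e^t-\sum_{j=0}^N\frac{t^j}{j!}$ for an integer $N\ge0$. *)

(* Defs.v *)
From HB Require Import structures.
From mathcomp Require Import all_boot all_order all_algebra.
From mathcomp Require Import boolp classical_sets functions reals ereal topology.
From mathcomp Require Import normedtype sequences derive exp trigo measure measurable_realfun.
From mathcomp Require Import lebesgue_measure lebesgue_integral hoelder.

Set Implicit Arguments.
Unset Strict Implicit.
Unset Printing Implicit Defensive.
Import Order.TTheory GRing.Theory Num.Theory.
Import numFieldNormedType.Exports.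

Local Open Scope classical_set_scope.
Local Open Scope ring_scope.

(* 'rV[R]_n carries the sigma-algebra generated by the coordinates, i.e. the
   Borel one; the construction mirrors the library's one for tuples. *)
Definition measure_rV_display : measure_display -> measure_display.
Proof. exact. Qed.

Section measurable_rV.
Context {d} {T : sigmaRingType d}.
Variable n : nat.

Definition rV_coord (i : 'I_n) (x : 'rV[T]_n) : T := x ord0 i.

Let rV_set0 : g_sigma_preimage rV_coord set0.
Proof. exact: sigma_algebra0. Qed.

Let rV_setC A : g_sigma_preimage rV_coord A -> g_sigma_preimage rV_coord (~` A).
Proof. exact: sigma_algebraC. Qed.

Let rV_bigcup (F : _^nat) : (forall i, g_sigma_preimage rV_coord (F i)) ->
  g_sigma_preimage rV_coord (\bigcup_i (F i)).
Proof. exact: sigma_algebra_bigcup. Qed.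

HB.instance Definition _ := @isMeasurable.Build (measure_rV_display d)
  'rV[T]_n (g_sigma_preimage rV_coord) rV_set0 rV_setC rV_bigcup.

Lemma measurable_rV_coord (i : 'I_n) : measurable_fun setT (rV_coord i).
Proof.
move=> _ Y mY; rewrite setTI; apply: sub_sigma_algebra => /=.
rewrite -bigcup_seq/=; exists i => /=; first by rewrite mem_index_enum.
by exists Y => //; rewrite setTI.
Qed.

Lemma measurable_fun_rVP d1 (T1 : measurableType d1) (f : T1 -> 'rV[T]_n) :
  (forall i, measurable_fun setT (rV_coord i \o f)) -> measurable_fun setT f.
Proof.
move=> mf.
have pf : g_sigma_preimage (fun i => rV_coord i \o f) `<=` measurable.
  apply: smallest_sub; first exact: sigma_algebra_measurable.
  rewrite -bigcup_seq; apply: bigcup_sub => i _.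
  by move=> A [B mB <-]; exact: mf.
by rewrite g_sigma_preimage_comp in pf => _ A mA; apply: pf; exists A.
Qed.

End measurable_rV.

Section lebesgue_rV.
Context {R : realType}.

(* The library's Lebesgue measure lives on the alias measurableTypeR R of R;
   this is the same function on R itself, which has the same measurable sets
   but a different display. *)
Definition lebesgue_R : set R -> \bar R := @lebesgue_measure R.

Let lebesgue_R0 : lebesgue_R set0 = 0%E.
Proof. exact: (measure0 (@lebesgue_measure R)). Qed.

Let lebesgue_R_ge0 A : (0 <= lebesgue_R A)%E.
Proof. exact: (measure_ge0 (@lebesgue_measure R)). Qed.

Let lebesgue_R_sigma_additive : semi_sigma_additive lebesgue_R.
Proof. exact: (@measure_semi_sigma_additive _ _ _ (@lebesgue_measure R)). Qed.

HB.instance Definition _ := isMeasure.Build _ _ _ lebesgue_R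
  lebesgue_R0 lebesgue_R_ge0 lebesgue_R_sigma_additive.

Let lebesgue_R_sigma_finite : sigma_finite setT lebesgue_R.
Proof. exact: (sigma_finiteT (@lebesgue_measure R)). Qed.

HB.instance Definition _ := Measure_isSigmaFinite.Build _ _ _ lebesgue_R
  lebesgue_R_sigma_finite.

Definition cons_rV n (p : R * 'rV[R]_n) : 'rV[R]_n.+1 :=
  row_mx (p.1%:M : 'rV_1) p.2.

Definition uncons_rV n (x : 'rV[R]_n.+1) : R * 'rV[R]_n :=
  (x ord0 ord0, \row_i x ord0 (lift ord0 i)).

Lemma cons_rVK n : cancel (@cons_rV n) (@uncons_rV n).
Proof.
move=> [a y]; rewrite /uncons_rV /cons_rV; congr pair => /=.
  have -> : @ord0 n = lshift n (@ord0 0) by exact/val_inj.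
  by rewrite (@row_mxEl _ 1 1 n) mxE eqxx mulr1n.
apply/rowP => i; rewrite mxE.
have -> : lift ord0 i = rshift 1 i by exact/val_inj.
by rewrite (@row_mxEr _ 1 1 n).
Qed.

Lemma measurable_cons_rV n : measurable_fun setT (@cons_rV n).
Proof.
apply: measurable_fun_rVP => i.
case: (unliftP ord0 i) => [j|] ->.
  rewrite (_ : _ \o _ = rV_coord j \o snd).
    by apply: measurableT_comp; [exact: measurable_rV_coord|exact: measurable_snd].
  apply/funext => -[a y] /=; rewrite /rV_coord.
  by have /(congr1 snd)/rowP/(_ j) := cons_rVK (a, y); rewrite mxE.
rewrite (_ : _ \o _ = fst); first exact: measurable_fst.
by apply/funext => -[a y] /=; have /(congr1 fst) := cons_rVK (a, y).
Qed.

Lemma measurable_uncons_rV n : measurable_fun setT (@uncons_rV n).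
Proof.
apply: measurable_fun_pair; first exact: measurable_rV_coord.
apply: measurable_fun_rVP => i.
rewrite (_ : _ \o _ = rV_coord (lift ord0 i)); first exact: measurable_rV_coord.
by apply/funext => x /=; rewrite /rV_coord mxE.
Qed.

Section step.
Variables (n : nat) (m : {sigma_finite_measure set 'rV[R]_n -> \bar R}).

Definition lebesgue_rVS : set 'rV[R]_n.+1 -> \bar R :=
  pushforward (lebesgue_R \x m)%E (@cons_rV n).

Let lebesgue_rVS0 : lebesgue_rVS set0 = 0%E.
Proof. by rewrite /lebesgue_rVS /pushforward preimage_set0 measure0. Qed.

Let lebesgue_rVS_ge0 A : (0 <= lebesgue_rVS A)%E.
Proof. by rewrite /lebesgue_rVS /pushforward measure_ge0. Qed.

Let lebesgue_rVS_sigma_additive : semi_sigma_additive lebesgue_rVS.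
Proof.
move=> F mF tF mUF; rewrite /lebesgue_rVS /pushforward preimage_bigcup.
apply: measure_semi_sigma_additive.
- by move=> k; rewrite -[X in measurable X]setTI; exact: measurable_cons_rV.
- apply/trivIsetP => /= i j _ _ ij; rewrite -preimage_setI.
  by move/trivIsetP : tF => /(_ _ _ _ _ ij) ->//; rewrite preimage_set0.
- rewrite -preimage_bigcup -[X in measurable X]setTI.
  exact: measurable_cons_rV.
Qed.

HB.instance Definition _ := isMeasure.Build _ _ _ lebesgue_rVS
  lebesgue_rVS0 lebesgue_rVS_ge0 lebesgue_rVS_sigma_additive.

Let lebesgue_rVS_sigma_finite : sigma_finite setT lebesgue_rVS.
Proof.
have /sigma_finiteP[F [FT ndF Foo]] := sigma_finiteT lebesgue_R.
have /sigma_finiteP[G [GT ndG Goo]] := sigma_finiteT m.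
exists (fun k => @uncons_rV n @^-1` (F k `*` G k)) => [|k].
  rewrite -preimage_bigcup; apply/esym/seteqP; split => // x _ /=.
  have [i _ Fi] : (\bigcup_i F i) (uncons_rV x).1 by rewrite -FT.
  have [j _ Gj] : (\bigcup_i G i) (uncons_rV x).2 by rewrite -GT.
  exists (maxn i j) => //; split.
    by move: Fi; apply/subsetPset/ndF/leq_maxl.
  by move: Gj; apply/subsetPset/ndG/leq_maxr.
have [mF Fk] := Foo k; have [mG Gk] := Goo k; split.
  rewrite -[X in measurable X]setTI.
  by apply: measurable_uncons_rV => //; exact: measurableX.
rewrite /lebesgue_rVS /pushforward -comp_preimage.
rewrite (_ : _ \o _ = id); last by apply/funext => y /=; rewrite cons_rVK.
by rewrite preimage_id product_measure1E// lte_mul_pinfty// ge0_fin_numE.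
Qed.

HB.instance Definition _ := Measure_isSigmaFinite.Build _ _ _ lebesgue_rVS
  lebesgue_rVS_sigma_finite.

End step.

Fixpoint lebesgue_rV n : {sigma_finite_measure set 'rV[R]_n -> \bar R} :=
  match n with
  | 0 => [the {sigma_finite_measure set 'rV[R]_0 -> \bar R}
            of dirac (0 : 'rV[R]_0)]
  | n'.+1 => [the {sigma_finite_measure set 'rV[R]_n'.+1 -> \bar R}
            of lebesgue_rVS (lebesgue_rV n')]
  end.

End lebesgue_rV.
Arguments lebesgue_rV R n : clear implicits.

(* The point (z, t) with z = (x_j + i y_j)_j is encoded as ((x, y), t). *)
Notation heis R n := ('rV[R]_n * 'rV[R]_n * R)%type.

Definition hdim (n : nat) : nat := (2 * n + 2)%N.

Section heisenberg.
Context {R : realType} {n : nat}.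
Implicit Types (x : heis R n) (f phi u : heis R n -> R).

Definition heis_measure : {measure set (heis R n) -> \bar R} :=
  ((lebesgue_rV R n \x lebesgue_rV R n) \x lebesgue_R)%E.

(* `|z| is the Euclidean norm, unlike the library's (maximum) norm on rows. *)
Definition hzabs x : R :=
  Num.sqrt (\sum_(j < n) (x.1.1 ord0 j ^+ 2 + x.1.2 ord0 j ^+ 2)).

Definition hnorm x : R := (hzabs x ^+ 4 + x.2 ^+ 2) `^ (4%:R^-1).

Definition hdil (r : R) x : heis R n := (r *: x.1.1, r *: x.1.2, r ^+ 2 * x.2).

Definition hsphere : set (heis R n) := [set x | hnorm x = 1].

(* The measure dx^* on the unit sphere, as a measure on the whole group that
   is carried by the sphere. *)
Definition is_polar_measure (sigma : {measure set (heis R n) -> \bar R}) :=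
  sigma (~` hsphere) = 0%E /\
  forall h : heis R n -> \bar R, measurable_fun [set: heis R n] h ->
    (forall x, 0 <= h x)%E ->
    (\int[heis_measure]_x h x =
     \int[@lebesgue_measure R]_(r in `]0%R, +oo[)
       \int[sigma]_(x in hsphere) (h (hdil r x) * (r ^+ (hdim n).-1)%:E))%E.

Definition vecX (j : 'I_n) f x : R :=
  'D_(delta_mx ord0 j, 0, 0) f x + 2 * x.1.2 ord0 j * 'D_(0, 0, 1) f x.

Definition vecY (j : 'I_n) f x : R :=
  'D_(0, delta_mx ord0 j, 0) f x - 2 * x.1.1 ord0 j * 'D_(0, 0, 1) f x.

Definition sublap f x : R :=
  - (4%:R^-1) * \sum_(j < n) (vecX j (vecX j f) x + vecY j (vecY j f) x).

(* C^oo on the (open) set A: all iterated directional derivatives exist and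
   are continuous at every point of A. *)
Definition smooth_on (A : set (heis R n)) f :=
  forall (s : seq (heis R n)) x, A x ->
    let f_s := foldr (fun v h => 'D_v h) f s in
    {for x, continuous f_s} /\ forall v, derivable f_s x v.

Definition test_function phi :=
  smooth_on setT phi /\ compact (closure [set x | phi x != 0]).

(* L^k u = f in the sense of distributions; L is formally self-adjoint. *)
Definition weak_sublap (k : nat) u f :=
  forall phi, test_function phi ->
    \int[heis_measure]_x (u x * iter k sublap phi x) =
    \int[heis_measure]_x (f x * phi x).

(* u belongs to W^{2k,q,p} and L^k u = f. *)
Definition sobolev (k : nat) (q p : R) u f :=
  [/\ u \in Lfun heis_measure p%:E, f \in Lfun heis_measure q%:E &
      weak_sublap k u f].

(* The principal argument of a + ib (unspecified at 0). *)
Definition carg (a b : R) : R :=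
  get [set th | [/\ - pi < th <= pi,
    a = Num.sqrt (a ^+ 2 + b ^+ 2) * cos th &
    b = Num.sqrt (a ^+ 2 + b ^+ 2) * sin th]].

Definition htheta x : R :=
  carg (hzabs x ^+ 2 / hnorm x ^+ 2) (x.2 / hnorm x ^+ 2).

(* g(theta)|x|^(alpha - Q) is the fundamental solution of L^(alpha/2) with
   pole 0; this determines g on [-pi/2, pi/2], the range of theta. *)
Definition is_fundamental (alpha : nat) (g : R -> R) :=
  let G x := g (htheta x) * hnorm x `^ (alpha%:R - (hdim n)%:R) in
  smooth_on [set x | x != 0] G /\
  forall phi, test_function phi ->
    \int[heis_measure]_x (G x * iter alpha./2 sublap phi x) = phi 0.

Definition adams_const (sigma : {measure set (heis R n) -> \bar R})
    (alpha : nat) (g : R -> R) : R :=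
  (hdim n)%:R^-1 * \int[sigma]_(x in hsphere)
    (`|g (htheta x)| `^ ((hdim n)%:R / ((hdim n)%:R - alpha%:R))).

Definition expN (N : nat) (t : R) : R :=
  expR t - \sum_(0 <= j < N.+1) t ^+ j / j`!%:R.

End heisenberg.
Arguments heis_measure R n : clear implicits.
Arguments is_fundamental {R} n alpha g.

Section inequalities.
Context {R : realType} (n alpha : nat).
Let Q : R := (hdim n)%:R.
Let a : R := alpha%:R.
Let mu := heis_measure R n.

(* In both inequalities the ceiling is a nonnegative integer, so that `|_|%N
   is a mere cast. *)
Definition adams_ineq_masmoudi (p B : R) :=
  exists C : R, forall u f : heis R n -> R,
    sobolev alpha./2 (Q / a) p u f ->
    ('N[mu]_(Q / a)%:E [EFin \o f] <= 1)%E ->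
    (\int[mu]_x (expN `|Num.ceil (p * ((Q - a) / Q) - 1)|%N
                   (B * `|u x| `^ (Q / (Q - a))) /
                 (1 + `|u x| `^ (p * a / (Q - a))))%:E
      <= C%:E * 'N[mu]_p%:E [EFin \o u] `^ p)%E.

Definition adams_ineq_ruf (B : R) :=
  exists C : R, forall u f : heis R n -> R,
    sobolev alpha./2 (Q / a) (Q / a) u f ->
    ('N[mu]_(Q / a)%:E [EFin \o u] `^ (Q / a) +
     'N[mu]_(Q / a)%:E [EFin \o f] `^ (Q / a) <= 1)%E ->
    (\int[mu]_x (expN `|Num.ceil (Q / a - 2)|%N
                   (B * `|u x| `^ (Q / (Q - a))))%:E <= C%:E)%E.

End inequalities.

(* Main.v *)
Require Import Defs.
From HB Require Import structures.
From mathcomp Require Import all_boot all_order all_algebra.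
From mathcomp Require Import boolp classical_sets functions reals ereal topology.
From mathcomp Require Import normedtype sequences derive exp trigo measure measurable_realfun.
From mathcomp Require Import lebesgue_measure lebesgue_integral hoelder.
From mathcomp Require Import numfun realfun ftc.
From mathcomp Require Import ring lra.

(** Let G be the fundamental solution of L^k, k = alpha/2, cut off smoothly at
    scale r to H_r.  Then L^k H_r = delta - K_r with K_r a test function of size
    r^-Q, so that u = f * H_r - u * K_r almost everywhere (du Bois-Reymond), and
    the last term is at most C (||u||_p^p / r^Q)^(1/p).  Average this over a
    subset of measure t2 <= t1 of a level set of |u|, after splitting f by a
    weight that selects its largest values up to mass t1.  Hoelder's inequality
    on shells, where the integral of |G|^q' over a < |x| < b is A Q ln(b/a),
    bounds the level by a power of ln(1/t1), up to terms controlled by the share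
    e of ||f||_q^q carried by the weight.  Used at the integer levels j of
    A^-1 |u|^q', with e depending on j, these bounds leave only finitely many
    levels in each band of excess, and the measures of the level sets sum to the
    first inequality.  The second follows from the case p = q by scaling.

    For the sharpness take F = |G(x^-1)|^(q'-2) G(x^-1) on a shell eps < |x| < rho
    and u = F * H_r, which solves L^k u = F + F * K_r.  Then
    u(0) = ||F||_q^q = A Q ln(rho/eps), by homogeneity u is almost constant on a
    ball of radius delta eps, and ||u||_q is negligible for r small. *)

Set Implicit Arguments.
Unset Strict Implicit.
Unset Printing Implicit Defensive.
Import Order.TTheory GRing.Theory Num.Theory.
Import numFieldNormedType.Exports.

Local Open Scope classical_set_scope.
Local Open Scope ring_scope.

(** * Iterated directional derivatives *)

Section directional.
Context {R : realType} {V : normedModType R}.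
Implicit Types (f : V -> R) (x v w : V).

(** The constant 1/A is to be attained, so on the scale of A^-1 |u|^q' every loss has to be an
    additive constant; a factor larger than 1 in front of the logarithm would already be fatal. One
    level on its own only gives e^j j^(-p/q) mu_j <= C ||u||_p^p for its measure mu_j, and such
    bounds cannot be summed over j. The sum converges because a level at which this bound is nearly
    attained leaves a share e = O(1/j) of ||f||_q^q for the higher levels, so that such levels
    cannot be far apart. The weight in the first inequality is the price of the radius r: the error
    (||u||_p^p / r^Q)^(1/p) is harmless at level j when it is O(j^(-1/q)), which leads to r^Q of
    order j^(p/q) ||u||_p^p and puts the factor j^(p/q), comparable to |u|^(p alpha / (Q - alpha)),
    in front of the measure. In the second inequality the part of the unit budget used by u leaves
    for L^k u a norm below 1, and the resulting gain in the exponent pays for the weight. *)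

Lemma is_derive_line f x v (t : R) : derivable f (t *: v + x) v ->
  is_derive t (1 : R) (fun h : R => f (h *: v + x)) ('D_v f (t *: v + x)).
Proof.
move=> df.
have E : (fun h : R => h^-1 *: (((fun h : R => f (h *: v + x)) \o shift t) (h *: (1 : R)) - f (t *: v + x))) =
    (fun h => h^-1 *: ((f \o shift (t *: v + x)) (h *: v) - f (t *: v + x))).
  apply/funext => h /=; congr (_ *: (f _ - _)).
  by rewrite addrA -scalerDl /GRing.scale/= mulr1.
by split; rewrite /derivable /derive E.
Qed.

Lemma is_derive_of_line f x v d :
  is_derive (0 : R) (1 : R) (fun h : R => f (h *: v + x)) d -> is_derive x v f d.
Proof.
move=> [].
have E : (fun h : R => h^-1 *: (((fun h : R => f (h *: v + x)) \o shift 0) (h *: (1 : R)) - f (0 *: v + x))) =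
    (fun h => h^-1 *: ((f \o shift x) (h *: v) - f x)).
  apply/funext => h /=; rewrite scale0r add0r; congr (_ *: (f _ - _)).
  by rewrite /GRing.scale/= mulr1 addr0.
by rewrite /derivable /derive E => h1 h2; split.
Qed.

Lemma is_derive_line0 f x v : derivable f x v ->
  is_derive (0 : R) (1 : R) (fun h : R => f (h *: v + x)) ('D_v f x).
Proof.
have E : 0 *: v + x = x by rewrite scale0r add0r.
by rewrite -{1 3}E; exact: is_derive_line.
Qed.

Lemma is_derive_scale f x v (k : R) : derivable f x v ->
  is_derive x (k *: v) f (k * 'D_v f x).
Proof.
move=> df; apply: is_derive_of_line.
have -> : (fun h : R => f (h *: (k *: v) + x)) =
    (fun h : R => f (h *: v + x)) \o (fun h => h * k).
  by apply/funext => h /=; rewrite scalerA.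
apply: is_derive_eq.
  apply: is_derive1_comp.
  by rewrite mul0r; exact: is_derive_line0.
by rewrite /GRing.scale /= !mulr1 mulr0 add0r mulrC.
Qed.

Lemma is_derive_comp f x v (phi : R -> R) :
  derivable f x v -> derivable phi (f x) 1 ->
  is_derive x v (phi \o f) ('D_1 phi (f x) * 'D_v f x).
Proof.
move=> df dp; apply: is_derive_of_line.
have -> : (fun h : R => (phi \o f) (h *: v + x)) =
    phi \o (fun h : R => f (h *: v + x)) by [].
apply: is_derive1_comp; last exact: is_derive_line0.
by rewrite scale0r add0r; exact: derivableP.
Qed.

Lemma MVT_line f x v : (forall t : R, 0 <= t <= 1 -> derivable f (t *: v + x) v) ->
  exists2 c : R, 0 <= c <= 1 & f (v + x) - f x = 'D_v f (c *: v + x).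
Proof.
move=> df.
have [|||c c01] := @MVT_segment R (fun h : R => f (h *: v + x))
  (fun h => 'D_v f (h *: v + x)) 0 1.
- exact: ler01.
- move=> t; rewrite in_itv/= => /andP[t0 t1].
  by apply: is_derive_line; apply: df; rewrite !ltW.
- apply: derivable_within_continuous => t; rewrite in_itv/= => t01.
  exact: (@ex_derive _ _ _ _ _ _ _ (is_derive_line (df t t01))).
- rewrite scale1r scale0r add0r subr0 mulr1 => E; exists c => //.
Qed.

(** Directional derivatives alone need not be additive in the direction. The increment along h(v +
    w) is split at x + h v: the mean value theorem turns its second half into a value of ['D_w f]
    near x, and continuity of that single derivative at x suffices. *)
Lemma is_derive_addv f (A : set V) x v w : open A -> A x ->
  (forall y, A y -> derivable f y w) -> {for x, continuous ('D_w f)} ->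
  derivable f x v -> is_derive x (v + w) f ('D_v f x + 'D_w f x).
Proof.
move=> oA Ax dw cw dv.
suff H : (fun h : R => h^-1 *: ((f \o shift x) (h *: (v + w)) - f x)) @ (0:R)^' -->
    'D_v f x + 'D_w f x.
  by split; [apply/cvg_ex; eexists; exact: H | exact: cvg_lim H].
have -> : (fun h : R => h^-1 *: ((f \o shift x) (h *: (v + w)) - f x)) =
   (fun h : R => h^-1 *: ((f \o shift x) (h *: v) - f x)) \+
   (fun h : R => h^-1 *: (f (h *: w + (h *: v + x)) - f (h *: v + x))).
  apply/funext => h /=; rewrite -scalerDr; congr (_ *: _).
  by rewrite [RHS]addrC addrA subrK scalerDr addrA (addrC (h *: v)).
apply: cvgD; first exact: dv.
apply/cvgrPdist_lt => e e0.
have /nbhs_ballP[r/= r0 rA] : nbhs x (A `&` [set y | `|'D_w f x - 'D_w f y| < e]).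
  apply: filterI; first exact: open_nbhs_nbhs.
  by move/cvgrPdist_lt : cw => /(_ _ e0).
have c0 : 0 < `|v| + `|w| + 1 by rewrite ltr_wpDl// addr_ge0.
near=> h.
have h0 : h != 0 by near: h; exact: nbhs_dnbhs_neq.
have hr : `|h| * (`|v| + `|w| + 1) < r.
  rewrite -ltr_pdivlMr//; near: h.
  have := @dnbhs0_lt _ R^o (r / (`|v| + `|w| + 1)) (divr_gt0 r0 c0); exact.
have inb c : 0 <= c <= 1 -> ball x r (c *: (h *: w) + (h *: v + x)).
  move=> /andP[c0' c1]; rewrite -ball_normE /ball_ /=.
  have -> : x - (c *: (h *: w) + (h *: v + x)) = - (c *: (h *: w) + h *: v).
    by rewrite addrA opprD addrCA subrr addr0.
  rewrite normrN (le_lt_trans _ hr)// (le_trans (ler_normD _ _))// !normrZ !mulrDr mulr1.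
  rewrite (ger0_norm c0') addrC -addrA lerD2l ler_wpDr// ler_piMl// mulr_ge0//.
have [|d d01 E] := @MVT_line f (h *: v + x) (h *: w).
  move=> t t01; have [At _] := rA _ (inb _ t01).
  exact: (@ex_derive _ _ _ _ _ _ _ (is_derive_scale h (dw _ At))).
have [Ac Bc] := rA _ (inb _ d01).
rewrite E (@derive_val _ _ _ _ _ _ _ (is_derive_scale h (dw _ Ac))).
by rewrite /GRing.scale/= mulrA mulVf// mul1r; exact: Bc.
Unshelve. all: by end_near. Qed.

End directional.

(** * Functions of class C^m *)

Section Cn.
Context {R : realType}.

(** Differentiating in one direction at a time lowers m by one, so that stability under products,
    inverses and compositions follows by induction on m. [smooth_onP] identifies the resulting
    [smooth] with [smooth_on]. *)
Fixpoint Cn {V : normedModType R} (m : nat) (A : set V) (f : V -> R) : Prop :=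
  (forall x, A x -> {for x, continuous f}) /\
  if m is m'.+1 then
    forall v, (forall x, A x -> derivable f x v) /\ Cn m' A ('D_v f)
  else True.

Definition smooth {V : normedModType R} (A : set V) (f : V -> R) :=
  forall m, Cn m A f.

Section theory.
Context {V : normedModType R}.
Implicit Types (f g : V -> R) (A B : set V).

Lemma Cn_cont m A f : Cn m A f -> forall x, A x -> {for x, continuous f}.
Proof. by case: m => [|m] []. Qed.

Lemma CnW m A f : Cn m.+1 A f -> Cn m A f.
Proof.
elim: m f => [|m IH] f; first by case.
move=> [cf df]; split => // v; have [d1 d2] := df v; split => //; exact: IH.
Qed.

Lemma Cn_setU m A B f : Cn m A f -> Cn m B f -> Cn m (A `|` B) f.
Proof.
elim: m f => [|m IH] f [c1 d1] [c2 d2]; split => //.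
- by move=> x [/c1|/c2].
- by move=> x [/c1|/c2].
- move=> v; have [a1 b1] := d1 v; have [a2 b2] := d2 v; split; last exact: IH.
  by move=> x [/a1|/a2].
Qed.

Lemma Cn_sub m A B f : B `<=` A -> Cn m A f -> Cn m B f.
Proof.
move=> BA; elim: m f => [|m IH] f [c1 d1]; split => //.
- by move=> x /BA/c1.
- by move=> x /BA/c1.
- move=> v; have [a1 b1] := d1 v; split; last exact: IH.
  by move=> x /BA/a1.
Qed.

Lemma Cn_ext m A f g : open A -> {in A, f =1 g} -> Cn m A f -> Cn m A g.
Proof.
move=> oA.
have nE f' g' : {in A, f' =1 g'} -> forall x, A x -> \near x, f' x = g' x.
  move=> fg x Ax; near=> y; apply/fg/mem_set; near: y; exact: open_nbhs_nbhs.
have cE f' g' : {in A, f' =1 g'} -> (forall x, A x -> {for x, continuous f'}) ->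
    forall x, A x -> {for x, continuous g'}.
  move=> fg cf x Ax; have n1 := nE _ _ fg _ Ax.
  rewrite /prop_for/continuous_at -(fg _ (mem_set Ax)).
  apply: cvg_trans (cf _ Ax); apply: near_eq_cvg.
  by move: n1; apply: filterS => y ->.
elim: m f g => [|m IH] f g fg [cf df]; split => //; try exact: cE cf.
move=> v; have [d1 d2] := df v; split.
  move=> x Ax; have := d1 x Ax; apply: near_eq_derivable.
  - exact: nE.
apply: (IH ('D_v f)) => // x /set_mem Ax.
by apply: near_eq_derive; exact: nE.
Unshelve. all: by end_near. Qed.

Lemma Cn_cst m A (c : R) : Cn m A (cst c).
Proof.
elim: m c => [|m IH] c; split => //; try by move=> x _; exact: cst_continuous.
move=> v; split; first by move=> x _; exact: derivable_cst.
have -> : 'D_v (cst c : V -> R) = cst 0 by apply/funext => x; rewrite derive_cst.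
exact: IH.
Qed.

Lemma Cn_add m A f g : open A -> Cn m A f -> Cn m A g -> Cn m A (f \+ g).
Proof.
move=> oA; elim: m f g => [|m IH] f g [c1 d1] [c2 d2]; split => //;
  try by move=> x Ax; apply: continuousD; [exact: c1|exact: c2].
move=> v; have [a1 b1] := d1 v; have [a2 b2] := d2 v; split.
  by move=> x Ax; apply: derivableD; [exact: a1|exact: a2].
apply: (@Cn_ext _ _ ('D_v f \+ 'D_v g)) => //; last exact: IH.
move=> x /set_mem Ax; rewrite deriveD//; [exact: a1|exact: a2].
Qed.

Lemma Cn_mul m A f g : open A -> Cn m A f -> Cn m A g -> Cn m A (f \* g).
Proof.
move=> oA; elim: m f g => [|m IH] f g f1 g1; split => //;
  try by move=> x Ax; apply: continuousM; [exact: (Cn_cont f1 Ax)|exact: (Cn_cont g1 Ax)].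
have [c1 d1] := f1; have [c2 d2] := g1.
move=> v; have [a1 b1] := d1 v; have [a2 b2] := d2 v; split.
  by move=> x Ax; apply: derivableM; [exact: a1|exact: a2].
apply: (@Cn_ext _ _ ((f \* 'D_v g) \+ (g \* 'D_v f))) => //.
  by move=> x /set_mem Ax; rewrite /= deriveM//; [exact: a1|exact: a2].
by apply: Cn_add => //; apply: IH => //; exact: CnW.
Qed.

Lemma Cn_inv m A f : open A -> (forall x, A x -> f x != 0) -> Cn m A f ->
  Cn m A (fun x => (f x)^-1).
Proof.
move=> oA f0; elim: m => [|m IH] f1; split => //;
  try by move=> x Ax; apply: cvgV; [exact: f0|exact: (Cn_cont f1 Ax)].
have [c1 d1] := f1.
move=> v; have [a1 b1] := d1 v; split.
  by move=> x Ax; apply: derivableV; [exact: f0|exact: a1].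
have f1' := IH (CnW f1).
apply: (@Cn_ext _ _ ((cst (-1) \* ((fun x => (f x)^-1) \* (fun x => (f x)^-1))) \* 'D_v f)) => //.
  move=> x /set_mem Ax; rewrite /= deriveV//; [|exact: f0|exact: a1].
  by rewrite /GRing.scale/= mulN1r expr2 invfM.
apply: Cn_mul => //; apply: Cn_mul => //; first exact: Cn_cst.
exact: Cn_mul.
Qed.

Lemma Cn_sum m A I (r : seq I) (P : pred I) (F : I -> V -> R) : open A ->
  (forall i, Cn m A (F i)) -> Cn m A (fun x => \sum_(i <- r | P i) F i x).
Proof.
move=> oA FA; elim: r => [|i r IH].
  by under eq_fun do rewrite big_nil; exact: Cn_cst.
have [Pi|Pi] := boolP (P i).
  by under eq_fun do rewrite big_cons Pi; exact: Cn_add.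
by under eq_fun do rewrite big_cons (negbTE Pi).
Qed.

End theory.

Lemma Cn_comp {V : normedModType R} m (A : set V) (B : set R) (f : V -> R) (phi : R -> R) : open A ->
  (forall x, A x -> B (f x)) -> Cn m B phi -> Cn m A f -> Cn m A (phi \o f).
Proof.
move=> oA AB; elim: m phi f AB => [|m IH] phi f AB p1 f1.
  split => // x Ax; apply: continuous_comp; first exact: (Cn_cont f1 Ax).
  have H := Cn_cont p1 (AB _ Ax); exact: H.
split.
  move=> x Ax; apply: continuous_comp; first exact: (Cn_cont f1 Ax).
  have H := Cn_cont p1 (AB _ Ax); exact: H.
have [c1 d1] := f1; have [c2 d2] := p1.
move=> v; have [a1 b1] := d1 v; have [a2 b2] := d2 1.
have D x : A x -> is_derive x v (phi \o f) ('D_1 phi (f x) * 'D_v f x).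
  by move=> Ax; apply: is_derive_comp; [exact: a1|exact/a2/AB].
split; first by move=> x Ax; exact: (@ex_derive _ _ _ _ _ _ _ (D x Ax)).
apply: (@Cn_ext _ _ _ (('D_1 phi \o f) \* 'D_v f)) => //.
  by move=> x /set_mem Ax; rewrite (@derive_val _ _ _ _ _ _ _ (D x Ax)).
by apply: Cn_mul => //; apply: IH => //; exact: CnW.
Qed.

Lemma is_derive_affine {V W : normedModType R} (T : W -> V) (L : W -> V) (f : V -> R) v x :
  (forall (h : R) w y, T (h *: w + y) = h *: L w + T y) ->
  derivable f (T x) (L v) -> is_derive x v (f \o T) ('D_(L v) f (T x) : R).
Proof.
move=> TL df; apply: is_derive_of_line.
have -> : (fun h : R => (f \o T) (h *: v + x)) = (fun h => f (h *: L v + T x)).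
  by apply/funext => h /=; rewrite TL.
exact: is_derive_line0.
Qed.

(** T is affine with linear part L. Left translations, right translations and dilations of the group
    are all of this kind in the linear coordinates, a translation having a linear part that depends
    on the translating point. *)
Lemma Cn_affine {V W : normedModType R} (T : W -> V) (L : W -> V) m (A : set V)
    (B : set W) f : open B ->
  (forall (h : R) w y, T (h *: w + y) = h *: L w + T y) -> continuous T ->
  (forall x, B x -> A (T x)) -> Cn m A f -> Cn m B (f \o T).
Proof.
move=> oB TL cT BA; elim: m f => [|m IH] f f1.
  by split => // x Bx; apply: continuous_comp; [exact: cT|exact: (Cn_cont f1 (BA _ Bx))].
split; first by move=> x Bx; apply: continuous_comp; [exact: cT|exact: (Cn_cont f1 (BA _ Bx))].
have [c1 d1] := f1 => v; have [a1 b1] := d1 (L v).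
have D x : B x -> is_derive x v (f \o T) ('D_(L v) f (T x)).
  by move=> Bx; apply: is_derive_affine => //; exact/a1/BA.
split; first by move=> x Bx; exact: (@ex_derive _ _ _ _ _ _ _ (D x Bx)).
apply: (@Cn_ext _ _ _ ('D_(L v) f \o T)) => //; last exact: IH.
by move=> x /set_mem Bx; rewrite (@derive_val _ _ _ _ _ _ _ (D x Bx)).
Qed.

Lemma Cn_id m (A : set R) : Cn m A id.
Proof.
case: m => [|m]; split => //; try by move=> x _; exact: cvg_id.
move=> v; split; first by move=> x _; exact: derivable_id.
have -> : 'D_v (id : R -> R) = cst v by apply/funext => x; rewrite derive_id.
exact: Cn_cst.
Qed.

Lemma Cn_linear {V : normedModType R} (l : V -> R) m (A : set V) : open A ->
  (forall (h : R) w y, l (h *: w + y) = h * l w + l y) -> continuous l ->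
  Cn m A l.
Proof.
move=> oA lE cl; have -> : l = id \o l by [].
by apply: (@Cn_affine _ _ _ l _ setT) => //; exact: Cn_id.
Qed.

(** [foldr] differentiates first along the last direction of the list, hence the inductions through
    [rcons]. *)
Lemma smooth_onP n (A : set (heis R n)) f : smooth_on A f <-> smooth A f.
Proof.
split => [sf m|sf s].
  elim: m f sf => [|m IH] f sf; split; try by move=> x Ax; have [] := sf [::] x Ax.
    by [].
  move=> v; split; first by move=> x Ax; have [_] := sf [::] x Ax; exact.
  by apply: IH => s x Ax; have := sf (rcons s v) x Ax; rewrite foldr_rcons.
elim/last_ind: s f sf => [|s v IH] f sf x Ax /=.
  split; first exact: Cn_cont (sf 0%N) _ Ax.
  by move=> v; have [_ /(_ v)[]] := sf 1%N => + _; exact.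
rewrite foldr_rcons; apply: IH => // m.
by have [_ /(_ v)[]] := sf m.+1.
Qed.

End Cn.

(** * A smooth cutoff on the line *)

Section smoothstep.
Context {R : realType}.
Implicit Types s t : R.

(* The derivatives of exp(-1/s) are combinations of these functions. *)
Definition expinv (k : nat) s : R := if 0 < s then s^-1 ^+ k * expR (- s^-1) else 0.

Lemma expinv_gt0 s : 0 < s -> 0 < expinv 0 s.
Proof. by move=> s0; rewrite /expinv s0 mulr_gt0// ?expR_gt0// exprn_gt0// invr_gt0. Qed.

Lemma expinv_ge0 k s : 0 <= expinv k s.
Proof.
rewrite /expinv; case: ifPn => // s0.
by rewrite mulr_ge0// ?expR_ge0// exprn_ge0// invr_ge0 ltW.
Qed.

Lemma expinv_le0 k s : s <= 0 -> expinv k s = 0.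
Proof. by rewrite /expinv ltNge => ->. Qed.

(** From y^(k+1) / (k+1)! <= e^y at y = 1/s. Linear decay at 0 is enough for differentiability
    there, because the difference quotient of the k-th function at 0 is the (k+1)-th function. *)
Lemma expinv_bound k s : 0 <= s -> expinv k s <= k.+1`!%:R * s.
Proof.
rewrite le_eqVlt => /predU1P[<-|s0]; first by rewrite expinv_le0// mulr0.
rewrite /expinv s0.
have i0 : 0 <= s^-1 by rewrite invr_ge0 ltW.
have f0 : 0 < (k.+1`!%:R : R) by rewrite ltr0n fact_gt0.
have H : s^-1 ^+ k.+1 <= k.+1`!%:R * expR (s^-1).
  rewrite mulrC -ler_pdivrMr// (le_trans _ (expR_ge1Dxn k i0))//.
  by rewrite lerDr.
rewrite expRN ler_pdivrMr ?expR_gt0// mulrAC -ler_pdivrMr//.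
by rewrite -exprSr.
Qed.

Lemma is_derive_expinv k s :
  is_derive s (1 : R) (expinv k) (- k%:R * expinv k.+1 s + expinv k.+2 s).
Proof.
have [s0|s0|<-] := ltgtP 0 s.
- have E : \near s, s^-1 ^+ k * expR (- s^-1) = expinv k s.
    near=> t; rewrite /expinv; suff -> : 0 < t by [].
    by near: t; exact: lt_nbhsr.
  apply: near_eq_is_derive E _.
  have sn0 : s != 0 by rewrite gt_eqF.
  have dV : is_derive s (1 : R) (fun t => t^-1) (- s ^- 2).
    split; first by apply: (@derivableV _ _ id) => //; exact: derivable_id.
    by rewrite (@deriveV _ _ id)// derive_id /GRing.scale/= mulr1.
  have dE : is_derive s (1 : R) (expR \o (fun t => - t^-1)) (expR (- s^-1) * s ^- 2).
    apply: is_derive1_comp; rewrite -[s ^- 2]opprK; exact: is_deriveN.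
  have dK : is_derive s (1 : R) ((fun t => t^-1) ^+ k) ((k%:R * s^-1 ^+ k.-1) *: - s ^- 2).
    exact: is_deriveX.
  have := is_deriveM dK dE.
  rewrite (_ : _ * (expR \o _) = (fun t => t^-1 ^+ k * expR (- t^-1))); last first.
    by apply/funext => t; rewrite /= exprfctE.
  move=> H; apply: is_derive_eq.
  rewrite /expinv s0 exprfctE /GRing.scale/= /GRing.scale/= -exprVn.
  case: k {dK H} => [|k]; first by rewrite !mul0r !mulr0 oppr0 mul0r addr0 add0r !expr0 mul1r mulrC.
  by rewrite !exprS; ring.
- have E : \near s, 0 = expinv k s.
    near=> t; rewrite expinv_le0//; suff : t < 0 by exact: ltW.
    by near: t; exact: lt_nbhsl.
  rewrite !expinv_le0 ?ltW// mulr0 addr0.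
  by apply: near_eq_is_derive E _; exact: is_derive_cst.
rewrite !expinv_le0// mulr0 addr0.
suff H : (fun h : R => h^-1 *: ((expinv k \o shift 0) (h *: (1 : R)) - expinv k 0)) @ (0:R)^' --> (0 : R).
  by split; [apply/cvg_ex; eexists; exact: H | exact: cvg_lim H].
have f0 : 0 < (k.+2`!%:R : R) by rewrite ltr0n fact_gt0.
apply/cvgrPdist_lt => e e0; near=> h.
have h0 : h != 0 by near: h; exact: nbhs_dnbhs_neq.
rewrite /= addr0 (expinv_le0 _ (lexx 0)) subr0 sub0r normrN.
have -> : h *: (1 : R) = h by rewrite /GRing.scale/= mulr1.
have [hp|hn] := ltP 0 h; last by rewrite (expinv_le0 _ hn) scaler0 normr0.
have -> : h^-1 *: expinv k h = expinv k.+1 h.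
  by rewrite /expinv hp /GRing.scale/= exprS mulrA.
rewrite ger0_norm ?expinv_ge0// (le_lt_trans (expinv_bound _ (ltW hp)))//.
rewrite mulrC -ltr_pdivlMr// -[X in X < _]ger0_norm ?ltW//; near: h.
by have := @dnbhs0_lt _ R^o (e / k.+2`!%:R) (divr_gt0 e0 f0); exact.
Unshelve. all: by end_near. Qed.

Lemma Cn_expinv k m (A : set R) : Cn m A (expinv k).
Proof.
apply: (@Cn_sub _ _ _ setT) => //; elim: m k => [|m IH] k.
  split => // x _; apply: differentiable_continuous; apply/derivable1_diffP.
  exact: (@ex_derive _ _ _ _ _ _ _ (is_derive_expinv k x)).
split => [x _|v].
  apply: differentiable_continuous; apply/derivable1_diffP.
  exact: (@ex_derive _ _ _ _ _ _ _ (is_derive_expinv k x)).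
have D x : is_derive x v (expinv k) (v * (- k%:R * expinv k.+1 x + expinv k.+2 x)).
  have [d1 d2] := is_derive_expinv k x.
  rewrite -d2; have := is_derive_scale v d1.
  by rewrite (_ : v *: 1 = v)// /GRing.scale/= mulr1.
split; first by move=> x _; exact: (@ex_derive _ _ _ _ _ _ _ (D x)).
have -> : 'D_v (expinv k) = cst v \* ((cst (- k%:R) \* expinv k.+1) \+ expinv k.+2).
  by apply/funext => x; rewrite (@derive_val _ _ _ _ _ _ _ (D x)).
apply: Cn_mul; [exact: openT|exact: Cn_cst|].
apply: Cn_add; [exact: openT| |exact: IH].
apply: Cn_mul; [exact: openT|exact: Cn_cst|exact: IH].
Qed.

Definition smoothstep s := expinv 0 (2 - s) / (expinv 0 (2 - s) + expinv 0 (s - 1)).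

Lemma smoothstep_den s : 0 < expinv 0 (2 - s) + expinv 0 (s - 1).
Proof.
have [s2|s2] := ltP s 2.
  by rewrite ltr_wpDr// ?expinv_ge0// expinv_gt0// subr_gt0.
by rewrite ltr_wpDl// ?expinv_ge0// expinv_gt0// subr_gt0 (lt_le_trans _ s2)// ltr1n.
Qed.

Lemma smoothstep01 s : 0 <= smoothstep s <= 1.
Proof.
rewrite /smoothstep divr_ge0 ?expinv_ge0// ?(ltW (smoothstep_den s))//=.
by rewrite ler_pdivrMr ?smoothstep_den// mul1r lerDl expinv_ge0.
Qed.

Lemma smoothstep1 s : s <= 1 -> smoothstep s = 1.
Proof.
move=> s1; have := smoothstep_den s; rewrite /smoothstep (@expinv_le0 _ (s - 1)) ?subr_le0//.
by rewrite addr0 => d0; rewrite divff// gt_eqF.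
Qed.

Lemma smoothstep0 s : 2 <= s -> smoothstep s = 0.
Proof. by move=> s2; rewrite /smoothstep expinv_le0 ?mul0r// subr_le0. Qed.

Lemma Cn_smoothstep m (A : set R) : Cn m A smoothstep.
Proof.
apply: (@Cn_sub _ _ _ setT) => //.
have aff (a b : R) k : Cn m setT (fun s => expinv k (a * s + b)).
  apply: (@Cn_comp _ _ _ setT setT (fun s => a * s + b) (expinv k)) => //; first exact: openT.
    exact: Cn_expinv.
  apply: (@Cn_add _ _ _ _ (fun s => a * s) (cst b)); [exact: openT| |exact: Cn_cst].
  apply: (@Cn_mul _ _ _ _ (cst a) id); [exact: openT|exact: Cn_cst|exact: Cn_id].
have E1 : (fun s => expinv 0 (-1 * s + 2)) = (fun s => expinv 0 (2 - s)).
  by apply/funext => s; rewrite mulN1r addrC.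
have E2 : (fun s => expinv 0 (1 * s + -1)) = (fun s => expinv 0 (s - 1)).
  by apply/funext => s; rewrite mul1r.
have a1 := aff (-1) 2 0; have a2 := aff 1 (-1) 0; rewrite E1 in a1; rewrite E2 in a2.
apply: (@Cn_mul _ _ _ _ (fun s => expinv 0 (2 - s))
  (fun s => (expinv 0 (2 - s) + expinv 0 (s - 1))^-1)) => //; first exact: openT.
apply: Cn_inv; first exact: openT.
  by move=> s _; rewrite gt_eqF// smoothstep_den.
exact: (Cn_add openT a1 a2).
Qed.

End smoothstep.

(** * Measure-preserving maps and the group law *)

Section preserving.
Context {d} {T : measurableType d} {R : realType}.
Implicit Types (mu : {measure set T -> \bar R}).

Definition preserving mu (F : T -> T) :=
  measurable_fun setT F /\ forall A, measurable A -> mu (F @^-1` A) = mu A.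

Lemma preserving_comp mu F G : preserving mu F -> preserving mu G -> preserving mu (F \o G).
Proof.
move=> [mF pF] [mG pG]; split; first exact: measurableT_comp.
move=> A mA; rewrite comp_preimage pG ?pF//.
by rewrite -[X in measurable X]setTI; exact: mF.
Qed.

Lemma ge0_integral_preserving mu F (f : T -> \bar R) : preserving mu F ->
  measurable_fun setT f -> (forall x, 0 <= f x)%E ->
  (\int[mu]_x f (F x) = \int[mu]_x f x)%E.
Proof.
move=> [mF pF] mf f0; rewrite -[LHS](@ge0_integral_pushforward _ _ _ _ R F mF mu setT f)//=.
by apply: eq_measure_integral => A mA _; exact: pF.
Qed.

Lemma integrable_preserving mu F (f : T -> \bar R) : preserving mu F ->
  mu.-integrable setT f -> mu.-integrable setT (f \o F).
Proof.
move=> pF /integrableP[mf fi]; apply/integrableP; split.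
  by apply: measurableT_comp => //; case: pF.
have mabs : measurable_fun setT (fun x => `|f x|)%E by exact: measurableT_comp.
have E := ge0_integral_preserving pF mabs (fun x => abse_ge0 (f x)).
by rewrite -E in fi.
Qed.

Lemma Rintegral_preserving mu F (f : T -> R) : preserving mu F ->
  measurable_fun setT f ->
  \int[mu]_x f (F x) = \int[mu]_x f x.
Proof.
move=> pF mf; rewrite /Rintegral; congr fine.
have mg : measurable_fun setT (EFin \o f) by exact/measurable_EFinP.
have e1 := ge0_integral_preserving pF (measurable_funepos mg) (fun x => funepos_ge0 _ x).
have e2 := ge0_integral_preserving pF (measurable_funeneg mg) (fun x => funeneg_ge0 _ x).
have h1 := integralE mu setT (fun x => (f (F x))%:E).
have h2 := integralE mu setT (EFin \o f).
apply: etrans h1 _; apply: etrans _ (esym h2).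
by rewrite (_ : (fun x0 : T => (f (F x0))%:E) = (EFin \o f) \o F)// funepos_comp funeneg_comp e1 e2.
Qed.

End preserving.

Section preserving_heis.
Context {R : realType}.

(** The sign 1 gives translations, the sign -1 translations composed with the inversion; both are
    treated together. *)
Definition sgn_unit (e : R) := e = 1 \/ e = -1.

Lemma preserving_R (e c : R) : sgn_unit e -> preserving (@lebesgue_R R) (fun t => e * t + c).
Proof.
move=> ep.
have mF : measurable_fun setT (fun t : R => e * t + c).
  by apply: measurable_funD => //; exact: measurable_funM.
split => // A mA.
pose nu : {measure set (measurableTypeR R) -> \bar R} :=
  [the {measure set (measurableTypeR R) -> \bar R} of @pushforward _ _ (measurableTypeR R) (measurableTypeR R) R (@lebesgue_measure R) (fun t : R => e * t + c)].
apply/esym; apply: (@lebesgue_measure_unique R (nu mF)) => // _ [[a b] _ <-] /=.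
rewrite /pushforward.
have [ab|ba] := ltP a b; last first.
  by rewrite set_itv_ge ?bnd_simp -?leNgt// preimage_set0 !measure0.
case: ep => ->.
  rewrite (_ : _ @^-1` _ = `]a - c, b - c]%classic); last first.
    by apply/seteqP; split => t /=; rewrite !in_itv/= mul1r ltrBlDr lerBrDr.
  by rewrite !lebesgue_measure_itv/= !lte_fin ltrD2r ab -!EFinB; congr (_%:E); ring.
rewrite (_ : _ @^-1` _ = `[c - b, c - a[%classic); last first.
  apply/seteqP; split => t /=; rewrite !in_itv/= mulN1r; lra.
by rewrite !lebesgue_measure_itv/= !lte_fin ltrD2l ltrN2 ab -!EFinB; congr (_%:E); ring.
Qed.

(** Sections of the preimage are preimages of sections, so the invariance follows by integrating in
    the first factor. A shift of the last coordinate by any measurable function of the others is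
    covered, which is the form of the twist in the group law. *)
Lemma preserving_skew d1 d2 (T1 : measurableType d1) (T2 : measurableType d2)
  (m1 : {measure set T1 -> \bar R}) (m2 : {sigma_finite_measure set T2 -> \bar R})
  (S : T1 -> T1) (U : T1 -> T2 -> T2) :
  preserving m1 S -> (forall x, preserving m2 (U x)) ->
  measurable_fun setT (fun p : T1 * T2 => U p.1 p.2) ->
  preserving (m1 \x m2)%E (fun p : T1 * T2 => (S p.1, U p.1 p.2)).
Proof.
move=> pS pU mU; have [mS _] := pS.
have mF : measurable_fun setT (fun p : T1 * T2 => (S p.1, U p.1 p.2)).
  by apply: measurable_fun_pair => //; exact: measurableT_comp.
split => // A mA.
apply: (@etrans _ _ (\int[m1]_x m2 (xsection A (S x)))%E); last first.
  apply: (@ge0_integral_preserving _ _ _ _ _ (fun x => m2 (xsection A x)) pS) => //.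
  exact: measurable_fun_xsection.
suff : (\int[m1]_x m2 (xsection ((fun p : T1 * T2 => (S p.1, U p.1 p.2)) @^-1` A) x) =
  \int[m1]_x m2 (xsection A (S x)))%E by exact: id.
apply: eq_integral => x _ /=; have [mUx pUx] := pU x.
rewrite -(pUx (xsection A (S x))); last exact: measurable_xsection.
by congr (m2 _); apply/seteqP; split => y; rewrite /xsection/= !inE.
Qed.

Lemma preserving_rV n (e : R) (a : 'rV[R]_n) : sgn_unit e ->
  preserving (lebesgue_rV R n) (fun z => e *: z + a).
Proof.
move=> ep; elim: n a => [|n IH] a.
  have E : (fun z : 'rV[R]_0 => e *: z + a) = id by apply/funext => z; rewrite thinmx0 [RHS]thinmx0.
  by rewrite E; split; [exact: measurable_id|move=> A _; rewrite preimage_id].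
have mF : measurable_fun setT (fun z : 'rV[R]_n.+1 => e *: z + a).
  apply: measurable_fun_rVP => i.
  have -> : rV_coord i \o (fun z : 'rV[R]_n.+1 => e *: z + a) = fun z => e * rV_coord i z + a ord0 i.
    by apply/funext => z; rewrite /rV_coord/= !mxE.
  apply: measurable_funD => //; apply: measurable_funM => //; exact: measurable_rV_coord.
split => // A mA; rewrite /= /lebesgue_rVS /pushforward.
have [mG pG] := @preserving_skew _ _ _ _ lebesgue_R (lebesgue_rV R n)
  (fun t => e * t + (uncons_rV a).1) (fun _ z => e *: z + (uncons_rV a).2)
  (preserving_R _ ep) (fun _ => IH _)
  (measurableT_comp (proj1 (IH _)) measurable_snd).
have mcA : measurable (@cons_rV R n @^-1` A).
  by rewrite -[X in measurable X]setTI; exact: measurable_cons_rV.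
apply: etrans (pG _ mcA).
apply: (congr1 (fun F => (lebesgue_R \x lebesgue_rV R n)%E (F @^-1` A))
  (_ : (fun z : 'rV_n.+1 => e *: z + a) \o @cons_rV R n =
    @cons_rV R n \o (fun p => (e * p.1 + (uncons_rV a).1, e *: p.2 + (uncons_rV a).2)))).
apply/funext => -[t z] /=; apply/rowP => i.
have Ea : a = cons_rV (uncons_rV a).
  apply/rowP => j; case: (unliftP ord0 j) => [k|] ->.
    by have /(congr1 snd)/rowP/(_ k) := cons_rVK (uncons_rV a); rewrite !mxE => <-.
  by have /(congr1 fst) := cons_rVK (uncons_rV a) => /= <-.
rewrite [in LHS]Ea !mxE.
by case: (@fintype.split 1 n i) => j /=; rewrite !mxE// ?(ord1 j) ?eqxx ?mulr1n.
Qed.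

Lemma preserving_heis n (e : R) (a b : 'rV[R]_n) (l : 'rV[R]_n * 'rV[R]_n -> R) :
  sgn_unit e -> measurable_fun setT l ->
  preserving (heis_measure R n)
    (fun x => (e *: x.1.1 + a, e *: x.1.2 + b, e * x.2 + l x.1)).
Proof.
move=> ep ml; have p1 := preserving_rV a ep; have p2 := preserving_rV b ep.
have p12 := preserving_skew p1 (fun _ => p2) (measurableT_comp (proj1 p2) measurable_snd).
have H := @preserving_skew _ _ _ _ (lebesgue_rV R n \x lebesgue_rV R n)%E (@lebesgue_R R)
  (fun z => (e *: z.1 + a, e *: z.2 + b)) (fun z t => e * t + l z) p12
  (fun z => preserving_R (l z) ep).
apply: H.
apply: measurable_funD; first by apply: measurable_funM => //; exact: measurable_snd.
by apply: measurableT_comp => //; exact: measurable_fst.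
Qed.

End preserving_heis.

Lemma cont_sum {R : realType} (V : topologicalType) I (r : seq I) (F : I -> V -> R) :
  (forall i, continuous (F i)) -> continuous (fun v => \sum_(i <- r) F i v).
Proof.
move=> cF; elim: r => [|i r IH] v.
  by under eq_fun do rewrite big_nil; exact: cvg_cst.
by under eq_fun do rewrite big_cons; apply: cvgD; [exact: cF|exact: IH].
Qed.

(** * Topology and measurability *)

Section heis_topology.
Context {R : realType} {n : nat}.
Local Notation H := (heis R n).
Implicit Types (x y w : H) (r : R).

Lemma rV_norm_le (m : nat) (v : 'rV[R]_m) r : 0 <= r ->
  (`|v| <= r) <-> (forall j, `|v ord0 j| <= r).
Proof.
move=> r0; rewrite /Num.norm/= mx_normrE; split => [vr j|vr].
  apply: le_trans vr; exact: (le_bigmax 0 (fun ij : 'I_1 * 'I_m => `|v ij.1 ij.2|) (ord0, j)).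
apply/bigmax_leP; split => // -[i j] _ /=; rewrite (ord1 i); exact: vr.
Qed.

Definition heis_normed : normedModType R := [the normedModType R of H].

(** By conversion the norm of [heis_normed]. Bounded support and compactness are expressed through
    it; the homogeneous norm [hnorm] is kept for scaling arguments. *)
Definition hmax (x : H) : R := Num.max (Num.max `|x.1.1| `|x.1.2|) `|x.2|.

Lemma hmaxE (x : heis_normed) : hmax x = `|x|. Proof. by []. Qed.

Lemma hmax_ge0 x : 0 <= hmax x. Proof. by rewrite hmaxE. Qed.

Lemma heis_norm_le x r : 0 <= r ->
  (hmax x <= r) <-> [/\ forall j, `|x.1.1 ord0 j| <= r, forall j, `|x.1.2 ord0 j| <= r & `|x.2| <= r].
Proof.
move=> r0; rewrite /hmax !ge_max; split.
  by move=> /andP[/andP[/(rV_norm_le _ r0) a /(rV_norm_le _ r0) b] c].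
by move=> [/(rV_norm_le _ r0) -> /(rV_norm_le _ r0) -> ->].
Qed.

Lemma coord_le_norm x j : `|x.1.1 ord0 j| <= hmax x /\ `|x.1.2 ord0 j| <= hmax x.
Proof. by have [/(_ (lexx _))[a b c] _] := heis_norm_le x (hmax_ge0 x). Qed.

Lemma coord2_le_norm x : `|x.2| <= hmax x.
Proof. by have [/(_ (lexx _))[a b c] _] := heis_norm_le x (hmax_ge0 x). Qed.

Lemma compact_cube r : compact [set x : H | hmax x <= r].
Proof.
have [r0|r0] := leP 0 r; last first.
  rewrite (_ : [set _ | _] = set0); first exact: compact0.
  by apply/seteqP; split => // x /= /(le_trans (hmax_ge0 _)); rewrite leNgt r0.
have cI : compact (`[- r, r]%classic : set R) by exact: segment_compact.
have cV : compact [set v : 'rV[R]_n | forall i, `[- r, r]%classic (v ord0 i)].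
  exact: (@rV_compact _ _ (fun=> `[- r, r]%classic)).
rewrite (_ : [set _ | _] = ([set v : 'rV[R]_n | forall i, `[- r, r]%classic (v ord0 i)] `*`
  [set v : 'rV[R]_n | forall i, `[- r, r]%classic (v ord0 i)]) `*` `[- r, r]%classic).
  by apply: compact_setX => //; exact: compact_setX.
apply/seteqP; split => x /=.
  move=> /(heis_norm_le _ r0)[a b c]; rewrite in_itv/= -ler_norml.
  by split => //; split => i; rewrite in_itv/= -ler_norml.
move=> [[a b] c]; apply/heis_norm_le => //; split.
- by move=> j; have := a j; rewrite in_itv/= -ler_norml.
- by move=> j; have := b j; rewrite in_itv/= -ler_norml.
- by move: c; rewrite in_itv/= -ler_norml.
Qed.

Lemma measurable_coordx j : measurable_fun setT (fun x : H => x.1.1 ord0 j).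
Proof.
apply: (measurableT_comp (measurable_rV_coord j)).
by apply: measurableT_comp => //; exact: measurable_fst.
Qed.

Lemma measurable_coordy j : measurable_fun setT (fun x : H => x.1.2 ord0 j).
Proof.
apply: (measurableT_comp (measurable_rV_coord j)).
by apply: measurableT_comp => //; exact: measurable_fst.
Qed.

Lemma measurable_coordt : measurable_fun setT (fun x : H => x.2).
Proof. exact: measurable_snd. Qed.

Lemma measurable_heisP d (T : measurableType d) (F : T -> H) :
  (forall j, measurable_fun setT (fun t => (F t).1.1 ord0 j)) ->
  (forall j, measurable_fun setT (fun t => (F t).1.2 ord0 j)) ->
  measurable_fun setT (fun t => (F t).2) -> measurable_fun setT F.
Proof.
move=> a b c.
have -> : F = (fun t => ((F t).1, (F t).2)) by apply/funext => t; case: (F t).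
apply: measurable_fun_pair => //.
have -> : (fun t => (F t).1) = (fun t => ((F t).1.1, (F t).1.2)).
  by apply/funext => t; case: (F t) => -[].
by apply: measurable_fun_pair; exact: measurable_fun_rVP.
Qed.

(** The measurable sets are generated by the coordinates, not by the open sets, so continuous
    functions are reached through a grid of mesh 1/(k+1) whose cells are described by the integer
    parts of the coordinates. *)
Let grid := ('rV[int]_n * 'rV[int]_n * int)%type.

Let cell (k : nat) x : grid :=
  (map_mx (fun t => Num.floor (t * k.+1%:R)) x.1.1,
   map_mx (fun t => Num.floor (t * k.+1%:R)) x.1.2, Num.floor (x.2 * k.+1%:R)).

Let corner (k : nat) (c : grid) : H :=
  (map_mx (fun z => z%:~R / k.+1%:R) c.1.1, map_mx (fun z => z%:~R / k.+1%:R) c.1.2,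
   c.2%:~R / k.+1%:R).

Let measurable_floor_eq (f : H -> R) (z : int) (k : nat) : measurable_fun setT f ->
  measurable [set x | Num.floor (f x * k.+1%:R) = z].
Proof.
move=> mf.
have mf' : measurable_fun setT (fun x => f x * k.+1%:R) by exact: measurable_funM.
rewrite (_ : [set _ | _] = (fun x => f x * k.+1%:R) @^-1` `[z%:~R, (z + 1)%:~R[%classic).
  by rewrite -[X in measurable X]setTI; exact: mf'.
apply/seteqP; split => x /=; rewrite in_itv/=.
  by move=> <-; rewrite floor_le floorD1_gt.
by move=> h; exact: floor_def.
Qed.

Let measurable_cell k c : measurable [set x | cell k x = c].
Proof.
have -> : [set x : H | cell k x = c] = ((\bigcap_(j in [set: 'I_n]) [set x : H | Num.floor (x.1.1 ord0 j * k.+1%:R) = c.1.1 ord0 j]) `&`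
  (\bigcap_(j in [set: 'I_n]) [set x : H | Num.floor (x.1.2 ord0 j * k.+1%:R) = c.1.2 ord0 j]) `&`
  [set x : H | Num.floor (x.2 * k.+1%:R) = c.2]).
  apply/seteqP; split => x /=.
    by move=> <-; split => //; split => j _ /=; rewrite mxE.
  move=> [[a b] d]; rewrite /cell [RHS]surjective_pairing d [c.1]surjective_pairing.
  by congr (_, _, _); apply/rowP => j; rewrite mxE; [exact: a|exact: b].
apply: measurableI; first apply: measurableI.
- by apply: fin_bigcap_measurable => // j _; exact: (measurable_floor_eq _ _ (measurable_coordx j)).
- by apply: fin_bigcap_measurable => // j _; exact: (measurable_floor_eq _ _ (measurable_coordy j)).
- exact: (measurable_floor_eq _ _ measurable_coordt).
Qed.

Let corner_near k x : hmax (x - corner k (cell k x)) <= k.+1%:R^-1.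
Proof.
have k0 : 0 < (k.+1%:R : R) by rewrite ltr0n.
have F (t : R) : `|t - (Num.floor (t * k.+1%:R))%:~R / k.+1%:R| <= k.+1%:R^-1.
  have a := floor_le (t * k.+1%:R); have b := floorD1_gt (t * k.+1%:R).
  have -> : t - (Num.floor (t * k.+1%:R))%:~R / k.+1%:R = (t * k.+1%:R - (Num.floor (t * k.+1%:R))%:~R) / k.+1%:R.
    by rewrite mulrBl mulfK// gt_eqF.
  rewrite normrM (gtr0_norm (x := k.+1%:R^-1)) ?invr_gt0// ler_piMl ?invr_ge0 ?ltW//.
  rewrite ger0_norm ?subr_ge0//; move: b; rewrite intrD; lra.
apply/heis_norm_le; first by rewrite invr_ge0 ltW.
by split => [j|j|]; rewrite ?mxE/= ?mxE; exact: F.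
Qed.

(* A continuous function is the pointwise limit of its values at grid points. *)
Lemma continuous_measurable (f : H -> R) : continuous f -> measurable_fun setT f.
Proof.
move=> cf; apply: (@measurable_fun_cvg _ _ _ _ (fun k x => f (corner k (cell k x)))).
  move=> k _ B mB; rewrite setTI.
  (* There are countably many cells, so the preimage is a countable union of cells, indexed by their
     codes; a number that codes no cell contributes the empty set. *)
  rewrite (_ : _ @^-1` _ = \bigcup_i (if unpickle i is Some c then
      (if `[< B (f (corner k c)) >] then [set x | cell k x = c] else set0) else set0)).
    apply: bigcupT_measurable => i; case: (unpickle i) => [c|]; last exact: measurable0.
    by case: ifPn => _; [exact: measurable_cell|exact: measurable0].
  apply/seteqP; split => x /=.
    move=> Bx; exists (pickle (cell k x)); first by [].
    by rewrite pickleK asboolT.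
  move=> [i _]; case: (unpickle i) => [c|//].
  by case: ifPn => // /asboolP Bc /= E; rewrite E.
move=> x _; apply: (@cvg_comp _ _ _ (fun k => corner k (cell k x)) f _ (nbhs x)); last exact: cf.
apply/(@cvgrPdist_le _ heis_normed) => e e0; near=> k; rewrite -hmaxE.
apply: (le_trans (corner_near k x)); apply: ltW; near: k.
by have := near_infty_natSinv_lt (PosNum e0).
Unshelve. all: by end_near. Qed.

End heis_topology.

(** * The group law *)

Section group.
Context {R : realType} {n : nat}.
Local Notation H := (heis R n).
Implicit Types (x y w : H) (r : R).

(** The form 2 Im of z times the conjugate of z', written in real coordinates: the cocycle of the
    central extension. *)
Definition symp (z z' : 'rV[R]_n * 'rV[R]_n) : R :=
  2 * \sum_(j < n) (z.2 ord0 j * z'.1 ord0 j - z.1 ord0 j * z'.2 ord0 j).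

(* The inverse of x is the additive opposite - x. *)
Definition hmul x y : H := (x.1.1 + y.1.1, x.1.2 + y.1.2, x.2 + y.2 + symp x.1 y.1).

Lemma sympDl z z' z'' : symp (z + z') z'' = symp z z'' + symp z' z''.
Proof.
rewrite /symp -mulrDr -big_split/=; congr (_ * _); apply: eq_bigr => j _.
by rewrite !mxE; ring.
Qed.

Lemma sympN z z' : symp z z' = - symp z' z.
Proof. by rewrite /symp -mulrN -sumrN; congr (_ * _); apply: eq_bigr => j _; ring. Qed.

Lemma sympDr z z' z'' : symp z (z' + z'') = symp z z' + symp z z''.
Proof. by rewrite sympN sympDl opprD -!sympN. Qed.

Lemma sympNl z z' : symp (- z) z' = - symp z z'.
Proof. by rewrite /symp -mulrN -sumrN; congr (_ * _); apply: eq_bigr => j _; rewrite !mxE; ring. Qed.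

Lemma sympNr z z' : symp z (- z') = - symp z z'.
Proof. by rewrite sympN sympNl opprK -sympN. Qed.

Lemma sympZ (a b : R) (z z' : 'rV[R]_n * 'rV[R]_n) : symp (a *: z) (b *: z') = a * b * symp z z'.
Proof.
rewrite /symp mulrCA; congr (_ * _); rewrite mulr_sumr; apply: eq_bigr => j _.
by rewrite !mxE; ring.
Qed.

Lemma sympzz z : symp z z = 0.
Proof. by rewrite /symp big1 ?mulr0// => j _; rewrite mulrC subrr. Qed.

Lemma hmul1E x y : (hmul x y).1 = x.1 + y.1. Proof. by []. Qed.

Lemma hmul2E x y : (hmul x y).2 = x.2 + y.2 + symp x.1 y.1. Proof. by []. Qed.

Lemma heis_eq x y : x.1 = y.1 -> x.2 = y.2 -> x = y.
Proof. by case: x y => [? ?] [? ?] /= -> ->. Qed.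

Lemma hmulA x y w : hmul x (hmul y w) = hmul (hmul x y) w.
Proof.
apply: heis_eq; first by rewrite !hmul1E addrA.
by rewrite !hmul2E !hmul1E sympDl sympDr; ring.
Qed.

Lemma hmul0 x : hmul x 0 = x.
Proof.
apply: heis_eq; first by rewrite hmul1E addr0.
by rewrite /= /symp big1 ?mulr0 ?addr0// => j _; rewrite !mxE; ring.
Qed.

Lemma hmul0l x : hmul 0 x = x.
Proof.
apply: heis_eq; first by rewrite hmul1E add0r.
by rewrite /= /symp big1 ?mulr0 ?addr0 ?add0r// => j _; rewrite !mxE; ring.
Qed.

Lemma hmulxN x : hmul x (- x) = 0.
Proof.
apply: heis_eq; first by rewrite hmul1E subrr.
by rewrite /= sympNr sympzz subrr oppr0 addr0.
Qed.

Lemma hmulNx x : hmul (- x) x = 0.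
Proof. by rewrite -{2}(opprK x) hmulxN. Qed.

Lemma hmulK x y : hmul (- x) (hmul x y) = y.
Proof. by rewrite hmulA hmulNx hmul0l. Qed.

Lemma hmulNK x y : hmul x (hmul (- x) y) = y.
Proof. by rewrite hmulA hmulxN hmul0l. Qed.

Lemma hmulN x y : - hmul x y = hmul (- y) (- x).
Proof.
apply: heis_eq; first by rewrite hmul1E /= opprD addrC.
by rewrite /= sympNl sympNr opprK (sympN y.1) ; ring.
Qed.

Lemma measurable_symp d (T : measurableType d) (f g : T -> H) :
  measurable_fun setT f -> measurable_fun setT g ->
  measurable_fun setT (fun t => symp (f t).1 (g t).1).
Proof.
move=> mf mg; apply: measurable_funM => //; apply: measurable_sum => j.
by apply: measurable_funB; apply: measurable_funM;
  [apply: (measurableT_comp (measurable_coordy j))|apply: (measurableT_comp (measurable_coordx j))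
  |apply: (measurableT_comp (measurable_coordx j))|apply: (measurableT_comp (measurable_coordy j))].
Qed.

Lemma measurable_hmul d (T : measurableType d) (f g : T -> H) :
  measurable_fun setT f -> measurable_fun setT g ->
  measurable_fun setT (fun t => hmul (f t) (g t)).
Proof.
move=> mf mg; apply: measurable_heisP.
- move=> j; under eq_fun do rewrite mxE.
  by apply: measurable_funD; apply: (measurableT_comp (measurable_coordx j)).
- move=> j; under eq_fun do rewrite mxE.
  by apply: measurable_funD; apply: (measurableT_comp (measurable_coordy j)).
- apply: measurable_funD; last exact: measurable_symp.
  by apply: measurable_funD; apply: (measurableT_comp measurable_coordt).
Qed.

Lemma measurable_opp_heis : measurable_fun setT (fun x : H => - x).
Proof.
apply: measurable_heisP => [j|j|].
- by under eq_fun do rewrite mxE; apply: measurableT_comp => //; exact: measurable_coordx.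
- by under eq_fun do rewrite mxE; apply: measurableT_comp => //; exact: measurable_coordy.
- rewrite (_ : (fun t : H => (- t).2) = (fun t => - t.2))//.
  by apply: measurableT_comp => //; exact: measurable_coordt.
Qed.

Let mfst : measurable_fun setT (fun z : 'rV[R]_n * 'rV[R]_n => ((z, 0) : H)).
Proof. exact: measurable_fun_pair. Qed.

Let mu := heis_measure R n.

Lemma preserving_hmul x : preserving mu (hmul x).
Proof.
have -> : hmul x = fun y => (1 *: y.1.1 + x.1.1, 1 *: y.1.2 + x.1.2, 1 * y.2 + (x.2 + symp x.1 y.1)).
  apply/funext => y; apply: heis_eq => /=.
    by rewrite !scale1r (addrC x.1.1) (addrC x.1.2).
  by rewrite mul1r; ring.
apply: (preserving_heis _ _ (l := fun z => x.2 + symp x.1 z)); first by left.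
apply: measurable_funD => //; exact: (measurable_symp (f := cst x) _ mfst).
Qed.

(** The change of variable y = x w^-1: Haar measure is invariant under inversion as well as under
    left translation. This is what passes from one form of a convolution to the other. *)
Lemma preserving_hmulN x : preserving mu (fun w => hmul x (- w)).
Proof.
have -> : (fun w => hmul x (- w)) = fun y => (-1 *: y.1.1 + x.1.1, -1 *: y.1.2 + x.1.2, -1 * y.2 + (x.2 - symp x.1 y.1)).
  apply/funext => y; apply: heis_eq => /=.
    by rewrite !scaleN1r (addrC x.1.1) (addrC x.1.2).
  by rewrite sympNr; ring.
apply: (preserving_heis _ _ (l := fun z => x.2 - symp x.1 z)); first by right.
apply: measurable_funB => //; exact: (measurable_symp (f := cst x) _ mfst).
Qed.

Lemma preserving_add x : preserving mu (fun y => y + x).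
Proof.
have -> : (fun y => y + x) = fun y => (1 *: y.1.1 + x.1.1, 1 *: y.1.2 + x.1.2, 1 * y.2 + x.2).
  by apply/funext => y; rewrite !scale1r mul1r.
apply: (preserving_heis _ _ (l := cst x.2)) => //; by left.
Qed.

Lemma preserving_opp : preserving mu (fun y => - y).
Proof.
have := preserving_hmulN 0; congr preserving; apply/funext => w; exact: hmul0l.
Qed.

Lemma symp_bound x y (a b : R) : hmax x <= a -> hmax y <= b ->
  `|symp x.1 y.1| <= 4 * n%:R * a * b.
Proof.
move=> xa yb; rewrite /symp normrM ger0_norm//.
have -> : 4 * n%:R * a * b = 2 * \sum_(j < n) (2 * a * b) by rewrite sumr_const card_ord -mulr_natr; ring.
rewrite ler_wpM2l// (le_trans (ler_norm_sum _ _ _))// ler_sum// => j _.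
have [x1 x2] := coord_le_norm x j; have [y1 y2] := coord_le_norm y j.
rewrite (le_trans (ler_normB _ _))// !normrM.
have H1 : `|x.1.2 ord0 j| * `|y.1.1 ord0 j| <= a * b by rewrite ler_pM// (le_trans _ xa, le_trans _ yb)//; exact: le_trans yb.
have H2 : `|x.1.1 ord0 j| * `|y.1.2 ord0 j| <= a * b by rewrite ler_pM// (le_trans _ xa, le_trans _ yb)//; exact: le_trans yb.
by move: H1 H2; lra.
Qed.

(** [hmax] is not subadditive for the group law; the quadratic term pays for the cocycle. The bound
    serves to keep supports bounded under translation and convolution. *)
Lemma hmul_norm x y (a b : R) : hmax x <= a -> hmax y <= b ->
  hmax (hmul x y) <= a + b + 4 * n%:R * a * b.
Proof.
move=> xa yb; have a0 := le_trans (hmax_ge0 _) xa; have b0 := le_trans (hmax_ge0 _) yb.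
have s := symp_bound xa yb.
have c0 : 0 <= 4 * n%:R * a * b by rewrite !mulr_ge0.
have H (u v : R) : `|u| <= hmax x -> `|v| <= hmax y -> `|u + v| <= a + b.
  by move=> ux vy; rewrite (le_trans (ler_normD _ _))// lerD// (le_trans _ xa, le_trans _ yb)//; exact: le_trans yb.
apply/heis_norm_le; first by rewrite !addr_ge0.
split=> [j|j|]; rewrite ?mxE.
- have [x1 x2] := coord_le_norm x j; have [y1 y2] := coord_le_norm y j.
  by rewrite (le_trans (H _ _ x1 y1))// lerDl.
- have [x1 x2] := coord_le_norm x j; have [y1 y2] := coord_le_norm y j.
  by rewrite (le_trans (H _ _ x2 y2))// lerDl.
- by rewrite (le_trans (ler_normD _ _))// lerD// H// coord2_le_norm.
Qed.

Lemma cont_coordx j : continuous (fun x : H => x.1.1 ord0 j).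
Proof.
move=> x; apply: (@continuous_comp _ _ _ (fun x : H => x.1.1) (fun v : 'rV[R]_n => v ord0 j)); last exact: coord_continuous.
by apply: continuous_comp; exact: cvg_fst.
Qed.

Lemma cont_coordy j : continuous (fun x : H => x.1.2 ord0 j).
Proof.
move=> x; apply: (@continuous_comp _ _ _ (fun x : H => x.1.2) (fun v : 'rV[R]_n => v ord0 j)); last exact: coord_continuous.
by apply: continuous_comp; [exact: cvg_fst|exact: cvg_snd].
Qed.

Lemma cont_coordt : continuous (fun x : H => x.2).
Proof. by move=> x; exact: cvg_snd. Qed.

Lemma cont_hmul2 (V : topologicalType) (f g : V -> H) :
  continuous f -> continuous g -> continuous (fun t => hmul (f t) (g t)).
Proof.
move=> cf cg t.
have c (k : H -> R) (f' : V -> H) : continuous f' -> continuous k -> continuous (k \o f').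
  by move=> c1 c2 s; apply: continuous_comp; [exact: c1|exact: c2].
have cs : continuous (fun t => symp (f t).1 (g t).1).
  move=> s; apply: cvgM; first exact: cvg_cst.
  apply: (@cont_sum R V _ _ (fun j t => (f t).1.2 ord0 j * (g t).1.1 ord0 j - (f t).1.1 ord0 j * (g t).1.2 ord0 j)) => j s'.
  by apply: cvgB; apply: cvgM;
    [apply: (c (fun x : H => x.1.2 ord0 j))|apply: (c (fun x : H => x.1.1 ord0 j))
    |apply: (c (fun x : H => x.1.1 ord0 j))|apply: (c (fun x : H => x.1.2 ord0 j))] => //;
    [exact: cont_coordy|exact: cont_coordx|exact: cont_coordx|exact: cont_coordy].
have c1 (f' : V -> H) : continuous f' -> continuous (fun t => (f' t).1.1).
  move=> c' s; apply: (@continuous_comp _ _ _ f' (fun x : H => x.1.1)); first exact: c'.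
  by apply: continuous_comp; exact: cvg_fst.
have c2 (f' : V -> H) : continuous f' -> continuous (fun t => (f' t).1.2).
  move=> c' s; apply: (@continuous_comp _ _ _ f' (fun x : H => x.1.2)); first exact: c'.
  by apply: continuous_comp; [exact: cvg_fst|exact: cvg_snd].
have A1 : (fun t => (f t).1.1 + (g t).1.1) @ t --> (f t).1.1 + (g t).1.1 by apply: cvgD; exact: c1.
have A2 : (fun t => (f t).1.2 + (g t).1.2) @ t --> (f t).1.2 + (g t).1.2 by apply: cvgD; exact: c2.
have A3 : (fun t => (f t).2 + (g t).2 + symp (f t).1 (g t).1) @ t --> (f t).2 + (g t).2 + symp (f t).1 (g t).1.
  apply: cvgD; last exact: cs.
  by apply: cvgD; apply: (c (fun x : H => x.2)) => //; exact: cont_coordt.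
exact: (cvg_pair (cvg_pair A1 A2) A3).
Qed.

Lemma cont_hmul x : continuous (hmul x).
Proof. by apply: (@cont_hmul2 H (cst x) id) => // y; [exact: cvg_cst|exact: cvg_id]. Qed.

Lemma cont_hmulr x : continuous (hmul ^~ x).
Proof. by apply: (@cont_hmul2 H id (cst x)) => // y; [exact: cvg_id|exact: cvg_cst]. Qed.

Lemma cont_oppH : continuous (fun x : H => - x).
Proof. exact: opp_continuous. Qed.

End group.

(** * Integration on the group *)

Section heis_measure.
Context {R : realType} {n : nat}.
Local Notation H := (heis R n).
Local Notation mu := (heis_measure R n).
Implicit Types (x y w v : H) (r : R) (f g b phi psi : H -> R).

Lemma measurable_hmax : measurable_fun setT (@hmax R n).
Proof. by apply: continuous_measurable => x; exact: (@norm_continuous _ (heis_normed (R := R) (n := n))). Qed.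

Definition cube r : set H := [set x | hmax x <= r].

Lemma measurable_cube r : measurable (cube r).
Proof.
rewrite (_ : cube r = hmax @^-1` `]-oo, r]%classic).
  by rewrite -[X in measurable X]setTI; exact: measurable_hmax.
by apply/seteqP; split => x /=; rewrite in_itv.
Qed.

Lemma lebesgue_rV_fin (m : nat) r : 0 <= r ->
  (lebesgue_rV R m [set v : 'rV[R]_m | (forall j, `|v ord0 j| <= r)%R] < +oo)%E.
Proof.
move=> r0; elim: m => [|m IH]; first by rewrite /= diracE ltey; case: (_ \in _).
rewrite /= /lebesgue_rVS /pushforward.
have mB (k : nat) : measurable [set v : 'rV[R]_k | (forall j, `|v ord0 j| <= r)%R].
  rewrite (_ : [set v | _] = \bigcap_(j in [set: 'I_k]) ((@rV_coord _ R k j) @^-1` `[- r, r]%classic)).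
    apply: fin_bigcap_measurable => // j _; rewrite -[X in measurable X]setTI.
    exact: measurable_rV_coord.
  apply/seteqP; split => v vr j; first by move=> _; rewrite /= in_itv/= -ler_norml; exact: vr.
  by have := vr j I; rewrite /= in_itv/= -ler_norml.
have mI : measurable (`[- r, r]%classic : set R) by exact: measurable_itv.
rewrite (_ : _ @^-1` _ = `[- r, r]%classic `*` [set v : 'rV[R]_m | (forall j, `|v ord0 j| <= r)%R]).
  have E := product_measure1E lebesgue_R (lebesgue_rV R m) mI (mB m).
  suff : (lebesgue_R (`[(- r)%R, r]%classic) * lebesgue_rV R m [set v | (forall j, `|v ord0 j| <= r)%R] < +oo)%E by rewrite -E.
  apply: lte_mul_pinfty => //.
  by rewrite ge0_fin_numE// /lebesgue_R lebesgue_measure_itv/=; case: ifP; rewrite ltry.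
apply/seteqP; split => -[t v] /=.
  move=> h; split.
    by have := h ord0; have /(congr1 fst)/= -> := cons_rVK (t, v); rewrite in_itv/= -ler_norml.
  move=> j; have := h (lift ord0 j).
  by have /(congr1 snd)/rowP/(_ j) := cons_rVK (t, v); rewrite mxE => ->.
move=> [t1 v1] j; case: (unliftP ord0 j) => [k|] ->.
  by have /(congr1 snd)/rowP/(_ k) := cons_rVK (t, v); rewrite mxE => ->.
by have /(congr1 fst)/= -> := cons_rVK (t, v); rewrite ler_norml; move: t1; rewrite in_itv.
Qed.

Lemma mu_cube_fin r : (mu (cube r) < +oo)%E.
Proof.
have [r0|r0] := leP 0 r; last first.
  rewrite (_ : cube r = set0) ?measure0//; apply/seteqP; split => // x /= h.
  by have := le_trans (hmax_ge0 x) h; rewrite leNgt r0.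
pose B := [set v : 'rV[R]_n | (forall j, `|v ord0 j| <= r)%R].
have mB : measurable B.
  rewrite (_ : B = \bigcap_(j in [set: 'I_n]) ((@rV_coord _ R n j) @^-1` `[- r, r]%classic)).
    apply: fin_bigcap_measurable => // j _; rewrite -[X in measurable X]setTI.
    exact: measurable_rV_coord.
  apply/seteqP; split => v vr j; first by move=> _; rewrite /= in_itv/= -ler_norml; exact: vr.
  by have := vr j I; rewrite /= in_itv/= -ler_norml.
have mI : measurable (`[- r, r]%classic : set R) by exact: measurable_itv.
have fB : (lebesgue_rV R n B < +oo)%E by exact: lebesgue_rV_fin.
rewrite (_ : cube r = (B `*` B) `*` `[- r, r]%classic).
  have E := product_measure1E (lebesgue_rV R n \x lebesgue_rV R n)%E (@lebesgue_R R) (measurableX mB mB) mI.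
  have E' := product_measure1E (lebesgue_rV R n) (lebesgue_rV R n) mB mB.
  have fBB : ((lebesgue_rV R n \x lebesgue_rV R n) (B `*` B) < +oo)%E.
    suff : (lebesgue_rV R n B * lebesgue_rV R n B < +oo)%E by rewrite -E'.
    by rewrite lte_mul_pinfty// ge0_fin_numE.
  suff : ((lebesgue_rV R n \x lebesgue_rV R n) (B `*` B) * lebesgue_R (`[(- r)%R, r]%classic) < +oo)%E by rewrite -E.
  apply: lte_mul_pinfty => //; first by rewrite ge0_fin_numE.
  by rewrite /lebesgue_R lebesgue_measure_itv/=; case: ifP; rewrite ltry.
apply/seteqP; split => x /=.
  move=> /(heis_norm_le _ r0)[a c d]; split => //=.
  by rewrite in_itv/= -ler_norml.
move=> [[a c] d]; apply/heis_norm_le => //; split => //.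
by move: d; rewrite /= in_itv/= -ler_norml.
Qed.

Definition bsupp f := exists r, forall x, r < hmax x -> f x = 0.

Lemma bsuppMr f g : bsupp g -> bsupp (fun x => f x * g x).
Proof. by move=> [r fr]; exists r => x /fr ->; rewrite mulr0. Qed.

Lemma bsuppD f g : bsupp f -> bsupp g -> bsupp (fun x => f x + g x).
Proof.
move=> [r fr] [s gs]; exists (Num.max r s) => x; rewrite gt_max => /andP[/fr -> /gs ->].
by rewrite addr0.
Qed.

Lemma bounded_continuous f : continuous f -> bsupp f -> exists2 M, 0 < M & forall x, `|f x| <= M.
Proof.
move=> cf [r fr].
have /compact_bounded[M [_ /(_ (`|M| + 1))]] : compact (f @` cube r).
  by apply: continuous_compact; [exact: continuous_subspaceT|exact: compact_cube].
rewrite (le_lt_trans (ler_norm M)) ?ltrDl// => /(_ isT) HM.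
exists (`|M| + 1) => [|x]; first by rewrite ltr_wpDl.
have [xr|xr] := leP (hmax x) r; first by apply: HM; exists x.
by rewrite fr// normr0 addr_ge0.
Qed.

Definition locint b := measurable_fun setT b /\
  forall r, (\int[mu]_(x in cube r) `|b x|%:E < +oo)%E.

Lemma integrable_fun_le f g : measurable_fun setT f -> (forall x, `|f x| <= g x) ->
  mu.-integrable setT (EFin \o g) -> mu.-integrable setT (EFin \o f).
Proof.
move=> mf fg; apply: le_integrable => //; first exact/measurable_EFinP.
by move=> x _ /=; rewrite lee_fin (le_trans (fg x))// ler_norm.
Qed.

Lemma locint_integrable b f : locint b -> measurable_fun setT f ->
  (exists M, forall x, `|f x| <= M) -> bsupp f ->
  mu.-integrable setT (EFin \o (fun x => b x * f x)).
Proof.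
move=> [mb ib] mf [M fM] [r fr].
have M0 : 0 <= M by exact: le_trans (fM 0).
have mbf : measurable_fun setT (fun x => b x * f x) by exact: measurable_funM.
apply/integrableP; split; first exact/measurable_EFinP.
apply: (@le_lt_trans _ _ (\int[mu]_x (M%:E * ((fun y => `|b y|%:E) \_ (cube r)) x))%E).
  apply: ge0_le_integral => //.
  - by apply/measurable_EFinP; exact: measurableT_comp.
  - apply: emeasurable_funM => //; apply/(measurable_restrictT _ (measurable_cube r)).
    by apply/measurable_EFinP; apply: measurable_funTS; exact: measurableT_comp.
  - move=> x _; rewrite patchE; case: ifPn => [_|].
      by rewrite -EFinM lee_fin normrM mulrC ler_wpM2r.
    by rewrite notin_setE /cube/= => /negP; rewrite -ltNge => /fr ->; rewrite mulr0 normr0 mule0.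
rewrite ge0_integralZl//; last first.
  - by move=> x _; rewrite patchE; case: ifPn => // _; rewrite lee_fin.
  - apply/(measurable_restrictT _ (measurable_cube r)).
    by apply/measurable_EFinP; apply: measurable_funTS; exact: measurableT_comp.
rewrite -integral_mkcond lte_mul_pinfty ?lee_fin//.
Qed.

Lemma cont_locint f : continuous f -> locint f.
Proof.
move=> cf; split; first exact: continuous_measurable.
move=> r.
have /compact_bounded[M [_ /(_ (`|M| + 1))]] : compact (f @` cube r).
  by apply: continuous_compact; [exact: continuous_subspaceT|exact: compact_cube].
rewrite (le_lt_trans (ler_norm M)) ?ltrDl// => /(_ isT) HM.
apply: (@le_lt_trans _ _ (\int[mu]_(x in cube r) (`|M| + 1)%:E)%E).
  apply: ge0_le_integral => //; first exact: measurable_cube.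
  - apply/measurable_EFinP; apply: measurable_funTS; apply: measurableT_comp => //.
    exact: continuous_measurable.
  - by move=> x xr; rewrite lee_fin; apply: HM; exists x.
by rewrite integral_cst ?lte_mul_pinfty ?lee_fin ?mu_cube_fin//; exact: measurable_cube.
Qed.

Lemma cont_integrable f : continuous f -> bsupp f -> mu.-integrable setT (EFin \o f).
Proof.
move=> cf bf.
have c1 : locint (cst 1) by apply: cont_locint => x; exact: cvg_cst.
have [M _ fM] := bounded_continuous cf bf.
have := locint_integrable c1 (continuous_measurable cf) (ex_intro _ M fM) bf.
by apply: eq_integrable => // x _ /=; rewrite mul1r.
Qed.

Lemma integrable_locint f : mu.-integrable setT (EFin \o f) -> locint f.
Proof.
move=> /integrableP[/measurable_EFinP mf fi]; split => // r.
apply: le_lt_trans fi; rewrite integral_mkcond; apply: ge0_le_integral => //.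
- by move=> x _; rewrite patchE; case: ifP => // _; rewrite lee_fin.
- apply/(measurable_restrictT _ (measurable_cube r)).
  by apply/measurable_EFinP; apply: measurable_funTS; exact: measurableT_comp.
- by apply/measurable_EFinP; exact: measurableT_comp.
- by move=> x _; rewrite patchE; case: ifP => // _ /=; rewrite lee_fin.
Qed.

Lemma Rintegral_dct (F : nat -> H -> R) f g :
  (forall k, measurable_fun setT (F k)) ->
  (forall x, F ^~ x @ \oo --> f x) -> mu.-integrable setT (EFin \o g) ->
  (forall k x, `|F k x| <= g x) ->
  (fun k => \int[mu]_x F k x) @ \oo --> \int[mu]_x f x.
Proof.
move=> mF Ff ig Fg.
have mf : measurable_fun setT f by exact: (measurable_fun_cvg (h := F)).
have := @dominated_cvg _ _ _ mu setT measurableT (fun k => EFin \o F k) (EFin \o f) (EFin \o g).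
have fi : mu.-integrable setT (EFin \o f).
  apply: integrable_fun_le ig => // x.
  apply: (@limr_le_near _ _ _ _ (fun k => `|F k x|)) || idtac.
  have Fx : (fun k => `|F k x|) @ \oo --> `|f x| by apply: cvg_norm; exact: Ff.
  rewrite -(cvg_lim _ Fx)//; apply: limr_le; first by apply/cvg_ex; exists `|f x|.
  by apply: nearW => k; exact: Fg.
move=> H; apply: fine_cvg; rewrite fineK; last exact: integrable_fin_num.
apply: H => //.
- by move=> k; exact/measurable_EFinP.
- by move=> x _; apply/cvg_EFin; [exact: nearW|exact: Ff].
- by move=> k x _ /=; rewrite lee_fin.
Qed.

(** Dominated convergence is stated along sequences; this turns its conclusion into continuity of
    integrals depending on a point. *)
Lemma cont_seq (V : normedModType R) (f : V -> R) (x : V) :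
  (forall u : nat -> V, u @ \oo --> x -> (f \o u) @ \oo --> f x) -> {for x, continuous f}.
Proof.
move=> H; apply: contrapT => nc.
have : exists2 e : R, 0 < e & forall k : nat, exists y : V, `|x - y| < k.+1%:R^-1 /\ e <= `|f x - f y|.
  apply: contrapT => /forall2NP hn; apply: nc; apply/cvgrPdist_lt => e e0.
  have [//|/existsNP[k /forallNP hk]] := hn e.
  have k0 : 0 < (k.+1%:R^-1 : R) by rewrite invr_gt0 ltr0n.
  have := nbhsx_ballx x _ k0; apply: filterS => y; rewrite -ball_normE/= => yb.
  by rewrite ltNge; apply/negP => le; exact: (hk y (conj yb le)).
move=> [e e0 /choice[u hu]].
have : u @ \oo --> x.
  apply/cvgrPdist_lt => d d0; near=> k.
  apply: (lt_trans (hu k).1); near: k; by have := near_infty_natSinv_lt (PosNum d0).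
move=> /H /cvgrPdist_lt /(_ _ e0) [k _ /(_ k (leqnn k))]/=.
by rewrite ltNge (hu k).2.
Unshelve. all: by end_near. Qed.

End heis_measure.

(** * Test functions *)

Section test_functions.
Context {R : realType} {n : nat}.
Local Notation H := (heis R n).
Local Notation mu := (heis_measure R n).
Implicit Types (x y w v : H) (r : R) (f g b phi psi : H -> R).

Lemma test_functionP phi : test_function phi <-> smooth setT phi /\ bsupp phi.
Proof.
rewrite /test_function smooth_onP; split => -[sp hp]; split => //.
  have /compact_bounded[M [_ /(_ (`|M| + 1))]] := hp.
  rewrite (le_lt_trans (ler_norm M)) ?ltrDl// => /(_ isT) HM.
  exists (`|M| + 1) => x hx; apply/eqP/negPn/negP => px.
  have : hmax x <= `|M| + 1 by apply: HM; exact: subset_closure.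
  by rewrite leNgt hx.
have [r pr] := hp.
apply: (@subclosed_compact _ _ (cube r)); [exact: closed_closure|exact: compact_cube|].
have cl : closed [set x : H | hmax x <= r].
  rewrite (_ : [set x | _] = hmax @^-1` [set t | t <= r])//.
  apply: preimage_closed; last exact: closed_le.
  by move=> x _; exact: (@norm_continuous _ (heis_normed (R := R) (n := n))).
rewrite [X in _ `<=` X](closure_id _).1//; apply: closure_subset => x /=.
by apply: contraNP => /negP; rewrite -ltNge => /pr ->.
Qed.

Lemma smooth_continuous (A : set H) f : smooth A f -> forall x, A x -> {for x, continuous f}.
Proof. by move=> sf; exact: Cn_cont (sf 0%N). Qed.

Lemma smooth_cont f : smooth setT f -> continuous f.
Proof. by move=> sf x; exact: smooth_continuous sf x I. Qed.

Lemma smooth_meas f : smooth setT f -> measurable_fun setT f.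
Proof. by move=> sf; apply: continuous_measurable; exact: smooth_cont. Qed.

Lemma smooth_derivable (A : set H) f v x : smooth A f -> A x -> derivable f x v.
Proof. by move=> sf Ax; have [_ /(_ v)[d _]] := sf 1%N; exact: d. Qed.

Lemma smooth_derive (A : set H) f v : smooth A f -> smooth A ('D_v f).
Proof. by move=> sf m; have [_ /(_ v)[_]] := sf m.+1. Qed.

Lemma smoothM (A : set H) f g : open A -> smooth A f -> smooth A g -> smooth A (fun x => f x * g x).
Proof. by move=> oA sf sg m; exact: Cn_mul. Qed.

Lemma smoothD (A : set H) f g : open A -> smooth A f -> smooth A g -> smooth A (fun x => f x + g x).
Proof. by move=> oA sf sg m; exact: Cn_add. Qed.

Lemma smooth_cst (A : set H) (c : R) : smooth A (fun=> c).
Proof. by move=> m; exact: Cn_cst. Qed.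

Lemma smoothZ (A : set H) c f : open A -> smooth A f -> smooth A (fun x => c * f x).
Proof. by move=> oA sf; apply: smoothM => //; exact: smooth_cst. Qed.

Lemma smoothN (A : set H) f : open A -> smooth A f -> smooth A (fun x => - f x).
Proof.
move=> oA sf; rewrite (_ : (fun x => _) = (fun x => -1 * f x)); first exact: smoothZ.
by apply/funext => x; rewrite mulN1r.
Qed.

Lemma smoothB (A : set H) f g : open A -> smooth A f -> smooth A g -> smooth A (fun x => f x - g x).
Proof. by move=> oA sf sg; apply: smoothD => //; exact: smoothN. Qed.

Lemma smooth_sum (A : set H) I (r : seq I) (F : I -> H -> R) : open A ->
  (forall i, smooth A (F i)) -> smooth A (fun x => \sum_(i <- r) F i x).
Proof. by move=> oA sF m; apply: Cn_sum => // i; exact: sF. Qed.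

Lemma smooth_linear (l : H -> R) : (forall (h : R) w y, l (h *: w + y) = h * l w + l y) ->
  continuous l -> smooth setT l.
Proof. by move=> ll cl m; apply: Cn_linear => //; exact: openT. Qed.

Lemma smooth_coordx j : smooth setT (fun x : H => x.1.1 ord0 j).
Proof. by apply: smooth_linear; [move=> h w y; rewrite !mxE|exact: cont_coordx]. Qed.

Lemma smooth_coordy j : smooth setT (fun x : H => x.1.2 ord0 j).
Proof. by apply: smooth_linear; [move=> h w y; rewrite !mxE|exact: cont_coordy]. Qed.

Lemma smooth_coordt : smooth setT (fun x : H => x.2).
Proof. by apply: smooth_linear => //; exact: cont_coordt. Qed.

Lemma bsupp_derive f v : smooth setT f -> bsupp f -> bsupp ('D_v f).
Proof.
move=> sf [r fr]; exists r => x xr.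
rewrite -(@derive_cst _ _ R^o (0 : R) x v); apply: near_eq_derive.
have : nbhs x [set y | r < hmax y].
  apply: open_nbhs_nbhs; split => //.
  rewrite (_ : [set x | _] = hmax @^-1` [set t | r < t])//.
  apply: open_comp; last exact: open_gt.
  by move=> y _; exact: (@norm_continuous _ (heis_normed (R := R) (n := n))).
by apply: filterS => y /fr.
Qed.

Definition test phi := smooth setT phi /\ bsupp phi.

Lemma test_derive f v : test f -> test ('D_v f).
Proof. by move=> [sf bf]; split; [exact: smooth_derive|exact: bsupp_derive]. Qed.

Lemma testM f g : smooth setT f -> test g -> test (fun x => f x * g x).
Proof. by move=> sf [sg bg]; split; [apply: smoothM => //; exact: openT|exact: bsuppMr]. Qed.

Lemma testD f g : test f -> test g -> test (fun x => f x + g x).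
Proof. by move=> [sf bf] [sg bg]; split; [apply: smoothD => //; exact: openT|exact: bsuppD]. Qed.

Lemma test_bounded f : test f -> exists2 M, 0 < M & forall x, `|f x| <= M.
Proof. by move=> [sf bf]; apply: bounded_continuous => //; exact: smooth_cont. Qed.

Lemma test_integrable f : test f -> mu.-integrable setT (EFin \o f).
Proof. by move=> [sf bf]; apply: cont_integrable => //; exact: smooth_cont. Qed.

Lemma locint_test b f : locint b -> test f -> mu.-integrable setT (EFin \o (fun x => b x * f x)).
Proof.
move=> lb tf; have [M _ fM] := test_bounded tf; have [sf bf] := tf.
by apply: locint_integrable => //; [exact: smooth_meas|exists M].
Qed.

(* Differentiating the translation-invariant integral of a along v gives 0. *)
Lemma Rintegral_derive0 f v : test f -> \int[mu]_x ('D_v f x) = 0.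
Proof.
move=> tf; have [sf bf] := tf.
have tv := test_derive v tf; have [M M0 HM] := test_bounded tv; have [_ [r Hr]] := tv.
have shift_int (s : R) : \int[mu]_y f (s *: v + y) = \int[mu]_y f y.
  have := Rintegral_preserving (preserving_add (s *: v)) (smooth_meas sf) => <-.
  by apply: eq_Rintegral => y _; rewrite addrC.
have shift_cont (s : R) : continuous (fun y => f (s *: v + y)).
  move=> y; apply: (@continuous_comp _ _ _ (fun y : H => s *: v + y) f); last exact: smooth_cont.
  by apply: cvgD; [exact: cvg_cst|exact: cvg_id].
(* For |s| < 1 the translates by s v of a function supported in the cube of radius r stay in the
   cube of radius B, so one bounded function dominates all the derivatives. *)
pose B := r + hmax v.
pose G := fun y : H => M * \1_(cube B) y.
have tri (s : R) (y : H) : s \in `]-1, 1[%R -> hmax y <= hmax (s *: v + y) + hmax v.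
  rewrite in_itv/= => /andP[s1 s2]; rewrite !hmaxE.
  have := @ler_normB _ (heis_normed (R := R) (n := n)) (s *: v + y) (s *: v).
  rewrite addrAC subrr add0r => /le_trans; apply; rewrite lerD2l normrZ ler_piMl//.
  by rewrite ler_norml !ltW.
have D (s : R) y : is_derive s (1 : R) (fun s => f (s *: v + y)) ('D_v f (s *: v + y)).
  by apply: is_derive_line; exact: smooth_derivable sf _.
have := @cvg_differentiation_under_integral R _ _ mu (fun s y => f (s *: v + y)) setT measurableT 0 (-1) 1.
move=> /(_ _ _ _ G) H.
have {}H : h^-1 *: (\int[mu]_y f ((h + 0) *: v + y) - \int[mu]_y f (0 *: v + y)) @[h --> 0^'] -->
    \int[mu]_y partial1of2 (fun s y => f (s *: v + y)) 0 y.
  apply: H.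
  - by rewrite /= in_itv/= ltrN10 ltr01.
  - move=> s _.
    have := integrable_preserving (preserving_add (s *: v)) (test_integrable tf).
    by apply: eq_integrable => // y _ /=; rewrite addrC.
  - by move=> s y _ _; exact: (@ex_derive _ _ _ _ _ _ _ (D s y)).
  - by move=> y; rewrite mulr_ge0// ltW.
  - have c1 : locint (cst M : H -> R) by apply: cont_locint => x; exact: cvg_cst.
    apply: (locint_integrable c1).
    + exact: measurable_indic (measurable_cube _).
    + by exists 1 => x; rewrite indicE; case: (_ \in _); rewrite ?normr1 ?normr0.
    + exists B => x xB; rewrite indicE memNset//= => h; by move: xB; rewrite ltNge h.
  - move=> s y sI _; rewrite partial1of2E (@derive_val _ _ _ _ _ _ _ (D s y)) /G indicE.
    case: (boolP (y \in cube B)) => [_|]; first by rewrite mulr1.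
    rewrite notin_setE /cube/= => /negP; rewrite -ltNge => yB.
    rewrite Hr ?normr0 ?mulr0// -(ltrD2r (hmax v)) (lt_le_trans yB)//; exact: tri.
have E : (fun h : R => h^-1 *: (\int[mu]_y f ((h + 0) *: v + y) - \int[mu]_y f (0 *: v + y))) = cst 0.
  by apply/funext => h; rewrite !shift_int subrr scaler0.
rewrite E in H.
have := @cvg_unique _ (@norm_hausdorff _ R^o) _ _ _ _ H (cvg_cst _).
move=> <-; apply: eq_Rintegral => y _.
by rewrite partial1of2E (@derive_val _ _ _ _ _ _ _ (D 0 y)) scale0r add0r.
Qed.

End test_functions.

(** * The sublaplacian *)

Section fields.
Context {R : realType} {n : nat}.
Local Notation H := (heis R n).
Local Notation mu := (heis_measure R n).
Implicit Types (x y w v : H) (r : R) (f g b phi psi : H -> R).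

(* Both families of fields have the form D_v + l D_t with l linear in z and independent of v. *)
Definition vfield v (l : H -> R) f x := 'D_v f x + l x * 'D_(0, 0, 1) f x.

Definition field_of (s : 'I_n + 'I_n) : H * (H -> R) :=
  match s with
  | inl j => ((delta_mx ord0 j, 0, 0), fun x => 2 * x.1.2 ord0 j)
  | inr j => ((0, delta_mx ord0 j, 0), fun x => - (2 * x.1.1 ord0 j))
  end.

Definition Z (s : 'I_n + 'I_n) := vfield (field_of s).1 (field_of s).2.

Lemma ZlE (j : 'I_n) f : Z (inl j) f = vecX j f. Proof. by []. Qed.

Lemma ZrE (j : 'I_n) f : Z (inr j) f = vecY j f.
Proof. by apply/funext => x; rewrite /Z /vfield /vecY /= mulNr. Qed.

Lemma sublapE f : sublap f = fun x => - (4%:R^-1) * \sum_(j < n) (Z (inl j) (Z (inl j) f) x + Z (inr j) (Z (inr j) f) x).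
Proof.
apply/funext => x; rewrite /sublap; congr (_ * _); apply: eq_bigr => j _.
by rewrite !ZlE !ZrE.
Qed.

Lemma smooth_coef s : smooth setT (field_of s).2.
Proof.
case: s => j /=.
  by apply: smoothZ; [exact: openT|exact: smooth_coordy].
by apply: smoothN; [exact: openT|apply: smoothZ; [exact: openT|exact: smooth_coordx]].
Qed.

Lemma smooth_setT (A : set H) f : smooth setT f -> smooth A f.
Proof. by move=> sf m; apply: Cn_sub (sf m). Qed.

Lemma Z_smooth (A : set H) s f : open A -> smooth A f -> smooth A (Z s f).
Proof.
move=> oA sf; apply: smoothD => //; first exact: smooth_derive.
by apply: smoothM => //; [exact/smooth_setT/smooth_coef|exact: smooth_derive].
Qed.

Lemma sublap_smooth (A : set H) f : open A -> smooth A f -> smooth A (sublap f).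
Proof.
move=> oA sf; rewrite sublapE; apply: smoothZ => //; apply: smooth_sum => // j.
by apply: smoothD => //; do 2 apply: Z_smooth => //.
Qed.

Lemma iter_sublap_smooth (A : set H) k f : open A -> smooth A f -> smooth A (iter k sublap f).
Proof. by move=> oA sf; elim: k => //= k; exact: sublap_smooth. Qed.

Lemma Z_test s f : test f -> test (Z s f).
Proof.
move=> tf; apply: testD; first exact: test_derive.
by apply: testM; [exact: smooth_coef|exact: test_derive].
Qed.

Lemma sublap_test f : test f -> test (sublap f).
Proof.
move=> tf; have [sf bf] := tf; split; first by apply: sublap_smooth => //; exact: openT.
have h j : bsupp (fun x => Z (inl j) (Z (inl j) f) x + Z (inr j) (Z (inr j) f) x).
  by apply: bsuppD; [have [] := Z_test (inl j) (Z_test (inl j) tf)|have [] := Z_test (inr j) (Z_test (inr j) tf)].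
rewrite sublapE; apply: bsuppMr; elim: (index_enum _) => [|j s IH].
  by exists 0 => x _; rewrite big_nil.
by under eq_fun do rewrite big_cons; exact: bsuppD.
Qed.

Lemma iter_sublap_test k f : test f -> test (iter k sublap f).
Proof. by move=> tf; elim: k => //= k; exact: sublap_test. Qed.

Lemma derive_near f g v x : (\near x, f x = g x) -> \near x, 'D_v f x = 'D_v g x.
Proof.
move=> fg; have : \near x, \near x, f x = g x by exact: near_join.
by apply: filterS => y; exact: near_eq_derive.
Qed.

Lemma Z_near s f g x : (\near x, f x = g x) -> \near x, Z s f x = Z s g x.
Proof.
move=> fg; have a := derive_near (field_of s).1 fg; have b := derive_near (0, 0, 1) fg.
by move: a b; apply: filterS2 => y ya yb; rewrite /Z /vfield ya yb.
Qed.

Lemma sublap_near f g x : (\near x, f x = g x) -> \near x, sublap f x = sublap g x.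
Proof.
move=> fg; rewrite !sublapE.
have h (j : 'I_n) : \near x, Z (inl j) (Z (inl j) f) x + Z (inr j) (Z (inr j) f) x =
    Z (inl j) (Z (inl j) g) x + Z (inr j) (Z (inr j) g) x.
  have a := Z_near (inl j) (Z_near (inl j) fg); have b := Z_near (inr j) (Z_near (inr j) fg).
  by move: a b; apply: filterS2 => y -> ->.
have : \near x, forall j : 'I_n, Z (inl j) (Z (inl j) f) x + Z (inr j) (Z (inr j) f) x =
    Z (inl j) (Z (inl j) g) x + Z (inr j) (Z (inr j) g) x.
  pose P (j : 'I_n) y := Z (inl j) (Z (inl j) f) y + Z (inr j) (Z (inr j) f) y =
    Z (inl j) (Z (inl j) g) y + Z (inr j) (Z (inr j) g) y.
  exact: (@filter_forall _ _ P (nbhs x) _ h).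
apply: filterS => y hy.
exact: (congr1 (fun t => - (4%:R^-1) * t) (eq_bigr _ (fun j _ => hy j))).
Qed.

Lemma iter_sublap_near k f g x : (\near x, f x = g x) ->
  \near x, iter k sublap f x = iter k sublap g x.
Proof. by move=> fg; elim: k => //= k; exact: sublap_near. Qed.

Lemma Z_cst0 s : Z s (fun _ : H => 0) = fun=> 0.
Proof.
apply/funext => x; rewrite /Z /vfield.
by rewrite !(derive_cst (0:R)) mulr0 addr0.
Qed.

Lemma iter_sublap0 k : iter k sublap (fun _ : H => 0 : R) = fun=> 0.
Proof.
elim: k => //= k ->; rewrite sublapE; apply/funext => x.
by rewrite big1 ?mulr0// => j _; rewrite !Z_cst0 addr0.
Qed.

Lemma derive_linear (l : H -> R) v x : (forall (h : R) w y, l (h *: w + y) = h * l w + l y) ->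
  continuous l -> 'D_v l x = l v.
Proof.
move=> ll cl; rewrite -[l]/(id \o l).
have D := @is_derive_affine R _ _ l l id v x ll (@derivable_id _ _ _ _).
by rewrite (@derive_val _ _ _ _ _ _ _ D) derive_id.
Qed.

Lemma D_coef s v x : 'D_v (field_of s).2 x = (field_of s).2 v.
Proof.
case: s => j /=; apply: derive_linear.
- by move=> h w y; rewrite !mxE; ring.
- by move=> y; apply: cvgM; [exact: cvg_cst|exact: cont_coordy].
- by move=> h w y; rewrite !mxE; ring.
- by move=> y; apply: cvgN; apply: cvgM; [exact: cvg_cst|exact: cont_coordx].
Qed.

Lemma coef_t s : (field_of s).2 (0, 0, 1) = 0.
Proof. by case: s => j /=; rewrite mxE mulr0 ?oppr0. Qed.

(** The coefficient of the central derivative does not vary along the centre, so it can be moved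
    inside: [Z s f] is a sum of two plain directional derivatives of test functions, each of
    integral 0. *)
Lemma Z_int0 s f : test f -> \int[mu]_x (Z s f x) = 0.
Proof.
move=> tf; have [sf bf] := tf.
have tlf : test (fun x => (field_of s).2 x * f x) by apply: testM => //; exact: smooth_coef.
rewrite /Z /vfield RintegralD//.
- rewrite Rintegral_derive0// add0r -[RHS](Rintegral_derive0 (0, 0, 1) tlf).
  apply: eq_Rintegral => x _.
  have dl := @smooth_derivable R n setT _ (0, 0, 1) x (smooth_coef s) I.
  have df := @smooth_derivable R n setT _ (0, 0, 1) x sf I.
  by rewrite (deriveM dl df) D_coef coef_t /GRing.scale/= mulr0 addr0.
- exact/test_integrable/test_derive.
- by apply: test_integrable; apply: testM; [exact: smooth_coef|exact: test_derive].
Qed.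

Lemma Z_mul s f g x : smooth setT f -> smooth setT g ->
  Z s (fun y => f y * g y) x = Z s f x * g x + f x * Z s g x.
Proof.
move=> sf sg; rewrite /Z /vfield.
have D v : 'D_v (fun y => f y * g y) x = f x * 'D_v g x + g x * 'D_v f x.
  by rewrite (deriveM (@smooth_derivable R n setT _ v x sf I) (@smooth_derivable R n setT _ v x sg I)).
by rewrite !D; ring.
Qed.

Lemma Z_ibp s f g : smooth setT f -> test g ->
  \int[mu]_x (f x * Z s g x) = - \int[mu]_x (Z s f x * g x).
Proof.
move=> sf tg; have [sg bg] := tg; apply/eqP; rewrite -subr_eq0 opprK addrC; apply/eqP.
rewrite -RintegralD//.
- rewrite -[RHS](Z_int0 s (testM sf tg)); apply: eq_Rintegral => x _.
  by rewrite Z_mul.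
- by apply: test_integrable; apply: testM => //; apply: Z_smooth => //; exact: openT.
- by apply: test_integrable; apply: testM => //; exact: Z_test.
Qed.

Lemma Rintegral_sum I (r : seq I) (F : I -> H -> R) :
  (forall i, mu.-integrable setT (EFin \o F i)) ->
  \int[mu]_x (\sum_(i <- r) F i x) = \sum_(i <- r) \int[mu]_x F i x.
Proof.
move=> iF; elim: r => [|i r IH].
  by under eq_Rintegral do rewrite big_nil; rewrite big_nil Rintegral_cst// mul0r.
under eq_Rintegral do rewrite big_cons.
rewrite big_cons RintegralD// ?IH//.
have : mu.-integrable setT (fun x => \sum_(i <- r) (F i x)%:E)%E.
  by apply: integrable_sum => // j _; exact: iF.
by apply: eq_integrable => // x _; rewrite /= sumEFin.
Qed.

Lemma sublap_ibp f g : smooth setT f -> test g ->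
  \int[mu]_x (f x * sublap g x) = \int[mu]_x (sublap f x * g x).
Proof.
move=> sf tg; have [sg bg] := tg.
have oT : open (setT : set H) by exact: openT.
have ibp2 s : \int[mu]_x (f x * Z s (Z s g) x) = \int[mu]_x (Z s (Z s f) x * g x).
  by rewrite Z_ibp//; [rewrite Z_ibp ?opprK//; exact: Z_smooth|exact: Z_test].
have i1 s : mu.-integrable setT (EFin \o (fun x => f x * Z s (Z s g) x)).
  by apply: test_integrable; apply: testM => //; do 2 apply: Z_test.
have i2 s : mu.-integrable setT (EFin \o (fun x => Z s (Z s f) x * g x)).
  by apply: test_integrable; apply: testM => //; do 2 apply: Z_smooth => //.
have iD (F G : H -> R) : mu.-integrable setT (EFin \o F) -> mu.-integrable setT (EFin \o G) ->
    mu.-integrable setT (EFin \o (fun x => F x + G x)).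
  by move=> a b; apply: (integrableD measurableT a b).
transitivity (- (4%:R^-1) * \sum_(j < n) \int[mu]_x (f x * Z (inl j) (Z (inl j) g) x + f x * Z (inr j) (Z (inr j) g) x)).
  rewrite -Rintegral_sum; last by move=> j; exact: iD.
  rewrite -RintegralZl//; last first.
    have : mu.-integrable setT (fun x => \sum_(j < n) (f x * Z (inl j) (Z (inl j) g) x + f x * Z (inr j) (Z (inr j) g) x)%:E)%E.
      by apply: integrable_sum => // j _; exact: iD.
    by apply: eq_integrable => // x _; rewrite /= sumEFin.
  apply: eq_Rintegral => x _; rewrite sublapE mulrCA; congr (_ * _).
  by rewrite mulr_sumr; apply: eq_bigr => j _; rewrite mulrDr.
transitivity (- (4%:R^-1) * \sum_(j < n) \int[mu]_x (Z (inl j) (Z (inl j) f) x * g x + Z (inr j) (Z (inr j) f) x * g x)).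
  by congr (_ * _); apply: eq_bigr => j _; rewrite !RintegralD// !ibp2.
rewrite -Rintegral_sum; last by move=> j; exact: iD.
rewrite -RintegralZl//; last first.
  have : mu.-integrable setT (fun x => \sum_(j < n) (Z (inl j) (Z (inl j) f) x * g x + Z (inr j) (Z (inr j) f) x * g x)%:E)%E.
    by apply: integrable_sum => // j _; exact: iD.
  by apply: eq_integrable => // x _; rewrite /= sumEFin.
apply: eq_Rintegral => x _; rewrite sublapE -mulrA; congr (_ * _).
by rewrite [RHS]mulr_suml; apply: eq_bigr => j _; rewrite [RHS]mulrDl.
Qed.

Lemma iter_sublap_ibp k f g : smooth setT f -> test g ->
  \int[mu]_x (f x * iter k sublap g x) = \int[mu]_x (iter k sublap f x * g x).
Proof.
move=> sf tg; elim: k f sf => //= k IH f sf.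
rewrite sublap_ibp//; last exact: iter_sublap_test.
rewrite IH; last by apply: sublap_smooth => //; exact: openT.
by rewrite -iterSr.
Qed.

End fields.

(** * Homogeneous norm and cutoffs *)

Section homogeneous_norm.
Context {R : realType} {n : nat}.
Local Notation H := (heis R n).
Local Notation mu := (heis_measure R n).
Implicit Types (x y w v : H) (r : R) (f g b phi psi : H -> R).

(** The fourth power of [hnorm]. It is a polynomial, hence smooth also at 0, and all cutoffs are
    built from it. *)
Definition hN4 x : R := (\sum_(j < n) (x.1.1 ord0 j ^+ 2 + x.1.2 ord0 j ^+ 2)) ^+ 2 + x.2 ^+ 2.

Let s2 x : R := \sum_(j < n) (x.1.1 ord0 j ^+ 2 + x.1.2 ord0 j ^+ 2).

Let s2_ge0 x : 0 <= s2 x.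
Proof. by apply: sumr_ge0 => j _; rewrite addr_ge0 ?sqr_ge0. Qed.

Let hN4E x : hN4 x = s2 x ^+ 2 + x.2 ^+ 2. Proof. by []. Qed.

Lemma hzabs2 x : hzabs x ^+ 2 = \sum_(j < n) (x.1.1 ord0 j ^+ 2 + x.1.2 ord0 j ^+ 2).
Proof. by rewrite sqr_sqrtr// s2_ge0. Qed.

Lemma hN4_ge0 x : 0 <= hN4 x. Proof. by rewrite addr_ge0 ?sqr_ge0. Qed.

Lemma hnormE x : hnorm x = hN4 x `^ (4%:R^-1).
Proof. by rewrite /hnorm (exprM _ 2 2) hzabs2. Qed.

Lemma hnorm_ge0 x : 0 <= hnorm x. Proof. by rewrite hnormE powR_ge0. Qed.

Lemma hnorm4 x : hnorm x ^+ 4 = hN4 x.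
Proof. by rewrite hnormE -powR_mulrn ?powR_ge0// -powRrM mulVf// powRr1// hN4_ge0. Qed.

Lemma smooth_hN4 : smooth setT hN4.
Proof.
have oT : open (setT : set H) by exact: openT.
have sq f : smooth setT f -> smooth setT (fun x => f x ^+ 2).
  by move=> sf; rewrite (_ : (fun x => _) = (fun x => f x * f x)); [exact: smoothM|apply/funext => x; rewrite expr2].
apply: smoothD => //; last by apply: (sq _); exact: smooth_coordt.
apply: (sq _); apply: smooth_sum => // j.
by apply: smoothD => //; apply: (sq _); [exact: smooth_coordx|exact: smooth_coordy].
Qed.

Lemma cont_hN4 : continuous hN4. Proof. exact: smooth_cont smooth_hN4. Qed.

Lemma measurable_hnorm : measurable_fun setT (@hnorm R n).
Proof.
rewrite (_ : @hnorm R n = (fun t => t `^ (4%:R^-1)) \o hN4); last by apply/funext => x; rewrite hnormE.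
by apply: measurableT_comp; [exact: measurable_powR|exact: continuous_measurable cont_hN4].
Qed.

(** With [hN4_le_hmax]: both gauges have the same bounded sets. The 1 absorbs the small values,
    where the two scale differently. *)
Lemma hmax_le_hN4 x : hmax x <= 1 + hN4 x.
Proof.
have a4 (a : R) : `|a| <= 1 + a ^+ 4.
  have [a1|a1] := leP `|a| 1; first by rewrite (le_trans a1)// lerDl (exprM _ 2 2) sqr_ge0.
  rewrite ler_wpDl// (exprM _ 2 2) -[a ^+ 2]real_normK ?num_real// -exprM.
  by rewrite -[X in X <= _]expr1 ler_weXn2l// ltW.
have a2 (a : R) : `|a| <= 1 + a ^+ 2.
  have [a1|a1] := leP `|a| 1; first by rewrite (le_trans a1)// lerDl sqr_ge0.
  by rewrite ler_wpDl// -[a ^+ 2]real_normK ?num_real// -[X in X <= _]expr1 ler_weXn2l// ltW.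
have c4 (a : R) : a ^+ 2 <= s2 x -> a ^+ 4 <= hN4 x.
  by move=> h; rewrite hN4E (exprM _ 2 2) ler_wpDr ?sqr_ge0// ler_sqr ?nnegrE ?sqr_ge0.
apply/heis_norm_le; first by rewrite addr_ge0 ?hN4_ge0.
have sj j : x.1.1 ord0 j ^+ 2 + x.1.2 ord0 j ^+ 2 <= s2 x.
  rewrite /s2 (bigD1 j)//= lerDl; apply: sumr_ge0 => i _; by rewrite addr_ge0 ?sqr_ge0.
split => [j|j|].
- by rewrite (le_trans (a4 _))// lerD2l c4// (le_trans _ (sj j))// lerDl sqr_ge0.
- by rewrite (le_trans (a4 _))// lerD2l c4// (le_trans _ (sj j))// lerDr sqr_ge0.
- by rewrite (le_trans (a2 _))// lerD2l hN4E lerDr sqr_ge0.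
Qed.

Lemma hN4_le_hmax x (m : R) : hmax x <= m -> hN4 x <= (2 * n%:R * m ^+ 2) ^+ 2 + m ^+ 2.
Proof.
move=> xm; have m0 := le_trans (hmax_ge0 x) xm; have [/(_ xm)[a b c] _] := heis_norm_le x m0.
have sq (t : R) : `|t| <= m -> t ^+ 2 <= m ^+ 2.
  by move=> tm; rewrite -real_normK ?num_real// ler_sqr ?nnegrE.
rewrite hN4E lerD ?sq// ler_sqr ?nnegrE ?mulr_ge0 ?sqr_ge0//.
have -> : 2 * n%:R * m ^+ 2 = \sum_(j < n) (m ^+ 2 + m ^+ 2).
  by rewrite sumr_const card_ord -mulr_natr; ring.
by apply: ler_sum => j _; rewrite lerD// sq.
Qed.

Lemma hnorm_eq0 x : (hnorm x == 0) = (x == 0).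
Proof.
apply/eqP/eqP => [x0|->]; last first.
  rewrite hnormE /hN4 big1 ?expr0n/= ?addr0 ?powR0//.
  by move=> j _; rewrite !mxE expr0n/= addr0.
have /eqP : hN4 x = 0 by rewrite -hnorm4 x0 expr0n.
rewrite hN4E paddr_eq0 ?sqr_ge0// !sqrf_eq0 => /andP[/eqP s0 /eqP t0].
have z0 j : x.1.1 ord0 j ^+ 2 + x.1.2 ord0 j ^+ 2 = 0.
  apply/eqP; rewrite eq_le addr_ge0 ?sqr_ge0// andbT -s0 /s2 (bigD1 j)//= lerDl.
  by apply: sumr_ge0 => i _; rewrite addr_ge0 ?sqr_ge0.
apply: heis_eq => //=; rewrite [x.1]surjective_pairing; congr pair; apply/rowP => j; rewrite mxE;
  move/eqP: (z0 j); rewrite paddr_eq0 ?sqr_ge0// !sqrf_eq0 => /andP[/eqP a /eqP b] //.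
Qed.

Lemma hnorm_gt0 x : (0 < hnorm x) = (x != 0).
Proof. by rewrite lt_neqAle hnorm_ge0 andbT eq_sym hnorm_eq0. Qed.

Lemma hN4_dil r x : hN4 (hdil r x) = r ^+ 4 * hN4 x.
Proof.
rewrite /hN4 /= (eq_bigr (fun j => r ^+ 2 * (x.1.1 ord0 j ^+ 2 + x.1.2 ord0 j ^+ 2))).
  by rewrite -mulr_sumr; ring.
by move=> j _; rewrite !mxE; ring.
Qed.

Lemma hnorm_dil r x : 0 <= r -> hnorm (hdil r x) = r * hnorm x.
Proof.
move=> r0; rewrite !hnormE hN4_dil powRM ?exprn_ge0 ?hN4_ge0//; congr (_ * _).
by rewrite -powR_mulrn// -powRrM mulfV// powRr1.
Qed.

Lemma hnormN x : hnorm (- x) = hnorm x.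
Proof.
rewrite !hnormE /hN4 /= sqrrN; congr ((_ ^+ 2 + _) `^ _).
by apply: eq_bigr => j _; rewrite !mxE !sqrrN.
Qed.

Lemma hnorm_le r x : 0 <= r -> (hnorm x <= r) = (hN4 x <= r ^+ 4).
Proof. by move=> r0; rewrite -hnorm4 ler_pXn2r ?nnegrE ?hnorm_ge0. Qed.

Lemma hnorm_lt r x : 0 <= r -> (hnorm x < r) = (hN4 x < r ^+ 4).
Proof. by move=> r0; rewrite -hnorm4 ltr_pXn2r ?nnegrE ?hnorm_ge0. Qed.

(** It vanishes already from [hnorm x] = 2^(1/4) r on; the cruder radius 2 r is the one used below.
    Its dilates are again of this form, see [hcut_dil]. *)
Definition hcut r x := smoothstep (hN4 x / r ^+ 4).

Lemma hcut01 r x : 0 <= hcut r x <= 1. Proof. exact: smoothstep01. Qed.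

Lemma hcut1 r x : 0 < r -> hnorm x <= r -> hcut r x = 1.
Proof.
move=> r0 xr; rewrite /hcut smoothstep1// ler_pdivrMr ?exprn_gt0// mul1r.
by rewrite -hnorm_le// ltW.
Qed.

Lemma hcut0 r x : 0 < r -> 2 * r <= hnorm x -> hcut r x = 0.
Proof.
move=> r0 xr; rewrite /hcut smoothstep0// ler_pdivlMr ?exprn_gt0// -hnorm4.
apply: (@le_trans _ _ ((2 * r) ^+ 4)).
  by rewrite exprMn ler_wpM2r ?exprn_ge0 ?ltW// -natrX ltr_nat.
by rewrite ler_pXn2r ?nnegrE ?hnorm_ge0 ?mulr_ge0// ltW.
Qed.

Lemma smooth_hcut r : smooth setT (hcut r).
Proof.
move=> m; rewrite (_ : hcut r = smoothstep \o (fun x => (r ^+ 4)^-1 * hN4 x)); last first.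
  by apply/funext => x /=; rewrite mulrC.
apply: (@Cn_comp _ _ _ setT setT) => //; [exact: openT|exact: Cn_smoothstep|].
by apply: smoothZ; [exact: openT|exact: smooth_hN4].
Qed.

Lemma bsupp_hnorm r f : (forall x, r <= hnorm x -> f x = 0) -> bsupp f.
Proof.
move=> h; exists (1 + `|r| ^+ 4) => x xr; apply: h; rewrite leNgt; apply/negP => xr'.
have : hmax x <= 1 + `|r| ^+ 4.
  by rewrite (le_trans (hmax_le_hN4 x))// lerD2l -hnorm_le// ltW// (lt_le_trans xr')// ler_norm.
by rewrite leNgt xr.
Qed.

Lemma test_hcut r : 0 < r -> test (hcut r).
Proof.
move=> r0; split; first exact: smooth_hcut.
by apply: (@bsupp_hnorm (2 * r)) => x; exact: hcut0.
Qed.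

Lemma bsupp_hcut f : bsupp f -> exists2 r0, 0 < r0 & forall r x, r0 <= r -> r < hnorm x -> f x = 0.
Proof.
move=> [m fm]; exists (1 + ((2 * n%:R * m ^+ 2) ^+ 2 + m ^+ 2)).
  by rewrite ltr_wpDr// addr_ge0 ?sqr_ge0.
move=> r x h xr; apply: fm; rewrite ltNge; apply/negP => /hN4_le_hmax.
rewrite leNgt => /negP; apply; rewrite -hnorm4.
set c := _ + m ^+ 2 in h *; have c0 : 0 <= c by rewrite addr_ge0 ?sqr_ge0.
have hx : 1 + c < hnorm x by exact: le_lt_trans xr.
have h1 : 1 <= hnorm x by rewrite (le_trans _ (ltW hx))// lerDl.
apply: (@lt_le_trans _ _ (hnorm x)); first by rewrite (le_lt_trans _ hx)// lerDr.
by rewrite -[X in X <= _]expr1 ler_weXn2l.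
Qed.

End homogeneous_norm.

Lemma cvg_cst_eq {R : realType} (a b : R) : (fun _ : nat => a) @ \oo --> b -> b = a.
Proof. by move=> h; rewrite -(cvg_lim _ h)// lim_cst. Qed.

(** * The du Bois-Reymond lemma *)

Section dubois_reymond.
Context {R : realType} {n : nat}.
Local Notation H := (heis R n).
Local Notation mu := (heis_measure R n).
Implicit Types (x y w v : H) (r : R) (f g b phi psi : H -> R).

(** These sets form a pi-system that generates the sigma-algebra, since the coordinates are smooth,
    and the indicator of {F > 0} is the limit of the smooth functions 1 - [smoothstep] (k F).
    Vanishing of an integral against test functions is therefore inherited first by these sets and
    then by all measurable ones. *)
Definition smooth_pos : set (set H) := [set A | exists2 F : H -> R, smooth setT F & A = [set x | 0 < F x]].

Lemma setI_closed_smooth_pos : setI_closed smooth_pos.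
Proof.
move=> _ _ [F sF ->] [G sG ->].
have sE (K : H -> R) : smooth setT K -> smooth setT (expinv 0 \o K).
  by move=> sK m; apply: (@Cn_comp _ _ _ setT setT) => //; [exact: openT|exact: Cn_expinv].
(* F G itself would also be positive where both factors are negative; [expinv 0] sends the
   nonpositive values to 0 first. *)
exists (fun x => (expinv 0 \o F) x * (expinv 0 \o G) x).
  by apply: smoothM; [exact: openT|exact: sE|exact: sE].
apply/seteqP; split => x /=; first by move=> [a b]; rewrite mulr_gt0// expinv_gt0.
move=> h; split; rewrite ltNge; apply/negP => /(@expinv_le0 R 0) E.
  by move: h; rewrite E mul0r ltxx.
by move: h; rewrite E mulr0 ltxx.
Qed.

Lemma measurable_of_gt d (T : measurableType d) (f : T -> R) :
  (forall a, measurable [set x | a < f x]) -> measurable_fun setT f.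
Proof.
move=> h; apply: (@measurability _ _ T (measurableTypeR R) setT f _ (RGenOInfty.measurableE R)) => _ [_ [a ->] <-].
rewrite setTI (_ : _ @^-1` _ = [set x | a < f x])//.
by apply/seteqP; split => x /=; rewrite in_itv/= andbT.
Qed.

Lemma measurable_smooth_pos (A : set H) : measurable A -> <<s smooth_pos >> A.
Proof.
move=> mA; pose T := g_sigma_algebraType smooth_pos.
suff mid : measurable_fun (setT : set T) (id : T -> H).
  by have := mid measurableT _ mA; rewrite setTI.
have mc (c : H -> R) : smooth setT c -> measurable_fun (setT : set T) (c : T -> R).
  move=> sc; apply: measurable_of_gt => a; apply: sub_sigma_algebra.
  exists (fun x => c x - a); last by apply/seteqP; split => x /=; rewrite subr_gt0.
  by apply: smoothB; [exact: openT|exact: sc|exact: smooth_cst].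
apply: measurable_heisP => [j|j|]; apply: mc; [exact: smooth_coordx|exact: smooth_coordy|exact: smooth_coordt].
Qed.

Lemma smoothstep_cvg (s : R) :
  (fun k : nat => 1 - smoothstep (k%:R * s)) @ \oo --> (if 0 < s then 1 else 0 : R).
Proof.
case: ifPn => [s0|]; last first.
  rewrite -leNgt => s0; have -> : (fun k : nat => 1 - smoothstep (k%:R * s)) = cst 0.
    by apply/funext => k; rewrite smoothstep1 ?subrr// (le_trans _ ler01)// mulr_ge0_le0.
  exact: cvg_cst.
apply: cvg_near_cst; near=> k; rewrite smoothstep0 ?subr0// -ler_pdivrMr//.
near: k; exact: nbhs_infty_ger.
Unshelve. all: by end_near. Qed.

(* The sets A on which the integral of b psi vanishes form a lambda-system containing the sets {F > 0}, F smooth. *)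
Lemma integral_test_set b psi (A : set H) : locint b ->
  (forall phi, test phi -> \int[mu]_x (b x * phi x) = 0) ->
  test psi -> measurable A -> \int[mu]_x (b x * psi x * \1_A x) = 0.
Proof.
move=> lb b0 tp mA.
have ib := locint_test lb tp; have mb := lb.1; have mp := smooth_meas tp.1.
have mbp : measurable_fun setT (fun x => b x * psi x) by exact: measurable_funM.
have ibn : mu.-integrable setT (EFin \o (fun x => `|b x * psi x|)).
  by have := integrable_norm ib.
have bnd (B : set H) x : `|b x * psi x * \1_B x| <= `|b x * psi x|.
  by rewrite normrM ler_piMr// indicE; case: (_ \in _); rewrite ?normr1 ?normr0.
have mB (B : set H) : measurable B -> measurable_fun setT (fun x => b x * psi x * \1_B x).
  by move=> mB; apply: measurable_funM => //; exact: measurable_indic.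
pose D := [set B : set H | measurable B /\ \int[mu]_x (b x * psi x * \1_B x) = 0].
suff : <<s smooth_pos >> `<=` D by move=> /(_ _ (measurable_smooth_pos mA))[].
apply: lambda_system_subset => //; first exact: setI_closed_smooth_pos.
  split => //.
  - split => //; rewrite -[RHS](b0 _ tp); apply: eq_Rintegral => x _.
    by rewrite indicE in_setT mulr1.
  - move=> B C CB [mB0 iB] [mC iC]; split; first exact: measurableD.
    transitivity (\int[mu]_x (b x * psi x * \1_B x - b x * psi x * \1_C x)).
      apply: eq_Rintegral => x _; rewrite -mulrBr !indicE in_setD; congr (_ * _).
      case: (boolP (x \in C)) => xC; last by rewrite andbT subr0.
      by rewrite andbF (_ : x \in B) ?subrr//; apply/mem_set/CB/set_mem.
    rewrite RintegralB// ?iB ?iC ?subrr//.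
      exact: integrable_fun_le (mB _ mB0) (bnd _) ibn.
    exact: integrable_fun_le (mB _ mC) (bnd _) ibn.
  - move=> F ndF DF; split; first by apply: bigcupT_measurable => i; exact: (DF i).1.
    have E : (fun k => \int[mu]_x (b x * psi x * \1_(F k) x)) = cst 0.
      by apply/funext => k; exact: (DF k).2.
    apply: cvg_cst_eq; rewrite -[X in X @ _ --> _]/(cst 0) -E.
      apply: (@Rintegral_dct _ _ (fun k x => b x * psi x * \1_(F k) x) _ (fun x => `|b x * psi x|)) => //.
      + by move=> k; apply: mB; exact: (DF k).1.
      + move=> x; apply: cvgM; first exact: cvg_cst.
        rewrite indicE; case: (boolP (x \in _)) => [/set_mem[k _ Fx]|xF].
          apply: cvg_near_cst; exists k => // m /= km; rewrite indicE mem_set//.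
          by have /subsetPset := ndF k m km; exact.
        apply: cvg_near_cst; apply: nearW => m; rewrite indicE memNset//= => Fm.
        by move/negP: xF; apply; apply/mem_set; exists m.
move=> _ [F sF ->].
have mF : measurable [set x | 0 < F x].
  rewrite (_ : [set x | _] = F @^-1` `]0, +oo[%classic).
    by rewrite -[X in measurable X]setTI; apply: smooth_meas.
  by apply/seteqP; split => x /=; rewrite in_itv/= andbT.
split => //.
have E : (fun k : nat => \int[mu]_x (b x * psi x * (1 - smoothstep (k%:R * F x)))) = cst 0.
apply/funext => k.
have tk : test (fun x => psi x * (1 - smoothstep (k%:R * F x))).
  rewrite (_ : (fun x => _) = (fun x => (1 - smoothstep (k%:R * F x)) * psi x)); last first.
    by apply/funext => x; rewrite mulrC.
  apply: testM => //; apply: smoothB; [exact: openT|exact: smooth_cst|].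
  move=> m; apply: (@Cn_comp _ _ _ setT setT (fun x => k%:R * F x) smoothstep) => //; [exact: openT|exact: Cn_smoothstep|].
  by apply: smoothZ => //; exact: openT.
by rewrite -[RHS](b0 _ tk); apply: eq_Rintegral => x _; rewrite mulrA.
apply: cvg_cst_eq; rewrite -[X in X @ _ --> _]/(cst 0) -E.
  apply: (@Rintegral_dct _ _ (fun k x => b x * psi x * (1 - smoothstep (k%:R * F x))) _ (fun x => `|b x * psi x|)) => //.
  - move=> k; apply: measurable_funM => //; apply: smooth_meas.
    apply: smoothB; [exact: openT|exact: smooth_cst|].
    move=> m; apply: (@Cn_comp _ _ _ setT setT (fun x => k%:R * F x) smoothstep) => //; [exact: openT|exact: Cn_smoothstep|].
    by apply: smoothZ => //; exact: openT.
  - move=> x; apply: cvgM; first exact: cvg_cst.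
    have -> : \1_[set x | 0 < F x] x = (if 0 < F x then 1 else 0 : R).
      rewrite indicE; case: ifPn => h; first by rewrite mem_set.
      by rewrite memNset//= => h'; move: h; rewrite h'.
    exact: (@smoothstep_cvg (F x)).
  - move=> k x; rewrite normrM ler_piMr//; have /andP[a c] := smoothstep01 (k%:R * F x).
    by rewrite ger0_norm ?subr_ge0// gerBl.
Qed.

(** With psi a nonnegative cutoff and A = {b > 0}, the integral of |b psi| is twice that of b psi
    over A minus that of b psi, hence 0. The cutoffs at the radii k + 1 exhaust the group. *)
Lemma dubois_reymond b : locint b ->
  (forall phi, test phi -> \int[mu]_x (b x * phi x) = 0) -> {ae mu, forall x, b x = 0}.
Proof.
move=> lb b0; have mb := lb.1.
pose A := [set x | 0 < b x].
have mA : measurable A.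
  rewrite (_ : A = b @^-1` `]0, +oo[%classic).
    by rewrite -[X in measurable X]setTI; exact: mb.
  by apply/seteqP; split => x /=; rewrite in_itv/= andbT.
have ae_k (k : nat) : {ae mu, forall x, b x * hcut k.+1%:R x = 0}.
  have k0 : 0 < (k.+1%:R : R) by rewrite ltr0n.
  have tk := test_hcut (n := n) k0.
  have ib := locint_test lb tk.
  have mbk : measurable_fun setT (fun x => b x * hcut k.+1%:R x).
    by apply: measurable_funM => //; exact: smooth_meas tk.1.
  have i1 : \int[mu]_x `|b x * hcut k.+1%:R x| = 0.
    transitivity (2 * \int[mu]_x (b x * hcut k.+1%:R x * \1_A x) - \int[mu]_x (b x * hcut k.+1%:R x)).
      have iA : mu.-integrable setT (EFin \o (fun x => b x * hcut k.+1%:R x * \1_A x)).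
        apply: integrable_fun_le (integrable_norm ib) => [|x /=].
          by apply: measurable_funM => //; exact: measurable_indic.
        by rewrite normrM ler_piMr// indicE; case: (_ \in _); rewrite ?normr1 ?normr0.
      rewrite -RintegralZl// -RintegralB//; last by have := integrableZl measurableT 2 iA.
      apply: eq_Rintegral => x _; rewrite indicE; have /andP[h0 h1] := hcut01 k.+1%:R x.
      case: (boolP (x \in A)) => [/set_mem|/negP]; rewrite /A/=.
        by move=> bx; rewrite ger0_norm; [ring|rewrite mulr_ge0// ltW].
      move=> bx; have {}bx : b x <= 0 by rewrite leNgt; apply/negP => h; apply: bx; exact/mem_set.
      by rewrite ler0_norm; [ring|rewrite mulr_le0_ge0].
    by rewrite integral_test_set// b0// mulr0 subrr.
  have {}i1 : (\int[mu]_x `|(b x * hcut k.+1%:R x)%:E| = 0)%E.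
    have f : (\int[mu]_x `|(b x * hcut k.+1%:R x)%:E| \is a fin_num)%E.
      have := integrable_norm ib => /= h; exact: (integrable_fin_num measurableT h).
    by rewrite -(fineK f); congr (_%:E).
  have /(ae_eq_integral_abs mu measurableT) := i1.
  have mE : measurable_fun setT (EFin \o (fun x => b x * hcut k.+1%:R x)) by exact/measurable_EFinP.
  by move=> /(_ mE); apply: filterS => x /= /(_ I) [].
have /negligible_bigcup : forall k : nat, mu.-negligible (~` [set x | b x * hcut k.+1%:R x = 0]) by exact: ae_k.
apply: negligibleS => x /= bx; exists (Num.bound (hnorm x)) => //= h; apply: bx.
have xk : hnorm x <= (Num.bound (hnorm x)).+1%:R.
  by rewrite ltW// (lt_trans (archi_boundP (hnorm_ge0 x)))// ltr_nat.
by move: h; rewrite hcut1 ?mulr1// ltr0n.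
Qed.

End dubois_reymond.

(** * Invariance of the fields under translations and dilations *)

Section invariance.
Context {R : realType} {n : nat}.
Local Notation H := (heis R n).
Local Notation mu := (heis_measure R n).
Local Notation et := ((0, 0, 1) : H).
Implicit Types (x y w v : H) (r : R) (f g b phi psi : H -> R).

(** The differential of a translation sends v to v plus a multiple of the central direction, so
    additivity in the direction is needed exactly in this form. *)
Lemma derive_add_t phi v c x : smooth setT phi ->
  'D_(v + c *: et) phi x = 'D_v phi x + c * 'D_et phi x.
Proof.
move=> sp; have dt y : derivable phi y et by exact: (@smooth_derivable R n setT).
have dv : derivable phi x v by exact: (@smooth_derivable R n setT).
have dct y := is_derive_scale c (dt y).
have cct : {for x, continuous ('D_(c *: et) phi)}.
  have E : 'D_(c *: et) phi = fun y => c * 'D_et phi y.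
    by apply/funext => y; rewrite (@derive_val _ _ _ _ _ _ _ (dct y)).
  rewrite E; apply: cvgM; first exact: cvg_cst.
  exact: (smooth_continuous (smooth_derive _ sp)).
have D := @is_derive_addv _ _ phi setT x v (c *: et) openT I
  (fun y _ => @ex_derive _ _ _ _ _ _ _ (dct y)) cct dv.
by rewrite (@derive_val _ _ _ _ _ _ _ D) (@derive_val _ _ _ _ _ _ _ (dct x)).
Qed.

Lemma derive_scale phi v c x : smooth setT phi -> 'D_(c *: v) phi x = c * 'D_v phi x.
Proof.
move=> sp; have dv : derivable phi x v by exact: (@smooth_derivable R n setT).
by rewrite (@derive_val _ _ _ _ _ _ _ (is_derive_scale c dv)).
Qed.

Lemma sympZr (c : R) (z z' : 'rV[R]_n * 'rV[R]_n) : symp z (c *: z') = c * symp z z'.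
Proof. by rewrite -{1}[z]scale1r sympZ mul1r. Qed.

Lemma sympZl (c : R) (z z' : 'rV[R]_n * 'rV[R]_n) : symp (c *: z) z' = c * symp z z'.
Proof. by rewrite -{1}[z']scale1r sympZ mulr1. Qed.

Lemma hmul_affine x (h : R) w y :
  hmul x (h *: w + y) = h *: (w + symp x.1 w.1 *: et) + hmul x y.
Proof.
apply: heis_eq.
  transitivity (x.1 + (h *: w.1 + y.1)); first by [].
  transitivity (h *: (w.1 + symp x.1 w.1 *: 0) + (x.1 + y.1)); last by [].
  by rewrite scaler0 addr0 addrCA.
transitivity (x.2 + (h * w.2 + y.2) + symp x.1 (h *: w.1 + y.1)); first by [].
transitivity (h * (w.2 + symp x.1 w.1 * 1) + (x.2 + y.2 + symp x.1 y.1)); last by [].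
by rewrite sympDr sympZr; ring.
Qed.

Lemma hmulr_affine x (h : R) w y :
  hmul (h *: w + y) x = h *: (w + symp w.1 x.1 *: et) + hmul y x.
Proof.
apply: heis_eq.
  transitivity ((h *: w.1 + y.1) + x.1); first by [].
  transitivity (h *: (w.1 + symp w.1 x.1 *: 0) + (y.1 + x.1)); last by [].
  by rewrite scaler0 addr0 addrA.
transitivity ((h * w.2 + y.2) + x.2 + symp (h *: w.1 + y.1) x.1); first by [].
transitivity (h * (w.2 + symp w.1 x.1 * 1) + (y.2 + x.2 + symp y.1 x.1)); last by [].
by rewrite sympDl sympZl; ring.
Qed.

Lemma derive_hmul phi x v y : smooth setT phi ->
  'D_v (phi \o hmul x) y = 'D_v phi (hmul x y) + symp x.1 v.1 * 'D_et phi (hmul x y).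
Proof.
move=> sp; have D := @is_derive_affine R _ _ (hmul x) (fun w => w + symp x.1 w.1 *: et) phi v y
  (hmul_affine x) (@smooth_derivable R n setT _ _ _ sp I).
by rewrite (@derive_val _ _ _ _ _ _ _ D) derive_add_t.
Qed.

Lemma derive_hmulr phi x v y : smooth setT phi ->
  'D_v (phi \o hmul ^~ x) y = 'D_v phi (hmul y x) + symp v.1 x.1 * 'D_et phi (hmul y x).
Proof.
move=> sp; have D := @is_derive_affine R _ _ (hmul ^~ x) (fun w => w + symp w.1 x.1 *: et) phi v y
  (hmulr_affine x) (@smooth_derivable R n setT _ _ _ sp I).
by rewrite (@derive_val _ _ _ _ _ _ _ D) derive_add_t.
Qed.

Lemma smooth_hmul phi x : smooth setT phi -> smooth setT (phi \o hmul x).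
Proof.
move=> sp m; apply: (Cn_affine openT (hmul_affine x) _ _ (sp m)) => //; exact: cont_hmul.
Qed.

Lemma bsupp_hmul f x : bsupp f -> bsupp (f \o hmul x).
Proof.
move=> [r fr]; exists (hmax (- x) + `|r| + 4 * n%:R * hmax (- x) * `|r|) => y xy; apply: fr.
rewrite ltNge; apply/negP => h; move: xy; apply/negP; rewrite -leNgt -[y in hmax y](hmulK x).
by apply: hmul_norm => //; rewrite (le_trans h)// ler_norm.
Qed.

Lemma test_hmul phi x : test phi -> test (phi \o hmul x).
Proof. by move=> [sp bp]; split; [exact: smooth_hmul|exact: bsupp_hmul]. Qed.

(** Left invariance at the level of coefficients: the shear that the translation by x adds to the
    direction of the field is the difference of the coefficient of the central derivative at
    [hmul x y] and at y. *)
Lemma symp_coef s x y : symp x.1 (field_of s : H * (H -> R)).1.1 = (field_of s).2 (hmul x y) - (field_of s).2 y.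
Proof.
case: s => j /=; rewrite /symp !mxE.
  have -> : \sum_(j0 < n) (x.1.2 ord0 j0 * (delta_mx ord0 j : 'rV[R]_n) ord0 j0 - x.1.1 ord0 j0 * (0 : 'rV[R]_n) ord0 j0) = x.1.2 ord0 j.
    rewrite (bigD1 j)//= !mxE !eqxx mulr1 mulr0 subr0 big1 ?addr0// => i ij.
    by rewrite !mxE (negbTE ij) andbF !mulr0 subr0.
  by ring.
have -> : \sum_(j0 < n) (x.1.2 ord0 j0 * (0 : 'rV[R]_n) ord0 j0 - x.1.1 ord0 j0 * (delta_mx ord0 j : 'rV[R]_n) ord0 j0) = - x.1.1 ord0 j.
  rewrite (bigD1 j)//= !mxE !eqxx mulr1 mulr0 sub0r big1 ?addr0// => i ij.
  by rewrite !mxE (negbTE ij) andbF !mulr0 subr0.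
by ring.
Qed.

Lemma Z_hmul s phi x : smooth setT phi -> Z s (phi \o hmul x) = Z s phi \o hmul x.
Proof.
move=> sp; apply/funext => y; rewrite /Z /vfield /= !derive_hmul// (symp_coef s x y).
have -> : symp x.1 (0, 0) = 0 :> R by rewrite /symp big1 ?mulr0// => j _; rewrite !mxE; ring.
by rewrite mul0r addr0; ring.
Qed.

Opaque Z.

Lemma sublap_hmul phi x : smooth setT phi -> sublap (phi \o hmul x) = sublap phi \o hmul x.
Proof.
move=> sp; rewrite !sublapE; apply/funext => y /=.
have sZ s : smooth setT (Z s phi) by apply: Z_smooth => //; exact: openT.
have E s : Z s (Z s (phi \o hmul x)) y = Z s (Z s phi) (hmul x y).
  by rewrite (Z_hmul s x sp) (Z_hmul s x (sZ s)).
have EE (j : 'I_n) : Z (inl j) (Z (inl j) (phi \o hmul x)) y + Z (inr j) (Z (inr j) (phi \o hmul x)) y =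
    Z (inl j) (Z (inl j) phi) (hmul x y) + Z (inr j) (Z (inr j) phi) (hmul x y).
  exact: (f_equal2 (fun a b : R => a + b) (E (inl j)) (E (inr j))).
exact: (congr1 (fun t => - (4%:R^-1) * t) (eq_bigr _ (fun j _ => EE j))).
Qed.

Opaque sublap.

Lemma iter_sublap_hmul k phi x : smooth setT phi ->
  iter k sublap (phi \o hmul x) = iter k sublap phi \o hmul x.
Proof.
move=> sp; elim: k => [//|k IH]; rewrite !iterS IH sublap_hmul//.
by apply: iter_sublap_smooth => //; exact: openT.
Qed.

Lemma hdil_linear r (h : R) w y : hdil r (h *: w + y) = h *: hdil r w + hdil r y.
Proof.
apply: heis_eq => /=.
  by congr pair; rewrite scalerDr !scalerA mulrC.
by rewrite mulrDr /GRing.scale/= mulrCA.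
Qed.

Lemma cont_hdil r : continuous (hdil r : H -> H).
Proof.
move=> x; have A1 : (fun x : H => r *: x.1.1) @ x --> r *: x.1.1.
  by apply: cvgZr; apply: continuous_comp; exact: cvg_fst.
have A2 : (fun x : H => r *: x.1.2) @ x --> r *: x.1.2.
  by apply: cvgZr; apply: continuous_comp; [exact: cvg_fst|exact: cvg_snd].
have A3 : (fun x : H => r ^+ 2 * x.2) @ x --> r ^+ 2 * x.2.
  by apply: cvgM; [exact: cvg_cst|exact: cont_coordt].
exact: (cvg_pair (cvg_pair A1 A2) A3).
Qed.

Lemma derive_dil phi r v y : smooth setT phi ->
  'D_v (phi \o hdil r) y = 'D_(hdil r v) phi (hdil r y).
Proof.
move=> sp; have D := @is_derive_affine R _ _ (hdil r) (hdil r) phi v y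
  (hdil_linear r) (@smooth_derivable R n setT _ _ _ sp I).
by rewrite (@derive_val _ _ _ _ _ _ _ D).
Qed.

Lemma smooth_dil phi r : smooth setT phi -> smooth setT (phi \o hdil r).
Proof.
move=> sp m; apply: (Cn_affine openT (hdil_linear r) _ _ (sp m)) => //; exact: cont_hdil.
Qed.

Transparent Z.

Lemma Z_dil s phi r : smooth setT phi -> Z s (phi \o hdil r) = fun x => r * Z s phi (hdil r x).
Proof.
move=> sp; apply/funext => y; rewrite /Z /vfield /= !derive_dil//.
have -> : hdil r et = r ^+ 2 *: et by apply: heis_eq => /=; rewrite ?scaler0// /GRing.scale/=.
have -> : hdil r (field_of s : H * (H -> R)).1 = r *: (field_of s).1.
  by case: s => j; apply: heis_eq => //=; rewrite /GRing.scale/= !mulr0.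
rewrite !derive_scale//.
have -> : (field_of s).2 (hdil r y) = r * (field_of s).2 y by case: s => j /=; rewrite !mxE; ring.
by ring.
Qed.

Lemma Z_scale s phi c : smooth setT phi -> Z s (fun x => c * phi x) = fun x => c * Z s phi x.
Proof.
move=> sp; apply/funext => x; rewrite Z_mul//; last exact: smooth_cst.
rewrite (_ : Z s (fun=> c) x = 0) ?mul0r ?add0r//.
by rewrite /Z /vfield !(derive_cst (c : R)) mulr0 addr0.
Qed.

Opaque Z.
Transparent sublap.

Lemma sublap_scale phi c : smooth setT phi -> sublap (fun x => c * phi x) = fun x => c * sublap phi x.
Proof.
move=> sp; rewrite !sublapE; apply/funext => y /=; rewrite mulrCA; congr (_ * _).
rewrite mulr_sumr; apply: eq_bigr => j _.
have sZ s : smooth setT (Z s phi) by apply: Z_smooth => //; exact: openT.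
have E s : Z s (Z s (fun x => c * phi x)) y = c * Z s (Z s phi) y.
  by rewrite (Z_scale s c sp) (Z_scale s c (sZ s)).
by rewrite !E [RHS]mulrDr.
Qed.

Opaque sublap.

Lemma iter_sublap_scale k phi c : smooth setT phi ->
  iter k sublap (fun x => c * phi x) = fun x => c * iter k sublap phi x.
Proof.
move=> sp; elim: k => [//|k IH]; rewrite !iterS IH sublap_scale//.
by apply: iter_sublap_smooth => //; exact: openT.
Qed.

Transparent sublap.

Lemma sublap_dil phi r : smooth setT phi ->
  sublap (phi \o hdil r) = fun x => r ^+ 2 * sublap phi (hdil r x).
Proof.
move=> sp; rewrite !sublapE; apply/funext => y /=; rewrite mulrCA; congr (_ * _).
rewrite mulr_sumr; apply: eq_bigr => j _.
have sZ s : smooth setT (Z s phi) by apply: Z_smooth => //; exact: openT.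
rewrite !Z_dil//.
have E s : Z s (fun x => r * Z s phi (hdil r x)) y = r ^+ 2 * Z s (Z s phi) (hdil r y).
  rewrite (Z_scale s r (smooth_dil r (sZ s))) (Z_dil s r (sZ s)); ring.
by rewrite !E [RHS]mulrDr.
Qed.

Opaque sublap.

Lemma iter_sublap_dil k phi r : smooth setT phi ->
  iter k sublap (phi \o hdil r) = fun x => r ^+ (2 * k) * iter k sublap phi (hdil r x).
Proof.
move=> sp; elim: k => [|k IH]; first by apply/funext => x; rewrite mul1r.
rewrite iterS IH; have sk : smooth setT (iter k sublap phi).
  by apply: iter_sublap_smooth => //; exact: openT.
rewrite (sublap_scale _ (smooth_dil r sk)) (sublap_dil r sk); apply/funext => x /=.
by rewrite mulrA -exprD mulnS addnC.
Qed.

End invariance.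

(** * Polar coordinates *)

Section one_dimensional.
Context {R : realType}.
Local Notation leb := (@lebesgue_measure R).

Lemma integral_itvoo_FTC (f F : R -> R) (a b : R) : a < b ->
  {within `[a, b], continuous f} -> derivable_oo_LRcontinuous F a b ->
  {in `]a, b[, F^`()%classic =1 f} ->
  (\int[leb]_(r in `]a, b[) (f r)%:E = (F b - F a)%:E)%E.
Proof.
move=> ab cf dF Ff; have E := continuous_FTC2 ab cf dF Ff.
have mf : measurable_fun `]a, b[ (EFin \o f).
  apply/measurable_EFinP; apply: (@measurable_funS _ _ _ _ `[a, b]%classic) => //.
    exact: subset_itv_oo_cc.
  exact: subspace_continuous_measurable_fun.
rewrite EFinB -E integral_itv_bndo_bndc// integral_itv_obnd_cbnd//.
apply/measurable_EFinP; apply: (@measurable_funS _ _ _ _ `[a, b]%classic) => //.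
  by move=> r; rewrite /= !in_itv/= => /andP[/ltW -> ->].
exact: subspace_continuous_measurable_fun.
Qed.

Lemma integral_pow (m : nat) (b : R) : 0 < b ->
  (\int[leb]_(r in `]0%R, b[) (r ^+ m)%:E = (b ^+ m.+1 / m.+1%:R)%:E)%E.
Proof.
move=> b0; pose F (r : R) := (m.+1%:R^-1) * r ^+ m.+1.
have D (r : R) : is_derive r (1 : R) F (r ^+ m).
  have h : is_derive r (1 : R) (fun r : R => r ^+ m.+1) (m.+1%:R * r ^+ m).
    by split; [exact: exprn_derivable|rewrite exp_derive /GRing.scale/= mulr1 mulr_natl].
  have D' := is_deriveZ m.+1%:R^-1 h.
  apply: (is_derive_eq D'); by rewrite /GRing.scale/= mulrA mulVf ?mul1r// pnatr_eq0.
have cF : continuous F.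
  move=> r; apply: differentiable_continuous; apply/derivable1_diffP.
  exact: (@ex_derive _ _ _ _ _ _ _ (D r)).
rewrite (@integral_itvoo_FTC _ F)//.
- by rewrite /F expr0n/= mulr0 subr0 mulrC.
- by apply: continuous_subspaceT => r; exact: exprn_continuous.
- split; first by move=> r _; exact: (@ex_derive _ _ _ _ _ _ _ (D r)).
  + by apply: cvg_at_right_filter; exact: cF.
  + by apply: cvg_at_left_filter; exact: cF.
- by move=> r _; rewrite derive1E (@derive_val _ _ _ _ _ _ _ (D r)).
Qed.

Lemma integral_inv (a b : R) : 0 < a -> a < b ->
  (\int[leb]_(r in `]a, b[) (r^-1)%:E = (ln (b / a))%:E)%E.
Proof.
move=> a0 ab; have b0 := lt_trans a0 ab.
rewrite ln_div ?posrE// (@integral_itvoo_FTC _ (@ln R))//.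
- apply: continuous_in_subspaceT => r; rewrite inE/= in_itv/= => /andP[ar _].
  by apply: cvgV => //; rewrite gt_eqF// (lt_le_trans a0).
- split.
  + move=> r; rewrite in_itv/= => /andP[ar _].
    exact: (@ex_derive _ _ _ _ _ _ _ (is_derive1_ln (lt_trans a0 ar))).
  + by apply: cvg_at_right_filter; exact: continuous_ln.
  + by apply: cvg_at_left_filter; exact: continuous_ln.
- move=> r; rewrite in_itv/= => /andP[ar _].
  by rewrite derive1E (@derive_val _ _ _ _ _ _ _ (is_derive1_ln (lt_trans a0 ar))).
Qed.

End one_dimensional.

Section polar.
Context {R : realType} {n : nat}.
Local Notation H := (heis R n).
Local Notation mu := (heis_measure R n).
Local Notation leb := (@lebesgue_measure R).
Local Notation Q := (hdim n).
Variable sigma : {measure set H -> \bar R}.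
Hypothesis hsigma : is_polar_measure sigma.
Implicit Types (x y w v : H) (r : R).

Lemma measurable_hsphere : measurable (@hsphere R n).
Proof.
rewrite (_ : @hsphere R n = @hnorm R n @^-1` [set 1]) //.
by rewrite -[X in measurable X]setTI; apply: measurable_hnorm.
Qed.

(** A radial factor and a factor of degree 0 separate. The radial powers |x|^(m - Q) then give the
    volumes of balls and the mass of the pole near 0, while |x|^(-Q) gives dr/r and so the logarithm
    that carries the sharp constant. *)
Lemma polar_prod (k : R -> R) (F : H -> R) (I : set R) : measurable I -> I `<=` `]0%R, +oo[%classic ->
  measurable_fun setT k -> (forall r, 0 < r -> 0 <= k r) ->
  measurable_fun setT F -> (forall x, 0 <= F x) ->
  (forall r x, 0 < r -> hnorm x = 1 -> F (hdil r x) = F x) ->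
  (\int[mu]_(x in @hnorm R n @^-1` I) (k (hnorm x) * F x)%:E =
   (\int[leb]_(r in I) (k r * r ^+ Q.-1)%:E) * \int[sigma]_(x in hsphere) (F x)%:E)%E.
Proof.
move=> mI I0 mk k0 mF F0 FE.
have mJ : measurable (@hnorm R n @^-1` I) by rewrite -[X in measurable X]setTI; exact: measurable_hnorm.
pose h x := (\1_I (hnorm x) * (k (hnorm x) * F x))%:E.
have kI r : 0 <= \1_I r * k r.
  rewrite indicE; case: (boolP (r \in I)) => [/set_mem/I0|_]; last by rewrite mul0r.
  by rewrite /= in_itv/= andbT mul1r => /k0.
have mkI : measurable_fun setT (fun r : R => \1_I r * k r) by apply: measurable_funM => //; exact: measurable_indic.
have mh : measurable_fun setT h.
  apply/measurable_EFinP; rewrite (_ : (fun x => _) = (fun x => (\1_I (hnorm x) * k (hnorm x)) * F x)).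
    apply: measurable_funM => //.
    by apply: (@measurableT_comp _ _ _ _ _ _ (fun r : R => \1_I r * k r)) => //; exact: measurable_hnorm.
  by apply/funext => x; rewrite mulrA.
have h0 x : (0 <= h x)%E by rewrite lee_fin mulrA mulr_ge0.
transitivity (\int[mu]_x h x)%E.
  rewrite integral_mkcond; apply: eq_integral => x _; rewrite patchE /h indicE.
  case: ifPn; first by move=> /set_mem xI; rewrite mem_set// mul1r.
  by rewrite notin_setE => xI; rewrite memNset// mul0r.
have [_ ->] := hsigma => //.
have mS := measurable_hsphere.
have mFS : measurable_fun hsphere (EFin \o F) by apply/measurable_EFinP; exact: measurable_funTS.
transitivity (\int[leb]_(r in `]0%R, +oo[) ((\1_I r * k r * r ^+ Q.-1)%:E * \int[sigma]_(x in hsphere) (F x)%:E))%E.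
  apply: eq_integral => r; rewrite inE/= in_itv/= andbT => r0.
  rewrite -ge0_integralZl//; last 2 first.
  - by move=> x _; rewrite lee_fin.
  - by rewrite lee_fin mulr_ge0// exprn_ge0// ltW.
  apply: eq_integral => x; rewrite inE /hsphere/= => x1.
  rewrite /h hnorm_dil ?(ltW r0)// x1 mulr1 FE// -!EFinM; congr (_%:E); ring.
rewrite ge0_integralZr//; last 3 first.
- apply/measurable_EFinP; apply: measurable_funTS; exact: measurable_funM.
- move=> r; rewrite /= in_itv/= andbT => r0.
  by rewrite lee_fin mulr_ge0// exprn_ge0// ltW.
- by apply: integral_ge0 => x _; rewrite lee_fin.
congr (_ * _)%E; rewrite [LHS]integral_mkcond [RHS]integral_mkcond; apply: eq_integral => r _.
rewrite !patchE indicE; case: (boolP (r \in I)) => [/set_mem rI|rI].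
  by rewrite (mem_set (I0 _ rI)) mul1r.
by case: ifP => // _; rewrite !mul0r.
Qed.

Lemma hdim_gt0 : (0 < Q)%N. Proof. by rewrite /hdim addn2. Qed.

Definition sphere_area : R := fine (sigma hsphere).

Lemma polar_pow (m : nat) (b : R) : 0 < b -> (0 < m)%N ->
  (\int[mu]_(x in @hnorm R n @^-1` `]0%R, b[) (hnorm x `^ (m%:R - Q%:R))%:E =
   (b ^+ m / m%:R)%:E * sigma hsphere)%E.
Proof.
move=> b0 m0.
have := @polar_prod (fun r => r `^ (m%:R - Q%:R)) (fun=> 1) `]0, b[%classic.
move=> H1; under eq_integral => x _ do rewrite -[_ `^ _]mulr1.
rewrite H1 //.
- rewrite integral_cst ?mul1e//; last exact: measurable_hsphere.
  congr (_ * _)%E; case: m m0 {H1} => // m _; rewrite -integral_pow//.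
  apply: eq_integral => r; rewrite inE/= in_itv/= => /andP[r0 _]; congr (_%:E).
  rewrite -!powR_mulrn ?(ltW r0)// -powRD; last by apply/implyP => _; rewrite gt_eqF.
  congr (_ `^ _); rewrite -[in LHS](prednK hdim_gt0) -!natr1; ring.
- by move=> r /=; rewrite !in_itv/= andbT => /andP[].
- by move=> r _; exact: powR_ge0.
Qed.

(** The sphere has mass Q times the volume of the punctured unit ball, and that ball lies in a cube
    of finite measure. *)
Lemma sphere_area_fin : (sigma hsphere < +oo)%E.
Proof.
have E := @polar_pow Q 1 ltr01 hdim_gt0.
have : (\int[mu]_(x in @hnorm R n @^-1` `]0%R, 1%R[) (hnorm x `^ (Q%:R - Q%:R))%:E < +oo)%E.
  apply: (@le_lt_trans _ _ (mu (cube 2))); last exact: mu_cube_fin.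
  have mJ : measurable (@hnorm R n @^-1` `]0%R, 1[%classic) by rewrite -[X in measurable X]setTI; apply: measurable_hnorm.
  under eq_integral do rewrite subrr powRr0.
  rewrite integral_cst// mul1e le_measure// ?inE//; first exact: measurable_cube.
  move=> x; rewrite /= in_itv/= => /andP[_ x1]; rewrite /cube/=.
  rewrite (le_trans (hmax_le_hN4 x))// -[2]/(1 + 1) lerD2l -[X in _ <= X](expr1n _ 4).
  by rewrite -hnorm_le// ltW.
rewrite E expr1n mul1r; have [//|] := ltP (sigma hsphere) +oo%E.
by rewrite leye_eq => /eqP ->; rewrite gt0_muley// lte_fin invr_gt0 ltr0n hdim_gt0.
Qed.

Lemma sphere_areaE : sigma hsphere = sphere_area%:E.
Proof. by rewrite fineK// ge0_fin_numE// sphere_area_fin. Qed.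

Lemma sphere_area_ge0 : 0 <= sphere_area. Proof. by rewrite fine_ge0. Qed.

Lemma polar_powE (m : nat) (b : R) : 0 < b -> (0 < m)%N ->
  (\int[mu]_(x in @hnorm R n @^-1` `]0%R, b[) (hnorm x `^ (m%:R - Q%:R))%:E =
   (b ^+ m / m%:R * sphere_area)%:E)%E.
Proof. by move=> b0 m0; rewrite polar_pow// sphere_areaE -EFinM. Qed.

Lemma polar_shell (F : H -> R) (a b : R) : 0 < a -> a < b ->
  measurable_fun setT F -> (forall x, 0 <= F x) ->
  (forall r x, 0 < r -> hnorm x = 1 -> F (hdil r x) = F x) ->
  (\int[mu]_(x in @hnorm R n @^-1` `]a, b[) (hnorm x `^ (- Q%:R) * F x)%:E =
   (ln (b / a))%:E * \int[sigma]_(x in hsphere) (F x)%:E)%E.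
Proof.
move=> a0 ab mF F0 FE; rewrite (@polar_prod (fun r => r `^ (- Q%:R)) F)//.
- congr (_ * _)%E; rewrite -integral_inv//; apply: eq_integral => r.
  rewrite inE/= in_itv/= => /andP[r0 _]; congr (_%:E); have {}r0 := lt_trans a0 r0.
  rewrite -powR_inv1 ?(ltW r0)// -powR_mulrn ?(ltW r0)// -powRD; last by apply/implyP => _; rewrite gt_eqF.
  congr (_ `^ _); rewrite -[in LHS](prednK hdim_gt0) -!natr1; ring.
- by move=> r /=; rewrite !in_itv/= andbT => /andP[/(lt_trans a0)].
- by move=> r _; exact: powR_ge0.
Qed.

End polar.

(** * The truncated fundamental solution *)

Section fundamental.
Context {R : realType} {n alpha : nat}.
Local Notation H := (heis R n).
Local Notation mu := (heis_measure R n).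
Local Notation Q := (hdim n).
Local Notation k := (alpha./2).
Variables (g : R -> R) (sigma : {measure set H -> \bar R}).
Hypotheses (halpha : ~~ odd alpha) (halpha0 : (0 < alpha < Q)%N).
Hypothesis hsigma : is_polar_measure sigma.
Hypothesis hg : is_fundamental n alpha g.
Implicit Types (x y w v : H) (r : R) (f b phi psi : H -> R).

Opaque Z sublap.

Lemma alpha2 : (2 * k)%N = alpha.
Proof. by rewrite mul2n -[RHS]odd_double_half (negbTE halpha). Qed.

Definition fundG x : R := g (htheta x) * hnorm x `^ (alpha%:R - Q%:R).

Lemma alphaQ : alpha%:R < Q%:R :> R.
Proof. by rewrite ltr_nat; case/andP: halpha0. Qed.

Lemma fundG_smooth : smooth [set x : H | x != 0] fundG.
Proof. by apply/smooth_onP; case: hg. Qed.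

Lemma fundG_fund phi : test phi -> \int[mu]_x (fundG x * iter k sublap phi x) = phi 0.
Proof. by move=> tp; case: hg => _; apply; apply/test_functionP. Qed.

Lemma hnorm0 : hnorm (0 : H) = 0. Proof. by apply/eqP; rewrite hnorm_eq0. Qed.

(** A default value: [powR] sends 0 to 0 for every nonzero exponent, negative ones included. *)
Lemma fundG0 : fundG 0 = 0.
Proof.
by rewrite /fundG hnorm0 powR0 ?mulr0// subr_eq0 lt_eqF// alphaQ.
Qed.

Lemma hzabs2_dil r x : hzabs (hdil r x) ^+ 2 = r ^+ 2 * hzabs x ^+ 2.
Proof.
rewrite !hzabs2 mulr_sumr; apply: eq_bigr => j _; rewrite !mxE; ring.
Qed.

Lemma htheta_dil r x : 0 < r -> htheta (hdil r x) = htheta x.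
Proof.
move=> r0; rewrite /htheta hzabs2_dil hnorm_dil ?(ltW r0)// exprMn.
have r2 : r ^+ 2 != 0 by rewrite expf_neq0// gt_eqF.
have E (a b : R) : r ^+ 2 * a / (r ^+ 2 * b) = a / b by rewrite -mulf_div divff// mul1r.
by rewrite -[(hdil r x).2]/(r ^+ 2 * x.2) !E.
Qed.

Lemma fundG_dil r x : 0 < r -> fundG (hdil r x) = r `^ (alpha%:R - Q%:R) * fundG x.
Proof.
move=> r0; rewrite /fundG htheta_dil// hnorm_dil ?(ltW r0)//.
by rewrite powRM ?hnorm_ge0 ?(ltW r0)//; ring.
Qed.

Lemma hdil1 x : hdil 1 x = x.
Proof. by apply: heis_eq; rewrite /= ?expr1n ?mul1r// !scale1r -surjective_pairing. Qed.

Lemma hdilM r s x : hdil r (hdil s x) = hdil (r * s) x.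
Proof. by apply: heis_eq => /=; rewrite ?scalerA// exprMn mulrA. Qed.

Lemma hdilK r x : 0 < r -> hdil r (hdil r^-1 x) = x.
Proof. by move=> r0; rewrite hdilM mulfV ?hdil1// gt_eqF. Qed.

Lemma hdil_sphere x : x != 0 -> hnorm (hdil (hnorm x)^-1 x) = 1.
Proof.
by rewrite -hnorm_gt0 => x0; rewrite hnorm_dil ?invr_ge0 ?hnorm_ge0// mulVf// gt_eqF.
Qed.

Lemma compact_hsphere : compact (@hsphere R n).
Proof.
apply: (@subclosed_compact _ _ (cube 2)); last 1 first.
- move=> x; rewrite /hsphere/= /cube/= => x1.
  by rewrite (le_trans (hmax_le_hN4 x))// -hnorm4 x1 expr1n.
- rewrite (_ : @hsphere R n = hN4 @^-1` [set 1]).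
    apply: preimage_closed; last exact: closed1 || exact: closed_eq.
    by move=> x _; exact: cont_hN4.
  apply/seteqP; split => x /=; rewrite /hsphere/= => h; first by rewrite -hnorm4 h expr1n.
  by rewrite hnormE h powR1.
- exact: compact_cube.
Qed.

(** The kernel is continuous on the compact unit sphere, and homogeneity of degree alpha - Q carries
    the bound to all points. At 0 both sides vanish by the convention on [powR]. *)
Lemma fundG_bound : exists2 C, 0 < C & forall x, `|fundG x| <= C * hnorm x `^ (alpha%:R - Q%:R).
Proof.
have cS : compact (fundG @` @hsphere R n).
  apply: continuous_compact; last exact: compact_hsphere.
  apply: continuous_in_subspaceT => x; rewrite inE /hsphere/= => x1.
  apply: (smooth_continuous fundG_smooth) => /=.
  by rewrite -hnorm_gt0 x1.
have /compact_bounded[M [_ /(_ (`|M| + 1))]] := cS.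
rewrite (le_lt_trans (ler_norm M)) ?ltrDl// => /(_ isT) HM.
exists (`|M| + 1) => [|x]; first by rewrite ltr_wpDl.
have [->|x0] := eqVneq x 0; first by rewrite fundG0 normr0 mulr_ge0 ?powR_ge0// addr_ge0.
have nx : 0 < hnorm x by rewrite hnorm_gt0.
rewrite -{1}(hdilK x nx) fundG_dil// normrM mulrC (ger0_norm (powR_ge0 _ _)).
rewrite ler_wpM2r ?powR_ge0//; apply: HM; exists (hdil (hnorm x)^-1 x) => //.
exact: hdil_sphere.
Qed.

Lemma smooth_eq0_near f x : (\near x, f x = 0) -> forall m, iter m sublap f x = 0.
Proof.
move=> f0 m; have := @iter_sublap_near _ _ m f (fun=> 0) x f0.
by rewrite iter_sublap0 => /nbhs_singleton.
Qed.

Lemma open_hnorm_lt r : 0 <= r -> open [set x : H | hnorm x < r].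
Proof.
move=> r0; rewrite (_ : [set x | _] = hN4 @^-1` [set t | t < r ^+ 4]).
  by apply: open_comp; [move=> x _; exact: cont_hN4|exact: open_lt].
by apply/seteqP; split => x /=; rewrite hnorm_lt.
Qed.

Lemma open_neq0 : open [set x : H | x != 0].
Proof.
rewrite (_ : [set x | _] = hN4 @^-1` [set t | 0 < t]).
  by apply: open_comp; [move=> x _; exact: cont_hN4|exact: open_gt].
apply/seteqP; split => x /=; rewrite -hnorm_gt0 -hnorm4 => h; first by rewrite exprn_gt0.
by rewrite lt_neqAle hnorm_ge0 andbT eq_sym; apply: contraTneq h => ->; rewrite expr0n ltxx.
Qed.

Definition Gfar r x := (1 - hcut r x) * fundG x.

Lemma Gfar_smooth r : 0 < r -> smooth setT (Gfar r).
Proof.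
move=> r0 m; have oT : open [set x : H | hnorm x < r] by exact/open_hnorm_lt/ltW.
have s1 : Cn m [set x : H | x != 0] (Gfar r).
  apply: (@smoothM R n _ (fun x => 1 - hcut r x)); [exact: open_neq0| |exact: fundG_smooth].
  by apply: smooth_setT; apply: smoothB; [exact: openT|exact: smooth_cst|exact: smooth_hcut].
have s2 : Cn m [set x : H | hnorm x < r] (Gfar r).
  apply: (@Cn_ext _ _ _ _ (fun=> 0)); [exact: oT| |exact: Cn_cst].
  by move=> x /set_mem/= xr; rewrite /Gfar hcut1 ?subrr ?mul0r// ltW.
apply: Cn_sub (Cn_setU s1 s2) => x _ /=.
have [->|x0] := eqVneq x 0; last by left.
by right; rewrite hnorm0.
Qed.

Lemma measurable_fundG : measurable_fun setT fundG.
Proof.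
have p0 (m : nat) : 0 < (m.+1%:R^-1 : R) by rewrite invr_gt0 ltr0n.
apply: (@measurable_fun_cvg _ _ _ _ (fun m => Gfar m.+1%:R^-1)).
  by move=> m; exact: smooth_meas (Gfar_smooth (p0 m)).
move=> x _; have [->|x0] := eqVneq x 0.
  by under eq_fun do rewrite /Gfar fundG0 mulr0; rewrite fundG0; exact: cvg_cst.
apply: cvg_near_cst; have nx : 0 < hnorm x / 2 by rewrite divr_gt0// hnorm_gt0.
near=> m; rewrite /Gfar hcut0 ?subr0 ?mul1r// mulrC -ler_pdivlMr//.
apply: ltW; near: m; by have := near_infty_natSinv_lt (PosNum nx).
Unshelve. all: by end_near. Qed.

Lemma integrable_pole (f : H -> R) r C : 0 < r -> measurable_fun setT f ->
  (forall x, `|f x| <= C * hnorm x `^ (alpha%:R - Q%:R)) ->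
  (forall x, r <= hnorm x -> f x = 0) -> mu.-integrable setT (EFin \o f).
Proof.
move=> r0 mf fC fr; have [ap aQ] := andP halpha0.
have mI : measurable (@hnorm R n @^-1` `]0%R, r[%classic).
  by rewrite -[X in measurable X]setTI; apply: measurable_hnorm.
have mP : measurable_fun setT (fun x : H => hnorm x `^ (alpha%:R - Q%:R)).
  by apply: (@measurableT_comp _ _ _ _ _ _ (fun t => t `^ (alpha%:R - Q%:R))); [exact: measurable_powR|exact: measurable_hnorm].
have C0 : 0 <= C.
  pose e1 : H := (0, 0, 1).
  have e10 : 0 < hnorm e1.
    rewrite hnorm_gt0; apply/eqP => /(congr1 snd)/= /eqP; by rewrite oner_eq0.
  have := le_trans (normr_ge0 _) (fC e1); rewrite pmulr_lge0// powR_gt0//.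
apply/integrableP; split; first exact/measurable_EFinP.
have mE : measurable_fun setT (fun x : H => (hnorm x `^ (alpha%:R - Q%:R))%:E) by exact/measurable_EFinP.
apply: (@le_lt_trans _ _ (\int[mu]_x (C%:E * ((fun x => (hnorm x `^ (alpha%:R - Q%:R))%:E) \_ (@hnorm R n @^-1` `]0%R, r[%classic)) x))%E).
  apply: ge0_le_integral => //.
  - by apply/measurable_EFinP; exact: measurableT_comp.
  - by apply: emeasurable_funM => //; apply/(measurable_restrictT _ mI); exact: measurable_funTS.
  - move=> x _ /=; rewrite patchE; case: ifPn => [_|]; first by rewrite -EFinM lee_fin.
    rewrite notin_setE /= in_itv/= => /negP; rewrite negb_and -!leNgt => /orP[x0|xr].
      have /eqP : hnorm x = 0 by apply/eqP; rewrite eq_le x0 hnorm_ge0.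
      rewrite hnorm_eq0 => /eqP x00; rewrite mule0 lee_fin (le_trans (fC x))// x00 hnorm0 powR0 ?mulr0//.
      by rewrite subr_eq0 lt_eqF// alphaQ.
    by rewrite fr// normr0 mule0.
rewrite ge0_integralZl//; last 2 first.
- by apply/(measurable_restrictT _ mI); exact: measurable_funTS.
- by move=> x _; rewrite patchE; case: ifP => // _; rewrite lee_fin powR_ge0.
rewrite -integral_mkcond (polar_powE hsigma r0 ap) -EFinM; exact: ltry.
Qed.

Definition Hker r x := hcut r x * fundG x.

Lemma Hker_le r x : `|Hker r x| <= `|fundG x|.
Proof.
rewrite /Hker normrM ler_piMl//; have /andP[a c] := hcut01 r x.
by rewrite ger0_norm.
Qed.

Lemma Hker0 r x : 0 < r -> 2 * r <= hnorm x -> Hker r x = 0.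
Proof. by move=> r0 xr; rewrite /Hker hcut0 ?mul0r. Qed.

Lemma Hker_eq r x : 0 < r -> hnorm x <= r -> Hker r x = fundG x.
Proof. by move=> r0 xr; rewrite /Hker hcut1 ?mul1r. Qed.

Lemma measurable_Hker r : measurable_fun setT (Hker r).
Proof.
by apply: measurable_funM; [exact: smooth_meas (smooth_hcut r)|exact: measurable_fundG].
Qed.

Lemma integrable_Hker r : 0 < r -> mu.-integrable setT (EFin \o Hker r).
Proof.
move=> r0; have [C C0 GC] := fundG_bound.
apply: (@integrable_pole _ (2 * r) C); [by rewrite mulr_gt0|exact: measurable_Hker| |].
  by move=> x; exact: le_trans (Hker_le r x) (GC x).
by move=> x; exact: Hker0.
Qed.

Lemma bsupp_Hker r : 0 < r -> bsupp (Hker r).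
Proof. by move=> r0; apply: (@bsupp_hnorm _ _ (2 * r)) => x; exact: Hker0. Qed.

Lemma locint_fundG : locint fundG.
Proof.
split; first exact: measurable_fundG.
move=> r; pose r' := 1 + ((2 * n%:R * r ^+ 2) ^+ 2 + r ^+ 2).
have c0 : 0 <= (2 * n%:R * r ^+ 2) ^+ 2 + r ^+ 2 by rewrite addr_ge0 ?sqr_ge0.
have r'0 : 0 < r' by rewrite ltr_wpDr.
have [_ /(_ r)] := integrable_locint (integrable_Hker r'0).
apply: le_lt_trans; rewrite le_eqVlt; apply/orP; left; apply/eqP; apply: eq_integral => x; rewrite inE /cube/= => xr.
rewrite Hker_eq// hnorm_le ?(ltW r'0)// (le_trans (hN4_le_hmax xr))//.
rewrite (@le_trans _ _ r')//; first by rewrite /r' lerDr.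
by rewrite -[X in X <= _]expr1 ler_weXn2l// /r' lerDl.
Qed.

Lemma hcut_dil c r x : 0 < r -> hcut (c * r) x = hcut c (hdil r^-1 x).
Proof.
by move=> r0; rewrite /hcut hN4_dil; congr smoothstep; rewrite exprMn invfM exprVn mulrA mulrC mulrA.
Qed.

Lemma Gfar_dil r x : 0 < r -> Gfar r x = r `^ (alpha%:R - Q%:R) * Gfar 1 (hdil r^-1 x).
Proof.
move=> r0; rewrite /Gfar -{1}(mul1r r) hcut_dil// -{2}(hdilK x r0) fundG_dil//; ring.
Qed.

(** The correction kernel at scale 1; in the sense of distributions L^k [Hker r] = delta + [Kker r].
    Since [Gfar] is the fundamental solution far from 0, its image under L^k gives no contribution
    there; the factor [hcut 2] builds this in, so that bounded support holds by construction. *)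
Definition Kker1 x := - (hcut 2 x * iter k sublap (Gfar 1) x).

Definition Kker r x := r `^ (- Q%:R) * Kker1 (hdil r^-1 x).

Lemma iter_sublap_Gfar r x : 0 < r ->
  iter k sublap (Gfar r) x = r `^ (- Q%:R) * iter k sublap (Gfar 1) (hdil r^-1 x).
Proof.
move=> r0; have s1 := Gfar_smooth ltr01.
have -> : Gfar r = fun x => r `^ (alpha%:R - Q%:R) * (Gfar 1 \o hdil r^-1) x.
  by apply/funext => y; rewrite Gfar_dil.
apply: (etrans (congr1 (fun F => F x) (iter_sublap_scale k (r `^ (alpha%:R - Q%:R)) (smooth_dil r^-1 s1)))).
apply: (etrans (congr1 (fun F => r `^ (alpha%:R - Q%:R) * F x) (iter_sublap_dil k r^-1 s1))) => /=.
rewrite mulrA; congr (_ * _).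
rewrite alpha2 exprVn -powR_mulrn ?(ltW r0)// -powRN -powRD; last by apply/implyP => _; rewrite gt_eqF.
by congr (_ `^ _); ring.
Qed.

Lemma KkerE r x : 0 < r -> Kker r x = - (hcut (2 * r) x * iter k sublap (Gfar r) x).
Proof. by move=> r0; rewrite /Kker /Kker1 (@iter_sublap_Gfar r x r0) hcut_dil//; ring. Qed.

Lemma smooth_Kker1 : smooth setT Kker1.
Proof.
apply: smoothN; first exact: openT.
apply: smoothM; [exact: openT|exact: smooth_hcut|].
by apply: iter_sublap_smooth; [exact: openT|exact: Gfar_smooth].
Qed.

Lemma Kker10 x : 4 <= hnorm x -> Kker1 x = 0.
Proof.
move=> x4; rewrite /Kker1 hcut0 ?mul0r ?oppr0// (le_trans _ x4)//.
by rewrite -natrM.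
Qed.

Lemma Kker0 r x : 0 < r -> 4 * r <= hnorm x -> Kker r x = 0.
Proof.
move=> r0 xr; rewrite /Kker Kker10 ?mulr0// hnorm_dil ?invr_ge0 ?(ltW r0)//.
by rewrite mulrC ler_pdivlMr.
Qed.

Lemma smooth_Kker r : smooth setT (Kker r).
Proof. by apply: smoothZ; [exact: openT|exact: smooth_dil smooth_Kker1]. Qed.

Lemma bsupp_Kker r : 0 < r -> bsupp (Kker r).
Proof. by move=> r0; apply: (@bsupp_hnorm _ _ (4 * r)) => x; exact: Kker0. Qed.

Lemma test_Kker r : 0 < r -> test (Kker r).
Proof. by move=> r0; split; [exact: smooth_Kker|exact: bsupp_Kker]. Qed.

Lemma Kker_bound : exists2 C, 0 < C & forall r x, 0 < r -> `|Kker r x| <= C * r `^ (- Q%:R).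
Proof.
have tK1 : test Kker1 by split; [exact: smooth_Kker1|apply: (@bsupp_hnorm _ _ 4) => x; exact: Kker10].
have [M M0 HM] := test_bounded tK1; exists M => // r x r0.
by rewrite /Kker normrM (ger0_norm (powR_ge0 _ _)) mulrC ler_wpM2r// powR_ge0.
Qed.

(** [Hker r] is the fundamental solution minus the smooth [Gfar r], and L^k is moved from psi onto
    [Gfar r]. The part of psi cut out by 1 - [hcut (2 * r)] contributes nothing: it lives where
    [Gfar r] and the fundamental solution coincide, and it vanishes at 0. *)
Lemma Hker_identity r psi : 0 < r -> test psi ->
  \int[mu]_x (Hker r x * iter k sublap psi x) = psi 0 + \int[mu]_x (Kker r x * psi x).
Proof.
move=> r0 tp; have tL := iter_sublap_test k tp; have sG := Gfar_smooth r0.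
have oT : open (setT : set H) by exact: openT.
have sLG : smooth setT (iter k sublap (Gfar r)) by exact: iter_sublap_smooth.
pose psi' x := (1 - hcut (2 * r) x) * psi x.
have tp' : test psi'.
  by apply: testM => //; apply: smoothB => //; [exact: smooth_cst|exact: smooth_hcut].
have r20 : 0 < 2 * r by rewrite mulr_gt0.
have z : \int[mu]_x (iter k sublap (Gfar r) x * psi' x) = 0.
  rewrite -iter_sublap_ibp//.
  transitivity (\int[mu]_x (fundG x * iter k sublap psi' x)).
    apply: eq_Rintegral => x _; have [xr|xr] := leP (2 * r) (hnorm x).
      by rewrite /Gfar hcut0// subr0 mul1r.
    rewrite (@smooth_eq0_near psi' x) ?mulr0//.
    have : nbhs x [set y : H | hnorm y < 2 * r].
      by apply: open_nbhs_nbhs; split => //; exact/open_hnorm_lt/ltW.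
    by apply: filterS => y /= yr; rewrite /psi' hcut1 ?subrr ?mul0r// ltW.
  by rewrite fundG_fund// /psi' hcut1 ?subrr ?mul0r// hnorm0 ltW.
transitivity (\int[mu]_x (fundG x * iter k sublap psi x - Gfar r x * iter k sublap psi x)).
  by apply: eq_Rintegral => x _; rewrite /Hker /Gfar; ring.
rewrite RintegralB//; last 2 first.
- exact: locint_test locint_fundG tL.
- by apply: test_integrable; exact: testM.
rewrite fundG_fund// iter_sublap_ibp//; congr (_ + _).
rewrite -[X in - X]subr0 -z -RintegralB//; last 2 first.
- by apply: test_integrable; exact: testM.
- by apply: test_integrable; exact: testM.
rewrite -mulN1r -RintegralZl//; last first.
  apply: test_integrable.
  rewrite (_ : (fun x => _) = (fun x => (hcut (2 * r) x * iter k sublap (Gfar r) x) * psi x)).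
    by apply: testM => //; apply: smoothM => //; exact: smooth_hcut.
  by apply/funext => x; rewrite /psi'; ring.
by apply: eq_Rintegral => x _; rewrite KkerE// /psi'; ring.
Qed.

Lemma Hker_translate r x phi : 0 < r -> test phi ->
  \int[mu]_y (Hker r (hmul (- x) y) * iter k sublap phi y) =
  phi x + \int[mu]_y (Kker r (hmul (- x) y) * phi y).
Proof.
move=> r0 tp; have mL : measurable_fun setT (iter k sublap phi) by exact: smooth_meas (iter_sublap_test k tp).1.
have mh : measurable_fun setT (hmul (- x)) by case: (preserving_hmul (- x)).
have mphi := smooth_meas tp.1.
rewrite -(Rintegral_preserving (preserving_hmul x)) /=; last first.
  by apply: measurable_funM => //; apply: measurableT_comp => //; exact: measurable_Hker.
under eq_Rintegral => y _ do rewrite hmulK.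
have := Hker_identity r0 (test_hmul x tp); rewrite (iter_sublap_hmul k x tp.1) /= hmul0 => ->.
congr (_ + _); rewrite -[RHS](Rintegral_preserving (preserving_hmul x)) /=; last first.
  by apply: measurable_funM => //; apply: measurableT_comp => //; exact: smooth_meas (smooth_Kker r).
by apply: eq_Rintegral => y _; rewrite hmulK.
Qed.

End fundamental.

(** * Convolution and representation *)

Section fubini_factor.
Context {d} {T : measurableType d} {R : realType} (m : {sigma_finite_measure set T -> \bar R}).

(** Where a x = 0 the inner integral of c may diverge, and its value is then multiplied by 0; hence
    integrability of c in the second variable is asserted for almost every x with a x != 0. *)
Lemma fubini_factor (a : T -> R) (c : T * T -> R) : measurable_fun setT a -> measurable_fun setT c ->
  (\int[m]_x \int[m]_y `|a x * c (x, y)|%:E < +oo)%E ->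
  (\int[m]_x (a x * \int[m]_y c (x, y))%:E = \int[m]_y \int[m]_x (a x * c (x, y))%:E)%E /\
  {ae m, forall x, a x != 0 -> m.-integrable setT (EFin \o (fun y => c (x, y)))} /\
  m.-integrable setT (EFin \o (fun x => a x * \int[m]_y c (x, y))).
Proof.
move=> ma mc fin; pose F (p : T * T) := a p.1 * c p.
have mF : measurable_fun setT F.
  by apply: measurable_funM => //; apply: measurableT_comp => //; exact: measurable_fst.
have mE : measurable_fun setT (EFin \o F) by exact/measurable_EFinP.
have mN : measurable_fun setT (fun p => `|F p|%:E).
  by apply/measurable_EFinP; exact: measurableT_comp.
have mcx x : measurable_fun setT (fun y => c (x, y)) by apply: (measurableT_comp mc); exact: measurable_pair1.
have i : (m \x m)%E.-integrable setT (EFin \o F) by apply/(integrable12ltyP _ _ mE).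
have aeI : {ae m, forall x, (\int[m]_y `|F (x, y)|%:E < +oo)%E}.
  have ix : m.-integrable setT (fun x => \int[m]_y `|F (x, y)|%:E)%E.
    apply/integrableP; split; first exact: (measurable_fun_fubini_tonelli_F _ mN).
    apply: le_lt_trans fin; rewrite le_eqVlt; apply/orP; left; apply/eqP.
    by apply: eq_integral => x _; rewrite gee0_abs//; apply: integral_ge0 => y _; rewrite lee_fin.
  have := integrable_ae measurableT ix; apply: filterS => x /(_ I).
  by rewrite ge0_fin_numE//; apply: integral_ge0 => y _; rewrite lee_fin.
have aeI2 : {ae m, forall x, a x != 0 -> m.-integrable setT (EFin \o (fun y => c (x, y)))}.
  apply: filterS aeI => x fx px; apply/integrableP; split; first exact/measurable_EFinP.
  have E : (\int[m]_y `|F (x, y)|%:E = `|a x|%:E * \int[m]_y `|(c (x, y))%:E|)%E.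
    rewrite -ge0_integralZl//; last by apply/measurable_EFinP; exact: measurableT_comp.
    by apply: eq_integral => y _; rewrite /F normrM.
  rewrite E in fx; rewrite ltey; apply/eqP => fy.
  by move: fx; rewrite /= in fy; rewrite fy gt0_muley ?ltxx// lte_fin normr_gt0.
have mI : measurable_fun setT (fun x => \int[m]_y (c (x, y))%:E)%E.
  have mG : measurable_fun setT (EFin \o c) by exact/measurable_EFinP.
  have -> : (fun x => \int[m]_y (c (x, y))%:E)%E = (fun x => \int[m]_y (EFin \o c)^\+ (x, y) - \int[m]_y (EFin \o c)^\- (x, y))%E.
    apply/funext => x; rewrite integralE.
    by rewrite (_ : (fun y => (c (x, y))%:E) = (EFin \o c) \o (pair x))// funepos_comp funeneg_comp.
  apply: emeasurable_funB.
    exact: (measurable_fun_fubini_tonelli_F _ (measurable_funepos mG) (fun p => funepos_ge0 _ p)).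
  exact: (measurable_fun_fubini_tonelli_F _ (measurable_funeneg mG) (fun p => funeneg_ge0 _ p)).
have mA : measurable_fun setT (fun x => (a x * \int[m]_y c (x, y))%:E).
  apply/measurable_EFinP; apply: measurable_funM => //.
  exact: (@measurableT_comp _ _ _ _ _ _ (@fine R)).
split; last split => //; last first.
  apply/integrableP; split => //; apply: le_lt_trans fin; apply: ge0_le_integral => //.
  - exact: measurableT_comp.
  - exact: (measurable_fun_fubini_tonelli_F _ mN).
  - move=> x _ /=; apply: (@le_trans _ _ (`|a x|%:E * \int[m]_y `|(c (x, y))%:E|)%E).
      rewrite normrM EFinM lee_wpmul2l//.
      apply: (@le_trans _ _ `|\int[m]_y (c (x, y))%:E|%E); last first.
        by apply: le_abse_integral => //; exact/measurable_EFinP.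
      by rewrite /Rintegral; case: (\int[m]_y _)%E => [t||] //=; rewrite normr0 leey.
    rewrite -ge0_integralZl//; last by apply/measurable_EFinP; exact: measurableT_comp.
    rewrite le_eqVlt; apply/orP; left; apply/eqP; apply: eq_integral => y _.
    by rewrite normrM EFinM.
rewrite -(Fubini i); apply: ae_eq_integral => //.
- exact: measurable_int (integrable_fubini_F i).
- apply: filterS aeI2 => x ix _; have [px|px] := eqVneq (a x) 0.
    by rewrite px mul0r; under eq_integral do rewrite /F/= px mul0r; rewrite integral0.
  have fi := integrable_fin_num measurableT (ix px).
  by rewrite EFinM fineK// -integralZl//; exact: ix.
Qed.

End fubini_factor.

Section sigma_finite.
Context {R : realType} {n : nat}.
Local Notation H := (heis R n).

(** [heis_measure] is declared as a mere measure. The same set function under a new name carries the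
    sigma-finite structure, with the cubes of integral size as exhaustion, so that Tonelli's theorem
    applies. *)
Definition heis_mu (A : set H) : \bar R := heis_measure R n A.

Let heis_mu0 : heis_mu set0 = 0%E. Proof. exact: measure0. Qed.
Let heis_mu_ge0 A : (0 <= heis_mu A)%E. Proof. exact: measure_ge0. Qed.
Let heis_mu_sigma_additive : semi_sigma_additive heis_mu.
Proof. exact: (@measure_semi_sigma_additive _ _ _ (heis_measure R n)). Qed.

HB.instance Definition _ := isMeasure.Build _ _ _ heis_mu heis_mu0 heis_mu_ge0 heis_mu_sigma_additive.

Let heis_mu_sigma_finite : sigma_finite setT heis_mu.
Proof.
exists (fun k => cube k%:R) => [|k]; last by split; [exact: measurable_cube|exact: mu_cube_fin].
apply/esym/seteqP; split => // x _; exists (Num.bound (hmax x)) => //.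
by rewrite /cube/= ltW// archi_boundP// hmax_ge0.
Qed.

HB.instance Definition _ := Measure_isSigmaFinite.Build _ _ _ heis_mu heis_mu_sigma_finite.

Definition heis_sigma : {sigma_finite_measure set H -> \bar R} :=
  [the {sigma_finite_measure set H -> \bar R} of heis_mu].

Local Notation mu := (heis_measure R n).

Lemma heis_tonelli (F : H * H -> \bar R) : measurable_fun setT F -> (forall p, 0 <= F p)%E ->
  (\int[mu]_x \int[mu]_y F (x, y) = \int[mu]_y \int[mu]_x F (x, y))%E.
Proof. by move=> mF F0; exact: (@fubini_tonelli _ _ _ _ R heis_sigma heis_sigma F mF F0). Qed.

Lemma measurable_int1 (F : H * H -> \bar R) : measurable_fun setT F -> (forall p, 0 <= F p)%E ->
  measurable_fun setT (fun x => \int[mu]_y F (x, y))%E.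
Proof. by move=> mF F0; exact: (@measurable_fun_fubini_tonelli_F _ _ _ _ R heis_sigma F mF F0). Qed.

Lemma heis_fubini_factor (a : H -> R) (c : H * H -> R) : measurable_fun setT a -> measurable_fun setT c ->
  (\int[mu]_x \int[mu]_y `|a x * c (x, y)|%:E < +oo)%E ->
  (\int[mu]_x (a x * \int[mu]_y c (x, y))%:E = \int[mu]_y \int[mu]_x (a x * c (x, y))%:E)%E /\
  {ae mu, forall x, a x != 0 -> mu.-integrable setT (EFin \o (fun y => c (x, y)))} /\
  mu.-integrable setT (EFin \o (fun x => a x * \int[mu]_y c (x, y))).
Proof. exact: (@fubini_factor _ H R heis_sigma a c). Qed.

End sigma_finite.

Section convolution.
Context {R : realType} {n : nat}.
Local Notation H := (heis R n).
Local Notation mu := (heis_measure R n).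
Local Notation et := ((0, 0, 1) : H).
Implicit Types (x y w v : H) (r : R) (f b h phi psi : H -> R).

Definition kernel h := mu.-integrable setT (EFin \o h) /\ bsupp h.

Lemma kernel_meas h : kernel h -> measurable_fun setT h.
Proof. by move=> [/integrableP[/measurable_EFinP]]. Qed.

Lemma kernel_test h : test h -> kernel h.
Proof. by move=> th; split; [exact: test_integrable|case: th]. Qed.

(** In this form derivatives in y fall on psi alone and h may be singular; [convE] gives the form
    with h evaluated at x^-1 y. *)
Definition conv psi h y := \int[mu]_w (psi (hmul y (- w)) * h w).

Definition bounded_bsupp psi :=
  [/\ measurable_fun setT psi, exists2 M, 0 < M & forall x, `|psi x| <= M & bsupp psi].

Lemma test_bounded_bsupp psi : test psi -> bounded_bsupp psi.
Proof.
by move=> tp; split; [exact: smooth_meas tp.1|exact: test_bounded|exact: tp.2].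
Qed.

Lemma conv_integrable psi h y : bounded_bsupp psi -> kernel h ->
  mu.-integrable setT (EFin \o (fun w => psi (hmul y (- w)) * h w)).
Proof.
move=> [mp [M M0 HM] _] kh; have mh := kernel_meas kh.
apply: (@integrable_fun_le _ _ _ (fun w => M * `|h w|)).
- apply: measurable_funM => //; apply: measurableT_comp => //.
  by case: (preserving_hmulN y).
- by move=> w; rewrite normrM ler_wpM2r.
- by have := integrableZl measurableT M (integrable_norm kh.1).
Qed.

Lemma conv_cont psi h : test psi -> kernel h -> continuous (conv psi h).
Proof.
move=> tp kh y; have [M M0 HM] := test_bounded tp; have mh := kernel_meas kh.
apply: (@cont_seq R (heis_normed (R := R) (n := n))) => u uy.
apply: (@Rintegral_dct _ _ (fun k w => psi (hmul (u k) (- w)) * h w) _ (fun w => M * `|h w|)).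
- move=> k; apply: measurable_funM => //; apply: measurableT_comp; first exact: smooth_meas tp.1.
  by case: (preserving_hmulN (u k)).
- move=> w; apply: cvgM; last exact: cvg_cst.
  apply: (@cvg_comp _ _ _ u (fun y => psi (hmul y (- w))) _ (nbhs y)) => //.
  apply: (@continuous_comp _ _ _ (hmul ^~ (- w)) psi); first exact: cont_hmulr.
  exact: smooth_cont tp.1 _.
- by have := integrableZl measurableT M (integrable_norm kh.1).
- by move=> k w; rewrite normrM ler_wpM2r.
Qed.

(** The central component in the derivative along v of the right translation y -> y w^-1. *)
Definition sympN_coef v w : R := symp v.1 (- w).1.

Lemma cont_sympN v : continuous (sympN_coef v).
Proof.
move=> w; rewrite /sympN_coef /symp; apply: cvgM; first exact: cvg_cst.
apply: (@cont_sum R H _ _ (fun j w => v.1.2 ord0 j * (- w).1.1 ord0 j - v.1.1 ord0 j * (- w).1.2 ord0 j)) => j w'.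
have c1 : (fun w : H => (- w).1.1 ord0 j) @ w' --> (- w').1.1 ord0 j.
  by apply: (@continuous_comp _ _ _ (fun w : H => - w) (fun w : H => w.1.1 ord0 j)); [exact: cont_oppH|exact: cont_coordx].
have c2 : (fun w : H => (- w).1.2 ord0 j) @ w' --> (- w').1.2 ord0 j.
  by apply: (@continuous_comp _ _ _ (fun w : H => - w) (fun w : H => w.1.2 ord0 j)); [exact: cont_oppH|exact: cont_coordy].
by apply: cvgB; apply: cvgM => //; exact: cvg_cst.
Qed.

Lemma kernel_mul (c : H -> R) h : continuous c -> kernel h -> kernel (fun w => c w * h w).
Proof.
move=> cc kh; have mh := kernel_meas kh; have [r hr] := kh.2; split; last exact: bsuppMr kh.2.
have /compact_bounded[M [_ /(_ (`|M| + 1))]] : compact (c @` cube r).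
  by apply: continuous_compact; [exact: continuous_subspaceT|exact: compact_cube].
rewrite (le_lt_trans (ler_norm M)) ?ltrDl// => /(_ isT) HM.
apply: (@integrable_fun_le _ _ _ (fun w => (`|M| + 1) * `|h w|)).
- by apply: measurable_funM => //; exact: continuous_measurable.
- move=> w; have [wr|wr] := leP (hmax w) r; last by rewrite hr// !(mulr0, normr0).
  by rewrite normrM ler_wpM2r//; apply: HM; exists w.
- by have := integrableZl measurableT (`|M| + 1) (integrable_norm kh.1).
Qed.

(** Right translations shear the direction, so a second term appears; its kernel is again integrable
    with bounded support, and iterating shows that [conv psi h] is smooth. *)
Lemma conv_derive psi h v y : test psi -> kernel h ->
  is_derive y v (conv psi h)
    (conv ('D_v psi) h y + conv ('D_et psi) (fun w => sympN_coef v w * h w) y).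
Proof.
move=> tp kh; have mh := kernel_meas kh.
have kh2 := kernel_mul (cont_sympN (v := v)) kh; have mh2 := kernel_meas kh2.
have tv := test_derive v tp; have tt := test_derive et tp.
have [M1 M10 H1] := test_bounded tv; have [M2 M20 H2] := test_bounded tt.
pose F (s : R) w := psi (hmul (s *: v + y) (- w)) * h w.
pose DF (s : R) w := 'D_v psi (hmul (s *: v + y) (- w)) * h w +
   'D_et psi (hmul (s *: v + y) (- w)) * (sympN_coef v w * h w).
have D s w : is_derive s (1 : R) (F ^~ w) (DF s w).
  have sp : smooth setT (psi \o hmul ^~ (- w)).
    by move=> m; apply: (Cn_affine openT (hmulr_affine (- w)) _ _ (tp.1 m)) => //; exact: cont_hmulr.
  have d := @is_derive_line R _ (psi \o hmul ^~ (- w)) y v s (@smooth_derivable R n setT _ _ _ sp I).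
  have d2 := is_deriveZ (h w) d.
  have -> : F ^~ w = h w \*: (fun s : R => (psi \o hmul ^~ (- w)) (s *: v + y)).
    by apply/funext => t; rewrite /F mulrC.
  apply: (is_derive_eq d2); rewrite (derive_hmulr _ _ _ tp.1) /GRing.scale/= /DF /sympN_coef; ring.
pose G w := M1 * `|h w| + M2 * `|sympN_coef v w * h w|.
have iG : mu.-integrable setT (EFin \o G).
  have i1 := integrableZl measurableT M1 (integrable_norm kh.1).
  have i2 := integrableZl measurableT M2 (integrable_norm kh2.1).
  by have := integrableD measurableT i1 i2.
have Hc := @cvg_differentiation_under_integral R _ _ mu F setT measurableT 0 (-1) 1.
have {}Hc : h0^-1 *: (\int[mu]_w F (h0 + 0) w - \int[mu]_w F 0 w) @[h0 --> 0^'] -->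
    \int[mu]_w partial1of2 F 0 w.
  apply: (Hc _ _ _ G).
  - by rewrite /= in_itv/= ltrN10 ltr01.
  - by move=> s _; exact: (conv_integrable _ (test_bounded_bsupp tp)).
  - by move=> s w _ _; exact: (@ex_derive _ _ _ _ _ _ _ (D s w)).
  - by move=> w; rewrite /G addr_ge0 ?mulr_ge0 ?(ltW M10) ?(ltW M20).
  - exact: iG.
  - move=> s w _ _; rewrite partial1of2E (@derive_val _ _ _ _ _ _ _ (D s w)).
    by rewrite (le_trans (ler_normD _ _))// lerD// normrM ler_wpM2r.
have E : \int[mu]_w partial1of2 F 0 w =
    conv ('D_v psi) h y + conv ('D_et psi) (fun w => sympN_coef v w * h w) y.
  rewrite /conv -RintegralD//; [|exact: (conv_integrable y (test_bounded_bsupp tv) kh)|exact: (conv_integrable y (test_bounded_bsupp tt) kh2)].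
  apply: eq_Rintegral => w _; rewrite partial1of2E (@derive_val _ _ _ _ _ _ _ (D 0 w)).
  by rewrite /DF scale0r add0r.
rewrite E in Hc.
have E2 : (fun h0 : R => h0^-1 *: (\int[mu]_w F (h0 + 0) w - \int[mu]_w F 0 w)) =
    (fun h0 : R => h0^-1 *: ((conv psi h \o shift y) (h0 *: v) - conv psi h y)).
  by apply/funext => s; rewrite /F addr0 scale0r add0r.
rewrite E2 in Hc.
by split; [apply/cvg_ex; eexists; exact: Hc | exact: cvg_lim Hc].
Qed.

Lemma conv_eq0 psi h (r s : R) : (forall x, r < hmax x -> psi x = 0) -> (forall x, s < hmax x -> h x = 0) ->
  forall y, `|r| + `|s| + 4 * n%:R * `|r| * `|s| < hmax y -> conv psi h y = 0.
Proof.
move=> pr hs y yy.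
rewrite /conv; under eq_Rintegral => w _.
  rewrite (_ : _ * _ = 0); last first.
    have [ws|ws] := leP (hmax w) s; last by rewrite hs// mulr0.
    rewrite pr ?mul0r// ltNge; apply/negP => yr; move: yy; apply/negP; rewrite -leNgt.
    rewrite -[y]hmul0 -(hmulNx w) hmulA; apply: hmul_norm.
      by rewrite (le_trans yr)// ler_norm.
    by rewrite (le_trans ws)// ler_norm.
  over.
by rewrite Rintegral_cst// mul0r.
Qed.

Lemma conv_bsupp psi h : bsupp psi -> bsupp h -> bsupp (conv psi h).
Proof. by move=> [r pr] [s hs]; eexists; exact: conv_eq0 pr hs. Qed.

Lemma conv_Cn m psi h : test psi -> kernel h -> Cn m setT (conv psi h).
Proof.
elim: m psi h => [|m IH] psi h tp kh; split => //; try by move=> y _; exact: conv_cont.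
move=> v; split; first by move=> y _; exact: (@ex_derive _ _ _ _ _ _ _ (conv_derive v y tp kh)).
have -> : 'D_v (conv psi h) = conv ('D_v psi) h \+ conv ('D_et psi) (fun w => sympN_coef v w * h w).
  by apply/funext => y; rewrite (@derive_val _ _ _ _ _ _ _ (conv_derive v y tp kh)).
apply: Cn_add; [exact: openT| |].
  by apply: IH => //; exact: test_derive.
by apply: IH; [exact: test_derive|apply: kernel_mul => //; exact: cont_sympN].
Qed.

Lemma test_conv psi h : test psi -> kernel h -> test (conv psi h).
Proof.
move=> tp kh; split; first by move=> m; exact: conv_Cn.
by apply: conv_bsupp; [case: tp|case: kh].
Qed.

Lemma opp_hmulN y w : hmul (- hmul y (- w)) y = w.
Proof. by rewrite hmulN opprK -hmulA hmulNx hmul0. Qed.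

Lemma preserving_hmulNl y : preserving mu (fun x => hmul (- x) y).
Proof.
have := preserving_comp (preserving_opp (n := n)) (preserving_hmul (- y)).
by congr preserving; apply/funext => x /=; rewrite hmulN opprK.
Qed.

Lemma convE psi h y : measurable_fun setT psi -> measurable_fun setT h ->
  conv psi h y = \int[mu]_x (psi x * h (hmul (- x) y)).
Proof.
move=> mp mh; rewrite -[RHS](Rintegral_preserving (preserving_hmulN y)); last first.
  apply: measurable_funM => //.
  apply: measurableT_comp => //; apply: measurable_hmul => //; exact: measurable_opp_heis.
by apply: eq_Rintegral => w _; rewrite opp_hmulN.
Qed.

Lemma conv_integrableE psi h y : bounded_bsupp psi -> kernel h ->
  mu.-integrable setT (EFin \o (fun x => psi x * h (hmul (- x) y))).
Proof.
move=> bp kh; have := integrable_preserving (preserving_hmulNl y) (conv_integrable y bp kh).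
by apply: eq_integrable => // x _ /=; rewrite hmulN opprK hmulNK.
Qed.

(** The transpose of psi -> [conv psi h], see [pairing_fubini]. *)
Definition potential h b x := \int[mu]_y (b y * h (hmul (- x) y)).

Lemma measurable_kernel2 h : measurable_fun setT h ->
  measurable_fun setT (fun p : H * H => h (hmul (- p.1) p.2)).
Proof.
move=> mh; apply: measurableT_comp => //; apply: measurable_hmul; last exact: measurable_snd.
by apply: measurableT_comp; [exact: measurable_opp_heis|exact: measurable_fst].
Qed.

Lemma kernel_norm h : kernel h -> kernel (fun w => `|h w|).
Proof.
move=> [ih [r hr]]; split; first by have := integrable_norm ih.
by exists r => x /hr ->; rewrite normr0.
Qed.

Lemma measurable_Rintegral1 (F : H * H -> R) : measurable_fun setT F ->
  measurable_fun setT (fun x => \int[mu]_y F (x, y)).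
Proof.
move=> mF; pose G p := (F p)%:E.
have mG : measurable_fun setT G by exact/measurable_EFinP.
apply: (@measurableT_comp _ _ _ _ _ _ (@fine R)) => //=.
have -> : (fun x => \int[mu]_y (F (x, y))%:E)%E = (fun x => \int[mu]_y G^\+ (x, y) - \int[mu]_y G^\- (x, y))%E.
  apply/funext => x; rewrite integralE.
  by rewrite (_ : (fun y => (F (x, y))%:E) = G \o (pair x))// funepos_comp funeneg_comp.
apply: emeasurable_funB.
  exact: (measurable_int1 (measurable_funepos mG) (fun p => funepos_ge0 G p)).
exact: (measurable_int1 (measurable_funeneg mG) (fun p => funeneg_ge0 G p)).
Qed.

Lemma measurable_potential b h : measurable_fun setT b -> measurable_fun setT h ->
  measurable_fun setT (potential h b).
Proof.
move=> mb mh; apply: (@measurable_Rintegral1 (fun p => b p.2 * h (hmul (- p.1) p.2))).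
apply: measurable_funM; last exact: measurable_kernel2.
by apply: measurableT_comp => //; exact: measurable_snd.
Qed.

Lemma measurable_conv psi h : measurable_fun setT psi -> measurable_fun setT h ->
  measurable_fun setT (conv psi h).
Proof.
move=> mp mh; apply: (@measurable_Rintegral1 (fun p => psi (hmul p.1 (- p.2)) * h p.2)).
apply: measurable_funM; last by apply: measurableT_comp => //; exact: measurable_snd.
apply: measurableT_comp => //; apply: measurable_hmul; first exact: measurable_fst.
apply: (@measurableT_comp _ _ _ _ _ _ (fun x : H => - x)); first exact: measurable_opp_heis.
exact: measurable_snd.
Qed.

(** Local integrability of b is enough for Fubini: the integral of the absolute value in x is at
    most a constant times |b y|, and it is 0 for y outside a cube depending on the supports of psi
    and h. *)
Lemma pairing_fubini psi b h : bounded_bsupp psi -> locint b -> kernel h ->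
  \int[mu]_x (psi x * potential h b x) = \int[mu]_y (b y * conv psi h y) /\
  mu.-integrable setT (EFin \o (fun x => psi x * potential h b x)).
Proof.
move=> tp lb kh; have [mp [M M0 HM] [r0 pr0]] := tp; have mh := kernel_meas kh; have mb := lb.1.
pose F (p : H * H) := psi p.1 * (b p.2 * h (hmul (- p.1) p.2)).
have mk := measurable_kernel2 mh.
have mF : measurable_fun setT F.
  apply: measurable_funM; first by apply: measurableT_comp => //; exact: measurable_fst.
  by apply: measurable_funM => //; apply: measurableT_comp => //; exact: measurable_snd.
have kn := kernel_norm kh; have mhn := kernel_meas kn.
pose c := \int[mu]_w `|h w|.
have cE : (\int[mu]_w `|h w|%:E = c%:E)%E.
  by rewrite fineK//; exact: (integrable_fin_num measurableT kn.1).
have [s0 hs0] := kh.2.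
pose B := `|r0| + `|s0| + 4 * n%:R * `|r0| * `|s0|.
have inner y : (\int[mu]_x `|F (x, y)|%:E <= (M * c * \1_(cube B) y * `|b y|)%:E)%E.
  have mI : measurable_fun setT (fun x => `|F (x, y)|%:E).
    apply/measurable_EFinP; apply: measurableT_comp => //.
    by apply: (measurableT_comp mF); exact: measurable_pair2 || exact: measurable_fun_pair.
  rewrite -(ge0_integral_preserving (preserving_hmulN y) mI)//.
  apply: (@le_trans _ _ (\int[mu]_w ((M * \1_(cube B) y * `|b y|)%:E * `|h w|%:E))%E).
    apply: ge0_le_integral => //.
    - by have [mm _] := preserving_hmulN y; exact: (measurableT_comp mI mm).
    - by apply/measurable_EFinP; apply: measurable_funM.
    - move=> w _; rewrite -EFinM lee_fin /F/= opp_hmulN !normrM.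
      have [ws|ws] := leP (hmax w) s0; last by rewrite hs0// normr0 !mulr0.
      have [yr|yr] := leP (hmax (hmul y (- w))) r0; last first.
        by rewrite pr0// normr0 mul0r !mulr_ge0// ltW.
      have yB : y \in cube B.
        apply/mem_set; rewrite /cube/= -[y]hmul0 -(hmulNx w) hmulA; apply: hmul_norm.
          by rewrite (le_trans yr)// ler_norm.
        by rewrite (le_trans ws)// ler_norm.
      by rewrite indicE yB mulr1 mulrA !ler_wpM2r.
  rewrite ge0_integralZl//; last 2 first.
  - by apply/measurable_EFinP.
  - by rewrite lee_fin !mulr_ge0// ltW.
  rewrite cE -EFinM lee_fin le_eqVlt; apply/orP; left; apply/eqP; ring.
have fin : (\int[mu]_x \int[mu]_y `|F (x, y)|%:E < +oo)%E.
  have mN : measurable_fun setT (fun p => `|F p|%:E) by apply/measurable_EFinP; exact: measurableT_comp.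
  rewrite (heis_tonelli mN)//.
  have iB : mu.-integrable setT (EFin \o (fun y => b y * \1_(cube B) y)).
    apply: locint_integrable => //; first exact: measurable_indic (measurable_cube _).
      by exists 1 => x; rewrite indicE; case: (_ \in _); rewrite ?normr1 ?normr0.
    by exists B => x xB; rewrite indicE memNset//= => h'; move: xB; rewrite ltNge h'.
  have := integrableZl measurableT (M * c) (integrable_norm iB) => /integrableP[_].
  apply: le_lt_trans; apply: ge0_le_integral => //.
  - by move=> y _; apply: integral_ge0 => x _; rewrite lee_fin.
  - by apply: (@measurable_int1 R n (fun p => `|F (p.2, p.1)|%:E)) => //; apply: (measurableT_comp mN); exact: measurable_swap.
  - have mZ : measurable_fun setT (fun y => M * c * `|b y * \1_(cube B) y|).
      apply: measurable_funM => //; apply: measurableT_comp => //; apply: measurable_funM => //.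
      exact: measurable_indic (measurable_cube _).
    by apply/measurable_EFinP; exact: measurableT_comp.
  - move=> y _; rewrite (le_trans (inner y))//= lee_fin.
    apply: le_trans (ler_norm _); rewrite normrM indicE le_eqVlt; apply/orP; left; apply/eqP.
    by rewrite normr_nat; ring.
have mcc : measurable_fun setT (fun p : H * H => b p.2 * h (hmul (- p.1) p.2)).
  by apply: measurable_funM => //; apply: measurableT_comp => //; exact: measurable_snd.
have [f1 [f2 f3]] := heis_fubini_factor mp mcc fin.
split; last exact: f3.
apply: (congr1 fine); apply: (etrans f1); apply: eq_integral => y _.
rewrite convE// EFinM.
have i := conv_integrableE y tp kh.
have fi := integrable_fin_num measurableT i.
rewrite /Rintegral fineK// -integralZl//.
by apply: eq_integral => x _; rewrite -EFinM /=; congr (_%:E); ring.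
Qed.

End convolution.

(** * The representation formula *)

Section representation.
Context {R : realType} {n alpha : nat}.
Local Notation H := (heis R n).
Local Notation mu := (heis_measure R n).
Local Notation Q := (hdim n).
Local Notation k := (alpha./2).
Variables (g : R -> R) (sigma : {measure set H -> \bar R}).
Hypotheses (halpha : ~~ odd alpha) (halpha0 : (0 < alpha < Q)%N).
Hypothesis hsigma : is_polar_measure sigma.
Hypothesis hg : is_fundamental n alpha g.
Implicit Types (x y w v : H) (r : R) (f b phi psi : H -> R).
Local Notation Hk := (@Hker R n alpha g).
Local Notation Kk := (@Kker R n alpha g).

Opaque Z sublap.

Lemma kernel_Hker r : 0 < r -> kernel (Hk r).
Proof. by move=> r0; split; [exact: (integrable_Hker halpha0 hsigma hg)|exact: bsupp_Hker]. Qed.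

Lemma kernel_Kker r : 0 < r -> kernel (Kk r).
Proof. by move=> r0; apply: kernel_test; exact: test_Kker. Qed.

Lemma test_locint b : test b -> locint b.
Proof. by move=> tb; apply: cont_locint; exact: smooth_cont tb.1. Qed.

Lemma locint_pairing b (c : R) b' : locint b -> locint b' -> locint (fun x => b x + c * b' x).
Proof.
move=> [mb ib] [mb' ib']; split; first by apply: measurable_funD => //; exact: measurable_funM.
move=> r; have mC := @measurable_cube R n r.
have mN (h : H -> R) : measurable_fun setT h -> measurable_fun (cube r) (fun x => `|h x|%:E).
  by move=> mh; apply: measurable_funTS; apply/measurable_EFinP; exact: measurableT_comp.
apply: (@le_lt_trans _ _ (\int[mu]_(x in cube r) (`|b x|%:E + `|c|%:E * `|b' x|%:E))%E).
  apply: ge0_le_integral => //.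
  - by apply: mN; apply: measurable_funD => //; exact: measurable_funM.
  - by apply: emeasurable_funD; [exact: mN|apply: emeasurable_funM => //; exact: mN].
  - by move=> x _; rewrite -EFinM -EFinD lee_fin (le_trans (ler_normD _ _))// normrM.
rewrite ge0_integralD//; try exact: (mN _ mb); try (by apply: emeasurable_funM => //; exact: (mN _ mb')).
rewrite ge0_integralZl//; last exact: (mN _ mb').
by rewrite lte_add_pinfty// lte_mul_pinfty.
Qed.

Lemma locint_potential b h : locint b -> kernel h -> locint (potential h b).
Proof.
move=> lb kh; have mP := measurable_potential lb.1 (kernel_meas kh); split => // r.
pose r' := 1 + ((2 * n%:R * r ^+ 2) ^+ 2 + r ^+ 2).
have c0 : 0 <= (2 * n%:R * r ^+ 2) ^+ 2 + r ^+ 2 by rewrite addr_ge0 ?sqr_ge0.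
have r'0 : 0 < r' by rewrite ltr_wpDr.
have [_ /integrable_locint[_ /(_ r)]] := pairing_fubini (test_bounded_bsupp (test_hcut r'0)) lb kh.
apply: le_lt_trans; rewrite le_eqVlt; apply/orP; left; apply/eqP; apply: eq_integral => x; rewrite inE /cube/= => xr.
rewrite hcut1 ?mul1r// hnorm_le ?(ltW r'0)// (le_trans (hN4_le_hmax xr))//.
rewrite (@le_trans _ _ r')//; first by rewrite /r' lerDr.
by rewrite -[X in X <= _]expr1 ler_weXn2l// /r' lerDl.
Qed.

Lemma bounded_bsupp_locint b : bounded_bsupp b -> locint b.
Proof.
move=> [mb [M M0 HM] _]; split => // r; have mC := @measurable_cube R n r.
apply: (@le_lt_trans _ _ (\int[mu]_(x in cube r) M%:E)%E).
  apply: ge0_le_integral => //.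
  - by apply: measurable_funTS; apply/measurable_EFinP; exact: measurableT_comp.
  - by move=> x _; rewrite lee_fin.
by rewrite integral_cst// lte_mul_pinfty// ?mu_cube_fin// lee_fin ltW.
Qed.

Lemma bounded_bsupp_conv psi h : bounded_bsupp psi -> kernel h -> bounded_bsupp (conv psi h).
Proof.
move=> bp kh; have [mp [M M0 HM] sp] := bp; have mh := kernel_meas kh.
split; [exact: measurable_conv| |by apply: conv_bsupp => //; case: kh].
have fi : (\int[mu]_w `|h w|%:E \is a fin_num)%E by exact: (integrable_fin_num measurableT (kernel_norm kh).1).
have c0 : 0 <= \int[mu]_w `|h w| by apply: Rintegral_ge0.
exists (M * \int[mu]_w `|h w| + 1); first by rewrite ltr_wpDl// mulr_ge0// ltW.
move=> y; rewrite -lee_fin; apply: (@le_trans _ _ (M * \int[mu]_w `|h w|)%:E); last by rewrite lee_fin lerDl.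
have mpy : measurable_fun setT (fun w => psi (hmul y (- w))).
  by apply: measurableT_comp => //; case: (preserving_hmulN y).
have mph : measurable_fun setT (fun w => psi (hmul y (- w)) * h w) by exact: measurable_funM.
apply: (@le_trans _ _ (\int[mu]_w `|psi (hmul y (- w)) * h w|%:E)%E).
  apply: (@le_trans _ _ `|\int[mu]_w (psi (hmul y (- w)) * h w)%:E|%E); last first.
    by apply: le_abse_integral => //; exact/measurable_EFinP.
  by rewrite /conv /Rintegral; case: (\int[mu]_w _)%E => [t||] //=; rewrite normr0 leey.
have mn : measurable_fun setT (fun w => `|h w|%:E) by apply/measurable_EFinP; exact: measurableT_comp.
rewrite EFinM /Rintegral fineK// -ge0_integralZl//; last first.
- by rewrite lee_fin ltW.
apply: ge0_le_integral => //.
- by apply/measurable_EFinP; exact: measurableT_comp.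
- by apply/measurable_EFinP; apply: measurable_funM => //; exact: measurableT_comp.
by move=> w _; rewrite -EFinM lee_fin normrM ler_wpM2r.
Qed.

(** The identity for [Hker] is applied under the integral, after transposing the convolution. It is
    stated for bounded psi, without smoothness, because the extremal functions of the sharpness part
    jump at the boundary of a shell. *)
Lemma weak_sublap_conv r psi : 0 < r -> bounded_bsupp psi ->
  weak_sublap k (conv psi (Hk r)) (fun y => psi y + conv psi (Kk r) y).
Proof.
move=> r0 bp phi /test_functionP tphi; have kH := kernel_Hker r0; have kK := kernel_Kker r0.
have [mp [M M0 HM] sp] := bp; have lp := bounded_bsupp_locint bp.
have tLphi := iter_sublap_test k tphi.
have [P1 _] := pairing_fubini bp (test_locint tLphi) kH.
have [P2 I2] := pairing_fubini bp (test_locint tphi) kK.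
transitivity (\int[mu]_x (iter k sublap phi x * conv psi (Hk r) x)).
  by apply: eq_Rintegral => x _; rewrite mulrC.
rewrite -P1.
transitivity (\int[mu]_x (psi x * phi x + psi x * potential (Kk r) phi x)).
  apply: eq_Rintegral => x _; rewrite -mulrDr; congr (_ * _).
  transitivity (\int[mu]_y (Hk r (hmul (- x) y) * iter k sublap phi y)).
    by apply: eq_Rintegral => y _; rewrite mulrC.
  rewrite (Hker_translate halpha halpha0 hsigma hg x r0 tphi); congr (_ + _).
  by apply: eq_Rintegral => y _; rewrite mulrC.
have i3 := locint_test lp tphi; have i4 := locint_test (bounded_bsupp_locint (bounded_bsupp_conv bp kK)) tphi.
rewrite (RintegralD measurableT i3 I2) P2.
transitivity (\int[mu]_x (psi x * phi x + conv psi (Kk r) x * phi x)); last first.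
  by apply: eq_Rintegral => x _; rewrite mulrDl.
rewrite (RintegralD measurableT i3 i4).
by congr (_ + _); apply: eq_Rintegral => x _; rewrite mulrC.
Qed.

(** Deduced from the weak identity by the du Bois-Reymond lemma, which avoids commuting L^k with the
    convolution; equality almost everywhere suffices under an integral. *)
Lemma iter_sublap_conv r psi : 0 < r -> test psi ->
  {ae mu, forall y, iter k sublap (conv psi (Hk r)) y = psi y + conv psi (Kk r) y}.
Proof.
move=> r0 tp; have kH := kernel_Hker r0; have kK := kernel_Kker r0.
have tH := test_conv tp kH; have tK := test_conv tp kK.
have tL := iter_sublap_test k tH.
pose b1 y := psi y + conv psi (Kk r) y.
have tb1 : test b1 by exact: testD.
have lb : locint (fun y => iter k sublap (conv psi (Hk r)) y + (-1) * b1 y).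
  by apply: locint_pairing; exact: test_locint.
have := dubois_reymond lb; suff h0 phi : test phi -> \int[mu]_x ((iter k sublap (conv psi (Hk r)) x + (-1) * b1 x) * phi x) = 0.
  by move=> /(_ h0); apply: filterS => x /eqP; rewrite mulN1r subr_eq0 => /eqP.
move=> tphi.
have i1 : mu.-integrable setT (EFin \o (fun x => iter k sublap (conv psi (Hk r)) x * phi x)).
  by apply: test_integrable; apply: testM => //; exact: tL.1.
have i2 : mu.-integrable setT (EFin \o (fun x => b1 x * phi x)).
  by apply: test_integrable; apply: testM => //; exact: tb1.1.
transitivity (\int[mu]_x (iter k sublap (conv psi (Hk r)) x * phi x - b1 x * phi x)).
  by apply: eq_Rintegral => x _; ring.
rewrite (RintegralB measurableT i1 i2); apply/eqP; rewrite subr_eq0; apply/eqP.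
rewrite -(iter_sublap_ibp k tH.1 tphi).
exact: (weak_sublap_conv r0 (test_bounded_bsupp tp) (proj2 (test_functionP _) tphi)).
Qed.

Lemma ae_eq_Rintegral b b' : measurable_fun setT b -> measurable_fun setT b' ->
  {ae mu, forall x, b x = b' x} -> \int[mu]_x b x = \int[mu]_x b' x.
Proof.
move=> mb mb' bb; rewrite /Rintegral; congr fine; apply: ae_eq_integral => //.
- exact/measurable_EFinP.
- exact/measurable_EFinP.
- by apply: filterS bb => x -> _.
Qed.

(** The weak equation is tested with the convolution of psi and [Hker r], whose image under L^k is
    psi plus the convolution with [Kker r]. Transposing both convolutions leaves an identity tested
    against an arbitrary psi. *)
Lemma weak_representation r u f : 0 < r -> locint u -> locint f -> weak_sublap k u f ->
  {ae mu, forall x, u x = potential (Hk r) f x - potential (Kk r) u x}.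
Proof.
move=> r0 lu lf wu; have kH := kernel_Hker r0; have kK := kernel_Kker r0.
have lKu := locint_potential lu kK; have lHf := locint_potential lf kH.
have lb : locint (fun x => (u x + 1 * potential (Kk r) u x) + (-1) * potential (Hk r) f x).
  by apply: locint_pairing => //; exact: locint_pairing.
have := dubois_reymond lb; suff h0 psi : test psi -> \int[mu]_x (((u x + 1 * potential (Kk r) u x) + (-1) * potential (Hk r) f x) * psi x) = 0.
  move=> /(_ h0); apply: filterS => x.
  by rewrite mul1r mulN1r => /eqP; rewrite subr_eq0 => /eqP <-; rewrite addrK.
move=> tp; have tH := test_conv tp kH; have tK := test_conv tp kK.
have [P1 I1] := pairing_fubini (test_bounded_bsupp tp) lu kK; have [P2 I2] := pairing_fubini (test_bounded_bsupp tp) lf kH.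
have Iu := locint_test lu tp.
have mu' := lu.1; have mp := smooth_meas tp.1; have mK := smooth_meas tK.1.
transitivity (\int[mu]_x ((u x * psi x + psi x * potential (Kk r) u x) - psi x * potential (Hk r) f x)).
  by apply: eq_Rintegral => x _; ring.
have IuK : mu.-integrable setT (EFin \o (fun x => u x * psi x + psi x * potential (Kk r) u x)).
  by have := integrableD measurableT Iu I1.
rewrite (RintegralB measurableT IuK I2) (RintegralD measurableT Iu I1) P1 P2.
have := wu (conv psi (Hk r)); move=> /(_ (proj2 (test_functionP _) tH)) <-.
rewrite -(RintegralD measurableT Iu (locint_test lu tK)).
apply/eqP; rewrite subr_eq0; apply/eqP; apply: ae_eq_Rintegral.
- by apply: measurable_funD; apply: measurable_funM.
- exact: (measurable_funM mu' (smooth_meas (iter_sublap_test k tH).1)).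
- by apply: filterS (iter_sublap_conv r0 tp) => x ->; rewrite mulrDr.
Qed.

End representation.

(** * Integral inequalities *)

Section integral_inequalities.
Context {d} {T : measurableType d} {R : realType} (m : {measure set T -> \bar R}).
Implicit Types (f a b : T -> R).

Lemma measurable_absE f : measurable_fun setT f -> measurable_fun setT (fun x => `|f x|%:E).
Proof. by move=> mf; apply/measurable_EFinP; exact: measurableT_comp. Qed.

Lemma measurable_powR_fun f (q : R) : measurable_fun setT f -> measurable_fun setT (fun x => f x `^ q).
Proof. by move=> mf; apply: (@measurableT_comp _ _ _ _ _ _ (fun t => t `^ q)) => //; exact: measurable_powR. Qed.

Lemma abs_Rintegral_le f : measurable_fun setT f ->
  (`|\int[m]_x f x|%:E <= \int[m]_x `|f x|%:E)%E.
Proof.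
move=> mf; apply: (@le_trans _ _ `|\int[m]_y (f y)%:E|%E); last first.
  by apply: le_abse_integral => //; exact/measurable_EFinP.
by rewrite /Rintegral; case: (\int[m]_y _)%E => [t||] //=; rewrite normr0 leey.
Qed.

(** Split at height c: below it t <= c, above it t^(1-q) <= c^(1-q). Integrating this with the right
    c plays the part of Hoelder's inequality. *)
Lemma young_opt (q c t : R) : 1 <= q -> 0 < c -> 0 <= t -> t <= c + c `^ (1 - q) * t `^ q.
Proof.
move=> q1 c0 t0; have [tc|ct] := leP t c; first by rewrite (le_trans tc)// lerDl mulr_ge0 ?powR_ge0.
rewrite ler_wpDl ?(ltW c0)//; have tp := lt_trans c0 ct.
have -> : t = t `^ (1 - q) * t `^ q.
  by rewrite -powRD; [rewrite subrK powRr1// ltW|apply/implyP => _; rewrite gt_eqF].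
rewrite {2}(_ : t `^ (1 - q) * t `^ q = t); last first.
  by rewrite -powRD; [rewrite subrK powRr1// ltW|apply/implyP => _; rewrite gt_eqF].
rewrite ler_wpM2r ?powR_ge0//.
have -> : 1 - q = - (q - 1) by rewrite opprB.
by rewrite !powRN lef_pV2 ?posrE ?powR_gt0// ge0_ler_powR ?nnegrE ?subr_ge0 ?(ltW c0) ?(ltW ct)// ltW.
Qed.

Lemma hoelder_le (q q' : R) a b (X Y : R) : 0 < q -> 0 < q' -> q^-1 + q'^-1 = 1 ->
  measurable_fun setT a -> measurable_fun setT b -> (forall x, 0 <= a x) -> (forall x, 0 <= b x) ->
  0 <= X -> 0 <= Y ->
  (\int[m]_x (a x `^ q)%:E <= X%:E)%E -> (\int[m]_x (b x `^ q')%:E <= Y%:E)%E ->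
  (\int[m]_x (a x * b x)%:E <= (X `^ q^-1 * Y `^ q'^-1)%:E)%E.
Proof.
move=> q0 q'0 qq ma mb a0 b0 X0 Y0 aX bY.
have := hoelder m ma mb q0 q'0 qq; rewrite Lnorm1.
have -> : ((\int[m]_x `|(EFin \o (a \* b)%R) x|)%E = (\int[m]_x (a x * b x)%:E)%E).
  by apply: eq_integral => x _ /=; rewrite ger0_norm// mulr_ge0.
move=> /le_trans; apply; rewrite EFinM.
have N (p : R) (c : T -> R) (Z : R) : 0 < p -> (forall x, 0 <= c x) -> 0 <= Z -> (\int[m]_x (c x `^ p)%:E <= Z%:E)%E ->
    ('N[m]_p%:E [EFin \o c] <= (Z `^ p^-1)%:E)%E.
  move=> p0 c0 Z0 cZ; rewrite unlock -poweR_EFin; apply: gt0_ler_poweR.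
  - by rewrite invr_ge0 ltW.
  - by rewrite in_itv/= leey integral_ge0// => x _; exact: poweR_ge0.
  - by rewrite in_itv/= leey lee_fin Z0.
  - apply: le_trans cZ; rewrite le_eqVlt; apply/orP; left; apply/eqP; apply: eq_integral => x _ /=.
    by rewrite ger0_norm// ?poweR_EFin.
by apply: lee_pmul; [exact: Lnorm_ge0|exact: Lnorm_ge0|exact: N|exact: N].
Qed.

Lemma integral_ge_cst (f : T -> R) (A : set T) (c : R) : measurable A -> measurable_fun setT f ->
  (forall x, 0 <= f x) -> 0 <= c -> (forall x, A x -> c <= f x) ->
  (c%:E * m A <= \int[m]_x (f x)%:E)%E.
Proof.
move=> mA mf f0 c0 cf; rewrite -integral_cst//.
apply: (@le_trans _ _ (\int[m]_(x in A) (f x)%:E)%E).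
  apply: ge0_le_integral => //.
  by apply/measurable_EFinP; exact: measurable_funTS.
apply: ge0_subset_integral => //; first exact/measurable_EFinP.
by move=> x _; rewrite lee_fin.
Qed.

Lemma measurable_gt (f : T -> R) (s : R) : measurable_fun setT f -> measurable [set x | s < `|f x|].
Proof.
move=> mf; rewrite (_ : [set x | _] = (fun x => `|f x|) @^-1` `]s, +oo[%classic).
  have mn : measurable_fun setT (fun x => `|f x|) by exact: measurableT_comp.
  by rewrite -[X in measurable X]setTI; apply: mn.
by apply/seteqP; split => x /=; rewrite in_itv/= andbT.
Qed.

Lemma measure_gt_le (f : T -> R) (q s : R) : measurable_fun setT f -> 0 < q -> 0 < s ->
  ((s `^ q)%:E * m [set x | (s < `|f x|)%R] <= \int[m]_x (`|f x| `^ q)%:E)%E.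
Proof.
move=> mf q0 s0; apply: integral_ge_cst.
- exact: measurable_gt.
- by apply: measurable_powR_fun; exact: measurableT_comp.
- by move=> x; exact: powR_ge0.
- exact: powR_ge0.
- by move=> x /= sf; rewrite ge0_ler_powR ?nnegrE ?(ltW q0) ?(ltW s0)// ltW.
Qed.

(* The weight th selects the largest values of |f| up to total mass t. *)
Lemma bathtub (f : T -> R) (q t E : R) : measurable_fun setT f -> 0 < q -> 0 < t -> 0 <= E ->
  (\int[m]_x (`|f x| `^ q)%:E <= E%:E)%E ->
  exists th : T -> R, exists c : R,
   [/\ measurable_fun setT th /\ (forall x, 0 <= th x <= 1), 0 <= c,
       (\int[m]_x (th x)%:E <= t%:E)%E, forall x, (1 - th x) * `|f x| <= c &
       ((c `^ q * t)%:E <= (4 `^ q)%:E * \int[m]_x (th x * `|f x| `^ q)%:E)%E].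
Proof.
move=> mf q0 t0 E0 fE; pose L (s : R) := [set x | s < `|f x|].
have mL (s : R) : measurable (L s) by exact: measurable_gt.
have Lfin (s : R) : 0 < s -> (m (L s) < +oo)%E.
  move=> s0; have := le_trans (measure_gt_le mf q0 s0) fE.
  have p0 : 0 < s `^ q by rewrite powR_gt0.
  rewrite -/(L s); case: (m (L s)) (measure_ge0 m (L s)) => [r||] //= _; first by rewrite ltry.
  by rewrite gt0_muley ?lte_fin.
have Ldec (s s' : R) : s <= s' -> (m (L s') <= m (L s))%E.
  by move=> ss; apply: le_measure; rewrite ?inE// => x /=; exact: le_lt_trans.
pose S := [set s : R | 0 < s /\ (m (L s) <= t%:E)%E].
have S0 : S !=set0.
  (* Chebyshev's inequality; the added 1 keeps the threshold positive when E = 0. *)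
  exists (((E + 1) / t) `^ q^-1); have p0 : 0 < (E + 1) / t by rewrite divr_gt0// ltr_wpDl.
  have s0 : 0 < ((E + 1) / t) `^ q^-1 by rewrite powR_gt0.
  split => //; have := le_trans (measure_gt_le mf q0 s0) fE.
  rewrite -/(L _) -powRrM mulVf ?gt_eqF// powRr1 ?(ltW p0)//.
  rewrite -[m (L _)]fineK ?ge0_fin_numE ?Lfin//.
  rewrite -EFinM !lee_fin mulrAC ler_pdivrMr// => h.
  have E1 : 0 < E + 1 by rewrite ltr_wpDl.
  by rewrite -(ler_pM2l E1) (le_trans h)// ler_wpM2r ?(ltW t0)// lerDl.
have lbS : has_lbound S by exists 0 => s [s0 _]; exact: ltW.
have infS : has_inf S by [].
pose m0 := inf S.
have m00 : 0 <= m0 by apply: lb_le_inf => // s [s0 _]; exact: ltW.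
have below (s : R) : m0 < s -> (m (L s) <= t%:E)%E.
  move=> ms; have e0 : 0 < s - m0 by rewrite subr_gt0.
  have [s' [_ s't] s'm] := inf_adherent e0 infS.
  by rewrite (le_trans _ s't)// Ldec// ltW// (lt_le_trans s'm)// -/m0 addrC subrK.
have above (s : R) : 0 < s -> s < m0 -> (t%:E < m (L s))%E.
  move=> s0 sm; rewrite ltNge; apply/negP => h; move: sm; rewrite ltNge => /negP; apply.
  by apply: ge_inf => //; split.
have mfq : measurable_fun setT (fun x => `|f x| `^ q).
  by apply: measurable_powR_fun; exact: measurableT_comp.
(* If the critical height is 0, the set where f does not vanish has measure at most t and its
   indicator serves as weight, with c = 0. *)
have [m0p|] := ltP 0 m0; last first.
  move=> m0n; have {m0n m00}m0E : m0 = 0 by apply/eqP; rewrite eq_le m0n.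
  exists \1_(L 0), 0; split.
  - split; first exact: measurable_indic.
    by move=> x; rewrite indicE; case: (_ \in _); rewrite ?lexx ?ler01.
  - by [].
  - rewrite integral_indic// setIT.
    have -> : L 0 = \bigcup_k L k.+1%:R^-1.
      apply/seteqP; split => x /=.
        move=> fx; have [N _ /(_ N (leqnn N))/= hN] := near_infty_natSinv_lt (PosNum fx).
        by exists N.
      by move=> [N _]; apply: lt_trans; rewrite invr_gt0 ltr0n.
    have ndL : {homo (fun k : nat => L k.+1%:R^-1) : i j / (i <= j)%N >-> (i <= j)%O}.
      move=> i j ij; apply/subsetPset => x /=; apply: le_lt_trans.
      by rewrite lef_pV2 ?posrE ?ltr0n// ler_nat ltnS.
    have C := nondecreasing_cvg_mu (mu := m) (fun k => mL k.+1%:R^-1) (bigcupT_measurable _ (fun k => mL k.+1%:R^-1)) ndL.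
    rewrite -(cvg_lim _ C)//; apply: lime_le; first by apply/cvg_ex; eexists; exact: C.
    by apply: nearW => k /=; apply: below; rewrite m0E invr_gt0 ltr0n.
  - move=> x; rewrite indicE; case: (boolP (x \in L 0)) => [_|]; first by rewrite subrr mul0r.
    by rewrite notin_setE /L/= => /negP; rewrite -leNgt subr0 mul1r.
  - rewrite powR0 ?mul0r ?gt_eqF// mule_ge0 ?lee_fin ?powR_ge0//.
    by apply: integral_ge0 => x _; rewrite lee_fin mulr_ge0// powR_ge0.
have h2 : m0 / 2 < m0 by rewrite ltr_pdivrMr// ltr_pMr// ltr1n.
have h20 : 0 < m0 / 2 by rewrite divr_gt0.
have d2 : m0 < 2 * m0 by rewrite ltr_pMl// ltr1n.
have d20 : 0 < 2 * m0 by rewrite mulr_gt0.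
pose A := fine (m (L (2 * m0))); pose B := fine (m (L (m0 / 2))).
have EA : m (L (2 * m0)) = A%:E by rewrite fineK// ge0_fin_numE// Lfin.
have EB : m (L (m0 / 2)) = B%:E by rewrite fineK// ge0_fin_numE// Lfin.
have := below _ d2; have := above _ h20 h2; rewrite EA EB lte_fin lee_fin => tB At.
have BA : 0 < B - A by rewrite subr_gt0 (le_lt_trans At).
(* A mixture of the indicators of {|f| > 2 m0} and {|f| > m0 / 2} has mass exactly t, whatever the
   measure of {|f| = m0}. The ratio 4 of the two heights is the constant in the conclusion. *)
pose c := (t - A) / (B - A).
have c01 : 0 <= c <= 1.
  rewrite /c divr_ge0 ?subr_ge0//=; last by rewrite -subr_ge0 ltW.
  by rewrite ler_pdivrMr// mul1r lerB// ltW.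
have [c0 c1] := andP c01.
pose th x := (1 - c) * \1_(L (2 * m0)) x + c * \1_(L (m0 / 2)) x.
have sub x : L (2 * m0) x -> L (m0 / 2) x by move=> /=; apply: lt_trans; exact: lt_trans d2.
have mth : measurable_fun setT th.
  by apply: measurable_funD; apply: measurable_funM => //; exact: measurable_indic.
have thE x : th x = if x \in L (2 * m0) then 1 else if x \in L (m0 / 2) then c else 0.
  rewrite /th !indicE; case: (boolP (x \in L (2 * m0))) => [/set_mem/sub/mem_set ->|_].
    by rewrite !mulr1 subrK.
  by rewrite mulr0 add0r; case: ifPn => _; rewrite ?mulr1 ?mulr0.
have th01 x : 0 <= th x <= 1.
  by rewrite thE; case: ifPn => _; [rewrite ler01 lexx|case: ifPn => _ //; rewrite lexx ler01].
have thI : (\int[m]_x (th x)%:E = t%:E)%E.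
  under eq_integral do rewrite EFinD !EFinM.
  rewrite ge0_integralD//; last 4 first.
  - by move=> x _; rewrite mule_ge0 ?lee_fin ?subr_ge0.
  - by apply: emeasurable_funM => //; exact/measurable_EFinP/measurable_indic.
  - by move=> x _; rewrite mule_ge0 ?lee_fin.
  - by apply: emeasurable_funM => //; exact/measurable_EFinP/measurable_indic.
  rewrite !ge0_integralZl//; try (by rewrite lee_fin subr_ge0); try exact/measurable_EFinP/measurable_indic.
  rewrite !integral_indic// !setIT EA EB -!EFinM -EFinD; congr (_%:E).
  rewrite /c; field; by rewrite gt_eqF.
exists th, (2 * m0); split => //.
- exact: ltW.
- by rewrite thI.
- move=> x; rewrite thE; case: ifPn => [_|]; first by rewrite subrr mul0r ltW.
  rewrite notin_setE /L/= => /negP; rewrite -leNgt => fx.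
  apply: le_trans fx; rewrite ler_piMl//; case: ifPn => _; first by rewrite gerBl.
  by rewrite subr0.
rewrite EFinM -thI; apply: (@le_trans _ _ ((4 `^ q)%:E * (((m0 / 2) `^ q)%:E * \int[m]_x (th x)%:E))%E).
  rewrite muleA -EFinM -powRM ?(ltW h20)//.
  by rewrite (_ : 4 * (m0 / 2) = 2 * m0)// ; field.
rewrite lee_wpmul2l ?lee_fin ?powR_ge0// -ge0_integralZl//; last 3 first.
- exact/measurable_EFinP.
- by move=> x _; rewrite lee_fin; have /andP[] := th01 x.
- by rewrite lee_fin powR_ge0.
apply: ge0_le_integral => //.
- by move=> x _; rewrite mule_ge0 ?lee_fin ?powR_ge0//; have /andP[] := th01 x.
- by apply: emeasurable_funM => //; exact/measurable_EFinP.
- by apply/measurable_EFinP; exact: measurable_funM.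
move=> x _; rewrite -EFinM lee_fin mulrC thE.
case: ifPn => [/set_mem/sub/ltW fx|_].
  by rewrite !mul1r ge0_ler_powR ?nnegrE ?(ltW q0) ?(ltW h20).
case: ifPn => [/set_mem/ltW fx|_]; last by rewrite !mul0r.
by rewrite ler_wpM2l// ge0_ler_powR ?nnegrE ?(ltW q0) ?(ltW h20).
Qed.

End integral_inequalities.

Section Lp_facts.
Context {R : realType} {n : nat}.
Local Notation H := (heis R n).
Local Notation mu := (heis_measure R n).
Implicit Types (u f b : H -> R) (p r : R).

Lemma Lfun_measurable u p : u \in Lfun mu p%:E -> measurable_fun setT u.
Proof. by move=> /sub_Lfun_mfun; rewrite inE. Qed.

Lemma LnormX u p : 0 < p -> ('N[mu]_p%:E [EFin \o u] `^ p = \int[mu]_x (`|u x| `^ p)%:E)%E.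
Proof.
move=> p0; by rewrite powR_Lnorm ?gt_eqF.
Qed.

Lemma Lfun_fin u p : 1 <= p -> u \in Lfun mu p%:E -> exists2 P, 0 <= P & (\int[mu]_x (`|u x| `^ p)%:E = P%:E)%E.
Proof.
move=> p1 up; have p0 : 0 < p by rewrite (lt_le_trans ltr01).
have uf : (\int[mu]_x (`|u x| `^ p)%:E < +oo)%E.
  have := Lfun_integrable p1 up => /integrableP[_].
  by under eq_integral do rewrite gee0_abs ?lee_fin ?powR_ge0//.
exists (fine (\int[mu]_x (`|u x| `^ p)%:E)).
  by rewrite fine_ge0// integral_ge0// => x _; rewrite lee_fin powR_ge0.
by rewrite fineK// ge0_fin_numE// integral_ge0// => x _; rewrite lee_fin powR_ge0.
Qed.

Lemma integral_indic_mul (F : H -> R) (A : set H) : measurable A ->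
  (\int[mu]_x (F x * \1_A x)%:E = \int[mu]_(x in A) (F x)%:E)%E.
Proof.
move=> mA; rewrite [RHS]integral_mkcond; apply: eq_integral => x _.
by rewrite patchE indicE; case: (x \in A); rewrite ?mulr1 ?mulr0.
Qed.

Lemma locint_powR u p P : 1 <= p -> measurable_fun setT u ->
  (\int[mu]_x (`|u x| `^ p)%:E <= P%:E)%E -> locint u.
Proof.
move=> p1 mu' uP; split => // r; have mC := @measurable_cube R n r.
have mA := measurable_absE mu'.
have mP : measurable_fun setT (fun x => (`|u x| `^ p)%:E).
  by apply/measurable_EFinP; apply: measurable_powR_fun; exact: measurableT_comp.
apply: (@le_lt_trans _ _ (\int[mu]_(x in cube r) (1 + (`|u x| `^ p)%:E))%E).
  apply: ge0_le_integral => //.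
  - exact: measurable_funTS.
  - by apply: emeasurable_funD => //; exact: measurable_funTS.
  - move=> x _; rewrite -EFinD lee_fin.
    by have := young_opt p1 ltr01 (normr_ge0 (u x)); rewrite powR1 mul1r.
rewrite ge0_integralD//; last exact: measurable_funTS.
rewrite integral_cst// mul1e lte_add_pinfty ?mu_cube_fin//.
apply: le_lt_trans (ltry P); apply: le_trans uP; apply: ge0_subset_integral => //.
Qed.

End Lp_facts.

(** * Integrals of the kernel over balls and shells *)

Section kernel_bounds.
Context {R : realType} {n alpha : nat}.
Local Notation H := (heis R n).
Local Notation mu := (heis_measure R n).
Local Notation Q := (hdim n).
Variables (g : R -> R) (sigma : {measure set H -> \bar R}).
Hypotheses (halpha : ~~ odd alpha) (halpha0 : (0 < alpha < Q)%N).
Hypothesis hsigma : is_polar_measure sigma.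
Hypothesis hg : is_fundamental n alpha g.
Implicit Types (x y w v : H) (r : R) (f b phi psi : H -> R).
Local Notation G := (@fundG R n alpha g).
Local Notation Hk := (@Hker R n alpha g).
Local Notation Kk := (@Kker R n alpha g).
Local Notation a := (alpha%:R : R).
Local Notation Qr := (Q%:R : R).
Local Notation q := (Qr / a).
Local Notation q' := (Qr / (Qr - a)).
Local Notation A := (adams_const sigma alpha g).

Opaque Z sublap.

Lemma a_gt0 : 0 < a. Proof. by rewrite ltr0n; case/andP: halpha0. Qed.
Lemma aQ_lt : a < Qr. Proof. by rewrite ltr_nat; case/andP: halpha0. Qed.
Lemma Qr_gt0 : 0 < Qr. Proof. exact: lt_trans a_gt0 aQ_lt. Qed.
Lemma q_gt1 : 1 < q. Proof. by rewrite ltr_pdivlMr ?a_gt0// mul1r aQ_lt. Qed.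
Lemma q_gt0 : 0 < q. Proof. exact: lt_trans ltr01 q_gt1. Qed.
Lemma q'_gt1 : 1 < q'.
Proof. by rewrite ltr_pdivlMr ?subr_gt0 ?aQ_lt// mul1r gtrBl a_gt0. Qed.
Lemma q'_gt0 : 0 < q'. Proof. exact: lt_trans ltr01 q'_gt1. Qed.
Lemma q_conj : q^-1 + q'^-1 = 1.
Proof. by rewrite !invf_div -mulrDl addrC subrK divff// gt_eqF// Qr_gt0. Qed.

Definition hball r : set H := [set w | hnorm w <= r].
Definition hshell r1 r2 : set H := @hnorm R n @^-1` `]r1, r2[%classic.

Lemma measurable_hball r : measurable (hball r).
Proof.
rewrite (_ : hball r = @hnorm R n @^-1` `]-oo, r]%classic).
  by rewrite -[X in measurable X]setTI; apply: measurable_hnorm.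
by apply/seteqP; split => x /=; rewrite in_itv.
Qed.

Lemma measurable_hshell r1 r2 : measurable (hshell r1 r2).
Proof. by rewrite -[X in measurable X]setTI; apply: measurable_hnorm. Qed.

Lemma measurable_hnorm_powR (b : R) : measurable_fun setT (fun x : H => hnorm x `^ b).
Proof. apply: measurable_powR_fun; exact: measurable_hnorm. Qed.

Lemma pole_integral (m : nat) : (0 < m)%N -> exists2 C, 0 < C & forall r, 0 < r ->
  (\int[mu]_x ((hnorm x `^ (m%:R - Qr) * \1_(hshell 0 r) x)%:E) <= (C * r ^+ m)%:E)%E.
Proof.
move=> m0; exists (m%:R^-1 * sphere_area sigma + 1).
  by rewrite ltr_wpDl// mulr_ge0 ?invr_ge0 ?sphere_area_ge0.
move=> r r0; rewrite integral_indic_mul; last exact: measurable_hshell.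
rewrite (polar_powE hsigma r0 m0) lee_fin -mulrA mulrC ler_wpM2r ?exprn_ge0 ?(ltW r0)//.
by rewrite lerDl.
Qed.

Lemma near_integral : exists2 C, 0 < C & forall r, 0 < r ->
  (\int[mu]_x (`|G x| * \1_(hball r) x)%:E <= (C * r ^+ alpha)%:E)%E.
Proof.
have [C0 C00 GC] := fundG_bound halpha0 hg; have [ap _] := andP halpha0.
have [C1 C10 PC] := pole_integral ap.
exists (C0 * (C1 * 2 ^+ alpha)); first by rewrite !mulr_gt0// exprn_gt0.
move=> r r0; have r20 : 0 < 2 * r by rewrite mulr_gt0.
have mP : measurable_fun setT (fun x : H => (hnorm x `^ (a - Qr) * \1_(hshell 0 (2 * r)) x)%:E).
  apply/measurable_EFinP; apply: measurable_funM; first exact: measurable_hnorm_powR.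
  exact: measurable_indic (measurable_hshell _ _).
apply: (@le_trans _ _ (C0%:E * \int[mu]_x (hnorm x `^ (a - Qr) * \1_(hshell 0 (2 * r)) x)%:E)%E); last first.
  apply: le_trans (lee_wpmul2l _ (PC _ r20)) _; first by rewrite lee_fin ltW.
  by rewrite -EFinM lee_fin exprMn !mulrA.
rewrite -ge0_integralZl//; last 2 first.
- by move=> x _; rewrite lee_fin mulr_ge0 ?powR_ge0.
- by rewrite lee_fin ltW.
apply: ge0_le_integral => //.
- apply/measurable_EFinP; apply: measurable_funM; first exact: measurableT_comp (measurable_fundG halpha0 hg).
  exact: measurable_indic (measurable_hball _).
- by apply: emeasurable_funM.
move=> x _; rewrite -EFinM lee_fin mulrA !indicE.
have [xr|xr] := boolP (x \in hball r); last by rewrite mulr0 !mulr_ge0 ?powR_ge0// ltW.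
have [->|x0] := eqVneq x 0.
  by rewrite (@fundG0 _ _ _ g halpha0) normr0 mul0r !mulr_ge0 ?powR_ge0// ltW.
have -> : x \in hshell 0 (2 * r).
  apply/mem_set; rewrite /hshell/= in_itv/= hnorm_gt0 x0 /=.
  by apply: le_lt_trans (set_mem xr) _; rewrite ltr_pMl// ltr1n.
by rewrite !mulr1.
Qed.

(** The polar formula only sees the radii r > 0. *)
Lemma mu_hball0 : mu (hball 0) = 0%E.
Proof.
have mS := measurable_hball 0.
have E : (\int[mu]_x (\1_(hball 0) x)%:E = mu (hball 0%R))%E by rewrite integral_indic// setIT.
rewrite -E hsigma.2; last 2 first.
- by apply/measurable_EFinP; exact: measurable_indic.
- by move=> x; rewrite lee_fin.
apply: integral0_eq => r; rewrite /= in_itv/= andbT => r0; apply: integral0_eq => x xs.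
rewrite indicE memNset ?mul0e//=.
by rewrite /hball/= hnorm_dil ?(ltW r0)//; have -> : hnorm x = 1 by []; rewrite mulr1 leNgt r0.
Qed.

Lemma ball_volume : exists2 C, 0 < C & forall r, 0 < r -> (mu (hball r) <= (C * r ^+ Q)%:E)%E.
Proof.
have [C1 C10 PC] := pole_integral (hdim_gt0 (n := n)).
exists (C1 * 2 ^+ Q); first by rewrite !mulr_gt0// exprn_gt0.
move=> r r0; have r20 : 0 < 2 * r by rewrite mulr_gt0.
have {PC} := PC _ r20; rewrite subrr exprMn mulrA; apply: le_trans.
under eq_integral do rewrite powRr0.
rewrite integral_indic_mul; last exact: measurable_hshell.
rewrite integral_cst ?mul1e; last exact: measurable_hshell.
have mI := measurable_hshell 0 (2 * r); have m0 := measurable_hball 0.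
rewrite (@le_trans _ _ (mu (hshell 0 (2 * r) `|` hball 0)))//.
  apply: le_measure; rewrite ?inE//; [exact: measurable_hball|exact: measurableU|].
  move=> x xr; have [x0|x0] := leP (hnorm x) 0; first by right.
  left; rewrite /hshell/= in_itv/= x0 /=.
  by apply: le_lt_trans xr _; rewrite ltr_pMl// ltr1n.
apply: (@le_trans _ _ (mu (hshell 0 (2 * r)) + mu (hball 0%R))%E).
  exact: measureU2.
by rewrite mu_hball0 adde0.
Qed.

Lemma far_bound : exists2 C, 0 < C & forall r x, 0 < r -> r <= hnorm x -> `|G x| `^ q' <= C * r `^ (- Qr).
Proof.
have [C0 C00 GC] := fundG_bound halpha0 hg.
exists (C0 `^ q'); first by rewrite powR_gt0.
move=> r x r0 rx; have xp := lt_le_trans r0 rx.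
have -> : r `^ (- Qr) = (r `^ (a - Qr)) `^ q'.
  rewrite -powRrM; congr (_ `^ _); field; by rewrite subr_eq0 gt_eqF ?aQ_lt.
rewrite -powRM ?powR_ge0 ?(ltW C00)// ge0_ler_powR ?nnegrE ?(ltW q'_gt0)//.
  by rewrite mulr_ge0 ?powR_ge0// ltW.
apply: le_trans (GC x) _; rewrite ler_wpM2l ?(ltW C00)//.
have -> : a - Qr = - (Qr - a) by rewrite opprB.
have d0 : 0 <= Qr - a by rewrite subr_ge0 ltW// aQ_lt.
rewrite (powRN (hnorm x)) (powRN r) lef_pV2 ?posrE; [|exact: powR_gt0|exact: powR_gt0].
exact: (ge0_ler_powR d0 (ltW r0) (ltW xp) rx).
Qed.

(** Since (alpha - Q) q' = -Q, this function is homogeneous of degree 0, and on the unit sphere it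
    is |g(theta)|^q'. It is the angular factor in the polar formula for |G|^q', and its integral
    over the sphere is A Q. *)
Let F x := `|G x| `^ q' * hnorm x `^ Qr.

Let F_meas : measurable_fun setT F.
Proof.
apply: measurable_funM; last exact: measurable_hnorm_powR.
by apply: measurable_powR_fun; exact: measurableT_comp (measurable_fundG halpha0 hg).
Qed.

Let F_sphere x : hnorm x = 1 -> F x = `|g (htheta x)| `^ q'.
Proof. by move=> x1; rewrite /F /fundG x1 !powR1 !mulr1. Qed.

Let F_dil r x : 0 < r -> hnorm x = 1 -> F (hdil r x) = F x.
Proof.
move=> r0 x1; have E1 := @fundG_dil _ _ alpha g r x r0; have E2 := hnorm_dil x (ltW r0).
rewrite x1 (mulr1 r) in E2; rewrite /F E1 E2 x1 powR1 (mulr1 (_ `^ q')).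
rewrite normrM (ger0_norm (powR_ge0 r _)) (powRM _ (powR_ge0 r _) (normr_ge0 _)) -powRrM mulrAC -powRD; last first.
  by apply/implyP => _; rewrite gt_eqF.
have -> : (a - Qr) * q' + Qr = 0 by field; rewrite subr_eq0 gt_eqF ?aQ_lt.
by rewrite powRr0 mul1r.
Qed.

Lemma sphere_integral : (\int[sigma]_(x in @hsphere R n) (F x)%:E = (A * Qr)%:E)%E /\ 0 <= A.
Proof.
have E : (\int[sigma]_(x in @hsphere R n) (F x)%:E = \int[sigma]_(x in @hsphere R n) (`|g (htheta x)| `^ q')%:E)%E.
  by apply: eq_integral => x; rewrite inE => xs; rewrite F_sphere.
have I0 : (0 <= \int[sigma]_(x in @hsphere R n) (F x)%:E)%E.
  by apply: integral_ge0 => x _; rewrite lee_fin mulr_ge0 ?powR_ge0.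
(* [adams_const] goes through the real-valued integral, so finiteness is what makes it the actual
   value. *)
have fin : (\int[sigma]_(x in @hsphere R n) (F x)%:E < +oo)%E.
  have [C0 C00 GC] := fundG_bound halpha0 hg; have mS := @measurable_hsphere R n.
  apply: (@le_lt_trans _ _ (\int[sigma]_(x in @hsphere R n) (C0 `^ q')%:E)%E).
    apply: ge0_le_integral => //.
    - by move=> x _; rewrite lee_fin mulr_ge0 ?powR_ge0.
    - by apply/measurable_EFinP; exact: measurable_funTS F_meas.
    - move=> x xs; rewrite lee_fin /F; have -> : hnorm x = 1 by [].
      rewrite powR1 mulr1 ge0_ler_powR ?nnegrE ?(ltW q'_gt0) ?(ltW C00)//.
      by have := GC x; have -> : hnorm x = 1 by []; rewrite powR1 mulr1.
  by rewrite integral_cst// (sphere_areaE hsigma) -EFinM ltry.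
have Qn : Qr != 0 by rewrite gt_eqF ?Qr_gt0.
split; last by rewrite /adams_const mulr_ge0 ?invr_ge0 ?(ltW Qr_gt0)// fine_ge0// -E.
rewrite /adams_const mulrC mulrA divff// mul1r /Rintegral -E fineK//.
by rewrite ge0_fin_numE.
Qed.

Lemma A_ge0 : 0 <= A. Proof. exact: sphere_integral.2. Qed.

Lemma shell_integral (r1 r2 : R) : 0 < r1 -> r1 < r2 ->
  (\int[mu]_x (`|G x| `^ q' * \1_(hshell r1 r2) x)%:E = (A * Qr * ln (r2 / r1))%:E)%E.
Proof.
move=> r10 r12; rewrite integral_indic_mul; last exact: measurable_hshell.
transitivity (\int[mu]_(x in hshell r1 r2) (hnorm x `^ (- Qr) * F x)%:E)%E.
  apply: eq_integral => x; rewrite inE /hshell/= in_itv/= => /andP[/(lt_trans r10) x0 _].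
  congr (_%:E); rewrite /F mulrCA -powRD; last by apply/implyP => _; rewrite gt_eqF.
  by rewrite addNr powRr0 mulr1.
have F0 x : 0 <= F x by rewrite mulr_ge0 ?powR_ge0.
rewrite (polar_shell hsigma r10 r12 F_meas F0 F_dil).
by rewrite sphere_integral.1 -EFinM mulrC.
Qed.

End kernel_bounds.

(** * Averages of potentials over small sets *)

Section translated_kernels.
Context {R : realType} {n : nat}.
Local Notation H := (heis R n).
Local Notation mu := (heis_measure R n).
Implicit Types (x y w : H) (b k : H -> R).

Lemma measurable_translate k x : measurable_fun setT k -> measurable_fun setT (fun y => k (hmul (- x) y)).
Proof. by move=> mk; have [mF _] := preserving_hmul (- x); exact: (measurableT_comp mk mF). Qed.

Lemma integral_translate k x : measurable_fun setT k -> (forall w, 0 <= k w) ->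
  (\int[mu]_y (k (hmul (- x) y))%:E = \int[mu]_w (k w)%:E)%E.
Proof.
move=> mk k0; apply: (ge0_integral_preserving (f := EFin \o k) (preserving_hmul (- x))).
  exact/measurable_EFinP.
by move=> w; rewrite lee_fin.
Qed.

Lemma integral_translatel k y : measurable_fun setT k -> (forall w, 0 <= k w) ->
  (\int[mu]_x (k (hmul (- x) y))%:E = \int[mu]_w (k w)%:E)%E.
Proof.
move=> mk k0; apply: (ge0_integral_preserving (f := EFin \o k) (preserving_hmulNl y)).
  exact/measurable_EFinP.
by move=> w; rewrite lee_fin.
Qed.

Lemma measurable_kernel_prod b k : measurable_fun setT b -> measurable_fun setT k ->
  measurable_fun setT (fun p : H * H => (b p.2 * k (hmul (- p.1) p.2))%:E).
Proof.
move=> mb mk; apply/measurable_EFinP; apply: measurable_funM; last exact: measurable_kernel2.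
by apply: measurableT_comp => //; exact: measurable_snd.
Qed.

Lemma kernel_prod_integral b k : measurable_fun setT b -> measurable_fun setT k ->
  (forall y, 0 <= b y) -> (forall w, 0 <= k w) ->
  (\int[mu]_x \int[mu]_y (b y * k (hmul (- x) y))%:E = \int[mu]_w (k w)%:E * \int[mu]_y (b y)%:E)%E.
Proof.
move=> mb mk b0 k0; have mF := measurable_kernel_prod mb mk.
rewrite (heis_tonelli mF); last by move=> p; rewrite lee_fin mulr_ge0.
rewrite -ge0_integralZl//; last 3 first.
- exact/measurable_EFinP.
- by move=> y _; rewrite lee_fin.
- by apply: integral_ge0 => w _; rewrite lee_fin.
apply: eq_integral => y _; rewrite /= muleC -(integral_translatel y mk k0) -ge0_integralZl//.
- apply/measurable_EFinP; have [mF' _] := preserving_hmulNl y; exact: (measurableT_comp mk mF').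
- by move=> x _; rewrite lee_fin.
- by rewrite lee_fin.
Qed.

(** Split b at height c, so that b <= c + c^(1-q) b^q. The constant part is integrated over V only
    and gives c K t; the other part is integrated over the whole group, where Tonelli's theorem
    gives at most K e. *)
Lemma average_bound_aux (q : R) b k (V : set H) (t e K c : R) : 1 <= q -> 0 < c -> 0 < t -> 0 <= K ->
  measurable_fun setT b -> measurable_fun setT k -> (forall y, 0 <= b y) -> (forall w, 0 <= k w) ->
  measurable V -> (mu V <= t%:E)%E -> (\int[mu]_y (b y `^ q)%:E <= e%:E)%E ->
  (\int[mu]_w (k w)%:E <= K%:E)%E ->
  (\int[mu]_x ((\1_V x)%:E * \int[mu]_y (b y * k (hmul (- x) y))%:E) <= (K * (c * t + c `^ (1 - q) * e))%:E)%E.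
Proof.
move=> q1 c0 t0 K0 mb mk b0 k0 mV Vt be kK; pose bq y := b y `^ q.
have mbq : measurable_fun setT bq by exact: measurable_powR_fun.
have bq0 y : 0 <= bq y by exact: powR_ge0.
have mI (b' : H -> R) : measurable_fun setT b' -> (forall y, 0 <= b' y) ->
    measurable_fun setT (fun x => \int[mu]_y (b' y * k (hmul (- x) y))%:E)%E.
  move=> mb' b'0; apply: (measurable_int1 (measurable_kernel_prod mb' mk)).
  by move=> p; rewrite lee_fin mulr_ge0.
have I0 (b' : H -> R) x : (forall y, 0 <= b' y) -> (0 <= \int[mu]_y (b' y * k (hmul (- x) y))%:E)%E.
  by move=> b'0; apply: integral_ge0 => y _; rewrite lee_fin mulr_ge0.
have mV1 : measurable_fun setT (fun x : H => (\1_V x : R)%:E) by apply/measurable_EFinP; exact: measurable_indic.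
have c1 : 0 <= c `^ (1 - q) by exact: powR_ge0.
apply: (@le_trans _ _ (\int[mu]_x ((c * K)%:E * (\1_V x)%:E + (c `^ (1 - q))%:E * \int[mu]_y (bq y * k (hmul (- x) y))%:E))%E).
  apply: ge0_le_integral => //.
  - by move=> x _; rewrite mule_ge0 ?lee_fin ?I0.
  - by apply: emeasurable_funM => //; exact: mI.
  - by apply: emeasurable_funD; apply: emeasurable_funM => //; exact: mI.
  move=> x _; have mkx := measurable_translate x mk.
  rewrite indicE; have [_|_] := boolP (x \in V); last first.
    by rewrite mul0e mule0 add0e mule_ge0 ?lee_fin ?I0.
  rewrite mul1e mule1.
  apply: (@le_trans _ _ (\int[mu]_y (c%:E * (k (hmul (- x) y))%:E + (c `^ (1 - q))%:E * (bq y * k (hmul (- x) y))%:E))%E).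
    apply: ge0_le_integral => //.
    - by move=> y _; rewrite lee_fin mulr_ge0.
    - by apply/measurable_EFinP; exact: measurable_funM.
    - by apply/measurable_EFinP; apply: measurable_funD; apply: measurable_funM => //; exact: measurable_funM.
    - move=> y _; rewrite -!EFinM -EFinD lee_fin mulrA -mulrDl ler_wpM2r//.
      exact: young_opt.
  rewrite ge0_integralD//; last 4 first.
  - by move=> y _; rewrite mule_ge0 ?lee_fin ?(ltW c0).
  - by apply: emeasurable_funM => //; exact/measurable_EFinP.
  - by move=> y _; rewrite mule_ge0 ?lee_fin ?mulr_ge0.
  - by apply: emeasurable_funM => //; apply/measurable_EFinP; exact: measurable_funM.
  rewrite !ge0_integralZl ?lee_fin ?(ltW c0)//; last 4 first.
  - by apply/measurable_EFinP; exact: measurable_funM.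
  - by move=> y _; rewrite lee_fin mulr_ge0.
  - exact/measurable_EFinP.
  - by move=> y _; rewrite lee_fin.
  by rewrite leeD2r// EFinM integral_translate// lee_wpmul2l ?lee_fin ?(ltW c0).
rewrite ge0_integralD//; last 4 first.
- by move=> x _; rewrite -EFinM lee_fin !mulr_ge0 ?(ltW c0).
- by apply: emeasurable_funM.
- by move=> x _; rewrite mule_ge0 ?lee_fin ?I0.
- by apply: emeasurable_funM => //; exact: mI.
rewrite !ge0_integralZl ?lee_fin ?mulr_ge0 ?(ltW c0)//; last 2 first.
- exact: mI.
- by move=> x _; exact: I0.
rewrite kernel_prod_integral// integral_indic// setIT.
have -> : K * (c * t + c `^ (1 - q) * e) = c * K * t + c `^ (1 - q) * (K * e) by ring.
rewrite EFinD [X in (_ <= X + _)%E]EFinM [X in (_ <= _ + X)%E]EFinM; apply: leeD; apply: lee_wpmul2l; rewrite ?lee_fin ?mulr_ge0 ?(ltW c0)//.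
rewrite EFinM; apply: lee_pmul => //; apply: integral_ge0 => x _; rewrite lee_fin//.
Qed.

(** The height c = (e / t)^(1/q) balances the two terms. *)
Lemma average_bound (q : R) b k (V : set H) (t e K : R) : 1 < q -> 0 < t -> 0 <= K -> 0 <= e ->
  measurable_fun setT b -> measurable_fun setT k -> (forall y, 0 <= b y) -> (forall w, 0 <= k w) ->
  measurable V -> (mu V <= t%:E)%E -> (\int[mu]_y (b y `^ q)%:E <= e%:E)%E ->
  (\int[mu]_w (k w)%:E <= K%:E)%E ->
  (\int[mu]_x ((\1_V x)%:E * \int[mu]_y (b y * k (hmul (- x) y))%:E) <= (2 * K * (e `^ q^-1 * t `^ (1 - q^-1)))%:E)%E.
Proof.
move=> q1 t0 K0 e0 mb mk b0 k0 mV Vt be kK; have q0 := lt_trans ltr01 q1.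
have aux c c0 := @average_bound_aux q b k V t e K c (ltW q1) c0 t0 K0 mb mk b0 k0 mV Vt be kK.
(* For e = 0 there is no optimal height; c is sent to 0 instead. *)
move: e0; rewrite le_eqVlt => /orP[/eqP e0|e0].
  rewrite -e0 powR0 ?invr_eq0 ?gt_eqF// mul0r mulr0; apply/lee_addgt0Pr => eps eps0; rewrite add0e.
  have Kt : 0 < K * t + 1 by rewrite ltr_wpDl// mulr_ge0// ltW.
  apply: le_trans (aux (eps / (K * t + 1)) _) _; first by rewrite divr_gt0.
  rewrite -e0 mulr0 addr0 lee_fin mulrCA mulrC mulrA ler_pdivrMr// mulrC ler_wpM2l ?(ltW eps0)//.
  by rewrite mulrC lerDl.
have c0 : 0 < (e / t) `^ q^-1 by rewrite powR_gt0// divr_gt0.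
apply: le_trans (aux _ c0) _; rewrite lee_fin.
have et : 0 < e / t by rewrite divr_gt0.
have E1 : (e / t) `^ q^-1 * t = e `^ q^-1 * t `^ (1 - q^-1).
  rewrite powRM ?invr_ge0 ?(ltW e0) ?(ltW t0)// -[X in _ * X = _](powRr1 (ltW t0)) -mulrA.
  rewrite -(powR_inv1 (ltW t0)) -powRrM -powRD; last by apply/implyP => _; rewrite gt_eqF.
  by rewrite mulN1r addrC.
have E2 : ((e / t) `^ q^-1) `^ (1 - q) * e = (e / t) `^ q^-1 * t.
  have -> : e = (e / t) * t by rewrite divfK// gt_eqF.
  rewrite -{2}(powRr1 (ltW et)) divfK ?gt_eqF// mulrA; congr (_ * _).
  rewrite -powRrM -powRD; last by apply/implyP => _; rewrite gt_eqF.
  by congr (_ `^ _); field; rewrite gt_eqF.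
by rewrite E2 E1 -mulr2n -[X in K * X]mulr_natl mulrCA mulrA lexx.
Qed.

End translated_kernels.

Section kernel_estimates.
Context {R : realType} {n alpha : nat}.
Local Notation H := (heis R n).
Local Notation mu := (heis_measure R n).
Local Notation Q := (hdim n).
Variables (g : R -> R) (sigma : {measure set H -> \bar R}).
Hypotheses (halpha : ~~ odd alpha) (halpha0 : (0 < alpha < Q)%N).
Hypothesis hsigma : is_polar_measure sigma.
Hypothesis hg : is_fundamental n alpha g.
Implicit Types (x y w v : H) (r : R) (u f b phi psi : H -> R).
Local Notation G := (@fundG R n alpha g).
Local Notation Hk := (@Hker R n alpha g).
Local Notation Kk := (@Kker R n alpha g).
Local Notation a := (alpha%:R : R).
Local Notation Qr := (Q%:R : R).
Local Notation q := (Qr / a).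
Local Notation q' := (Qr / (Qr - a)).
Local Notation A := (adams_const sigma alpha g).

Opaque Z sublap fundG Hker Kker adams_const.

(** The kernel is at most C r^-Q and lives in the ball of radius 4 r, of volume at most C r^Q.
    Splitting |u| at the height (P / r^Q)^(1/p), its mean size on such a ball, makes both
    contributions of that order. *)
Lemma potential_Kker_bound (p : R) : 1 <= p -> exists2 C, 0 < C & forall (u : H -> R) (r P : R) (x : H), 0 < r -> 0 < P ->
  measurable_fun setT u -> (\int[mu]_x (`|u x| `^ p)%:E <= P%:E)%E ->
  `|potential (Kk r) u x| <= C * (P / r ^+ Q) `^ p^-1.
Proof.
move=> p1; have p0 := lt_le_trans ltr01 p1.
have [C1 C10 HC1] := Kker_bound hg.
have [C2 C20 HC2] := ball_volume hsigma.
exists (C1 * (C2 * 4 ^+ Q + 1)); first by rewrite mulr_gt0// ltr_wpDl// mulr_ge0 ?exprn_ge0 ?(ltW C20).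
move=> u r P x r0 P0 mu_ uP; have rQ : 0 < r ^+ Q by rewrite exprn_gt0.
pose c := (P / r ^+ Q) `^ p^-1; have c0 : 0 < c by rewrite powR_gt0 ?divr_gt0.
have mK : measurable_fun setT (Kk r) by exact: smooth_meas (smooth_Kker hg r).
have r40 : 0 < 4 * r by rewrite mulr_gt0.
pose D := C1 * r `^ (- Qr); have D0 : 0 <= D by rewrite mulr_ge0 ?powR_ge0 ?(ltW C10).
have Dc0 : 0 <= D * c := mulr_ge0 D0 (ltW c0).
have Dp0 : 0 <= D * c `^ (1 - p) := mulr_ge0 D0 (powR_ge0 _ _).
have mKx := measurable_translate x mK.
have m1 : measurable_fun setT (fun y => \1_(hball (4 * r)) (hmul (- x) y) : R).
  by apply: (measurable_translate x); exact: measurable_indic (measurable_hball _).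
have mup : measurable_fun setT (fun y => `|u y| `^ p) by apply: measurable_powR_fun; exact: measurableT_comp.
have muK : measurable_fun setT (fun y => u y * Kk r (hmul (- x) y)) by exact: measurable_funM.
rewrite -lee_fin /potential; apply: le_trans (abs_Rintegral_le mu muK) _.
apply: (@le_trans _ _ (\int[mu]_y ((D * c)%:E * (\1_(hball (4 * r)) (hmul (- x) y))%:E + (D * c `^ (1 - p))%:E * (`|u y| `^ p)%:E))%E).
  apply: ge0_le_integral => //.
  - by apply/measurable_EFinP; exact: measurableT_comp.
  - by apply/measurable_EFinP; apply: measurable_funD; exact: measurable_funM.
  move=> y _; rewrite -!EFinM -EFinD lee_fin normrM indicE.
  have [_|] := boolP (_ \in hball _); last first.
    rewrite notin_setE /hball/= => /negP; rewrite -ltNge => xr.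
    rewrite Kker0 ?(ltW xr)// normr0 !mulr0 add0r.
    exact: (mulr_ge0 (mulr_ge0 D0 (powR_ge0 _ _)) (powR_ge0 _ _)).
  have -> : D * c * true%:R + D * c `^ (1 - p) * `|u y| `^ p = (c + c `^ (1 - p) * `|u y| `^ p) * D.
    by rewrite mulr1; ring.
  by apply: ler_pM => //; [exact: young_opt|exact: HC1].
rewrite ge0_integralD//; last 4 first.
- by move=> y _; rewrite -EFinM lee_fin; exact: (mulr_ge0 Dc0).
- by apply: emeasurable_funM => //; exact/measurable_EFinP.
- by move=> y _; rewrite -EFinM lee_fin; exact: (mulr_ge0 Dp0 (powR_ge0 _ _)).
- by apply: emeasurable_funM => //; exact/measurable_EFinP.
rewrite !ge0_integralZl ?lee_fin ?Dc0 ?Dp0//; try exact/measurable_EFinP.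
rewrite (integral_translate (k := \1_(hball (4 * r))) x) //; last exact: measurable_indic (measurable_hball _).
rewrite integral_indic ?setIT//; last exact: measurable_hball.
apply: (@le_trans _ _ ((D * c)%:E * (C2 * (4 * r) ^+ Q)%:E + (D * c `^ (1 - p))%:E * P%:E)%E).
  by apply: leeD; apply: lee_wpmul2l => //; exact: HC2.
rewrite -!EFinM -EFinD lee_fin le_eqVlt; apply/orP; left; apply/eqP.
have -> : P = r ^+ Q * c `^ p.
  by rewrite /c -powRrM mulVf ?gt_eqF// powRr1 ?divr_ge0 ?(ltW P0) ?(ltW rQ)// mulrC divfK// gt_eqF.
have cc : c `^ (1 - p) * c `^ p = c.
  by rewrite -powRD; [rewrite subrK powRr1// ltW|apply/implyP => _; rewrite gt_eqF].
have rr : r `^ (- Qr) * r ^+ Q = 1 by rewrite powRN powR_mulrn ?(ltW r0)// mulVf// gt_eqF.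
have -> : (r ^+ Q * c `^ p / r ^+ Q) `^ p^-1 = c.
  by rewrite mulrAC divff ?gt_eqF// mul1r -powRrM divff ?gt_eqF// powRr1 ?(ltW c0).
rewrite /D exprMn.
transitivity (C1 * (r `^ (- Qr) * r ^+ Q) * (c * C2 * 4 ^+ Q + c `^ (1 - p) * c `^ p)); first ring.
by rewrite rr cc; ring.
Qed.

End kernel_estimates.

(** * Level sets *)

Section level_sets.
Context {R : realType} {n alpha : nat}.
Local Notation H := (heis R n).
Local Notation mu := (heis_measure R n).
Local Notation Q := (hdim n).
Local Notation k := (alpha./2).
Variables (g : R -> R) (sigma : {measure set H -> \bar R}).
Hypotheses (halpha : ~~ odd alpha) (halpha0 : (0 < alpha < Q)%N).
Hypothesis hsigma : is_polar_measure sigma.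
Hypothesis hg : is_fundamental n alpha g.
Implicit Types (x y w v : H) (r : R) (u f b th phi psi : H -> R).
Local Notation G := (@fundG R n alpha g).
Local Notation Hk := (@Hker R n alpha g).
Local Notation Kk := (@Kker R n alpha g).
Local Notation a := (alpha%:R : R).
Local Notation Qr := (Q%:R : R).
Local Notation q := (Qr / a).
Local Notation q' := (Qr / (Qr - a)).
Local Notation A := (adams_const sigma alpha g).

Opaque Z sublap fundG Hker Kker adams_const.

(** Passes from a measure t to the radius of a ball of comparable volume; the alpha-th power of the
    radius is the order of the integral of |G| over that ball. *)
Lemma Qroot (t : R) : 0 < t -> [/\ 0 < t `^ Qr^-1, (t `^ Qr^-1) ^+ Q = t & (t `^ Qr^-1) ^+ alpha = t `^ q^-1].
Proof.
move=> t0; have Q0 : Qr != 0 by rewrite pnatr_eq0 -lt0n hdim_gt0.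
split; first exact: powR_gt0.
  by rewrite -powR_mulrn ?powR_ge0// -powRrM mulVf// powRr1// ltW.
by rewrite -powR_mulrn ?powR_ge0// -powRrM invf_div mulrC.
Qed.

Definition Gball r w : R := `|G w| * \1_(hball r) w.
Definition Gfar_ r w : R := `|G w| * \1_(~` hball r) w.
Definition Gshell r1 r2 w : R := `|G w| * \1_(hshell r1 r2) w.

Let mG : measurable_fun setT (fun w : H => `|G w|).
Proof. by have mn := measurable_fundG halpha0 hg; exact: measurableT_comp. Qed.

Lemma measurable_Gball r : measurable_fun setT (Gball r).
Proof. exact: (measurable_funM mG (measurable_indic (measurable_hball _))). Qed.

Lemma measurable_Gfar r : measurable_fun setT (Gfar_ r).
Proof. exact: (measurable_funM mG (measurable_indic (measurableC (measurable_hball _)))). Qed.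

Lemma measurable_Gshell r1 r2 : measurable_fun setT (Gshell r1 r2).
Proof. exact: (measurable_funM mG (measurable_indic (measurable_hshell _ _))). Qed.

Let ind_ge0 (B : set H) w : 0 <= `|G w| * \1_B w.
Proof. by rewrite mulr_ge0. Qed.

Lemma shell_bound b (X r1 r2 : R) x : measurable_fun setT b -> (forall y, 0 <= b y) -> 0 <= X ->
  (\int[mu]_y (b y `^ q)%:E <= X%:E)%E -> 0 < r1 -> r1 < r2 ->
  (\int[mu]_y (b y * Gshell r1 r2 (hmul (- x) y))%:E <= (X `^ q^-1 * (A * Qr * ln (r2 / r1)) `^ q'^-1)%:E)%E.
Proof.
move=> mb b0 X0 bX r10 r12; have mS := measurable_Gshell r1 r2.
have L0 : 0 <= A * Qr * ln (r2 / r1).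
  rewrite mulr_ge0//; first by rewrite mulr_ge0 ?ler0n ?(A_ge0 halpha0 hsigma hg).
  by rewrite ln_ge0// ler_pdivlMr// mul1r ltW.
apply: hoelder_le => //.
- exact: q_gt0 halpha0.
- exact: q'_gt0 halpha0.
- exact: q_conj halpha0.
- exact: measurable_translate.
- by move=> y; exact: ind_ge0.
pose k2 w := Gshell r1 r2 w `^ q'.
rewrite (integral_translate (k := k2) x); last 2 first.
- exact: measurable_powR_fun.
- by move=> w; exact: powR_ge0.
rewrite -(shell_integral halpha0 hsigma hg r10 r12); rewrite le_eqVlt; apply/orP; left; apply/eqP.
apply: eq_integral => w _; rewrite /k2 /Gshell indicE; case: (w \in _); rewrite ?mulr1// !mulr0 powR0// gt_eqF//.
exact: q'_gt0 halpha0.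
Qed.

(** Hoelder's inequality with the weight split as th^(1/q) th^(1/q'). On the shell r2 < |x| < 2 r1
    the weight is bounded by 1 and the exact shell integral appears; beyond 2 r1, |G|^q' <= C (2
    r1)^-Q while th has mass at most r1^Q, so the tail costs only an additive constant next to the
    logarithm. *)
Lemma outer_bound : exists2 C, 0 < C & forall th f (e r1 r2 : R) x,
  measurable_fun setT th -> (forall y, 0 <= th y <= 1) -> measurable_fun setT f ->
  (\int[mu]_y (th y)%:E <= (r1 ^+ Q)%:E)%E -> 0 <= e -> (\int[mu]_y (th y * `|f y| `^ q)%:E <= e%:E)%E ->
  0 < r2 -> r2 <= r1 ->
  (\int[mu]_y (th y * `|f y| * Gfar_ r2 (hmul (- x) y))%:E <=
     (e `^ q^-1 * (A * Qr * ln (2 * r1 / r2) + C) `^ q'^-1)%:E)%E.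
Proof.
have [C C0 HC] := far_bound halpha0 hg; have q0 := q_gt0 (R := R) halpha0; have q'0 := q'_gt0 (R := R) halpha0.
exists C => // th f e r1 r2 x mth th01 mf thr e0 fe r20 r21; have r10 := lt_le_trans r20 r21.
have A0 := A_ge0 halpha0 hsigma hg.
have th0 y : 0 <= th y by have /andP[] := th01 y.
have mab : measurable_fun setT (fun y => `|f y|) by exact: measurableT_comp.
have mGx := measurable_translate x (measurable_Gfar r2).
have r2r1 : r2 < 2 * r1 by apply: le_lt_trans r21 _; rewrite ltr_pMl// ltr1n.
have L0 : 0 <= A * Qr * ln (2 * r1 / r2).
  rewrite mulr_ge0//; first by rewrite mulr_ge0 ?ler0n.
  by rewrite ln_ge0// ler_pdivlMr// mul1r ltW.
pose b1 y := th y `^ q^-1 * `|f y|; pose b2 y := th y `^ q'^-1 * Gfar_ r2 (hmul (- x) y).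
have E y : th y * `|f y| * Gfar_ r2 (hmul (- x) y) = b1 y * b2 y.
  rewrite /b1 /b2 [RHS]mulrACA -powRD; last by rewrite q_conj// oner_eq0.
  by rewrite q_conj// powRr1// mulrA.
under eq_integral do rewrite E.
apply: hoelder_le => //.
- exact: q_conj.
- by apply: measurable_funM => //; exact: measurable_powR_fun.
- by apply: measurable_funM => //; exact: measurable_powR_fun.
- by move=> y; rewrite mulr_ge0 ?powR_ge0.
- by move=> y; rewrite mulr_ge0 ?powR_ge0 ?ind_ge0.
- by rewrite addr_ge0// ltW.
- apply: le_trans fe; rewrite le_eqVlt; apply/orP; left; apply/eqP.
  apply: eq_integral => y _; rewrite /b1 powRM ?powR_ge0// -powRrM mulVf ?gt_eqF// powRr1//.
pose k2 w := `|G w| `^ q' * \1_(hshell r2 (2 * r1)) w.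
have k20 w : 0 <= k2 w by rewrite mulr_ge0 ?powR_ge0.
have mk2 : measurable_fun setT k2.
  by apply: measurable_funM; [exact: measurable_powR_fun|exact: measurable_indic (measurable_hshell _ _)].
have D0 : 0 <= C * (2 * r1) `^ (- Qr) by rewrite mulr_ge0 ?powR_ge0// ltW.
have mk2x := measurable_translate x mk2.
apply: (@le_trans _ _ (\int[mu]_y ((k2 (hmul (- x) y))%:E + (C * (2 * r1) `^ (- Qr))%:E * (th y)%:E))%E).
  apply: ge0_le_integral => //.
  - by move=> y _; rewrite lee_fin powR_ge0.
  - apply/measurable_EFinP; apply: measurable_powR_fun; apply: measurable_funM => //; exact: measurable_powR_fun.
  - by apply/measurable_EFinP; apply: measurable_funD => //; exact: measurable_funM.
  move=> y _; rewrite -EFinM -EFinD lee_fin /b2 powRM ?powR_ge0 ?ind_ge0// -powRrM mulVf ?gt_eqF// powRr1//.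
  rewrite /Gfar_ indicE in_setC; set w := hmul (- x) y.
  have [wr|] := boolP (w \in hball r2); first by rewrite mulr0 powR0 ?gt_eqF// mulr0 addr_ge0// mulr_ge0.
  rewrite notin_setE /hball/= => /negP; rewrite -ltNge => r2w; rewrite mulr1.
  have [w2|w2] := ltP (hnorm w) (2 * r1).
    have ws : w \in hshell r2 (2 * r1) by apply/mem_set; rewrite /hshell/= in_itv/= r2w.
    rewrite /k2 indicE ws mulr1; apply: ler_wpDr; first exact: mulr_ge0.
    by apply: ler_piMl; [exact: powR_ge0|have /andP[] := th01 y].
  apply: ler_wpDl => //; rewrite mulrC; apply: ler_wpM2r => //.
  by apply: HC w2; rewrite mulr_gt0.
rewrite ge0_integralD//; last 4 first.
- by move=> y _; rewrite lee_fin.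
- exact/measurable_EFinP.
- by move=> y _; rewrite -EFinM lee_fin mulr_ge0.
- by apply: emeasurable_funM => //; exact/measurable_EFinP.
rewrite ge0_integralZl//; last 2 first.
- exact/measurable_EFinP.
- by move=> y _; rewrite lee_fin.
rewrite (integral_translate (k := k2))// (shell_integral halpha0 hsigma hg r20 r2r1) EFinD leeD2l//.
apply: le_trans (lee_wpmul2l _ thr) _; first by rewrite lee_fin.
rewrite -EFinM lee_fin powRN powR_mulrn ?mulr_ge0 ?(ltW r10)// -mulrA ger_pMr//.
rewrite mulrC ler_pdivrMr ?exprn_gt0 ?mulr_gt0// mul1r lerXn2r ?nnegrE ?mulr_ge0 ?(ltW r10)//.
by rewrite ler_peMl ?(ltW r10)// ler1n.
Qed.


(** Four pieces. The selected part of f is left as it is within distance r2, to be averaged later,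
    and falls under [outer_bound] beyond. The remaining part is bounded by c, hence contributes at
    most c times the integral of |G| within distance r1, and between r1 and 2 r it obeys Hoelder's
    inequality with the share 1 - e. *)
Lemma potential_Hker_bound : exists2 C, 0 < C & forall f (r1 : R), measurable_fun setT f -> 0 < r1 ->
  (\int[mu]_y (`|f y| `^ q)%:E <= 1)%E ->
  exists th (e : R), [/\ measurable_fun setT th, forall y, 0 <= th y <= 1, 0 <= e <= 1,
    (\int[mu]_y (th y * `|f y| `^ q)%:E = e%:E)%E &
    forall r r2 x, 0 < r2 -> r2 <= r1 -> r1 < 2 * r ->
    (\int[mu]_y (`|f y| * `|Hk r (hmul (- x) y)|)%:E <=
      \int[mu]_y (th y * `|f y| * Gball r2 (hmul (- x) y))%:E +
      (e `^ q^-1 * (A * Qr * ln (2 * r1 / r2) + C) `^ q'^-1 + C * e `^ q^-1 +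
       (1 - e) `^ q^-1 * (A * Qr * ln (2 * r / r1)) `^ q'^-1)%:E)%E].
Proof.
have [C1 C10 HC1] := outer_bound; have [C2 C20 HC2] := near_integral halpha0 hsigma hg.
have q0 := q_gt0 (R := R) halpha0; have q'0 := q'_gt0 (R := R) halpha0; have q1 := q_gt1 (R := R) halpha0.
have A0 := A_ge0 halpha0 hsigma hg.
pose C := Num.max C1 (4 * C2).
exists C; first by rewrite lt_max C10.
move=> f r1 mf r10 f1; have t0 : 0 < r1 ^+ Q by rewrite exprn_gt0.
have [th [c [[mth th01] c0 tht thc ce]]] := bathtub mf q0 t0 ler01 f1.
have th0 y : 0 <= th y by have /andP[] := th01 y.
have th1 y : 0 <= 1 - th y by rewrite subr_ge0; have /andP[] := th01 y.
have mab : measurable_fun setT (fun y => `|f y|) by exact: measurableT_comp.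
have mfq : measurable_fun setT (fun y => `|f y| `^ q) by exact: measurable_powR_fun.
have m1th : measurable_fun setT (fun y => 1 - th y) by exact: measurable_funB.
pose I1 := (\int[mu]_y (th y * `|f y| `^ q)%:E)%E.
pose I2 := (\int[mu]_y ((1 - th y) * `|f y| `^ q)%:E)%E.
have I10 : (0 <= I1)%E by apply: integral_ge0 => y _; rewrite lee_fin mulr_ge0 ?powR_ge0.
have I20 : (0 <= I2)%E by apply: integral_ge0 => y _; rewrite lee_fin mulr_ge0 ?powR_ge0.
have I12 : (I1 + I2 <= 1)%E.
  apply: le_trans f1; rewrite -ge0_integralD//.
  - by rewrite le_eqVlt; apply/orP; left; apply/eqP; apply: eq_integral => y _; rewrite -EFinD -mulrDl subrKC mul1r.
  - by move=> y _; rewrite lee_fin mulr_ge0 ?powR_ge0.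
  - by apply/measurable_EFinP; exact: measurable_funM.
  - by move=> y _; rewrite lee_fin mulr_ge0 ?powR_ge0.
  - by apply/measurable_EFinP; exact: measurable_funM.
have I11 : (I1 <= 1)%E by apply: le_trans I12; rewrite leeDl.
pose e := fine I1; have eE : I1 = e%:E by rewrite fineK// ge0_fin_numE// (le_lt_trans I11)// ltry.
have e0 : 0 <= e by rewrite fine_ge0.
have e1 : e <= 1 by rewrite -lee_fin -eE.
have I2e : (I2 <= (1 - e)%:E)%E by rewrite EFinB leeBrDl// -eE.
exists th, e; split => //; first by rewrite e0.
move=> r r2 x r20 r21 r12; have r0 : 0 < r.
  by rewrite -(pmulr_rgt0 _ (ltr0n R 2)); exact: lt_trans r12.
have tq : (r1 ^+ Q) `^ q^-1 = r1 ^+ alpha.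
  by rewrite -!powR_mulrn ?(ltW r10)// -powRrM invf_div mulrCA divff ?mulr1// gt_eqF ?Qr_gt0 -?(Qr_gt0 halpha0)//; exact: (Qr_gt0 halpha0).
(* The last property of the weight bounds the height c by the selected energy e. Without it this
   piece would be O(1) instead of O(e^(1/q)), too large for high levels. *)
have cb : c * r1 ^+ alpha <= 4 * e `^ q^-1.
  have qi : 0 <= q^-1 by rewrite invr_ge0 ltW.
  move: ce; rewrite -/I1 eE -EFinM lee_fin => ce.
  have l0 : 0 <= c `^ q * r1 ^+ Q by rewrite mulr_ge0 ?powR_ge0 ?(ltW t0).
  have l1 : 0 <= 4 `^ q * e by rewrite mulr_ge0 ?powR_ge0.
  have := ge0_ler_powR qi l0 l1 ce.
  rewrite !powRM ?powR_ge0 ?(ltW t0)// tq -!powRrM divff ?gt_eqF// !powRr1//.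
have mHx : measurable_fun setT (fun y => `|Hk r (hmul (- x) y)|).
  by apply: measurableT_comp => //; apply: measurable_translate; exact: (measurable_Hker halpha0 hg).
have m1 : measurable_fun setT (fun y => th y * `|f y| * Gball r2 (hmul (- x) y)).
  apply: measurable_funM; first exact: measurable_funM.
  exact: measurable_translate (measurable_Gball r2).
have m2 : measurable_fun setT (fun y => th y * `|f y| * Gfar_ r2 (hmul (- x) y)).
  apply: measurable_funM; first exact: measurable_funM.
  exact: measurable_translate (measurable_Gfar r2).
have mb3 : measurable_fun setT (fun y => (1 - th y) * `|f y|) by exact: measurable_funM.
have m3 : measurable_fun setT (fun y => (1 - th y) * `|f y| * Gball r1 (hmul (- x) y)).
  by apply: measurable_funM => //; exact: measurable_translate (measurable_Gball r1).
have m4 : measurable_fun setT (fun y => (1 - th y) * `|f y| * Gshell r1 (2 * r) (hmul (- x) y)).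
  by apply: measurable_funM => //; exact: measurable_translate (measurable_Gshell r1 (2 * r)).
have p1 y : 0 <= th y * `|f y| * Gball r2 (hmul (- x) y) by rewrite !mulr_ge0.
have p2 y : 0 <= th y * `|f y| * Gfar_ r2 (hmul (- x) y) by rewrite !mulr_ge0.
have p3 y : 0 <= (1 - th y) * `|f y| * Gball r1 (hmul (- x) y) by rewrite !mulr_ge0.
have p4 y : 0 <= (1 - th y) * `|f y| * Gshell r1 (2 * r) (hmul (- x) y) by rewrite !mulr_ge0.
have T2 := HC1 th f e r1 r2 x mth th01 mf tht e0; rewrite -/I1 eE lexx in T2; have {}T2 := T2 isT r20 r21.
have T3 : (\int[mu]_y ((1 - th y) * `|f y| * Gball r1 (hmul (- x) y))%:E <= (4 * C2 * e `^ q^-1)%:E)%E.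
  apply: (@le_trans _ _ (\int[mu]_y (c%:E * (Gball r1 (hmul (- x) y))%:E))%E).
    apply: ge0_le_integral => //.
    - by move=> y _; rewrite lee_fin.
    - exact/measurable_EFinP.
    - by apply: emeasurable_funM => //; apply/measurable_EFinP; exact: measurable_translate (measurable_Gball r1).
    - by move=> y _; rewrite -EFinM lee_fin; apply: ler_wpM2r; [exact: ind_ge0|exact: thc].
  rewrite ge0_integralZl//; last 2 first.
  - by apply/measurable_EFinP; exact: measurable_translate (measurable_Gball r1).
  - by move=> y _; rewrite lee_fin ind_ge0.
  rewrite (integral_translate _ (measurable_Gball r1)); last by move=> w; exact: ind_ge0.
  apply: le_trans (lee_wpmul2l _ (HC2 _ r10)) _; first by rewrite lee_fin.
  rewrite -EFinM lee_fin mulrCA (le_trans (ler_wpM2l (ltW C20) cb))// le_eqVlt; apply/orP; left; apply/eqP; ring.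
have T4 : (\int[mu]_y ((1 - th y) * `|f y| * Gshell r1 (2 * r) (hmul (- x) y))%:E <=
    ((1 - e) `^ q^-1 * (A * Qr * ln (2 * r / r1)) `^ q'^-1)%:E)%E.
  apply: (shell_bound (b := fun y => (1 - th y) * `|f y|)) => //.
  - by move=> y; rewrite mulr_ge0.
  - by rewrite subr_ge0.
  apply: le_trans I2e; apply: ge0_le_integral => //.
  - by move=> y _; rewrite lee_fin powR_ge0.
  - by apply/measurable_EFinP; exact: measurable_powR_fun.
  - by apply/measurable_EFinP; exact: measurable_funM.
  move=> y _; rewrite lee_fin powRM// ler_wpM2r ?powR_ge0// -[leRHS](powRr1 (th1 y)).
  have [e00|n0] := eqVneq (1 - th y) 0; first by rewrite e00 !powR0 ?gt_eqF.
  by rewrite ger_powR ?(ltW q1)// lt_neqAle eq_sym n0 th1 gerBl th0.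
apply: (@le_trans _ _ (\int[mu]_y ((th y * `|f y| * Gball r2 (hmul (- x) y))%:E +
    ((th y * `|f y| * Gfar_ r2 (hmul (- x) y))%:E + ((((1 - th y) * `|f y| * Gball r1 (hmul (- x) y)))%:E +
     ((1 - th y) * `|f y| * Gshell r1 (2 * r) (hmul (- x) y))%:E))))%E).
  apply: ge0_le_integral => //.
  - by apply/measurable_EFinP; exact: measurable_funM.
  - by do 3 (apply: emeasurable_funD; first exact/measurable_EFinP); exact/measurable_EFinP.
  move=> y _; rewrite -!EFinD lee_fin; set w := hmul (- x) y.
  have HG : `|Hk r w| <= `|G w| := @Hker_le _ _ alpha g r w.
  have E : `|f y| * `|Hk r w| = th y * `|f y| * `|Hk r w| + (1 - th y) * `|f y| * `|Hk r w| by ring.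
  rewrite E addrA; apply: lerD.
    rewrite /Gball /Gfar_ !indicE in_setC -mulrDr -mulrDr; apply: ler_wpM2l; first exact: mulr_ge0.
    by case: (w \in _); rewrite ?addr0 ?add0r mulr1.
  rewrite /Gball /Gshell !indicE -mulrDr -mulrDr; apply: ler_wpM2l; first exact: mulr_ge0.
  have [w1|] := boolP (w \in hball r1); first by rewrite (le_trans HG)// ler_peMr// lerDl.
  rewrite notin_setE /hball/= => /negP; rewrite -ltNge => w1; rewrite add0r.
  have [w2|w2] := ltP (hnorm w) (2 * r); last by rewrite Hker0// normr0 mulr_ge0.
  have -> : w \in hshell r1 (2 * r) by apply/mem_set; rewrite /hshell/= in_itv/= w1.
  by rewrite mulr1.
rewrite ge0_integralD//; last 4 first.
- by move=> y _; rewrite lee_fin.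
- exact/measurable_EFinP.
- by move=> y _; rewrite -!EFinD lee_fin !addr_ge0.
- by do 2 (apply: emeasurable_funD; first exact/measurable_EFinP); exact/measurable_EFinP.
rewrite leeD2l// ge0_integralD//; last 4 first.
- by move=> y _; rewrite lee_fin.
- exact/measurable_EFinP.
- by move=> y _; rewrite -!EFinD lee_fin !addr_ge0.
- by apply: emeasurable_funD; exact/measurable_EFinP.
rewrite ge0_integralD//; last 4 first.
- by move=> y _; rewrite lee_fin.
- exact/measurable_EFinP.
- by move=> y _; rewrite lee_fin.
- exact/measurable_EFinP.
have E3 (s1 s2 s3 : R) : ((s1 + s2 + s3)%:E = s1%:E + (s2%:E + s3%:E))%E by rewrite -!EFinD addrA.
rewrite E3; apply: leeD.
  apply: le_trans T2 _; rewrite lee_fin ler_wpM2l ?powR_ge0//.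
  have L0 : 0 <= A * Qr * ln (2 * r1 / r2).
    rewrite mulr_ge0//; first by rewrite mulr_ge0 ?ler0n.
    by rewrite ln_ge0// ler_pdivlMr// mul1r (le_trans r21)// ler_peMl ?(ltW r10)// ler1n.
  have C0 : 0 <= C by rewrite le_max (ltW C10).
  rewrite ge0_ler_powR ?nnegrE ?invr_ge0 ?(ltW q'0) ?addr_ge0 ?(ltW C10)//.
  by rewrite lerD2l le_max lexx.
apply: leeD => //; apply: le_trans T3 _.
by rewrite lee_fin ler_wpM2r ?powR_ge0// le_max lexx orbT.
Qed.

End level_sets.

Section level_set_bound.
Context {R : realType} {n alpha : nat}.
Local Notation H := (heis R n).
Local Notation mu := (heis_measure R n).
Local Notation Q := (hdim n).
Local Notation k := (alpha./2).
Variables (g : R -> R) (sigma : {measure set H -> \bar R}).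
Hypotheses (halpha : ~~ odd alpha) (halpha0 : (0 < alpha < Q)%N).
Hypothesis hsigma : is_polar_measure sigma.
Hypothesis hg : is_fundamental n alpha g.
Implicit Types (x y w v : H) (r : R) (u f b th phi psi : H -> R).
Local Notation G := (@fundG R n alpha g).
Local Notation Hk := (@Hker R n alpha g).
Local Notation Kk := (@Kker R n alpha g).
Local Notation a := (alpha%:R : R).
Local Notation Qr := (Q%:R : R).
Local Notation q := (Qr / a).
Local Notation q' := (Qr / (Qr - a)).
Local Notation A := (adams_const sigma alpha g).

Opaque Z sublap fundG Hker Kker adams_const.

Lemma powR_le_self (s t : R) : 1 <= s -> 0 <= t <= 1 -> t `^ s <= t.
Proof.
move=> s1 /andP[t0 t1]; rewrite -[leRHS](powRr1 t0).
have [->|n0] := eqVneq t 0; first by rewrite !powR0 ?gt_eqF// (lt_le_trans ltr01).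
by rewrite ger_powR// lt_neqAle eq_sym n0 t0.
Qed.

(** Bookkeeping of constants. Each factor 2 in a radius becomes an additive Q ln 2 next to a
    logarithm, so the coefficient of the main logarithm is left untouched; everything else carries
    e1 or pe. *)
Lemma level_constants (B0 c1 c2 c3 s' e1 e2 pe t1 t2 r1 r2 r : R) :
  let D := B0 + B0 * Qr * ln 2 + c1 in
  let C := Qr * ln 2 + 2 * c2 + c1 + D `^ s' + c3 in
  0 <= B0 -> 0 <= c1 -> 0 <= c2 -> 0 <= c3 -> 0 < s' -> 0 <= e1 -> 0 <= e2 -> 0 <= pe ->
  0 < r2 -> r2 <= r1 -> r1 <= r -> r1 ^+ Q = t1 -> r2 ^+ Q = t2 ->
  2 * c2 * e1 + (e1 * (B0 * Qr * ln (2 * r1 / r2) + c1) `^ s' + c1 * e1 +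
    e2 * (B0 * Qr * ln (2 * r / r1)) `^ s' + c3 * pe) <=
  e2 * (B0 * (ln (r ^+ Q / t1) + C)) `^ s' + C * e1 * (1 + ln (t1 / t2)) `^ s' + C * pe.
Proof.
move=> D C B00 c10 c20 c30 s0 e10 e20 pe0 r20 r21 r1r <- <-.
have r10 := lt_le_trans r20 r21; have r0 := lt_le_trans r10 r1r.
have l2 : 0 <= ln 2 :> R by rewrite ln_ge0// ler1n.
have Q0 : 0 <= Qr by rewrite ler0n.
have lnE (s1 s2 : R) : 0 < s1 -> 0 < s2 -> Qr * ln (2 * s1 / s2) = Qr * ln 2 + ln (s1 ^+ Q / s2 ^+ Q).
  move=> s10 s20; rewrite -expr_div_n lnXn ?divr_gt0// -mulrA lnM ?posrE ?divr_gt0//.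
  by rewrite mulrDr; congr (_ + _); rewrite mulr_natl.
have L0 (s1 s2 : R) : 0 < s2 -> s2 <= s1 -> 0 <= ln (s1 ^+ Q / s2 ^+ Q).
  move=> s20 s21; rewrite ln_ge0// -expr_div_n exprn_ege1// ler_pdivlMr// mul1r//.
have D0 : 0 <= D by rewrite !addr_ge0 ?mulr_ge0.
have Ds0 : 0 <= D `^ s' by exact: powR_ge0.
have C0 : 0 <= C by rewrite !addr_ge0 ?mulr_ge0.
rewrite -!(mulrA B0) !lnE//.
set L := ln (r1 ^+ Q / r2 ^+ Q); set M := ln (r ^+ Q / r1 ^+ Q).
have Lp : 0 <= L by exact: L0.
have Mp : 0 <= M by exact: L0.
have T2 : (B0 * (Qr * ln 2 + L) + c1) `^ s' <= D `^ s' * (1 + L) `^ s'.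
  have D1 : 0 <= 1 + L by rewrite addr_ge0.
  have X0 : 0 <= B0 * (Qr * ln 2 + L) + c1 by rewrite addr_ge0// mulr_ge0// addr_ge0// mulr_ge0.
  rewrite -(powRM _ D0 D1); apply: (ge0_ler_powR (ltW s0) X0 (mulr_ge0 D0 D1)).
  rewrite /D -subr_ge0 (_ : _ - _ = B0 + (B0 * Qr * ln 2 + c1) * L); last by ring.
  by rewrite addr_ge0// mulr_ge0// addr_ge0// !mulr_ge0.
have T1 : 1 <= (1 + L) `^ s'.
  have D1 : 0 <= 1 + L by rewrite addr_ge0.
  have l1 : 1 <= 1 + L by rewrite lerDl.
  by have := ge0_ler_powR (ltW s0) ler01 D1 l1; rewrite powR1.
have T4 : (B0 * (Qr * ln 2 + M)) `^ s' <= (B0 * (M + C)) `^ s'.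
  have M0 : 0 <= Qr * ln 2 + M by rewrite addr_ge0// mulr_ge0.
  have M1 : 0 <= M + C by rewrite addr_ge0.
  apply: (ge0_ler_powR (ltW s0) (mulr_ge0 B00 M0) (mulr_ge0 B00 M1)); rewrite ler_wpM2l// addrC lerD2l.
  by rewrite /C -!addrA lerDl !addr_ge0 ?mulr_ge0.
have C3 : c3 * pe <= C * pe by rewrite ler_wpM2r// /C lerDr !addr_ge0 ?mulr_ge0.
have := ler_wpM2l e10 T2; have := ler_wpM2l e20 T4.
have : (2 * c2 + c1) * e1 <= (2 * c2 + c1) * e1 * (1 + L) `^ s'.
  by rewrite ler_peMr// mulr_ge0// addr_ge0 ?mulr_ge0.
have : (2 * c2 + c1 + D `^ s') * (e1 * (1 + L) `^ s') <= C * (e1 * (1 + L) `^ s').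
  rewrite ler_wpM2r ?mulr_ge0 ?powR_ge0// /C -!addrA; rewrite -subr_ge0.
  by rewrite (_ : _ - _ = Qr * ln 2 + c3); [rewrite addr_ge0 ?mulr_ge0|ring].
lra.
Qed.

(** The share e is chosen from f and t1 alone, before u, r, t2 and V. One e thus serves every set V
    of smaller measure, which is what later allows two different levels to be compared. *)
Lemma level_set_bound (p : R) : 1 <= p -> exists2 C, 0 < C & forall f (t1 : R),
  measurable_fun setT f -> (\int[mu]_y (`|f y| `^ q)%:E <= 1)%E -> 0 < t1 ->
  exists2 e : R, 0 <= e <= 1 & forall u (r P t2 lam : R) (V : set H), 0 < r -> 0 < P ->
  measurable_fun setT u -> (\int[mu]_y (`|u y| `^ p)%:E <= P%:E)%E -> weak_sublap k u f ->
  t1 <= r ^+ Q -> 0 < t2 <= t1 -> measurable V -> mu V = t2%:E -> (forall x, V x -> lam <= `|u x|) ->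
  lam <= (1 - e) `^ q^-1 * (A * (ln (r ^+ Q / t1) + C)) `^ q'^-1 +
    C * e `^ q^-1 * (1 + ln (t1 / t2)) `^ q'^-1 + C * (P / r ^+ Q) `^ p^-1.
Proof.
move=> p1; have q0 := q_gt0 (R := R) halpha0; have q'0 := q'_gt0 (R := R) halpha0.
have q1 := q_gt1 (R := R) halpha0; have A0 := A_ge0 halpha0 hsigma hg.
have [C1 C10 HC1] := potential_Hker_bound halpha0 hsigma hg.
have [C2 C20 HC2] := near_integral halpha0 hsigma hg.
have [C3 C30 HC3] := potential_Kker_bound hsigma hg p1.
pose D := A + A * Qr * ln 2 + C1.
pose C := Qr * ln 2 + 2 * C2 + C1 + D `^ q'^-1 + C3.
have l2 : 0 <= ln 2 :> R by rewrite ln_ge0// ler1n.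
have CC : 0 < C.
  by rewrite ltr_wpDl// !addr_ge0 ?mulr_ge0 ?powR_ge0 ?ler0n ?(ltW C10) ?(ltW C20).
exists C => // f t1 mf f1 t10; have [r10 r1Q r1a] := @Qroot R n alpha t1 t10.
set r1 := t1 `^ Qr^-1 in r10 r1Q r1a.
have [th [e [mth th01 e01 the Hth]]] := HC1 f r1 mf r10 f1.
exists e => // u r P t2 lam V r0 P0 mu_ uP wu t1r /andP[t20 t21] mV Vt2 Vlam.
have [e0 e1] := andP e01.
have [r20 r2Q r2a] := @Qroot R n alpha t2 t20; set r2 := t2 `^ Qr^-1 in r20 r2Q r2a.
have r21 : r2 <= r1 by rewrite ge0_ler_powR ?nnegrE ?invr_ge0 ?ler0n ?(ltW t20) ?(ltW t10).
have r1r : r1 <= r.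
  by rewrite -(@ler_pXn2r _ Q) ?nnegrE ?(ltW r10) ?(ltW r0) ?hdim_gt0// r1Q.
have r12r : r1 < 2 * r by apply: le_lt_trans r1r _; rewrite ltr_pMl// ltr1n.
have th0 y : 0 <= th y by have /andP[] := th01 y.
have LC := @level_constants A C1 C2 C3 q'^-1 (e `^ q^-1) ((1 - e) `^ q^-1) ((P / r ^+ Q) `^ p^-1) t1 t2 r1 r2 r.
apply: le_trans (LC _ _ _ _ _ _ _ _ _ _ _ _ _); rewrite ?invr_gt0 ?powR_ge0 ?(ltW C10) ?(ltW C20) ?(ltW C30)//.
set B := (X in _ <= _ + X).
have L1 : 0 <= ln (2 * r1 / r2).
  by rewrite ln_ge0// ler_pdivlMr// mul1r (le_trans r21)// ler_peMl ?(ltW r10)// ler1n.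
have B0 : 0 <= B by rewrite !addr_ge0// mulr_ge0 ?powR_ge0 ?(ltW C10) ?(ltW C30).
have [lam0|lam0] := leP lam 0.
  by rewrite (le_trans lam0)// addr_ge0// !mulr_ge0 ?powR_ge0 ?(ltW C20).
have lu : locint u by exact: locint_powR uP.
have lf : locint f by apply: (locint_powR (ltW q1)) f1.
have rep := weak_representation halpha halpha0 hsigma hg r0 lu lf wu.
pose b y := th y * `|f y|; pose T x := (\int[mu]_y (b y * Gball (alpha := alpha) g r2 (hmul (- x) y))%:E)%E.
have mab : measurable_fun setT (fun y => `|f y|) by exact: measurableT_comp.
have mb : measurable_fun setT b by exact: measurable_funM.
have b0 y : 0 <= b y by rewrite mulr_ge0.
have k0 w : 0 <= Gball (alpha := alpha) g r2 w by rewrite mulr_ge0.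
have mk := measurable_Gball halpha0 hg r2.
have mT : measurable_fun setT T.
  apply: (measurable_int1 (measurable_kernel_prod mb mk)).
  by move=> p'; rewrite lee_fin mulr_ge0.
have T0 x : (0 <= T x)%E by apply: integral_ge0 => y _; rewrite lee_fin mulr_ge0.
have mV1 : measurable_fun setT (fun x : H => (\1_V x : R)%:E) by apply/measurable_EFinP; exact: measurable_indic.
have be : (\int[mu]_y (b y `^ q)%:E <= e%:E)%E.
  rewrite -the; apply: ge0_le_integral => //.
  - by move=> y _; rewrite lee_fin powR_ge0.
  - by apply/measurable_EFinP; exact: measurable_powR_fun.
  - by apply/measurable_EFinP; apply: measurable_funM => //; exact: measurable_powR_fun.
  by move=> y _; rewrite lee_fin powRM// ler_wpM2r ?powR_ge0// powR_le_self// ltW.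
have K0 : 0 <= C2 * r2 ^+ alpha by rewrite mulr_ge0 ?exprn_ge0 ?(ltW C20) ?(ltW r20).
have Vt : (mu V <= t2%:E)%E by rewrite Vt2.
have AV := average_bound q1 t20 K0 e0 mb mk b0 k0 mV Vt be (HC2 _ r20).
have key : (lam%:E * mu V <= \int[mu]_x ((\1_V x)%:E * T x) + B%:E * mu V)%E.
  have -> : (lam%:E * mu V = \int[mu]_x (lam%:E * (\1_V x)%:E))%E.
    rewrite ge0_integralZl ?lee_fin ?(ltW lam0)//.
    by rewrite integral_indic// setIT.
  have -> : (B%:E * mu V = \int[mu]_x (B%:E * (\1_V x)%:E))%E.
    rewrite ge0_integralZl ?lee_fin//.
    by rewrite integral_indic// setIT.
  have mVT : measurable_fun setT (fun x => (\1_V x)%:E * T x)%E by exact: emeasurable_funM.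
  have mVB (c : R) : measurable_fun setT (fun x => c%:E * (\1_V x)%:E)%E by exact: emeasurable_funM.
  have VT0 x : (0 <= (\1_V x)%:E * T x)%E by rewrite mule_ge0 ?lee_fin.
  have VB0 (c : R) x : 0 <= c -> (0 <= c%:E * (\1_V x)%:E)%E by move=> c0; rewrite mule_ge0 ?lee_fin.
  rewrite -ge0_integralD//; last by move=> x _; exact: VB0.
  apply: ae_ge0_le_integral => //.
  - by move=> x _; apply: VB0; exact: ltW.
  - by move=> x _; rewrite adde_ge0// VB0.
  - exact: emeasurable_funD.
  apply: filterS rep => x ux _; rewrite indicE; have [/set_mem xV|_] := boolP (x \in V); last first.
    by rewrite !mule0 mul0e adde0.
  rewrite !mule1 mul1e; apply: (@le_trans _ _ (`|u x|)%:E); first by rewrite lee_fin Vlam.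
  have mfH : measurable_fun setT (fun y => f y * Hk r (hmul (- x) y)).
    by apply: measurable_funM => //; apply: measurable_translate; exact: (measurable_Hker halpha0 hg).
  rewrite ux; apply: (@le_trans _ _ (`|potential (Hk r) f x|%:E + `|potential (Kk r) u x|%:E)%E).
    by rewrite -EFinD lee_fin ler_normB.
  apply: (@le_trans _ _ (\int[mu]_y (`|f y| * `|Hk r (hmul (- x) y)|)%:E + (C3 * (P / r ^+ Q) `^ p^-1)%:E)%E).
    apply: leeD; last by rewrite lee_fin; exact: HC3.
    rewrite /potential; apply: le_trans (abs_Rintegral_le mu mfH) _.
    by rewrite le_eqVlt; apply/orP; left; apply/eqP; apply: eq_integral => y _; rewrite normrM.
  by rewrite /B EFinD addeA leeD2r//; exact: Hth.
have {key} : lam * t2 <= 2 * (C2 * r2 ^+ alpha) * (e `^ q^-1 * t2 `^ (1 - q^-1)) + B * t2.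
  rewrite -lee_fin EFinD (EFinM lam) (EFinM B) -Vt2; apply: le_trans key _.
  by rewrite leeD2r.
(* With r2^Q = t2 the powers of t2 combine to t2 itself, so that after division by the measure of V
   the near part is O(e^(1/q)). *)
rewrite r2a; have -> : 2 * (C2 * t2 `^ q^-1) * (e `^ q^-1 * t2 `^ (1 - q^-1)) = 2 * C2 * e `^ q^-1 * (t2 `^ q^-1 * t2 `^ (1 - q^-1)) by ring.
rewrite -powRD; last by apply/implyP => _; rewrite gt_eqF.
by rewrite subrKC powRr1 ?(ltW t20)// -mulrDl ler_pM2r.
Qed.

End level_set_bound.

(** * Counting levels and summing over them *)

Section counting.

Lemma count_iota_itv (a b m k : nat) : (count (fun j => a <= j < b) (iota m k) <= b - a)%N.
Proof.
rewrite -size_filter -(size_iota a (b - a)); apply: uniq_leq_size.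
  by rewrite filter_uniq ?iota_uniq.
move=> j; rewrite mem_filter mem_iota => /andP[/andP[aj jb] _].
by rewrite mem_iota aj /= subnKC// (leq_trans aj (ltnW jb)).
Qed.

(** Every solution is below t or within w of the least solution that is at least t. *)
Lemma count_clustered (P : pred nat) (t w m k : nat) :
  (forall i j, (t <= i)%N -> (i <= j)%N -> P i -> P j -> (j <= i + w)%N) ->
  (count P (iota m k) <= t + w.+1)%N.
Proof.
move=> HP; have [/hasP[i0 _ Pi0]|] := boolP (has (fun i => P i && (t <= i)%N) (iota m k)); last first.
  move=> /hasPn h; apply: leq_trans (leq_addr _ _); rewrite -[leqRHS](subn0 t).
  apply: leq_trans (count_iota_itv 0 t m k); rewrite -!size_filter; apply: uniq_leq_size.
    by rewrite filter_uniq ?iota_uniq.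
  move=> j; rewrite !mem_filter => /andP[Pj jm]; rewrite jm andbT /= ltnNge.
  by have := h j jm; rewrite Pj.
have ex : exists i, P i && (t <= i)%N by exists i0.
case: (ex_minnP ex) => i /andP[Pi ti] imin.
apply: leq_trans (leq_add (_ : count (fun j => 0 <= j < t)%N (iota m k) <= t)%N (_ : count (fun j => i <= j < i + w.+1)%N (iota m k) <= w.+1)%N).
- rewrite -count_predUI; apply: leq_trans (leq_addr _ _); apply: sub_count => j Pj /=.
  have [//|tj] := ltnP j t; rewrite /= addnS ltnS.
  have ij : (i <= j)%N by apply: imin; rewrite Pj.
  by rewrite ij HP.
- by rewrite -[leqRHS](subn0 t) count_iota_itv.
- by rewrite -[leqRHS](addKn i) count_iota_itv.
Qed.

End counting.

Section exponential_sum.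
Context {R : realType}.
Variables (kap c D : R) (s e : nat -> R) (pos : pred nat).
Hypotheses (kap0 : 0 <= kap) (c0 : 0 < c) (D0 : 0 <= D).
Hypothesis e0 : forall j, 0 <= e j.
Hypothesis diag : forall j, (0 < j)%N -> pos j ->
  j%:R + c * (e j * j%:R) <= s j + kap * ln j%:R + D.
Hypothesis offdiag : forall i j, (0 < i)%N -> (i <= j)%N -> pos i -> pos j ->
  j%:R <= s i + kap * ln j%:R + D + D * (e i * j%:R) + (s j - s i) / 4.

(** The excess of level j. With s j = ln (P / mu_j), exp(- del j) is e^j j^(-kap) mu_j / P, the term
    to be summed. The hypothesis [diag] bounds it below by -D and shows that small excess forces e j
    to be O(1/j). *)
Let del j : R := s j + kap * ln j%:R - j%:R.

Lemma del_ge j : (0 < j)%N -> pos j -> - D <= del j /\ e j * j%:R <= (del j + D) / c.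
Proof.
move=> j0 pj; have H := diag j0 pj.
have ce0 : 0 <= c * (e j * j%:R) by rewrite !mulr_ge0 ?(ltW c0)// ler0n.
split; first by rewrite /del; lra.
rewrite ler_pdivlMr// mulrC; rewrite /del; lra.
Qed.

(** In [offdiag], s i and s j are expressed through the excesses, so s j - s i is j - i up to the
    excesses and kap (ln j - ln i). The latter is at most kap (j - i)/i, and e i * j is e i * i =
    O(l) times 1 + (j - i)/i; for i above the stated multiple of l these terms take at most a
    quarter of j - i. With the quarter already present in [offdiag], half of j - i remains on the
    left, whence the constants 5/2 and 2. *)
Lemma del_clustered (i j : nat) (l : R) : 1 <= l -> (0 < i)%N -> (i <= j)%N -> pos i -> pos j ->
  del i <= l -> del j <= l -> 4 * (kap + D * (1 + D) / c) * l <= i%:R ->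
  j%:R <= i%:R + (5 / 2 * (1 + D) + 2 * D * (1 + D) / c) * l.
Proof.
move=> l1 i0 ij pi pj di dj il; have H := offdiag i0 ij pi pj.
have [di' ei] := del_ge i0 pi; have [dj' _] := del_ge (leq_trans i0 ij) pj.
have ip : 0 < i%:R :> R by rewrite ltr0n.
have jp : 0 < j%:R :> R by rewrite ltr0n (leq_trans i0 ij).
set x : R := i%:R in il ip *; set y : R := j%:R in H jp *.
have xy : x <= y by rewrite ler_nat.
have c'0 : 0 < c^-1 by rewrite invr_gt0.
pose E := (1 + D) * l / c.
have E0 : 0 <= E by rewrite /E !mulr_ge0 ?(ltW c'0) ?addr_ge0// (le_trans ler01).
have lD : l + D <= (1 + D) * l by rewrite mulrDl mul1r lerD2l ler_peMr.
have eE : e i * x <= E.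
  apply: le_trans ei _; rewrite /E ler_wpM2r ?(ltW c'0)//; lra.
have il' : 4 * (kap * l + D * E) <= x.
  by apply: le_trans il; rewrite le_eqVlt; apply/orP; left; apply/eqP; rewrite /E; field; rewrite gt_eqF.
have kl : kap <= kap * l by rewrite ler_peMr.
have lnE : ln y - ln x <= (y - x) / x.
  rewrite -ln_div ?posrE// mulrBl divff ?gt_eqF//.
  have yx : 0 < y / x by rewrite divr_gt0.
  by have := expR_ge1Dx (ln (y / x)); rewrite lnK ?posrE// => h; lra.
have d0 : 0 <= y - x by rewrite subr_ge0.
pose w := (y - x) / x.
have w0 : 0 <= w by rewrite divr_ge0// ltW.
have wx : w * x = y - x by rewrite divfK// gt_eqF.
have kw0 : 0 <= kap * w by rewrite mulr_ge0.
have T1 : kap * (ln y - ln x) <= kap * w by rewrite ler_wpM2l.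
have eyE : e i * y = e i * x + (e i * x) * w.
  by rewrite -mulrA [x * w]mulrC wx; ring.
have T2 : e i * y <= E + E * w by rewrite eyE lerD// ler_wpM2r.
have T3 : D * (e i * y) <= D * (E + E * w) by rewrite ler_wpM2l.
have T4 : (kap * l + D * E) * w <= (y - x) / 4.
  by rewrite -wx -subr_ge0 (_ : _ - _ = w * (x - 4 * (kap * l + D * E)) / 4); [rewrite divr_ge0// mulr_ge0// subr_ge0|field].
have T5 : kap * w <= kap * l * w by rewrite ler_wpM2r.
have -> : (5 / 2 * (1 + D) + 2 * D * (1 + D) / c) * l = 5 / 2 * ((1 + D) * l) + 2 * (D * E).
  by rewrite /E; field; rewrite gt_eqF.
move: di dj di' dj'; rewrite /del -/x -/y => di dj di' dj'.
set DE := D * E in T4 T3 *; have T3' : D * (e i * y) <= DE + DE * w by rewrite (le_trans T3)// /DE mulrDr mulrA.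
set DEw := DE * w in T3'; have T4' : kap * l * w + DEw <= (y - x) / 4 by rewrite /DEw -mulrDl.
set klw := kap * l * w in T4' T5; set kw := kap * w in T1 T5 kw0; set Dl := (1 + D) * l in lD *.
set De := D * (e i * y) in H T3'; clear - kw0 H T1 T3' T4' T5 di dj di' dj' lD.
rewrite mulrBr in T1; lra.
Qed.

Definition cluster_bound : nat :=
  (2 * Num.bound (Num.max `|4 * (kap + D * (1 + D) / c)| `|5 / 2 * (1 + D) + 2 * D * (1 + D) / c|)).+2.

Lemma count_del (l J : nat) : (0 < l)%N ->
  (count (fun j => pos j && (del j <= l%:R)%R) (iota 1 J) <= cluster_bound * l)%N.
Proof.
move=> l0; rewrite /cluster_bound.
set b1 := 4 * (kap + D * (1 + D) / c); set b2 := 5 / 2 * (1 + D) + 2 * D * (1 + D) / c.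
set b := Num.bound _; have b1b : b1 <= b%:R.
  by apply: ltW; apply: le_lt_trans (archi_boundP _); rewrite le_max ?normr_ge0// ler_norm.
have b2b : b2 <= b%:R.
  by apply: ltW; apply: le_lt_trans (archi_boundP _); rewrite le_max ?normr_ge0// ler_norm orbT.
have l1 : 1 <= l%:R :> R by rewrite ler1n.
have l00 : 0 <= l%:R :> R by rewrite ler0n.
apply: (@leq_trans ((b * l).+1 + (b * l).+1)%N); last first.
  by rewrite -addn2 mulnDl -mulnA mul2n addSn addnS -addnn -addn2 leq_add2l leq_pmulr.
have -> : count (fun j => pos j && (del j <= l%:R)%R) (iota 1 J) = count (fun j => [&& (0 < j)%N, pos j & (del j <= l%:R)%R]) (iota 1 J).
  by apply: eq_in_count => j; rewrite mem_iota => /andP[->].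
apply: count_clustered => i j ti ij /and3P[i0 pi di] /and3P[j0 pj dj].
rewrite -(ler_nat R) natrD natrM; have := del_clustered l1 i0 ij pi pj di dj.
move=> /(_ _)/le_trans; apply; last by rewrite lerD2l ler_wpM2r.
apply: le_trans (_ : b%:R * l%:R <= _); first by rewrite ler_wpM2r.
by rewrite -natrM ler_nat ltnW.
Qed.

Lemma geometric_le (x : R) (m : nat) : 0 <= x < 1 -> \sum_(0 <= i < m) x ^+ i <= (1 - x)^-1.
Proof.
move=> /andP[x0 x1]; have x1' : 0 < 1 - x by rewrite subr_gt0.
rewrite -[leRHS]mul1r ler_pdivlMr// mulrC -opprB mulNr big_mkord -subrX1 opprB.
by rewrite gerBl exprn_ge0.
Qed.

(** The inequality l e^-l <= 2 e^(-l/2) reduces the sum over the bands to a geometric series of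
    ratio e^(-1/2); the factor e^(D+1) pays for rounding the excess. *)
Definition exp_sum_const : R := expR (D + 1) * (2 * cluster_bound%:R * (1 - expR (- 2^-1))^-1).

Let x : R := expR (- 2^-1).

Let x01 : 0 <= x < 1.
Proof. by rewrite expR_ge0 /= expR_lt1 oppr_lt0 invr_gt0. Qed.

Lemma exp_sum_const_gt0 : 0 < exp_sum_const.
Proof. by rewrite !mulr_gt0 ?expR_gt0// ?ltr0n// invr_gt0 subr_gt0; case/andP: x01. Qed.

(** At most O(l) levels have excess at most l, so the sum is controlled by the convergent sum of l
    e^-l. *)
Lemma exponential_sum (J : nat) : \sum_(1 <= j < J.+1 | pos j) expR (- del j) <= exp_sum_const.
Proof.
(* [truncn] sends negative numbers to 0, so the levels whose excess lies between -D and 0 join the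
   first band. *)
pose m j := (Num.truncn (del j)).+1.
pose M := (\max_(1 <= j < J.+1) m j).+1.
have mM j : (1 <= j < J.+1)%N -> (m j < M)%N.
  by move=> jJ; rewrite ltnS; apply: (@leq_bigmax_seq _ (index_iota 1 J.+1) predT m) => //; rewrite mem_index_iota.
have step j : (0 < j)%N -> pos j -> expR (- del j) <= expR (D + 1) * expR (- (m j)%:R).
  move=> j0 pj; rewrite -expRD ler_expR; have [dD _] := del_ge j0 pj.
  have [d0|d0] := leP 0 (del j).
    have mE : (m j)%:R = (Num.truncn (del j))%:R + 1 :> R by rewrite natr1.
    by have /andP[h _] := truncn_itv d0; rewrite mE [X in _ <= X](_ : _ = D - (Num.truncn (del j))%:R); [rewrite lerNl opprB (le_trans _ h)// lerBlDr lerDl|ring].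
  have -> : m j = 1%N by rewrite /m; congr S; apply/eqP; rewrite -leqn0 truncn_le_nat (lt_trans d0)// ltr0n.
  lra.
(* Each term is bounded by a sum over all bands l >= m j; after exchanging the sums only cumulative
   counts are needed, which is what [count_del] gives. *)
apply: (@le_trans _ _ (\sum_(1 <= j < J.+1 | pos j) \sum_(1 <= l < M | (m j <= l)%N) expR (D + 1) * expR (- l%:R))).
  rewrite big_seq_cond [leRHS]big_seq_cond; apply: ler_sum => j /andP[]; rewrite mem_index_iota => jJ pj.
  have [j1 jJ'] := andP jJ; apply: le_trans (step j j1 pj) _.
  rewrite (big_cat_nat (_ : (1 <= m j)%N) (ltnW (mM j jJ)))//=.
  apply: ler_wpDl; first by apply: sumr_ge0 => l _; rewrite mulr_ge0// expR_ge0.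
  rewrite big_ltn_cond ?mM// leqnn lerDl; apply: sumr_ge0 => l _; by rewrite mulr_ge0// expR_ge0.
rewrite (exchange_big_dep predT)//=.
apply: (@le_trans _ _ (\sum_(1 <= l < M) expR (D + 1) * (2 * cluster_bound%:R * x ^+ l))).
  rewrite big_seq_cond [leRHS]big_seq_cond; apply: ler_sum => l /andP[]; rewrite mem_index_iota => /andP[l0 _] _.
  rewrite -big_distrr/= ler_wpM2l ?expR_ge0//.
  rewrite big_const_seq iter_addr_0.
  have cl : (count (fun j => pos j && (m j <= l)%N) (index_iota 1 J.+1) <= cluster_bound * l)%N.
    apply: leq_trans (count_del J l0); rewrite /index_iota subn1; apply: sub_count => j /andP[-> mjl] /=.
    by rewrite ltW// (lt_le_trans (truncnS_gt _))// ler_nat.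
  apply: (@le_trans _ _ ((cluster_bound * l)%:R * expR (- l%:R))).
    by rewrite -[leLHS]mulr_natl ler_wpM2r ?expR_ge0// ler_nat.
  have lx : l%:R * expR (- l%:R) <= 2 * x ^+ l :> R.
    rewrite /x -expRM_natl; have -> : expR (- l%:R) = expR (l%:R * - 2^-1) * expR (- (l%:R / 2)) :> R.
      by rewrite -expRD; congr expR; field.
    rewrite mulrCA [leRHS]mulrC ler_wpM2l ?expR_ge0// expRN ler_pdivrMr ?expR_gt0//.
    have := expR_ge1Dx (l%:R / 2 : R); lra.
  by rewrite natrM -mulrA [2 * _]mulrC -mulrA ler_wpM2l ?ler0n.
rewrite -big_distrr/= ler_wpM2l ?expR_ge0// -big_distrr/= ler_wpM2l ?mulr_ge0 ?ler0n//.
apply: le_trans (geometric_le M x01); rewrite [leRHS]big_ltn// lerDr exprn_ge0//; by case/andP: x01.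
Qed.

End exponential_sum.

(** * The truncated exponential *)

Section truncated_exponential.
Context {R : realType}.
Implicit Types (t X : R) (N M : nat).

Lemma exp_sum_le t M : 0 <= t -> \sum_(0 <= j < M) t ^+ j / j`!%:R <= expR t.
Proof.
move=> t0; have nd : nondecreasing_seq (series (exp_coeff t)).
  by apply/nondecreasing_series => i _ _; exact: exp_coeff_ge0.
exact: (nondecreasing_cvgn_le nd (is_cvg_series_exp_coeff t) M).
Qed.

Lemma expN_ge_sum N M t : 0 <= t -> \sum_(N.+1 <= j < M) t ^+ j / j`!%:R <= expN N t.
Proof.
move=> t0; have [NM|MN] := leqP N.+1 M; last first.
  by rewrite big_geq ?(ltnW MN)// /expN subr_ge0 exp_sum_le.
by rewrite /expN lerBrDl -big_cat_nat//= exp_sum_le.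
Qed.

Lemma expN_le N t X : (forall M, \sum_(N.+1 <= j < M) t ^+ j / j`!%:R <= X) -> expN N t <= X.
Proof.
move=> h; rewrite /expN lerBlDl /expR; apply: limr_le; first exact: is_cvg_series_exp_coeff.
exists N.+1 => // M /= NM; rewrite /series/= (big_cat_nat _ NM)//=.
by rewrite lerD2l; exact: h.
Qed.

Lemma expN_ge0 N t : 0 <= t -> 0 <= expN N t.
Proof. by move=> t0; have := expN_ge_sum N 0 t0; rewrite big_geq. Qed.

Lemma expN_le_exp N t : 0 <= t -> expN N t <= expR t.
Proof. by move=> t0; rewrite /expN gerBl sumr_ge0// => j _; rewrite divr_ge0 ?exprn_ge0. Qed.

Lemma expN0 N : expN N 0 = 0 :> R.
Proof.
rewrite /expN expR0 big_ltn// big1_seq; first by rewrite expr0 fact0 divr1 addr0 subrr.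
by move=> j /andP[_]; rewrite mem_index_iota => /andP[j0 _]; rewrite expr0n gtn_eqF// mul0r.
Qed.

Lemma expN_le_pow N t : 0 <= t <= 1 -> expN N t <= t ^+ N.+1 * expR 1.
Proof.
move=> /andP[t0 t1]; apply: expN_le => M.
apply: (@le_trans _ _ (t ^+ N.+1 * \sum_(N.+1 <= j < M) 1 ^+ j / j`!%:R)).
  rewrite big_distrr/= big_seq_cond [leRHS]big_seq_cond; apply: ler_sum => j /andP[].
  rewrite mem_index_iota => /andP[Nj _] _; rewrite expr1n mul1r ler_wpM2r ?invr_ge0//.
  by rewrite ler_wiXn2l.
rewrite ler_wpM2l ?exprn_ge0// (le_trans (expN_ge_sum N M ler01))//.
exact: expN_le_exp.
Qed.

(** For j <= N one has t^j <= 2^N (t/2)^j, so the removed sum is at most 2^N e^(t/2), and the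
    hypothesis makes this at most half of e^t. *)
Lemma expN_ge N t : 0 <= t -> 2 ^+ N.+1 <= expR (t / 2) -> expR t / 2 <= expN N t.
Proof.
move=> t0 h; have t20 : 0 <= t / 2 by rewrite divr_ge0.
have : \sum_(0 <= j < N.+1) t ^+ j / j`!%:R <= 2 ^+ N * expR (t / 2).
  apply: le_trans (ler_wpM2l _ (exp_sum_le N.+1 t20)); last by rewrite exprn_ge0.
  rewrite big_distrr/= big_seq_cond [leRHS]big_seq_cond; apply: ler_sum => j /andP[].
  rewrite mem_index_iota ltnS => /andP[_ jN] _; rewrite mulrA ler_wpM2r ?invr_ge0//.
  rewrite -{1}[t](divfK (_ : 2 != 0))// exprMn mulrC ler_wpM2r ?exprn_ge0//.
  by rewrite ler_eXn2l// ltr1n.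
have : 2 ^+ N.+1 * expR (t / 2) <= expR (t / 2) * expR (t / 2) by rewrite ler_wpM2r ?expR_ge0.
rewrite -expRD -splitr exprS -mulrA /expN => h1 h2; rewrite lerBrDl.
move: h1 h2; move: (2 ^+ N * _) (\sum_(_ <= _ < _) _) (expR t) => y1 y2 y3; lra.
Qed.

(* sup_j (j + 1) lam ^ j <= (1 - lam)^-1 absorbs the linear factor. *)
Lemma expN_absorb N (lam b t : R) : 0 <= lam < 1 -> 0 <= b -> 0 <= t ->
  expN N (lam * t) * (1 + b * t) <= (1 + b) / (1 - lam) * expN N t.
Proof.
move=> /andP[l0 l1] b0 t0; have l1' : 0 < 1 - lam by rewrite subr_gt0.
have bt : 0 < 1 + b * t by rewrite ltr_pwDl// mulr_ge0.
rewrite -ler_pdivlMr//; apply: expN_le => M; rewrite ler_pdivlMr//.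
have li : 1 <= (1 - lam)^-1 by rewrite invf_ge1// gerBl.
have key j : lam ^+ j * (j.+1)%:R <= (1 - lam)^-1.
  apply: le_trans (@geometric_le _ lam j.+1 _); last by rewrite l0.
  have -> : lam ^+ j * j.+1%:R = \sum_(0 <= i < j.+1) lam ^+ j by rewrite sumr_const_nat subn0 mulr_natr.
  by apply: ler_sum_nat => i /andP[_ ij]; rewrite ler_wiXn2l// ltW.
rewrite mulrDr mulr1 mulrDl mul1r [leRHS]mulrDl; apply: lerD.
  apply: (@le_trans _ _ (\sum_(N.+1 <= j < M) t ^+ j / j`!%:R)).
    apply: ler_sum => j _; rewrite ler_wpM2r ?invr_ge0// exprMn ler_piMl ?exprn_ge0//.
    by rewrite exprn_ile1// ltW.
  by rewrite (le_trans (expN_ge_sum N M t0))// ler_peMl// expN_ge0.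
rewrite -!mulrA mulrCA ler_wpM2l// big_distrl/=.
have [NM|MN] := leqP N.+1 M; last first.
  by rewrite big_geq ?(ltnW MN)// mulr_ge0 ?expN_ge0// invr_ge0 ltW.
apply: (@le_trans _ _ (\sum_(N.+1 <= j < M) (1 - lam)^-1 * (t ^+ j.+1 / (j.+1)`!%:R))).
  apply: ler_sum => j _; have -> : (lam * t) ^+ j / j`!%:R * t = lam ^+ j * j.+1%:R * (t ^+ j.+1 / (j.+1)`!%:R).
    rewrite factS natrM exprMn exprSr; field; rewrite pnatr_eq0 -lt0n fact_gt0 /= nat1r pnatr_eq0//.
  by rewrite ler_wpM2r// divr_ge0 ?exprn_ge0.
rewrite -big_distrr/= ler_wpM2l ?invr_ge0 ?(ltW l1')//.
rewrite -(big_add1 _ _ N.+1 M.+1 predT (fun j => t ^+ j / j`!%:R)).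
apply: le_trans (expN_ge_sum N M.+1 t0); rewrite (big_ltn (_ : N.+1 < M.+1)%N)//.
by rewrite lerDr divr_ge0 ?exprn_ge0.
Qed.

End truncated_exponential.

(** * Linearisation of the level estimate *)

Section real_inequalities.
Context {R : realType}.

(** After division by (A y)^(1/q'), Young's inequality is applied to the pairs (1 - e, X/y) and (K
    e, W'/y), where W' is the term in W of the conclusion; multiplication by q' y and q' = q'/q + 1
    give the claim. The last term of the hypothesis is of size y^(-1/q), exactly what becomes a
    constant. K < 1 leaves a positive multiple of e y on the left, a large K makes the coefficient
    of W small. *)
Lemma linearize (q q' A C K y e X W : R) : 0 < q -> 0 < q' -> q^-1 + q'^-1 = 1 ->
  0 < A -> 0 <= C -> 0 < K -> 0 < y -> 0 <= e <= 1 -> 0 <= X -> 0 <= W ->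
  (A * y) `^ q'^-1 <= (1 - e) `^ q^-1 * (A * X) `^ q'^-1 + C * e `^ q^-1 * W `^ q'^-1 + C * y `^ (- q^-1) ->
  y + q' / q * (1 - K) * (e * y) <= X + K `^ (- (q' / q)) * C `^ q' / A * W + q' * C * A `^ (- q'^-1).
Proof.
move=> q0 q'0 qq A0 C0 K0 y0 /andP[e0 e1] X0 W0 H.
have Ay : 0 < A * y by rewrite mulr_gt0.
have l0 : 0 < (A * y) `^ q'^-1 by rewrite powR_gt0.
have e1' : 0 <= 1 - e by rewrite subr_ge0.
have yg a b : 0 <= a -> 0 <= b -> a `^ q^-1 * b `^ q'^-1 <= a / q + b / q'.
  move=> a0 b0; have := conjugate_powR (powR_ge0 a q^-1) (powR_ge0 b q'^-1) q0 q'0 qq.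
  by rewrite -!powRrM !mulVf ?gt_eqF// !powRr1.
have H1 := yg _ (X / y) e1' (divr_ge0 X0 (ltW y0)).
pose W' := K `^ (- (q' / q)) * C `^ q' / A * W.
have W'0 : 0 <= W' by rewrite !mulr_ge0 ?powR_ge0// invr_ge0 ltW.
have H2 := yg (K * e) (W' / y) (mulr_ge0 (ltW K0) e0) (divr_ge0 W'0 (ltW y0)).
have E1 : (X / y) `^ q'^-1 = (A * X) `^ q'^-1 / (A * y) `^ q'^-1.
  by apply: (@mulIf _ ((A * y) `^ q'^-1)); rewrite ?gt_eqF// divfK ?gt_eqF// -powRM ?divr_ge0 ?(ltW y0) ?(ltW Ay)//; congr (_ `^ _); field; rewrite gt_eqF.
have E2 : (K * e) `^ q^-1 * (W' / y) `^ q'^-1 = C * e `^ q^-1 * W `^ q'^-1 / (A * y) `^ q'^-1.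
  have P0 : (A * y) `^ q'^-1 != 0 by rewrite gt_eqF.
  apply: (canRL (mulfK P0)).
  transitivity ((K * e) `^ q^-1 * ((W' / y) `^ q'^-1 * (A * y) `^ q'^-1)); first by rewrite mulrA.
  rewrite -(powRM _ (divr_ge0 W'0 (ltW y0)) (ltW Ay)).
  have -> : W' / y * (A * y) = K `^ (- (q' / q)) * (C `^ q' * W) by rewrite /W'; field; rewrite !gt_eqF.
  rewrite !powRM ?powR_ge0 ?mulr_ge0 ?powR_ge0 ?(ltW K0)// -!powRrM divff ?gt_eqF// powRr1//.
  have -> : - (q' / q) / q' = - q^-1 by field; rewrite !gt_eqF.
  have KK : K `^ q^-1 * K `^ (- q^-1) = 1.
    by rewrite -powRD; [rewrite subrr powRr0|apply/implyP => _; rewrite gt_eqF].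
  by transitivity (K `^ q^-1 * K `^ (- q^-1) * (C * e `^ q^-1 * W `^ q'^-1)); [ring|rewrite KK mul1r].
have E3 : C * y `^ (- q^-1) / (A * y) `^ q'^-1 = C * A `^ (- q'^-1) / y.
  rewrite (powRM _ (ltW A0) (ltW y0)) invfM -!powRN mulrACA; congr (_ * _).
  rewrite -(powR_inv1 (ltW y0)) -powRD; last by apply/implyP => _; rewrite gt_eqF.
  by congr (_ `^ _); rewrite -opprD qq.
have H3 : 1 <= (1 - e) `^ q^-1 * (X / y) `^ q'^-1 + (K * e) `^ q^-1 * (W' / y) `^ q'^-1 + C * A `^ (- q'^-1) / y.
  rewrite E2 E1 -E3 mulrA -!mulrDl ler_pdivlMr// mul1r.
  exact: H.
have : 1 <= (1 - e) / q + (X / y) / q' + (K * e / q + W' / y / q') + C * A `^ (- q'^-1) / y.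
  by apply: le_trans H3 _; rewrite lerD2r lerD.
have qy : 0 < q' * y by rewrite mulr_gt0.
rewrite -(ler_pM2l qy) mulr1.
have qE : q' = q' / q + 1 by rewrite -[X in _ = _ + X](divff (lt0r_neq0 q'0)) -mulrDr qq mulr1.
have -> : q' * y * ((1 - e) / q + X / y / q' + (K * e / q + W' / y / q') + C * A `^ (- q'^-1) / y) =
    q' / q * y * (1 - e) + X + (q' / q * y * (K * e) + W') + q' * C * A `^ (- q'^-1) by field; rewrite !gt_eqF.
rewrite {1}qE -/W'; move: (q' / q) (q' * C * _) => G c3.
have -> : G * (1 - K) * (e * y) = G * y * e - G * y * (K * e) by ring.
have -> : (G + 1) * y = G * y + y by ring.
have -> : G * y * (1 - e) = G * y - G * y * e by ring.
move: (G * y * e) (G * y * (K * e)) (G * y) => a b c'; lra.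
Qed.

End real_inequalities.

(** * Positivity of the constant A *)

Section adams_const_positive.
Context {R : realType} {n alpha : nat}.
Local Notation H := (heis R n).
Local Notation mu := (heis_measure R n).
Local Notation Q := (hdim n).
Local Notation k := (alpha./2).
Variables (g : R -> R) (sigma : {measure set H -> \bar R}).
Hypotheses (halpha : ~~ odd alpha) (halpha0 : (0 < alpha < Q)%N).
Hypothesis hsigma : is_polar_measure sigma.
Hypothesis hg : is_fundamental n alpha g.
Local Notation G := (@fundG R n alpha g).
Local Notation a := (alpha%:R : R).
Local Notation Qr := (Q%:R : R).
Local Notation q := (Qr / a).
Local Notation q' := (Qr / (Qr - a)).
Local Notation A := (adams_const sigma alpha g).

Opaque Z sublap fundG Hker Kker adams_const.

(** If A were 0, the kernel would contribute nothing on any shell, and the integral of G times the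
    image under L^k of a cutoff would reduce to a ball of radius eps, where it is O(eps^alpha); but
    it equals the value 1 of the cutoff at 0. *)
Lemma adams_const_gt0 : 0 < A.
Proof.
rewrite lt_neqAle (A_ge0 halpha0 hsigma hg) andbT; apply/negP => /eqP A0.
pose phi : H -> R := hcut 1; have tphi : test phi by exact: test_hcut.
pose D := iter k sublap phi; have tD : test D by exact: iter_sublap_test.
have [M M0 HM] := test_bounded tD; have [r0 r00 Hr0] := bsupp_hcut tD.2.
have [C C0 HC] := near_integral halpha0 hsigma hg.
have mG := measurable_fundG halpha0 hg; have mD := smooth_meas tD.1.
have phi0 : phi 0 = 1 by rewrite /phi hcut1// hnorm0.
have E := fundG_fund hg tphi; rewrite phi0 -/D in E.
have key eps : 0 < eps -> eps < r0 -> 1 <= M * (C * eps ^+ alpha).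
  move=> e0 er; have e2 : eps < 2 * r0 by apply: lt_trans er _; rewrite ltr_pMl// ltr1n.
  have mGD : measurable_fun setT (fun x => G x * D x) by exact: measurable_funM.
  have mGb := measurable_Gball halpha0 hg eps; have mGs := measurable_Gshell halpha0 hg eps (2 * r0).
  pose b : H -> R := \1_(hball (2 * r0)).
  have mb : measurable_fun setT b by exact: measurable_indic (measurable_hball _).
  have b0 y : 0 <= b y by [].
  have [C' C'0 HC'] := ball_volume hsigma.
  have X0 : 0 <= C' * (2 * r0) ^+ Q by rewrite mulr_ge0 ?exprn_ge0 ?(ltW C'0) ?mulr_ge0 ?(ltW r00).
  have bX : (\int[mu]_y (b y `^ q)%:E <= (C' * (2 * r0) ^+ Q)%:E)%E.
    apply: le_trans (HC' _ _); last by rewrite mulr_gt0.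
    rewrite -[X in mu X]setIT -integral_indic//; last exact: measurable_hball.
    rewrite le_eqVlt; apply/orP; left; apply/eqP; apply: eq_integral => y _.
    by rewrite /b indicE; case: (_ \in _); rewrite ?powR1// powR0// gt_eqF// (q_gt0 halpha0).
  have := shell_bound halpha0 hsigma hg (0 : H) mb b0 X0 bX e0 e2.
  rewrite -A0 !mul0r powR0 ?mulr0 ?invr_eq0 ?gt_eqF ?(q'_gt0 halpha0)// => S0.
  rewrite -lee_fin -E; apply: (@le_trans _ _ (`|\int[mu]_x (G x * D x)|%:E)); first by rewrite lee_fin ler_norm.
  apply: le_trans (abs_Rintegral_le mu mGD) _.
  apply: (@le_trans _ _ (\int[mu]_x (M%:E * ((Gball (alpha := alpha) g eps x)%:E + (b x * Gshell (alpha := alpha) g eps (2 * r0) (hmul (- 0) x))%:E)))%E).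
    apply: ge0_le_integral => //.
    - by apply/measurable_EFinP; exact: measurableT_comp.
    - apply: emeasurable_funM => //; apply: emeasurable_funD; apply/measurable_EFinP => //.
      by apply: measurable_funM => //; exact: measurable_translate.
    move=> x _; rewrite -EFinD -EFinM lee_fin normrM oppr0 hmul0l.
    have [xr|xr] := ltP r0 (hnorm x).
      by rewrite (Hr0 r0) ?lexx// normr0 mulr0 mulr_ge0 ?addr_ge0 ?mulr_ge0 ?(ltW M0).
    rewrite mulrC ler_pM// /b !indicE /Gball /Gshell !indicE.
    have xb : x \in hball (2 * r0) by apply/mem_set; rewrite /hball/= (le_trans xr)// ler_peMl ?(ltW r00)// ler1n.
    rewrite xb mul1r; have [xe|] := boolP (x \in hball eps); first by rewrite mulr1 lerDl mulr_ge0.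
    rewrite notin_setE /hball/= => /negP; rewrite -ltNge => xe.
    have -> : x \in hshell eps (2 * r0).
      by apply/mem_set; rewrite /hshell/= in_itv/= xe (le_lt_trans xr)// ltr_pMl// ltr1n.
    by rewrite mulr0 add0r mulr1.
  rewrite ge0_integralZl//; last 3 first.
  - apply: emeasurable_funD; apply/measurable_EFinP => //.
    by apply: measurable_funM => //; exact: measurable_translate.
  - by move=> x _; rewrite -EFinD lee_fin addr_ge0 ?mulr_ge0.
  - by rewrite lee_fin ltW.
  rewrite EFinM lee_wpmul2l ?lee_fin ?(ltW M0)// ge0_integralD//; last 4 first.
  - by move=> x _; rewrite lee_fin mulr_ge0.
  - exact/measurable_EFinP.
  - by move=> x _; rewrite lee_fin !mulr_ge0.
  - by apply/measurable_EFinP; apply: measurable_funM => //; exact: measurable_translate.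
  by rewrite -[leRHS]adde0; apply: leeD => //; exact: HC.
pose eps := Num.min (Num.min 1 (r0 / 2)) (M * C * 2)^-1.
have MC : 0 < M * C * 2 by rewrite !mulr_gt0.
have e0 : 0 < eps by rewrite !lt_min ltr01 divr_gt0//= invr_gt0.
have er : eps < r0 by rewrite !gt_min ltr_pdivrMr// ltr_pMr// ltr1n orbT.
have e1 : eps <= 1 by rewrite !ge_min lexx.
have e2 : eps <= (M * C * 2)^-1 by rewrite !ge_min lexx orbT.
have ea : eps ^+ alpha <= eps by rewrite -[leRHS]expr1 ler_wiXn2l ?(ltW e0)//; case/andP: halpha0.
have := key _ e0 er; rewrite leNgt => /negP; apply.
rewrite mulrA (le_lt_trans (ler_wpM2l _ ea)) ?mulr_ge0 ?(ltW M0) ?(ltW C0)//.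
rewrite (le_lt_trans (ler_wpM2l _ e2)) ?mulr_ge0 ?(ltW M0) ?(ltW C0)//.
by rewrite invfM mulrA divff ?gt_eqF ?mulr_gt0// mul1r invf_lt1// ltr1n.
Qed.

End adams_const_positive.

(** * Summation over the levels of u *)

Section level_sums.
Context {R : realType} {n alpha : nat}.
Local Notation H := (heis R n).
Local Notation mu := (heis_measure R n).
Local Notation Q := (hdim n).
Local Notation k := (alpha./2).
Variables (g : R -> R) (sigma : {measure set H -> \bar R}).
Hypotheses (halpha : ~~ odd alpha) (halpha0 : (0 < alpha < Q)%N).
Hypothesis hsigma : is_polar_measure sigma.
Hypothesis hg : is_fundamental n alpha g.
Variables p q q' : R.
Hypotheses (p1 : 1 <= p) (hq : q = (Q%:R : R) / (alpha%:R : R)) (hq' : q' = (Q%:R : R) / ((Q%:R : R) - (alpha%:R : R))).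
Implicit Types (u f : H -> R) (P : R).
Local Notation a := (alpha%:R : R).
Local Notation Qr := (Q%:R : R).
Local Notation A := (adams_const sigma alpha g).
Local Notation kap := (p / q).

Opaque Z sublap fundG Hker Kker adams_const.

Let p0 : 0 < p. Proof. exact: lt_le_trans ltr01 p1. Qed.
Let q0 : 0 < q. Proof. by rewrite hq; exact: q_gt0 halpha0. Qed.
Let q'0 : 0 < q'. Proof. by rewrite hq'; exact: q'_gt0 halpha0. Qed.
Let qq : q^-1 + q'^-1 = 1. Proof. by rewrite hq hq'; exact: q_conj halpha0. Qed.
Let A0 : 0 < A. Proof. exact: adams_const_gt0 halpha0 hsigma hg. Qed.
Let kap0 : 0 <= kap. Proof. by rewrite divr_ge0 ?(ltW p0) ?(ltW q0). Qed.

Definition lvl u (j : nat) : set H := [set x | (A * j%:R) `^ q'^-1 <= `|u x|].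

Lemma measurable_lvl u j : measurable_fun setT u -> measurable (lvl u j).
Proof.
move=> mu_; have mn : measurable_fun setT (fun x => `|u x|) by exact: measurableT_comp.
rewrite (_ : lvl u j = (fun x => `|u x|) @^-1` `[(A * j%:R) `^ q'^-1, +oo[%classic).
  by rewrite -[X in measurable X]setTI; apply: mn.
by apply/seteqP; split => x; rewrite /lvl/= in_itv/= andbT.
Qed.

Lemma lvl_volume u P j : 0 <= P -> measurable_fun setT u -> (\int[mu]_x (`|u x| `^ p)%:E <= P%:E)%E -> (0 < j)%N ->
  exists2 N : R, mu (lvl u j) = N%:E & 0 <= N <= P * (A * j%:R) `^ (- (p / q')).
Proof.
move=> P0 mu_ uP j0; have Aj : 0 < A * j%:R by rewrite mulr_gt0// ltr0n.
have mL := measurable_lvl j mu_.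
have mn : measurable_fun setT (fun x => `|u x|) by exact: measurableT_comp.
have H := integral_ge_cst mu mL (measurable_powR_fun p mn) (fun x => powR_ge0 _ _) (powR_ge0 (A * j%:R) (p / q')).
have {}H : ((((A * j%:R) `^ (p / q'))%:E * mu (lvl u j)) <= P%:E)%E.
  apply: le_trans uP; apply: H => x xl /=; rewrite [p / q']mulrC powRrM.
  exact: (ge0_ler_powR (ltW p0) (powR_ge0 _ _) (normr_ge0 _) xl).
have Ap : 0 < (A * j%:R) `^ (p / q') by rewrite powR_gt0.
have m0 := measure_ge0 mu (lvl u j).
have mfin : mu (lvl u j) \is a fin_num.
  rewrite ge0_fin_numE//; move: H m0; case: (mu (lvl u j)) => [r||]//=; first by rewrite ltry.
  by rewrite gt0_muley ?lte_fin.
exists (fine (mu (lvl u j))); first by rewrite fineK.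
rewrite fine_ge0//= powRN ler_pdivlMr// mulrC -lee_fin EFinM fineK//.
Qed.

Lemma lvl_sum : exists2 C, 0 < C & forall u f P, 0 < P -> measurable_fun setT u ->
  (\int[mu]_x (`|u x| `^ p)%:E <= P%:E)%E -> measurable_fun setT f ->
  (\int[mu]_x (`|f x| `^ q)%:E <= 1)%E -> weak_sublap k u f ->
  forall J : nat, (\sum_(1 <= j < J.+1) (expR j%:R * j%:R `^ (- kap))%:E * mu (lvl u j) <= (C * P)%:E)%E.
Proof.
have [C C0] := level_set_bound halpha halpha0 hsigma hg p1; rewrite -hq -hq' => HC.
(* By Chebyshev's inequality every level set from 1 on has measure at most A^(-p/q') P, so c0 P
   dominates them all; c0 >= 1 serves the bound on P / r^Q. *)
pose c0 := 1 + A `^ (- (p / q')).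
have c01 : 1 <= c0 by rewrite lerDl powR_ge0.
have c00 : 0 < c0 by exact: lt_le_trans ltr01 c01.
have Cq : 0 < C `^ q' by rewrite powR_gt0.
(* The value for which the coefficient of W in [linearize] is exactly 1/4. *)
pose K := (4 * C `^ q' / A) `^ (q / q').
have K0 : 0 < K by rewrite powR_gt0// !mulr_gt0// invr_gt0.
have KE : K `^ (- (q' / q)) * C `^ q' / A = 4^-1.
  rewrite /K -powRrM (_ : q / q' * - (q' / q) = -1); last by field; rewrite !gt_eqF.
  by rewrite powR_inv1 ?mulr_ge0 ?invr_ge0 ?(ltW Cq) ?(ltW A0)//; field; rewrite !gt_eqF.
pose D0 := ln c0 + C + 1 + q' * C * A `^ (- q'^-1).
pose D1 := 2^-1 `^ (- (q' / q)) * C `^ q' / A.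
pose D := D0 + D1 + q' / q * K.
have lc0 : 0 <= ln c0 by exact: ln_ge0.
have D00 : 0 <= D0 by rewrite !addr_ge0 ?mulr_ge0 ?powR_ge0 ?(ltW q'0) ?(ltW C0).
have D10 : 0 <= D1 by rewrite !mulr_ge0 ?powR_ge0 ?invr_ge0 ?(ltW A0).
have qK : 0 <= q' / q * K by rewrite mulr_ge0 ?divr_ge0 ?(ltW q'0) ?(ltW q0) ?(ltW K0).
have D_0 : 0 <= D := addr_ge0 (addr_ge0 D00 D10) qK.
pose c := q' / q / 2; have cp : 0 < c by rewrite !divr_gt0.
exists (exp_sum_const kap c D); first exact: exp_sum_const_gt0.
move=> u f P P0 mu_ uP mf f1 wu J.
have /choice[N HN] : forall j : nat, exists N : R, (0 < j)%N -> mu (lvl u j) = N%:E /\ 0 <= N <= P * (A * j%:R) `^ (- (p / q')).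
  move=> j; case: j => [|j]; first by exists 0.
  by have [N h1 h2] := lvl_volume (ltW P0) mu_ uP (ltn0Sn j); exists N.
(* Null levels contribute nothing to the sum and are set aside, since s j has no meaning for
   them. *)
pose pos j := 0 < N j; pose s j := ln (P / N j).
have /choice[e He] : forall i : nat, exists e : R, 0 <= e <= 1 /\ (pos i -> forall u (r P t2 lam : R) (V : set H), 0 < r -> 0 < P ->
  measurable_fun setT u -> (\int[mu]_y (`|u y| `^ p)%:E <= P%:E)%E -> weak_sublap k u f ->
  N i <= r ^+ Q -> 0 < t2 <= N i -> measurable V -> mu V = t2%:E -> (forall x, V x -> lam <= `|u x|) ->
  lam <= (1 - e) `^ q^-1 * (A * (ln (r ^+ Q / N i) + C)) `^ q'^-1 +
    C * e `^ q^-1 * (1 + ln (N i / t2)) `^ q'^-1 + C * (P / r ^+ Q) `^ p^-1).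
  move=> i; have [pi|pi] := boolP (pos i); last by exists 0; rewrite lexx ler01.
  by have [e e01 He] := HC f (N i) mf f1 pi; exists e.
have e0 j : 0 <= e j by have [/andP[]] := He j.
(* Level i selects the weight, with t1 the measure of level i, and the average is taken over the
   smaller level set j; i = j is allowed. *)
have main i j (K' : R) : (0 < i)%N -> (i <= j)%N -> pos i -> pos j -> 0 < K' ->
   j%:R + q' / q * (1 - K') * (e i * j%:R) <= ln c0 + kap * ln j%:R + s i + C +
     K' `^ (- (q' / q)) * C `^ q' / A * (1 + (s j - s i)) + q' * C * A `^ (- q'^-1).
  move=> i0 ij pi pj K'0; have j0 := leq_trans i0 ij; have jp : 0 < j%:R :> R by rewrite ltr0n.
  have j1 : 1 <= j%:R :> R by rewrite ler1n.
  have i1 : 1 <= i%:R :> R by rewrite ler1n.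
  have [hi /andP[_ Ni]] := HN i i0; have [hj /andP[_ Nj]] := HN j j0.
  have jk : 1 <= j%:R `^ kap by have := ge0_ler_powR kap0 ler01 (ltW jp) j1; rewrite powR1.
  have jk0 : 0 < j%:R `^ kap by exact: lt_le_trans ltr01 jk.
  have B0 : 0 < c0 * j%:R `^ kap * P by rewrite !mulr_gt0.
  have [r0 rQ _] := @Qroot R n alpha _ B0; set r := (c0 * j%:R `^ kap * P) `^ Qr^-1 in r0 rQ.
  have NiB : N i <= c0 * j%:R `^ kap * P.
    apply: le_trans Ni _; rewrite mulrC ler_wpM2r ?(ltW P0)//.
    apply: (@le_trans _ _ (A `^ (- (p / q')))).
      have pq : 0 <= p / q' by rewrite divr_ge0 ?(ltW p0) ?(ltW q'0).
      have Ai : 0 < A * i%:R by rewrite mulr_gt0// ltr0n.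
      rewrite (powRN A) (powRN (A * i%:R)) lef_pV2 ?posrE; [|exact: powR_gt0|exact: powR_gt0].
      by apply: (ge0_ler_powR pq (ltW A0) (ltW Ai)); rewrite ler_peMr// ltW.
    rewrite (le_trans _ (_ : c0 <= _))//; first by rewrite /c0 lerDr.
    by rewrite ler_peMr// ltW.
  have ss : N j <= N i.
    rewrite -lee_fin -hi -hj; apply: le_measure; rewrite ?inE; [exact: measurable_lvl|exact: measurable_lvl|].
    have Ai0 : 0 <= A * i%:R := mulr_ge0 (ltW A0) (ler0n _ _).
    have Aj0 : 0 <= A * j%:R := mulr_ge0 (ltW A0) (ler0n _ _).
    have qi : 0 <= q'^-1 by rewrite invr_ge0 ltW.
    move=> x; rewrite /lvl/=; apply: le_trans; apply: (ge0_ler_powR qi Ai0 Aj0).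
    by rewrite ler_wpM2l ?(ltW A0)// ler_nat.
  have [e01 /(_ pi u r P (N j) ((A * j%:R) `^ q'^-1) (lvl u j))] := He i.
  have NN : 0 < N j <= N i by apply/andP.
  rewrite rQ => /(_ r0 P0 mu_ uP wu NiB NN (measurable_lvl j mu_) hj (fun x h => h)) H.
  have E1 : ln (c0 * j%:R `^ kap * P / N i) = ln c0 + kap * ln j%:R + s i.
    have PN : 0 < P / N i := divr_gt0 P0 pi; have cj : 0 < c0 * j%:R `^ kap by exact: mulr_gt0.
    by rewrite -mulrA lnM ?posrE// lnM ?posrE// ln_powR.
  have E2 : ln (N i / N j) = s j - s i.
    have PN : 0 < P / N i := divr_gt0 P0 pi; have PN' : 0 < P / N j := divr_gt0 P0 pj.
    by rewrite /s -ln_div ?posrE//; congr ln; field; rewrite !gt_eqF.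
  have s0 : 0 <= s j - s i by rewrite -E2 ln_ge0// ler_pdivlMr// mul1r.
  have X0 : 0 <= ln (c0 * j%:R `^ kap * P / N i) + C.
    by rewrite addr_ge0 ?(ltW C0)// ln_ge0// ler_pdivlMr// mul1r.
  have H' : (A * j%:R) `^ q'^-1 <= (1 - e i) `^ q^-1 * (A * (ln (c0 * j%:R `^ kap * P / N i) + C)) `^ q'^-1 + C * e i `^ q^-1 * (1 + (s j - s i)) `^ q'^-1 + C * j%:R `^ (- q^-1).
    rewrite -E2; apply: le_trans H _; rewrite lerD2l ler_wpM2l ?(ltW C0)//.
    have -> : j%:R `^ (- q^-1) = (j%:R `^ (- kap)) `^ p^-1.
      by rewrite -powRrM; congr (_ `^ _); field; rewrite !gt_eqF.
    rewrite ge0_ler_powR ?nnegrE ?invr_ge0 ?(ltW p0) ?powR_ge0 ?divr_ge0 ?(ltW P0) ?(ltW B0)//.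
    rewrite powRN ler_pdivrMr// mulrC.
    have -> : c0 * j%:R `^ kap * P / j%:R `^ kap = c0 * P by field; rewrite gt_eqF.
    by rewrite ler_peMl ?(ltW P0).
  have := linearize q0 q'0 qq A0 (ltW C0) K'0 jp e01 X0 _ H'; rewrite E1; apply.
  by rewrite addr_ge0.
have es := @exponential_sum R kap c D s e pos kap0 cp D_0 e0 _ _ J.
have {}es : \sum_(1 <= j < J.+1 | pos j) expR (- (s j + kap * ln j%:R - j%:R)) <= exp_sum_const kap c D.
  (* On the diagonal K' = 1/2 keeps the positive coefficient c on e j times j. Off the diagonal K' =
     K yields the quarter, and the term (q'/q) K e i times j, which has the wrong sign, goes into
     D. *)
  apply: es => [j j0 pj|i j i0 ij pi pj].
    have h2 : 0 < 2^-1 :> R by rewrite invr_gt0.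
    have := main j j _ j0 (leqnn j) pj pj h2; rewrite subrr addr0 mulr1 -/D1.
    rewrite (_ : q' / q * (1 - 2^-1) = c); last by rewrite /c; field; rewrite gt_eqF.
    rewrite /D /D0; move: qK; move: (q' / q * K) (q' * C * _) (c * _) (kap * _) => x1 x2 x3 x4; lra.
  have j0 := leq_trans i0 ij.
  have := main i j K i0 ij pi pj K0; rewrite KE.
  have ej : 0 <= e i * j%:R by rewrite mulr_ge0 ?ler0n.
  have T1 : q' / q * K * (e i * j%:R) <= D * (e i * j%:R).
    by rewrite ler_wpM2r// /D lerDr addr_ge0.
  have T2 : 0 <= q' / q * (e i * j%:R) by rewrite mulr_ge0// divr_ge0 ?(ltW q'0) ?(ltW q0).
  rewrite mulrBr mulr1 mulrBl; have : D0 <= D by rewrite /D -addrA lerDl addr_ge0.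
  rewrite /D0; move: T1 T2.
  move: (q' / q * K * _) (q' / q * (e i * _)) (D * (e i * _)) (q' * C * _) (kap * _) => x1 x2 x3 x4 x5; lra.
have -> : (\sum_(1 <= j < J.+1) (expR j%:R * j%:R `^ (- kap))%:E * mu (lvl u j) =
    (\sum_(1 <= j < J.+1) (expR j%:R * j%:R `^ (- kap)) * N j)%:E)%E.
  rewrite -sumEFin big_seq_cond [RHS]big_seq_cond; apply: eq_bigr => j /andP[]; rewrite mem_index_iota => /andP[j0 _] _.
  by have [-> _] := HN j j0; rewrite EFinM.
rewrite lee_fin [leRHS]mulrC; apply: (@le_trans _ _ (P * \sum_(1 <= j < J.+1 | pos j) expR (- (s j + kap * ln j%:R - j%:R)))); last by rewrite ler_wpM2l ?(ltW P0).
rewrite big_distrr/= [leRHS]big_mkcond/= big_seq_cond [leRHS]big_seq_cond.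
apply: ler_sum => j /andP[]; rewrite mem_index_iota => /andP[j0 _] _.
have [_ /andP[N0 _]] := HN j j0; have [pj|] := boolP (pos j); last first.
  by rewrite /pos -leNgt => Nj; have -> : N j = 0 by [apply/eqP; rewrite eq_le Nj]; rewrite mulr0.
have jp : 0 < j%:R :> R by rewrite ltr0n.
rewrite le_eqVlt; apply/orP; left; apply/eqP.
have -> : - (s j + kap * ln j%:R - j%:R) = j%:R + (- kap) * ln j%:R + - s j by ring.
have PN : 0 < P / N j := divr_gt0 P0 pj.
rewrite !expRD -[in RHS]ln_powR lnK ?posrE ?powR_gt0// /s expRN lnK ?posrE//.
by field; rewrite !gt_eqF.
Qed.

End level_sums.

(** * The two inequalities *)

Section adams_inequalities.
Context {R : realType} {n alpha : nat}.
Local Notation H := (heis R n).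
Local Notation mu := (heis_measure R n).
Local Notation Q := (hdim n).
Local Notation k := (alpha./2).
Variables (g : R -> R) (sigma : {measure set H -> \bar R}).
Hypotheses (halpha : ~~ odd alpha) (halpha0 : (0 < alpha < Q)%N).
Hypothesis hsigma : is_polar_measure sigma.
Hypothesis hg : is_fundamental n alpha g.
Implicit Types (u f : H -> R) (P : R).
Local Notation a := (alpha%:R : R).
Local Notation Qr := (Q%:R : R).
Local Notation A := (adams_const sigma alpha g).

Opaque Z sublap fundG Hker Kker adams_const.

Lemma measurable_expN N : measurable_fun setT (expN N : R -> R).
Proof.
apply: measurable_funB; first exact: measurable_expR.
by apply: measurable_sum => j; apply: measurable_funM => //; exact: measurable_funX.
Qed.

Let A0 : 0 < A. Proof. exact: adams_const_gt0 halpha0 hsigma hg. Qed.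

Lemma measurable_expN_u u N (s : R) : measurable_fun setT u ->
  measurable_fun setT (fun x => expN N (A^-1 * `|u x| `^ s)).
Proof.
move=> mu_; apply: (@measurableT_comp _ _ _ _ _ _ (expN N : R -> R)); first exact: measurable_expN.
by apply: measurable_funM => //; apply: measurable_powR_fun; exact: measurableT_comp.
Qed.

Lemma measurable_inv_weight u (s : R) : measurable_fun setT u ->
  measurable_fun setT (fun x => (1 + `|u x| `^ s)^-1).
Proof.
move=> mu_; have E : (fun x => (1 + `|u x| `^ s)^-1) = (fun x => (1 + `|u x| `^ s) `^ (-1)).
  by apply/funext => x; rewrite powR_inv1// addr_ge0 ?powR_ge0.
rewrite E; apply: measurable_powR_fun; apply: measurable_funD => //.
by apply: measurable_powR_fun; exact: measurableT_comp.
Qed.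

Section masmoudi.
Variables p q q' : R.
Hypotheses (p1 : 1 <= p) (hq : q = (Q%:R : R) / (alpha%:R : R)) (hq' : q' = (Q%:R : R) / ((Q%:R : R) - (alpha%:R : R))).
Local Notation kap := (p / q).

Let p0 : 0 < p. Proof. exact: lt_le_trans ltr01 p1. Qed.
Let q0 : 0 < q. Proof. by rewrite hq; exact: q_gt0 halpha0. Qed.
Let q'0 : 0 < q'. Proof. by rewrite hq'; exact: q'_gt0 halpha0. Qed.
Let kap0 : 0 <= kap. Proof. by rewrite divr_ge0 ?(ltW p0) ?(ltW q0). Qed.

Let coef (j : nat) : R := expR 1 * A `^ (- kap) * (expR j%:R * j%:R `^ (- kap)).

Let coef_ge0 j : 0 <= coef j.
Proof. by rewrite !mulr_ge0 ?expR_ge0 ?powR_ge0. Qed.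

Let lvlq := @lvl R n alpha g sigma q'.

(** With z = A^-1 |u|^q': for z < 1 the truncation leaves at most e z^(N+1), and the condition on N
    makes this at most a multiple of |u|^p. For z >= 1 the single term of the series at the integer
    part j of z suffices, since e^z <= e e^j and the weight is at least (A j)^(p/q). *)
Lemma expN_pointwise u N x : p / q' <= N.+1%:R ->
  ((expN N (A^-1 * `|u x| `^ q') / (1 + `|u x| `^ (p * (q' / q))))%:E <=
   (expR 1 * A `^ (- (p / q')) * `|u x| `^ p)%:E + \sum_(0 <= j <oo) ((coef j.+1)%:E * (\1_(lvlq u j.+1) x)%:E))%E.
Proof.
move=> pN; set z := A^-1 * `|u x| `^ q'.
have z0 : 0 <= z by rewrite mulr_ge0 ?powR_ge0// invr_ge0 ltW.
have w1 : 1 <= 1 + `|u x| `^ (p * (q' / q)) by rewrite lerDl powR_ge0.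
have w0 : 0 < 1 + `|u x| `^ (p * (q' / q)) by exact: lt_le_trans ltr01 w1.
have S0 j : (0 <= (coef j)%:E * (\1_(lvlq u j) x)%:E)%E by rewrite mule_ge0 ?lee_fin.
have SS : (0 <= \sum_(0 <= j <oo) ((coef j.+1)%:E * (\1_(lvlq u j.+1) x)%:E))%E by apply: nneseries_ge0.
have U0 : 0 <= expR 1 * A `^ (- (p / q')) * `|u x| `^ p by rewrite !mulr_ge0 ?expR_ge0 ?powR_ge0.
have [z1|z1] := ltP z 1.
  rewrite -[leLHS]adde0; apply: leeD => //; rewrite lee_fin ler_pdivrMr//.
  apply: (@le_trans _ _ (expR 1 * A `^ (- (p / q')) * `|u x| `^ p)); last by rewrite ler_peMr.
  have zE : A `^ (- (p / q')) * `|u x| `^ p = z `^ (p / q').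
    have Ai : 0 <= A^-1 by rewrite invr_ge0 ltW.
    rewrite /z (powRM _ Ai (powR_ge0 _ _)) -powRrM (_ : q' * (p / q') = p); last by field; rewrite gt_eqF.
    by congr (_ * _); rewrite -(powR_inv1 (ltW A0)) -powRrM mulN1r.
  rewrite -mulrA zE; apply: (le_trans (expN_le_pow N _)); first by rewrite z0 ltW.
  rewrite mulrC ler_wpM2l ?expR_ge0// -powR_mulrn//.
  have [->|zn0] := eqVneq z 0; first by rewrite !powR0// ?pnatr_eq0// gt_eqF// divr_gt0.
  by rewrite ger_powR// lt_neqAle eq_sym zn0 z0 ltW.
have := truncn_itv z0; set j := Num.truncn z => /andP[jz zj].
have j0 : (0 < j)%N by rewrite truncn_gt0.
have jp : 0 < j%:R :> R by rewrite ltr0n.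
have Aj : 0 < A * j%:R by exact: mulr_gt0.
have Au : A * j%:R <= `|u x| `^ q' by rewrite -ler_pdivlMl.
have uA : 0 < `|u x| `^ q' by exact: lt_le_trans Au.
have xl : x \in lvlq u j.
  apply/mem_set; rewrite /lvlq /lvl/=.
  have qi : 0 <= q'^-1 by rewrite invr_ge0 ltW.
  have := ge0_ler_powR qi (ltW Aj) (ltW uA) Au.
  by rewrite -powRrM divff ?gt_eqF// powRr1.
have Fj : expN N z / (1 + `|u x| `^ (p * (q' / q))) <= coef j.
  rewrite ler_pdivrMr//; apply: le_trans (expN_le_exp N z0) _.
  have e1 : expR z <= expR 1 * expR j%:R by rewrite -expRD ler_expR addrC natr1 ltW.
  apply: le_trans e1 _; rewrite /coef.
  have E : A `^ (- kap) * j%:R `^ (- kap) = ((A * j%:R) `^ kap)^-1.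
    by rewrite -(powRM _ (ltW A0) (ltW jp)) powRN.
  have -> : expR 1 * A `^ (- kap) * (expR j%:R * j%:R `^ (- kap)) * (1 + `|u x| `^ (p * (q' / q))) =
     expR 1 * expR j%:R * ((A `^ (- kap) * j%:R `^ (- kap)) * (1 + `|u x| `^ (p * (q' / q)))) by ring.
  rewrite E ler_peMr ?mulr_ge0 ?expR_ge0// mulrC ler_pdivlMr ?powR_gt0// mul1r.
  apply: le_trans (_ : `|u x| `^ (p * (q' / q)) <= _); last by rewrite lerDr.
  rewrite (_ : p * (q' / q) = q' * kap); last by ring.
  by rewrite [leRHS]powRrM; exact: (ge0_ler_powR kap0 (ltW Aj) (ltW uA) Au).
rewrite -[leLHS]add0e; apply: leeD; first by rewrite lee_fin.
apply: (@le_trans _ _ (\sum_(0 <= i < j) ((coef i.+1)%:E * (\1_(lvlq u i.+1) x)%:E))%E); last first.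
  exact: nneseries_lim_ge.
case: j j0 xl Fj {jz zj jp Aj Au} => // j _ xl Fj.
rewrite big_nat_recr//= indicE xl mule1 -[leLHS]add0e; apply: leeD; last by rewrite lee_fin.
exact: sume_ge0.
Qed.

(** P is any positive upper bound for the p-th power of the norm; this covers u of norm 0 by a
    limit. *)
Lemma masmoudi_bound : exists2 C, 0 < C & forall N u f P, p / q' <= N.+1%:R -> 0 < P ->
  measurable_fun setT u -> (\int[mu]_x (`|u x| `^ p)%:E <= P%:E)%E -> measurable_fun setT f ->
  (\int[mu]_x (`|f x| `^ q)%:E <= 1)%E -> weak_sublap k u f ->
  (\int[mu]_x (expN N (A^-1 * `|u x| `^ q') / (1 + `|u x| `^ (p * (q' / q))))%:E <= (C * P)%:E)%E.
Proof.
have [C C0 HC] := lvl_sum halpha halpha0 hsigma hg p1 hq hq'.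
pose c1 := expR 1 * A `^ (- (p / q')); pose c2 := expR 1 * A `^ (- kap).
have c10 : 0 <= c1 by rewrite mulr_ge0 ?expR_ge0 ?powR_ge0.
have c20 : 0 < c2 by rewrite mulr_gt0 ?expR_gt0 ?powR_gt0.
exists (c1 + c2 * C); first by rewrite ltr_wpDl// mulr_gt0.
move=> N u f P pN P0 mu_ uP mf f1 wu.
have ml j : measurable (lvlq u j) by exact: measurable_lvl.
have m1 (j : nat) : measurable_fun setT (fun x : H => ((coef j.+1)%:E * (\1_(lvlq u j.+1) x)%:E)%E).
  by apply: emeasurable_funM => //; apply/measurable_EFinP; exact: measurable_indic.
have S0 j x : (0 <= (coef j)%:E * (\1_(lvlq u j) x)%:E)%E by rewrite mule_ge0 ?lee_fin.
have mup : measurable_fun setT (fun x => (c1 * `|u x| `^ p)%:E).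
  apply/measurable_EFinP; apply: measurable_funM => //; apply: measurable_powR_fun; exact: measurableT_comp.
have mS : measurable_fun setT (fun x => \sum_(0 <= j <oo) ((coef j.+1)%:E * (\1_(lvlq u j.+1) x)%:E))%E.
  by apply: ge0_emeasurable_sum => // j x _ _; exact: S0.
have U0 x : 0 <= c1 * `|u x| `^ p by rewrite mulr_ge0 ?powR_ge0.
apply: (@le_trans _ _ (\int[mu]_x ((c1 * `|u x| `^ p)%:E + \sum_(0 <= j <oo) ((coef j.+1)%:E * (\1_(lvlq u j.+1) x)%:E)))%E).
  apply: ge0_le_integral => //.
  - move=> x _; rewrite lee_fin; have z0 : 0 <= A^-1 * `|u x| `^ q' by rewrite mulr_ge0 ?powR_ge0// invr_ge0 ltW.
    exact: (divr_ge0 (expN_ge0 N z0) (addr_ge0 ler01 (powR_ge0 _ _))).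
  - apply/measurable_EFinP; apply: measurable_funM; first exact: measurable_expN_u.
    exact: measurable_inv_weight.
  - exact: emeasurable_funD.
  - by move=> x _; exact: expN_pointwise.
rewrite ge0_integralD//; last 2 first.
- by move=> x _; rewrite lee_fin.
- by move=> x _; apply: nneseries_ge0.
rewrite mulrDl EFinD; apply: leeD.
  under eq_integral do rewrite EFinM.
  have mup0 : measurable_fun setT (fun x => (`|u x| `^ p)%:E).
    by apply/measurable_EFinP; apply: measurable_powR_fun; exact: measurableT_comp.
  rewrite ge0_integralZl ?lee_fin//.
  by rewrite [leRHS]EFinM; apply: lee_wpmul2l.
rewrite (integral_nneseries mu measurableT m1); last by move=> j x _; exact: S0.
apply: lime_le.
  by apply: is_cvg_nneseries => j _ _; apply: integral_ge0 => x _; exact: S0.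
apply: nearW => J; rewrite -mulrA EFinM; apply: (@le_trans _ _ (c2%:E * (\sum_(1 <= j < J.+1) (expR j%:R * j%:R `^ (- kap))%:E * mu (lvlq u j)))%E); last first.
  by apply: lee_wpmul2l; [rewrite lee_fin ltW|exact: HC wu J].
rewrite ge0_sume_distrr; last by move=> j _; rewrite mule_ge0 ?lee_fin ?mulr_ge0 ?expR_ge0 ?powR_ge0.
rewrite big_add1/= le_eqVlt; apply/orP; left; apply/eqP; apply: eq_bigr => j _.
rewrite ge0_integralZl//; last 2 first.
- by apply/measurable_EFinP; exact: measurable_indic.
- by rewrite lee_fin; exact: coef_ge0.
by rewrite integral_indic// setIT /coef EFinM muleA.
Qed.

End masmoudi.

Let hq : (Qr / a) = Qr / a. Proof. by []. Qed.
Let hq' : (Qr / (Qr - a)) = Qr / (Qr - a). Proof. by []. Qed.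

Lemma ceil_nat (x : R) : -1 < x -> x <= (`|Num.ceil x|%N)%:R.
Proof.
move=> x1; have c0 : 0 <= Num.ceil x by rewrite ceil_ge0.
apply: le_trans (ceil_ge x) _; rewrite -[X in X%:~R <= _](gez0_abs c0).
by rewrite -pmulrn.
Qed.

Lemma exponent_eq (p : R) : p * a / (Qr - a) = p * (Qr / (Qr - a) / (Qr / a)).
Proof.
have a0 := a_gt0 (R := R) halpha0; have aQ := aQ_lt (R := R) halpha0; have Q0 := Qr_gt0 (R := R) halpha0.
have d0 : Qr - a != 0 by rewrite subr_eq0 gt_eqF.
by move: a Qr a0 Q0 d0 {aQ} => s t s0 t0 d0; field; rewrite d0 !gt_eqF.
Qed.

Lemma masmoudi (p : R) : 1 <= p -> adams_ineq_masmoudi n alpha p A^-1.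
Proof.
move=> p1; have p0 := lt_le_trans ltr01 p1.
have q0 := q_gt0 (R := R) halpha0; have q1 := q_gt1 (R := R) halpha0; have q'0 := q'_gt0 (R := R) halpha0.
have [C C0 HC] := masmoudi_bound p1 hq hq'.
exists C => u f [up fq wu] f1.
have mu_ := Lfun_measurable up; have mf := Lfun_measurable fq.
have {}f1 : (\int[mu]_x (`|f x| `^ (Qr / a))%:E <= 1)%E.
  rewrite -LnormX// -(poweR1r (Qr / a)); apply: gt0_ler_poweR => //.
  - by rewrite in_itv/= leey Lnorm_ge0.
  - by rewrite in_itv/= leey lee01.
have [P P0 uP] := Lfun_fin p1 up; rewrite LnormX// uP exponent_eq.
set N := `|Num.ceil _|%N.
have pN : p / (Qr / (Qr - a)) <= N.+1%:R.
  rewrite -natr1 -lerBlDr invf_div; apply: ceil_nat; rewrite ltrBrDr addNr.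
  by rewrite mulr_gt0// divr_gt0 ?subr_gt0 ?aQ_lt// (Qr_gt0 halpha0).
move: P0; rewrite le_eqVlt => /orP[/eqP P0|P0]; last first.
  by rewrite -EFinM; apply: (HC N u f) => //; rewrite uP.
(* For u of norm 0 the estimate is applied with arbitrarily small P. *)
rewrite -P0 mule0; apply/lee_addgt0Pr => eps eps0; rewrite add0e.
have e0 : 0 < eps / C by rewrite divr_gt0.
have := HC N u f (eps / C) pN e0 mu_ _ mf f1 wu; rewrite uP -P0 => /(_ _)/le_trans; apply.
  by rewrite lee_fin ltW.
by rewrite mulrC divfK// gt_eqF.
Qed.

Lemma weak_sublap_scale (c : R) u f : locint u -> locint f -> weak_sublap k u f ->
  weak_sublap k (fun x => c * u x) (fun x => c * f x).
Proof.
move=> lu lf wu phi tphi; have tp := proj1 (test_functionP phi) tphi.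
transitivity (c * \int[mu]_x (u x * iter k sublap phi x)).
  rewrite -RintegralZl//; last by exact: locint_test (iter_sublap_test k tp).
  by apply: eq_Rintegral => x _; rewrite mulrA.
rewrite wu// -RintegralZl//; last exact: locint_test.
by apply: eq_Rintegral => x _; rewrite mulrA.
Qed.

Lemma powR_scale (c t s : R) : 0 <= c -> `|c * t| `^ s = c `^ s * `|t| `^ s.
Proof. by move=> c0; rewrite normrM (ger0_norm c0) powRM. Qed.

(** From (1 - t)^s <= e^(-s t) <= 1 / (1 + s t); this treats s < 1 and s > 1 alike. *)
Lemma one_sub_powR (s t : R) : 0 < s -> 0 <= t < 1 -> s * t / (1 + s) <= 1 - (1 - t) `^ s.
Proof.
move=> s0 /andP[t0 t1]; have t1' : 0 < 1 - t by rewrite subr_gt0.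
have st : 0 <= s * t by rewrite mulr_ge0// ltW.
have h1 : (1 - t) `^ s <= (1 + s * t)^-1.
  apply: (@le_trans _ _ (expR (- (s * t)))).
    have -> : - (s * t) = - t * s by ring.
    rewrite expRM; apply: (ge0_ler_powR (ltW s0) (ltW t1') (expR_ge0 _)).
    exact: expR_ge1Dx.
  rewrite expRN lef_pV2 ?posrE ?expR_gt0//; last by rewrite ltr_pwDl.
  exact: expR_ge1Dx.
have st1 : 0 < 1 + s * t by rewrite ltr_pwDl.
apply: (@le_trans _ _ (1 - (1 + s * t)^-1)); last by rewrite lerD2l lerN2.
have -> : 1 - (1 + s * t)^-1 = s * t / (1 + s * t) by field; rewrite gt_eqF.
have s1 : 0 < 1 + s by rewrite addr_gt0.
apply: ler_wpM2l => //; rewrite lef_pV2 ?posrE//.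
by rewrite lerD2l ler_piMr ?(ltW s0) ?(ltW t1).
Qed.

(** Let th be the q-th power of the norm of u. The rescaled v = (1 - th/2)^(-1/q) u still satisfies
    the constraint on L^k v, and the exponent of u is lam times that of v with 1 - lam at least a
    multiple of th. By [expN_absorb] this gap removes the weight at the cost of a factor O(1/th),
    while the first inequality for v supplies the factor 2 th; the two cancel. *)
Lemma ruf : adams_ineq_ruf n alpha A^-1.
Proof.
have q0 := q_gt0 (R := R) halpha0; have q1 := q_gt1 (R := R) halpha0; have q'0 := q'_gt0 (R := R) halpha0.
have qq := q_conj (R := R) halpha0.
have [C C0 HC] := masmoudi_bound (ltW q1) hq hq'.
rewrite /adams_ineq_ruf; move: (Qr / a) (Qr / (Qr - a)) q0 q1 q'0 qq HC => q q' q0 q1 q'0 qq HC.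
pose gam := q' / q; have g0 : 0 < gam by rewrite divr_gt0.
exists (4 * C * (1 + A) * (1 + gam) / gam) => u f [uq fq wu] uf.
have mu_ := Lfun_measurable uq; have mf := Lfun_measurable fq.
have [th th0 uE] := Lfun_fin (ltW q1) uq; have [ph ph0 fE] := Lfun_fin (ltW q1) fq.
move: uf; rewrite !LnormX// uE fE -EFinD lee_fin => uf.
set N := `|Num.ceil _|%N.
have qN : q / q' <= N.+1%:R.
  have -> : q / q' = q - 1.
    by have -> : q'^-1 = 1 - q^-1 by [rewrite -qq addrAC subrr add0r]; rewrite mulrBr mulr1 divff// gt_eqF.
  rewrite -natr1 -lerBlDr (_ : q - 1 - 1 = q - 2); last by ring.
  by apply: ceil_nat; rewrite ltrBrDr (_ : -1 + 2 = 1) //; ring.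
have K0 : 0 <= 4 * C * (1 + A) * (1 + gam) / gam.
  by rewrite !mulr_ge0 ?invr_ge0 ?addr_ge0 ?(ltW C0) ?(ltW A0) ?(ltW g0).
have mE := measurable_expN_u N q' mu_.
(* If u vanishes almost everywhere the integrand is [expN N 0], which is 0. *)
move: th0; rewrite le_eqVlt => /orP[/eqP th0|th0].
  have m0 : measurable_fun setT (fun x => (`|u x| `^ q)%:E).
    by apply/measurable_EFinP; apply: measurable_powR_fun; exact: measurableT_comp.
  have ae0 : ae_eq mu setT (fun x => (`|u x| `^ q)%:E) (cst 0%E).
    apply/(ae_eq_integral_abs mu measurableT m0).
    by under eq_integral do rewrite gee0_abs ?lee_fin ?powR_ge0//; rewrite uE -th0.
  rewrite (_ : \int[mu]_x _ = 0)%E ?lee_fin//.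
  rewrite -(integral0 mu [set: H]); apply: ae_eq_integral => //.
    exact/measurable_EFinP.
  apply: filterS ae0 => x /(_ I) /= [] /eqP; rewrite powR_eq0 => /andP[/eqP u0 _] _.
  by rewrite u0 powR0 ?gt_eqF// mulr0 expN0.
(* Half of th, so that t = 1 - tau stays at least 1/2 even when u uses the whole budget. *)
pose tau := th / 2; have tau0 : 0 < tau by rewrite divr_gt0.
have th1 : th <= 1 by rewrite (le_trans _ uf)// lerDl.
have tau1 : tau <= 2^-1 by rewrite /tau ler_piMl// invr_ge0.
have h2 : 2^-1 < 1 :> R by rewrite invf_lt1// ltr1n.
pose t := 1 - tau; have t0 : 0 < t by rewrite subr_gt0 (le_lt_trans tau1).
have t1 : t < 1 by rewrite gtrBl.
have t2 : 2^-1 <= t by rewrite /t; move: tau1; lra.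
pose c := t `^ (- q^-1); have c0 : 0 < c by rewrite powR_gt0.
pose v x := c * u x; pose h x := c * f x.
have cq : c `^ q = t^-1.
  by rewrite /c -powRrM mulNr mulVf ?gt_eqF// powR_inv1// ltW.
have mv : measurable_fun setT v by exact: measurable_funM.
have mh : measurable_fun setT h by exact: measurable_funM.
have scaleE (w : H -> R) (W : R) : measurable_fun setT w -> (\int[mu]_x (`|w x| `^ q)%:E = W%:E)%E ->
    (\int[mu]_x (`|c * w x| `^ q)%:E = (W / t)%:E)%E.
  move=> mw wE; under eq_integral do rewrite powR_scale ?(ltW c0)// EFinM.
  have mwq : measurable_fun setT (fun x => (`|w x| `^ q)%:E).
    by apply/measurable_EFinP; apply: measurable_powR_fun; exact: measurableT_comp.
  rewrite ge0_integralZl ?lee_fin ?powR_ge0//.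
  by rewrite wE cq -EFinM mulrC.
have lu : locint u by apply: (locint_powR (ltW q1) mu_ (P := th)); rewrite uE.
have lf : locint f by apply: (locint_powR (ltW q1) mf (P := ph)); rewrite fE.
have wv : weak_sublap k v h by exact: weak_sublap_scale.
have h1 : (\int[mu]_x (`|h x| `^ q)%:E <= 1)%E.
  rewrite (scaleE f ph)// lee_fin ler_pdivrMr// mul1r /t /tau; move: uf ph0 th0; lra.
have v1 : (\int[mu]_x (`|v x| `^ q)%:E <= (2 * th)%:E)%E.
  rewrite (scaleE u th)// lee_fin ler_pdivrMr// mulrAC ler_peMl ?(ltW th0)//; move: t2; lra.
have P0 : 0 < 2 * th by rewrite mulr_gt0.
have := HC N v h _ qN P0 mv v1 mh h1 wv.
pose lam := t `^ gam; have lam0 : 0 <= lam by exact: powR_ge0.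
have lamE : gam * tau / (1 + gam) <= 1 - lam by apply: one_sub_powR; rewrite // (ltW tau0)/=; move: tau1 h2; lra.
have g1 : 0 < 1 + gam by exact: addr_gt0.
have gt0' : 0 < gam * tau / (1 + gam) := divr_gt0 (mulr_gt0 g0 tau0) g1.
have lam1 : lam < 1 by rewrite -subr_gt0; exact: lt_le_trans lamE.
have uv x : A^-1 * `|u x| `^ q' = lam * (A^-1 * `|v x| `^ q').
  rewrite /v powR_scale ?(ltW c0)// /lam /c -powRrM mulrCA mulrA -[in RHS]mulrA; congr (_ * _).
  rewrite mulrA -powRD; last by apply/implyP => _; rewrite gt_eqF.
  by rewrite /gam mulNr [_^-1 * _]mulrC subrr powRr0 mul1r.
(* For p = q the weight is 1 + |v|^q', that is 1 + A times the exponent, which is the linear factor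
   that [expN_absorb] removes. *)
have qE : q * (q' / q) = q' by field; rewrite gt_eqF.
rewrite qE => HV.
pose M := (1 + A) / (1 - lam); have l1' : 0 < 1 - lam by exact: lt_le_trans lamE.
have M0 : 0 <= M := divr_ge0 (addr_ge0 ler01 (ltW A0)) (ltW l1').
have s0 x : 0 <= A^-1 * `|v x| `^ q' by rewrite mulr_ge0 ?powR_ge0// invr_ge0 ltW.
apply: (@le_trans _ _ (\int[mu]_x (M%:E * (expN N (A^-1 * `|v x| `^ q') / (1 + `|v x| `^ q'))%:E))%E).
  apply: ge0_le_integral => //.
  - by move=> x _; rewrite lee_fin uv expN_ge0//; exact: (mulr_ge0 lam0 (s0 x)).
  - exact/measurable_EFinP.
  - apply: emeasurable_funM => //; apply/measurable_EFinP; apply: measurable_funM; first exact: measurable_expN_u.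
    exact: measurable_inv_weight.
  move=> x _; rewrite -EFinM lee_fin uv [leRHS]mulrA ler_pdivlMr; last by rewrite ltr_pwDl// powR_ge0.
  have := @expN_absorb R N lam A _ _ (ltW A0) (s0 x); rewrite lam0 lam1 => /(_ isT).
  by rewrite (mulrA A) divff ?gt_eqF// mul1r.
have mW : measurable_fun setT (fun x => (expN N (A^-1 * `|v x| `^ q') / (1 + `|v x| `^ q'))%:E).
  by apply/measurable_EFinP; apply: measurable_funM; [exact: measurable_expN_u|exact: measurable_inv_weight].
rewrite ge0_integralZl//; last first.
  move=> x _; rewrite lee_fin.
  exact: (divr_ge0 (expN_ge0 N (s0 x)) (addr_ge0 ler01 (powR_ge0 _ _))).
apply: le_trans (lee_wpmul2l _ HV) _; first by rewrite lee_fin.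
rewrite -EFinM lee_fin /M.
have i1 : (1 - lam)^-1 <= (gam * tau / (1 + gam))^-1.
  by rewrite lef_pV2 ?posrE.
have A1 : 0 <= 1 + A by rewrite addr_ge0// ltW.
have -> : (1 + A) / (1 - lam) * (C * (2 * th)) = (1 + A) * C * (2 * th) * (1 - lam)^-1 by ring.
apply: le_trans (ler_wpM2l _ i1) _; first by rewrite !mulr_ge0 ?(ltW C0) ?(ltW th0).
rewrite /tau le_eqVlt; apply/orP; left; apply/eqP; field.
by rewrite !gt_eqF ?addr_gt0.
Qed.

End adams_inequalities.

(** * Sharpness *)

Section concentration.
Context {R : realType} {n alpha : nat}.
Local Notation H := (heis R n).
Local Notation mu := (heis_measure R n).
Local Notation Q := (hdim n).
Local Notation k := (alpha./2).
Variables (g : R -> R) (sigma : {measure set H -> \bar R}).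
Hypotheses (halpha : ~~ odd alpha) (halpha0 : (0 < alpha < Q)%N).
Hypothesis hsigma : is_polar_measure sigma.
Hypothesis hg : is_fundamental n alpha g.
Implicit Types (x y w v : H) (r : R) (u f b phi psi : H -> R).
Local Notation G := (@fundG R n alpha g).
Local Notation Hk := (@Hker R n alpha g).
Local Notation Kk := (@Kker R n alpha g).
Local Notation a := (alpha%:R : R).
Local Notation Qr := (Q%:R : R).
Local Notation q := (Qr / a).
Local Notation q' := (Qr / (Qr - a)).
Local Notation A := (adams_const sigma alpha g).

Opaque Z sublap fundG Hker Kker adams_const.

Lemma hmul_dil (s : R) x y : hmul (hdil s x) (hdil s y) = hdil s (hmul x y).
Proof.
apply: heis_eq.
  by rewrite /= !scalerDr.
by rewrite /= (sympZ s s) !mulrDr expr2.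
Qed.

Lemma hmax_dil (s : R) x : 0 <= s <= 1 -> hmax (hdil s x) <= s * hmax x.
Proof.
move=> /andP[s0 s1]; have m0 := hmax_ge0 x.
apply/(heis_norm_le _ (mulr_ge0 s0 m0)); split => [j|j|].
- by rewrite /= mxE normrM (ger0_norm s0) ler_wpM2l//; case: (coord_le_norm x j).
- by rewrite /= mxE normrM (ger0_norm s0) ler_wpM2l//; case: (coord_le_norm x j).
rewrite /= normrM (ger0_norm (sqr_ge0 s)) expr2 -mulrA ler_wpM2l//.
by rewrite (le_trans _ (coord2_le_norm x))// ler_piMl.
Qed.

(** On the compact unit sphere the continuity of y -> G(x^-1 y) at y = 0 is uniform in x, and
    dilations carry it to every x != 0. The second bound keeps x^-1 y where the truncated kernel
    agrees with G. *)
Lemma pole_continuity (eta : R) : 0 < eta -> exists2 delta, 0 < delta & forall x y, x != 0 ->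
  hnorm y <= delta * hnorm x ->
  `|G (hmul (- x) y) - G (- x)| <= eta * hnorm x `^ (a - Qr) /\ hnorm (hmul (- x) y) <= 2 * hnorm x.
Proof.
move=> eta0.
pose P (y x : H) := `|G (hmul (- x) y) - G (- x)| <= eta /\ hN4 (hmul (- x) y) < 2 ^+ 4.
have near0 : \forall y \near nbhs (0 : H), @hsphere R n `<=` P y.
  apply: (proj1 (compact_near_coveringP _) (@compact_hsphere R n)) => x x1.
  have x1' : hnorm x = 1 by [].
  have Nx0 : - x != 0 by rewrite oppr_eq0 -hnorm_gt0 x1'.
  have cO : continuous (fun p : H * H => - p.1).
    by move=> p; apply: (@continuous_comp _ _ _ fst (fun x : H => - x)); [exact: cvg_fst|exact: cont_oppH].
  have cm : continuous (fun p : H * H => hmul (- p.1) p.2).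
    by apply: (@cont_hmul2 R n (H * H)%type (fun p => - p.1) snd) => // p; exact: cvg_snd.
  have cG : {for (- x), continuous G}.
    by apply: (smooth_continuous (fundG_smooth hg)).
  have cGm : {for hmul (- x) 0, continuous G} by rewrite hmul0.
  have c1 : (fun p : H * H => G (hmul (- p.1) p.2)) @ ((x, 0) : H * H) --> G (hmul (- x) 0).
    exact: (@continuous_comp _ _ _ (fun p : H * H => hmul (- p.1) p.2) G (x, 0) (cm _) cGm).
  rewrite hmul0 in c1.
  have c2 : (fun p : H * H => G (- p.1)) @ ((x, 0) : H * H) --> G (- x).
    exact: (@continuous_comp _ _ _ (fun p : H * H => - p.1) G ((x, 0) : H * H) (cO _) cG).
  have c3 : (fun p : H * H => hN4 (hmul (- p.1) p.2)) @ ((x, 0) : H * H) --> hN4 (hmul (- x) 0).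
    have cN : {for hmul (- x) 0, continuous (@hN4 R n)} by exact: cont_hN4.
    exact: (@continuous_comp _ _ _ (fun p : H * H => hmul (- p.1) p.2) (@hN4 R n) (x, 0) (cm _) cN).
  rewrite hmul0 -hnorm4 hnormN x1' expr1n in c3.
  have F0 : Filter (nbhs ((x, 0) : H * H)) by exact: nbhs_filter.
  have c4 := cvgB c1 c2; rewrite (subrr (G (- x))) in c4.
  have n1 : \forall p \near nbhs ((x, 0) : H * H), `|G (hmul (- p.1) p.2) - G (- p.1)| <= eta.
    have c5 := proj1 (cvgrPdist_le _ _) (c4 F0) eta eta0.
    apply: (@filterS _ _ F0 _ _ _ (c5 F0)) => p /=; by rewrite sub0r normrN.
  have n2 : \forall p \near nbhs ((x, 0) : H * H), hN4 (hmul (- p.1) p.2) < 2 ^+ 4.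
    apply: (cvgr_lt _ c3); by rewrite -[X in X < _](expr1n _ 4) ltr_pXn2r ?nnegrE// ltr1n.
  by apply: filterS2 n1 n2 => p; split.
have /(nbhs_ballP (M := heis_normed))[e /= e0 He] := near0.
pose delta := Num.min 1 (e / 4); have d0 : 0 < delta by rewrite lt_min ltr01 divr_gt0.
have d1 : delta <= 1 by rewrite ge_min lexx.
have de : delta * 2 < e.
  apply: (@le_lt_trans _ _ (e / 4 * 2)); first by rewrite ler_wpM2r// ge_min lexx orbT.
  by rewrite -mulrA gtr_pMr//; lra.
exists delta => // x y x0 yx; have nx : 0 < hnorm x by rewrite hnorm_gt0.
pose s := hnorm x; pose x' := hdil s^-1 x; pose y' := hdil s^-1 y.
have si0 : 0 <= s^-1 by rewrite invr_ge0 ltW.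
have y'd : hnorm y' <= delta.
  by rewrite /y' hnorm_dil// mulrC ler_pdivrMr.
have y'e : hmax y' < e.
  apply: le_lt_trans de; rewrite -{1}(hdilK y' d0).
  apply: le_trans (hmax_dil _ _) _; first by rewrite ltW.
  rewrite ler_wpM2l ?(ltW d0)//; apply: le_trans (hmax_le_hN4 _) _.
  rewrite -[2]/(1 + 1) lerD2l -hnorm4 exprn_ile1 ?hnorm_ge0//.
  by rewrite hnorm_dil ?invr_ge0 ?(ltW d0)// mulrC ler_pdivrMr// mul1r.
have [] : P y' x'.
  apply: He; last exact: hdil_sphere.
  by rewrite -ball_normE /ball_/= sub0r normrN; exact: y'e.
have hdN (t : R) z : - hdil t z = hdil t (- z) :> H by apply: heis_eq; rewrite /= ?mulrN// -scalerN.
have -> : hmul (- x') y' = hdil s^-1 (hmul (- x) y) by rewrite /x' /y' hdN hmul_dil.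
have -> : - x' = hdil s^-1 (- x) by rewrite /x' hdN.
have s0 : 0 < s^-1 by rewrite invr_gt0.
rewrite !fundG_dil// -mulrBr normrM ger0_norm ?powR_ge0// hN4_dil => h1 h2; split.
  by move: h1; rewrite -powR_inv1 ?(ltW nx)// -powRrM mulN1r powRN mulrC ler_pdivrMr; last exact: powR_gt0.
move: h2; rewrite exprVn mulrC ltr_pdivrMr ?exprn_gt0// -exprMn => h2.
rewrite hnorm_le; first exact: ltW.
exact: mulr_ge0 (ler0n _ 2) (ltW nx).
Qed.
End concentration.

(** * Bounds for volumes and convolutions *)

Section convolution_bounds.
Context {R : realType} {n alpha : nat}.
Local Notation H := (heis R n).
Local Notation mu := (heis_measure R n).
Local Notation Q := (hdim n).
Local Notation k := (alpha./2).
Variables (g : R -> R) (sigma : {measure set H -> \bar R}).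
Hypotheses (halpha : ~~ odd alpha) (halpha0 : (0 < alpha < Q)%N).
Hypothesis hsigma : is_polar_measure sigma.
Hypothesis hg : is_fundamental n alpha g.
Implicit Types (x y w v : H) (r : R) (u f b h phi psi : H -> R).
Local Notation G := (@fundG R n alpha g).
Local Notation Hk := (@Hker R n alpha g).
Local Notation Kk := (@Kker R n alpha g).
Local Notation a := (alpha%:R : R).
Local Notation Qr := (Q%:R : R).
Local Notation q := (Qr / a).
Local Notation q' := (Qr / (Qr - a)).
Local Notation A := (adams_const sigma alpha g).

Opaque Z sublap fundG Hker Kker adams_const.

(** The sphere has positive mass: otherwise its integral A Q would vanish, against A > 0. *)
Lemma ball_volume_ge : exists2 c, 0 < c & forall r, 0 < r -> ((c * r ^+ Q)%:E <= mu (hball r))%E.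
Proof.
have A0 : 0 < A by exact: adams_const_gt0 halpha0 hsigma hg.
have s0 : 0 < sphere_area sigma.
  rewrite lt_neqAle sphere_area_ge0 andbT eq_sym; apply/eqP => s0.
  have := sphere_areaE hsigma; rewrite s0 => sE.
  have [E _] := sphere_integral halpha0 hsigma hg.
  have : (A * Qr)%:E = 0%E :> \bar R.
    rewrite -E; apply: null_set_integral => //; first exact: measurable_hsphere.
    apply: measurable_funTS; apply/measurable_EFinP; apply: measurable_funM.
      by apply: measurable_powR_fun; apply: measurableT_comp (measurable_fundG halpha0 hg).
    exact: measurable_hnorm_powR.
  by move=> [] /eqP; rewrite mulf_eq0 !gt_eqF ?(Qr_gt0 halpha0).
exists (Qr^-1 * sphere_area sigma); first by rewrite mulr_gt0// invr_gt0 (Qr_gt0 halpha0).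
move=> r r0; have := polar_powE hsigma r0 (hdim_gt0 (n := n)).
under eq_integral do rewrite subrr powRr0.
rewrite integral_cst ?mul1e; last exact: measurable_hshell.
have -> : Qr^-1 * sphere_area sigma * r ^+ Q = r ^+ Q / Qr * sphere_area sigma by ring.
move=> <-; apply: le_measure; rewrite ?inE//; [exact: measurable_hshell|exact: measurable_hball|].
by move=> x /=; rewrite in_itv/= => /andP[_ /ltW].
Qed.

(** With (1 + z)^s = 1 + tau, either t2 <= z t1 and the sum is at most (1 + z) t1, or t1 < t2 / z
    and it is at most (1 + 1/z) t2. A small perturbation thus costs a factor close to 1 on the main
    term. *)
Lemma powR_add_le (s tau : R) : 0 < s -> 0 < tau -> exists2 C, 0 < C &
  forall t1 t2 : R, 0 <= t1 -> 0 <= t2 -> (t1 + t2) `^ s <= (1 + tau) * t1 `^ s + C * t2 `^ s.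
Proof.
move=> s0 tau0; pose z := (1 + tau) `^ s^-1 - 1.
have z0 : 0 < z.
  have t0 : 0 <= 1 + tau by rewrite addr_ge0// ltW.
  have si : 0 < s^-1 by rewrite invr_gt0.
  by rewrite /z subr_gt0; have := @gt0_ltr_powR R s^-1 si 1 (1 + tau); rewrite powR1 !nnegrE ltrDl; apply.
have zE : (1 + z) `^ s = 1 + tau.
  by rewrite /z addrC subrK -powRrM mulVf ?gt_eqF// powRr1// addr_ge0// ltW.
have zi : 0 < 1 + z^-1 by rewrite addr_gt0// invr_gt0.
exists ((1 + z^-1) `^ s); first by rewrite powR_gt0.
move=> t1 t2 t10 t20; have z1 : 0 <= 1 + z by rewrite addr_ge0 ?(ltW z0).
rewrite -zE -(powRM _ z1 t10) -(powRM _ (ltW zi) t20).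
have m1 : 0 <= (1 + z) * t1 by exact: mulr_ge0.
have m2 : 0 <= (1 + z^-1) * t2 by exact: mulr_ge0 (ltW zi) _.
have [h|h] := leP t2 (z * t1).
  apply: ler_wpDr; first exact: powR_ge0.
  by rewrite ge0_ler_powR ?nnegrE ?(ltW s0) ?addr_ge0// mulrDl mul1r lerD2l.
apply: ler_wpDl; first exact: powR_ge0.
rewrite ge0_ler_powR ?nnegrE ?(ltW s0) ?addr_ge0// mulrDl mul1r addrC lerD2l.
by rewrite mulrC ler_pdivlMr// mulrC ltW.
Qed.

Lemma conv_abs_le psi h y : measurable_fun setT psi -> measurable_fun setT h ->
  (`|conv psi h y|%:E <= \int[mu]_x (`|psi x| * `|h (hmul (- x) y)|)%:E)%E.
Proof.
move=> mp mh; have mk : measurable_fun setT (fun x => h (hmul (- x) y)).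
  by have [mF _] := preserving_hmulNl y; exact: measurableT_comp.
rewrite convE//; apply: le_trans (abs_Rintegral_le _ _) _; first exact: measurable_funM.
by rewrite le_eqVlt; apply/orP; left; apply/eqP; apply: eq_integral => x _; rewrite normrM.
Qed.

Lemma conv_sup psi h (M J : R) y : measurable_fun setT psi -> measurable_fun setT h ->
  0 <= M -> (forall x, `|h x| <= M) -> (\int[mu]_x `|psi x|%:E <= J%:E)%E -> `|conv psi h y| <= M * J.
Proof.
move=> mp mh M0 hM pJ; have mk : measurable_fun setT (fun x => h (hmul (- x) y)).
  by have [mF _] := preserving_hmulNl y; exact: measurableT_comp.
have mp' := measurable_absE mp.
rewrite -lee_fin; apply: le_trans (conv_abs_le y mp mh) _.
rewrite EFinM; apply: le_trans (lee_wpmul2l _ pJ); last by rewrite lee_fin.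
rewrite -ge0_integralZl//; apply: ge0_le_integral => //.
- by apply/measurable_EFinP; apply: measurable_funM; exact: measurableT_comp.
- exact: emeasurable_funM.
- by move=> x _; rewrite -EFinM lee_fin mulrC ler_wpM2r.
Qed.

(** Hoelder's inequality with respect to the measure |h(x^-1 y)| dx, of mass at most K, then
    Tonelli's theorem. *)
Lemma young_conv psi h (s K L : R) : 1 < s -> 0 < K -> measurable_fun setT psi -> measurable_fun setT h ->
  (\int[mu]_x `|h x|%:E <= K%:E)%E -> (\int[mu]_x (`|psi x| `^ s)%:E <= L%:E)%E ->
  (\int[mu]_y (`|conv psi h y| `^ s)%:E <= (K `^ s * L)%:E)%E.
Proof.
move=> s1 K0 mp mh hK pL; have s0 := lt_trans ltr01 s1.
pose s' := (1 - s^-1)^-1.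
have si : s^-1 < 1 by rewrite invf_lt1.
have s'0 : 0 < s' by rewrite invr_gt0 subr_gt0.
have ss : s^-1 + s'^-1 = 1 by rewrite invrK addrC subrK.
pose W y := (\int[mu]_x (`|psi x| `^ s * `|h (hmul (- x) y)|)%:E)%E.
have mpn : measurable_fun setT (fun x => `|psi x|) by exact: measurableT_comp.
have mhn : measurable_fun setT (fun x => `|h x|) by exact: measurableT_comp.
have mps : measurable_fun setT (fun x => `|psi x| `^ s) by exact: measurable_powR_fun.
have mF : measurable_fun setT (fun p : H * H => (`|psi p.2| `^ s * `|h (hmul (- p.2) p.1)|)%:E).
  apply/measurable_EFinP; apply: measurable_funM.
    by apply: (measurableT_comp mps); exact: measurable_snd.
  have := measurable_kernel2 mhn => mk.
  by apply: (@measurableT_comp _ _ _ _ _ _ (fun p : H * H => `|h (hmul (- p.1) p.2)|) _ (fun p : H * H => (p.2, p.1))) => //; exact: measurable_swap.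
have F0 (p : H * H) : (0 <= (`|psi p.2| `^ s * `|h (hmul (- p.2) p.1)|)%:E)%E by rewrite lee_fin mulr_ge0// powR_ge0.
have mW : measurable_fun setT W by exact: (measurable_int1 mF).
have W0 y : (0 <= W y)%E by apply: integral_ge0 => x _; exact: (F0 (y, x)).
have pt y : ((`|conv psi h y| `^ s)%:E <= (K `^ (s - 1))%:E * W y)%E.
  have mk : measurable_fun setT (fun x => `|h (hmul (- x) y)|).
    by have [mF' _] := preserving_hmulNl y; exact: (measurableT_comp mhn mF').
  have [Wy|Wy] := eqVneq (W y) +oo%E.
    by rewrite Wy gt0_muley ?leey// lte_fin powR_gt0.
  have Wf : W y \is a fin_num by rewrite ge0_fin_numE// ltey.
  have X0 : 0 <= fine (W y) by rewrite fine_ge0.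
  pose a1 x := `|psi x| * `|h (hmul (- x) y)| `^ s^-1.
  pose b1 x := `|h (hmul (- x) y)| `^ s'^-1.
  have ma1 : measurable_fun setT a1 by apply: measurable_funM => //; exact: measurable_powR_fun.
  have mb1 : measurable_fun setT b1 by exact: measurable_powR_fun.
  have := @hoelder_le _ _ R mu s s' a1 b1 (fine (W y)) K s0 s'0 ss ma1 mb1.
  have a10 x : 0 <= a1 x by rewrite mulr_ge0// powR_ge0.
  have b10 x : 0 <= b1 x by exact: powR_ge0.
  move=> /(_ a10 b10 X0 (ltW K0)) hh.
  have {}hh : `|conv psi h y| <= fine (W y) `^ s^-1 * K `^ s'^-1.
    rewrite -lee_fin; apply: le_trans (conv_abs_le y mp mh) _.
    apply: le_trans (hh _ _).
    - rewrite le_eqVlt; apply/orP; left; apply/eqP; apply: eq_integral => x _; congr (_%:E).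
      rewrite /a1 /b1 -mulrA -powRD; last by rewrite ss oner_eq0.
      by rewrite ss powRr1.
    - rewrite fineK// le_eqVlt; apply/orP; left; apply/eqP; apply: eq_integral => x _; congr (_%:E).
      by rewrite /a1 powRM ?powR_ge0// -powRrM mulVf ?gt_eqF// powRr1.
    - apply: le_trans hK; rewrite -(integral_translatel y mhn (fun x => normr_ge0 _)).
      rewrite le_eqVlt; apply/orP; left; apply/eqP; apply: eq_integral => x _; congr (_%:E).
      by rewrite /b1 -powRrM mulVf ?gt_eqF// powRr1.
  rewrite -(fineK Wf) -EFinM lee_fin.
  apply: (@le_trans _ _ ((fine (W y) `^ s^-1 * K `^ s'^-1) `^ s)).
    by rewrite ge0_ler_powR ?nnegrE ?(ltW s0)// mulr_ge0 ?powR_ge0.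
  rewrite powRM ?powR_ge0// -!powRrM mulVf ?gt_eqF// powRr1// mulrC.
  by rewrite invrK mulrBl mul1r mulVf ?gt_eqF.
apply: (@le_trans _ _ (\int[mu]_y ((K `^ (s - 1))%:E * W y))%E).
  apply: ge0_le_integral => //.
  - by apply/measurable_EFinP; apply: measurable_powR_fun; apply: measurableT_comp => //; exact: measurable_conv.
  - exact: emeasurable_funM.
rewrite ge0_integralZl ?lee_fin ?powR_ge0//.
have WE : (\int[mu]_y W y = \int[mu]_x (`|psi x| `^ s)%:E * \int[mu]_w `|h w|%:E)%E.
  rewrite /W (heis_tonelli mF F0) muleC -ge0_integralZl//; last 2 first.
  - exact/measurable_EFinP.
  - by apply: integral_ge0.
  apply: eq_integral => x _ /=; rewrite muleC -(integral_translate x mhn (fun w => normr_ge0 _)).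
  rewrite -ge0_integralZl ?lee_fin ?powR_ge0//.
  by apply/measurable_EFinP; exact: (measurable_translate x mhn).
have -> : K `^ s * L = K `^ (s - 1) * (L * K).
  have -> : K `^ s = K `^ (s - 1) * K.
    by rewrite -{3}(powRr1 (ltW K0)) -powRD; [rewrite subrK|apply/implyP => _; rewrite gt_eqF].
  by ring.
rewrite EFinM lee_wpmul2l ?lee_fin ?powR_ge0// WE EFinM.
by apply: lee_pmul => //; apply: integral_ge0 => x _; rewrite lee_fin ?powR_ge0.
Qed.

End convolution_bounds.

(** * The extremal functions *)

Section extremal.
Context {R : realType} {n alpha : nat}.
Local Notation H := (heis R n).
Local Notation mu := (heis_measure R n).
Local Notation Q := (hdim n).
Local Notation k := (alpha./2).
Variables (g : R -> R) (sigma : {measure set H -> \bar R}).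
Hypotheses (halpha : ~~ odd alpha) (halpha0 : (0 < alpha < Q)%N).
Hypothesis hsigma : is_polar_measure sigma.
Hypothesis hg : is_fundamental n alpha g.
Implicit Types (x y w v : H) (r : R) (u f b h phi psi : H -> R).
Local Notation G := (@fundG R n alpha g).
Local Notation Hk := (@Hker R n alpha g).
Local Notation Kk := (@Kker R n alpha g).
Local Notation a := (alpha%:R : R).
Local Notation Qr := (Q%:R : R).
Local Notation q := (Qr / a).
Local Notation q' := (Qr / (Qr - a)).
Local Notation A := (adams_const sigma alpha g).

Opaque Z sublap fundG Hker Kker adams_const.

Let aQ0 : 0 < Qr - a. Proof. by rewrite subr_gt0 (aQ_lt halpha0). Qed.
Let q'10 : 0 < q' - 1. Proof. by rewrite subr_gt0 (q'_gt1 halpha0). Qed.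
Let q'0 : 0 < q'. Proof. exact: (q'_gt0 halpha0). Qed.
Let q0 : 0 < q. Proof. exact: (q_gt0 halpha0). Qed.

(* The extremal function of Hoelder's inequality for the pairing with the pole on a shell. *)
Definition dual_pole (eps rho : R) x : R := G (- x) * `|G (- x)| `^ (q' - 2) * \1_(hshell eps rho) x.

Lemma measurable_poleN : measurable_fun setT (fun x : H => G (- x)).
Proof.
apply: (@measurableT_comp _ _ _ _ _ _ G); first exact: (measurable_fundG halpha0 hg).
exact: measurable_opp_heis.
Qed.

Lemma measurable_dual_pole eps rho : measurable_fun setT (dual_pole eps rho).
Proof.
have mG := measurable_poleN.
apply: measurable_funM; last exact: measurable_indic (measurable_hshell _ _).
by apply: measurable_funM => //; apply: measurable_powR_fun; exact: measurableT_comp.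
Qed.

Lemma dual_pole_norm eps rho x : `|dual_pole eps rho x| = `|G (- x)| `^ (q' - 1) * \1_(hshell eps rho) x.
Proof.
rewrite /dual_pole; move: (G (- x)) => t; rewrite !normrM (ger0_norm (powR_ge0 _ _)); congr (_ * _); last first.
  by rewrite indicE normr_nat.
have [->|t0] := eqVneq t 0.
  by rewrite normr0 mul0r powR0// gt_eqF.
rewrite -{1}(powRr1 (normr_ge0 t)) -powRD; last by apply/implyP => _; rewrite normr_eq0.
by congr (_ `^ _); ring.
Qed.

Lemma dual_pole_mul eps rho x : dual_pole eps rho x * G (- x) = `|G (- x)| `^ q' * \1_(hshell eps rho) x.
Proof.
rewrite /dual_pole mulrAC; congr (_ * _).
have [G0|G0] := eqVneq (G (- x)) 0.
  by rewrite G0 !mul0r normr0 powR0// gt_eqF.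
have -> : G (- x) * `|G (- x)| `^ (q' - 2) * G (- x) = `|G (- x)| `^ 2%:R * `|G (- x)| `^ (q' - 2).
  by rewrite powR_mulrn// real_normK ?num_real//; ring.
rewrite -powRD; last by apply/implyP => _; rewrite normr_eq0.
by congr (_ `^ _); ring.
Qed.

(** Since (q' - 1) q = q', the q-th power and the product with the kernel in [dual_pole_mul] are the
    same function: the case of equality in Hoelder's inequality. *)
Lemma dual_pole_powR eps rho x : `|dual_pole eps rho x| `^ q = `|G (- x)| `^ q' * \1_(hshell eps rho) x.
Proof.
rewrite dual_pole_norm indicE; case: (_ \in _); last by rewrite !mulr0 powR0// gt_eqF.
rewrite !mulr1 -powRrM; congr (_ `^ _); field.
by rewrite (gt_eqF aQ0) (gt_eqF (a_gt0 halpha0)).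
Qed.

Lemma poleN_shell_integral eps rho : 0 < eps -> eps < rho ->
  (\int[mu]_x (`|G (- x)| `^ q' * \1_(hshell eps rho) x)%:E = (A * Qr * ln (rho / eps))%:E)%E.
Proof.
move=> e0 er; rewrite -(shell_integral halpha0 hsigma hg e0 er).
have mG := measurable_fundG halpha0 hg.
pose K (x : H) : R := `|G x| `^ q' * \1_(hshell eps rho) x.
have mK : measurable_fun setT (EFin \o K).
  apply/measurable_EFinP; apply: measurable_funM; last exact: measurable_indic (measurable_hshell _ _).
  by apply: measurable_powR_fun; exact: measurableT_comp.
have K0 x : (0 <= (EFin \o K) x)%E by rewrite lee_fin mulr_ge0 ?powR_ge0.
rewrite -[RHS](ge0_integral_preserving (f := EFin \o K) (@preserving_opp R n) mK K0).
apply: eq_integral => x _; congr ((_ * _)%:E); rewrite !indicE; congr (_%:R).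
by apply: congr1; apply/idP/idP => /set_mem h; apply/mem_set; move: h; rewrite /hshell/= hnormN.
Qed.

Lemma dual_pole_bound : exists2 C, 0 < C & forall eps rho x,
  `|dual_pole eps rho x| <= C * (hnorm x `^ (- a) * \1_(hshell eps rho) x).
Proof.
have [C C0 HC] := fundG_bound halpha0 hg.
exists (C `^ (q' - 1)); first by rewrite powR_gt0.
move=> eps rho x; rewrite dual_pole_norm mulrA ler_wpM2r//.
have -> : hnorm x `^ (- a) = (hnorm x `^ (a - Qr)) `^ (q' - 1).
  rewrite -powRrM; congr (_ `^ _); field; exact: lt0r_neq0 aQ0.
rewrite -powRM ?powR_ge0 ?(ltW C0)// ge0_ler_powR ?nnegrE ?(ltW q'10)//.
  by rewrite mulr_ge0 ?powR_ge0// ltW.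
by have := HC (- x); rewrite hnormN.
Qed.

Lemma bounded_bsupp_dual_pole eps rho : 0 < eps -> bounded_bsupp (dual_pole eps rho).
Proof.
move=> e0; have [C C0 HC] := dual_pole_bound; split; first exact: measurable_dual_pole.
  exists (C * eps `^ (- a)) => [|x]; first by rewrite mulr_gt0// powR_gt0.
  apply: le_trans (HC _ _ _) _; rewrite ler_wpM2l ?(ltW C0)// indicE.
  have [xs|_] := boolP (x \in hshell eps rho); last by rewrite mulr0 powR_ge0.
  move/set_mem: xs; rewrite /hshell/= in_itv/= mulr1 => /andP[ex _].
  have x0 := lt_trans e0 ex.
  rewrite (powRN (hnorm x)) (powRN eps) lef_pV2 ?posrE; [|exact: powR_gt0|exact: powR_gt0].
  exact: (ge0_ler_powR (ltW (a_gt0 halpha0)) (ltW e0) (ltW x0) (ltW ex)).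
apply: (@bsupp_hnorm _ _ rho) => x rx; rewrite /dual_pole indicE memNset ?mulr0//.
by rewrite /hshell/= in_itv/= => /andP[_]; rewrite ltNge rx.
Qed.

(** The function is of size |x|^-alpha, integrable at 0, so the bound does not depend on eps. This
    keeps the correction by [Kker] bounded while the energy of the family grows. *)
Lemma dual_pole_L1 : exists2 C, 0 < C & forall eps rho, 0 < eps -> 0 < rho ->
  (\int[mu]_x `|dual_pole eps rho x|%:E <= (C * rho ^+ (Q - alpha))%:E)%E.
Proof.
have [C C0 HC] := dual_pole_bound; have [_ aQ] := andP halpha0.
have [C1 C10 HC1] := pole_integral hsigma (m := Q - alpha) ltac:(by rewrite subn_gt0).
exists (C * C1); first exact: mulr_gt0.
move=> eps rho e0 r0; have mP : measurable_fun setT (fun x : H => (hnorm x `^ ((Q - alpha)%N%:R - Qr) * \1_(hshell 0 rho) x)%:E).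
  apply/measurable_EFinP; apply: measurable_funM; first exact: measurable_hnorm_powR.
  exact: measurable_indic (measurable_hshell _ _).
rewrite -mulrA EFinM; apply: le_trans (lee_wpmul2l _ (HC1 _ r0)); last by rewrite lee_fin ltW.
rewrite -ge0_integralZl//; last 2 first.
- by move=> x _; rewrite lee_fin mulr_ge0 ?powR_ge0.
- by rewrite lee_fin ltW.
apply: ge0_le_integral => //.
- by apply: measurable_absE; exact: measurable_dual_pole.
- exact: emeasurable_funM.
move=> x _; rewrite -EFinM lee_fin; apply: le_trans (HC _ _ _) _.
rewrite ler_wpM2l ?(ltW C0)// natrB ?(ltnW aQ)// (_ : Qr - a - Qr = - a); last by ring.
rewrite ler_wpM2l ?powR_ge0// !indicE; have [xs|//] := boolP (x \in hshell eps rho).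
move/set_mem: xs; rewrite /hshell/= in_itv/= => /andP[ex xr].
by rewrite mem_set//= in_itv/= (lt_trans e0 ex).
Qed.

Lemma conv_dual_pole0 (eps rho r : R) : 0 < eps -> eps < rho -> rho <= r ->
  conv (dual_pole eps rho) (Hk r) 0 = A * Qr * ln (rho / eps).
Proof.
move=> e0 er rr; have r0 : 0 < r by exact: lt_le_trans (lt_trans e0 er) rr.
rewrite convE; [|exact: measurable_dual_pole|exact: (measurable_Hker halpha0 hg)].
rewrite /Rintegral -[RHS]/(fine (A * Qr * ln (rho / eps))%:E) -(poleN_shell_integral e0 er).
congr fine; apply: eq_integral => x _; congr (_%:E); rewrite hmul0 -dual_pole_mul.
have [xs|xs] := boolP (x \in hshell eps rho); last first.
  by rewrite /dual_pole indicE (negbTE xs) !mulr0 !mul0r.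
congr (_ * _); apply: Hker_eq => //; rewrite hnormN.
by move/set_mem: xs; rewrite /hshell/= in_itv/= => /andP[_ /ltW /le_trans]; apply.
Qed.

(** By [pole_continuity] moving the point from 0 to y changes the integrand by at most C eta |x|^-Q,
    whose integral over the shell is again a multiple of ln(rho/eps). The condition 2 rho <= r keeps
    all arguments where [Hker r] is G. *)
Lemma conv_dual_pole_near (tau : R) : 0 < tau -> exists2 delta, 0 < delta &
  forall (eps rho r : R) y, 0 < eps -> eps < rho -> 2 * rho <= r -> hnorm y <= delta * eps ->
  `|conv (dual_pole eps rho) (Hk r) y - A * Qr * ln (rho / eps)| <= tau * (A * Qr * ln (rho / eps)).
Proof.
move=> tau0; have [C C0 HC] := dual_pole_bound.
have A0 : 0 < A by exact: adams_const_gt0 halpha0 hsigma hg.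
have AQ0 : 0 < A * Qr := mulr_gt0 A0 (Qr_gt0 halpha0).
have S0 := sphere_area_ge0 sigma.
(* Chosen so that C eta times the mass of the sphere is at most tau A Q; the added 1 avoids a
   division by 0. *)
pose eta := tau * (A * Qr) / (C * (sphere_area sigma + 1)).
have D0 : 0 < C * (sphere_area sigma + 1) by rewrite mulr_gt0// ltr_wpDl.
have eta0 : 0 < eta by rewrite divr_gt0// mulr_gt0.
have [delta d0 Hd] := pole_continuity hg eta0.
exists delta => // eps rho r y e0 er rr yd.
have rho0 := lt_trans e0 er.
have rhor : rho <= r by apply: le_trans rr; rewrite ler_peMl ?(ltW rho0)// ler1n.
have r0 : 0 < r := lt_le_trans rho0 rhor.
have mF := measurable_dual_pole eps rho; have mH := measurable_Hker halpha0 hg r.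
rewrite -[X in `|_ - X| <= _](conv_dual_pole0 e0 er rhor) !convE// -RintegralB//; last 2 first.
- by apply: conv_integrableE; [exact: bounded_bsupp_dual_pole|exact: (kernel_Hker halpha0 hsigma hg)].
- by apply: conv_integrableE; [exact: bounded_bsupp_dual_pole|exact: (kernel_Hker halpha0 hsigma hg)].
have mHy z : measurable_fun setT (fun x => Hk r (hmul (- x) z)).
  by have [mm _] := preserving_hmulNl z; exact: (measurableT_comp mH mm).
have mD z : measurable_fun setT (fun x => dual_pole eps rho x * Hk r (hmul (- x) z)).
  exact: (measurable_funM mF (mHy z)).
have mDD : measurable_fun setT (fun x => dual_pole eps rho x * Hk r (hmul (- x) y) - dual_pole eps rho x * Hk r (hmul (- x) 0)).
  exact: (measurable_funB (mD y) (mD 0)).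
have mS : measurable_fun setT (fun x : H => (hnorm x `^ (- Qr) * \1_(hshell eps rho) x)%:E).
  apply/measurable_EFinP; apply: measurable_funM; first exact: measurable_hnorm_powR.
  exact: measurable_indic (measurable_hshell _ _).
rewrite -lee_fin; apply: le_trans (abs_Rintegral_le mu mDD) _.
apply: (@le_trans _ _ (\int[mu]_x ((C * eta)%:E * (hnorm x `^ (- Qr) * \1_(hshell eps rho) x)%:E))%E).
  apply: ge0_le_integral => //.
  - exact: (measurable_absE mDD).
  - exact: emeasurable_funM.
  move=> x _; rewrite -EFinM lee_fin -mulrBr normrM hmul0.
  have [xs|xs] := boolP (x \in hshell eps rho); last first.
    by rewrite /dual_pole indicE (negbTE xs) !mulr0 normr0 mul0r.
  have := HC eps rho x; rewrite !indicE xs !mulr1.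
  move/set_mem: xs; rewrite /hshell/= in_itv/= => /andP[ex xr].
  have nx := lt_trans e0 ex; have x0 : x != 0 by rewrite -hnorm_gt0.
  have [h1 h2] := Hd x y x0 (le_trans yd (ler_wpM2l (ltW d0) (ltW ex))).
  rewrite !Hker_eq ?hnormN//; last 2 first.
  - by rewrite (le_trans (ltW xr)).
  - by rewrite (le_trans h2)// (le_trans _ rr)// ler_wpM2l// ltW.
  move=> hC; apply: (@le_trans _ _ (C * hnorm x `^ (- a) * (eta * hnorm x `^ (a - Qr)))).
    by apply: ler_pM.
  rewrite mulrACA -powRD; last by apply/implyP => _; rewrite gt_eqF.
  by rewrite addrA addNr add0r.
rewrite ge0_integralZl//; last 2 first.
- by move=> x _; rewrite lee_fin mulr_ge0 ?powR_ge0.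
- by rewrite lee_fin mulr_ge0 ?(ltW C0) ?(ltW eta0).
rewrite integral_indic_mul; last exact: measurable_hshell.
have := polar_shell hsigma (F := fun=> 1) e0 er; move=> /(_ _ _ _).
under eq_integral do rewrite mulr1.
move=> ->//.
rewrite integral_cst ?mul1e; last exact: measurable_hsphere.
rewrite (sphere_areaE hsigma) -!EFinM lee_fin.
have l0 : 0 <= ln (rho / eps) by rewrite ln_ge0// ler_pdivlMr// mul1r ltW.
have -> : C * eta * (ln (rho / eps) * sphere_area sigma) =
    tau * (A * Qr * ln (rho / eps)) * (sphere_area sigma / (sphere_area sigma + 1)).
  rewrite /eta; field; rewrite (gt_eqF C0)/= gt_eqF// ltr_wpDl//.
have s10 : 0 < sphere_area sigma + 1 by rewrite ltr_wpDl.
apply: ler_piMr; first exact: mulr_ge0 (ltW tau0) (mulr_ge0 (ltW AQ0) l0).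
by rewrite ler_pdivrMr// mul1r lerDl.
Qed.

End extremal.

(** * The concentrating family *)

Section concentrating_family.
Context {R : realType} {n alpha : nat}.
Local Notation H := (heis R n).
Local Notation mu := (heis_measure R n).
Local Notation Q := (hdim n).
Local Notation k := (alpha./2).
Variables (g : R -> R) (sigma : {measure set H -> \bar R}).
Hypotheses (halpha : ~~ odd alpha) (halpha0 : (0 < alpha < Q)%N).
Hypothesis hsigma : is_polar_measure sigma.
Hypothesis hg : is_fundamental n alpha g.
Implicit Types (x y w v : H) (r : R) (u f b h phi psi : H -> R).
Local Notation G := (@fundG R n alpha g).
Local Notation Hk := (@Hker R n alpha g).
Local Notation Kk := (@Kker R n alpha g).
Local Notation a := (alpha%:R : R).
Local Notation Qr := (Q%:R : R).
Local Notation q := (Qr / a).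
Local Notation q' := (Qr / (Qr - a)).
Local Notation A := (adams_const sigma alpha g).

Opaque Z sublap fundG Hker Kker adams_const.

Let aQ0 : 0 < Qr - a. Proof. by rewrite subr_gt0 (aQ_lt halpha0). Qed.
Let q1 : 1 < q. Proof. exact: (q_gt1 halpha0). Qed.
Let q0 : 0 < q. Proof. exact: (q_gt0 halpha0). Qed.
Let q'0 : 0 < q'. Proof. exact: (q'_gt0 halpha0). Qed.
Let A0 : 0 < A. Proof. exact: adams_const_gt0 halpha0 hsigma hg. Qed.
Let AQ0 : 0 < A * Qr. Proof. exact: mulr_gt0 A0 (Qr_gt0 halpha0). Qed.

Lemma hnorm_gt_hmax (t : R) x : 0 <= t -> 1 + t ^+ 4 < hmax x -> t < hnorm x.
Proof.
move=> t0 h; rewrite ltNge; apply: contraTN h => xt; rewrite -leNgt.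
by rewrite (le_trans (hmax_le_hN4 x))// lerD2l -hnorm_le.
Qed.

Lemma bounded_bsuppD u f : bounded_bsupp u -> bounded_bsupp f -> bounded_bsupp (fun x => u x + f x).
Proof.
move=> [mu_ [M M0 HM] su] [mf [N N0 HN] sf]; split; [exact: measurable_funD| |exact: bsuppD].
exists (M + N) => [|x]; first exact: addr_gt0.
by rewrite (le_trans (ler_normD _ _))// lerD.
Qed.

Lemma bounded_bsuppZ (c : R) u : bounded_bsupp u -> bounded_bsupp (fun x => c * u x).
Proof.
move=> [mu_ [M M0 HM] su]; split; [exact: measurable_funM| |exact: (bsuppMr (fun=> c) su)].
exists ((`|c| + 1) * M) => [|x]; first by rewrite mulr_gt0// ltr_wpDl.
by rewrite normrM ler_pM// lerDl.
Qed.

Lemma near_kernel_integral (kap : R) : 0 < kap -> exists r K, [/\ 0 < r, 0 < K <= kap &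
  (\int[mu]_x `|Hk r x|%:E <= K%:E)%E].
Proof.
move=> kap0; have [C C0 HC] := near_integral halpha0 hsigma hg.
pose s := Num.min 1 (kap / C).
have s0 : 0 < s by rewrite lt_min ltr01 divr_gt0.
have s1 : s <= 1 by rewrite ge_min lexx.
have [ap _] := andP halpha0.
exists (s / 2), (C * s ^+ alpha); split; first by rewrite divr_gt0.
- rewrite mulr_gt0 ?exprn_gt0//=; apply: (@le_trans _ _ (C * s)).
    rewrite ler_wpM2l ?(ltW C0)// -[X in _ <= X]expr1 ler_wiXn2l ?(ltW s0)//.
  by rewrite mulrC -ler_pdivlMr// ge_min lexx orbT.
apply: le_trans (HC _ s0); apply: ge0_le_integral => //.
- by apply: measurable_absE; exact: (measurable_Hker halpha0 hg).
- apply/measurable_EFinP; apply: measurable_funM; last exact: measurable_indic (measurable_hball _).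
  by apply: measurableT_comp => //; exact: (measurable_fundG halpha0 hg).
move=> x _; rewrite lee_fin indicE; have [_|] := boolP (x \in hball s); first by rewrite mulr1 Hker_le.
rewrite notin_setE /hball/= => /negP; rewrite -ltNge => xs.
rewrite Hker0 ?normr0 ?mulr0 ?divr_gt0//.
by rewrite mulrC divfK// ltW.
Qed.

(** The radius r is fixed by tau before L, small enough for the q-norm of u to be negligible. Hence
    c, D and the size Ro of the support do not depend on L, and only eps shrinks as L grows. *)
Lemma concentrating (tau : R) : 0 < tau <= 1 -> exists c D Ro, [/\ 0 < c, 0 <= D & forall L : R, 0 < L ->
  exists u f E, [/\ bounded_bsupp u /\ bounded_bsupp f, weak_sublap k u f,
    (\int[mu]_x (`|u x| `^ q)%:E + \int[mu]_x (`|f x| `^ q)%:E <= ((1 + 2 * tau) * L + D)%:E)%E,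
    (forall x, Ro < hmax x -> u x = 0) &
    [/\ measurable E, ((c * expR (- (L / A)))%:E <= mu E)%E &
        forall y, E y -> (1 - tau) * L <= u y <= (1 + tau) * L]]].
Proof.
move=> /andP[tau0 tau1].
have [r [K [r0 /andP[K0 Kt] HK]]] := near_kernel_integral tau0.
have [delta d0 Hd] := conv_dual_pole_near halpha0 hsigma hg tau0.
have [C1 C10 HC1] := dual_pole_L1 halpha0 hsigma hg.
have [C2 C20 HC2] := Kker_bound hg.
have [C3 C30 HC3] := powR_add_le q0 tau0.
have [cb cb0 Hcb] := ball_volume_ge halpha0 hsigma hg.
pose rho := r / 2; have rho0 : 0 < rho by rewrite divr_gt0.
have rhoE : 2 * rho = r by rewrite mulrC divfK.
have rhor : rho <= r by rewrite -rhoE ler_peMl ?(ltW rho0)// ler1n.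
pose MK := C2 * r `^ (- Qr); have MK0 : 0 <= MK by rewrite mulr_ge0 ?powR_ge0 ?(ltW C20).
pose J := MK * (C1 * rho ^+ (Q - alpha)).
have J0 : 0 <= J by rewrite mulr_ge0// mulr_ge0 ?exprn_ge0 ?(ltW C10) ?(ltW rho0).
pose s1 := 1 + rho ^+ 4; pose s2 := 1 + (2 * r) ^+ 4; pose s3 := 1 + (4 * r) ^+ 4.
pose Ro := `|s1| + `|s2| + 4 * n%:R * `|s1| * `|s2|.
pose R1 := `|s1| + `|s3| + 4 * n%:R * `|s1| * `|s3|.
pose V := fine (mu (cube R1)).
have VE : mu (cube R1) = V%:E by rewrite fineK// ge0_fin_numE// mu_cube_fin.
have V0 : 0 <= V by rewrite fine_ge0.
exists (cb * (delta * rho) ^+ Q), (C3 * (J `^ q * V)), Ro.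
split; [by rewrite mulr_gt0// exprn_gt0// mulr_gt0|by rewrite !mulr_ge0 ?powR_ge0 ?(ltW C30)|].
(* Solves A Q ln(rho/eps) = L. Then eps^Q = rho^Q e^(-L/A), which is the size of the set where u is
   close to L. *)
move=> L L0; pose eps := rho * expR (- (L / (A * Qr))).
have e0 : 0 < eps by rewrite mulr_gt0// expR_gt0.
have er : eps < rho by rewrite gtr_pMr// expR_lt1 oppr_lt0 divr_gt0.
have LE : A * Qr * ln (rho / eps) = L.
  have -> : rho / eps = expR (L / (A * Qr)).
    by rewrite /eps invfM mulrA divff ?gt_eqF// mul1r expRN invrK.
  by rewrite expRK mulrC divfK// gt_eqF.
pose F := @dual_pole R n alpha g eps rho.
have bF : bounded_bsupp F by exact: (bounded_bsupp_dual_pole halpha0 hg).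
have mF : measurable_fun setT F by case: bF.
have kH := kernel_Hker halpha0 hsigma hg r0; have kK := kernel_Kker hg r0.
have mH := kernel_meas kH; have mK := kernel_meas kK.
pose u := conv F (Hk r); pose f x := F x + conv F (Kk r) x.
have bu : bounded_bsupp u by exact: bounded_bsupp_conv.
have bK : bounded_bsupp (conv F (Kk r)) by exact: bounded_bsupp_conv.
have bf : bounded_bsupp f by exact: bounded_bsuppD.
have Fq : (\int[mu]_x (`|F x| `^ q)%:E = L%:E)%E.
  rewrite -LE -(poleN_shell_integral halpha0 hsigma hg e0 er).
  by apply: eq_integral => x _; rewrite (dual_pole_powR g halpha0).
have F0 x : s1 < hmax x -> F x = 0.
  move=> /(hnorm_gt_hmax (ltW rho0)) xr; rewrite /F /dual_pole indicE memNset ?mulr0//.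
  by rewrite /hshell/= in_itv/= => /andP[_]; rewrite ltNge (ltW xr).
exists u, f, (hball (delta * eps)); split.
- by [].
- exact: (weak_sublap_conv halpha halpha0 hsigma hg r0 bF).
- have -> : (1 + 2 * tau) * L + C3 * (J `^ q * V) = tau * L + ((1 + tau) * L + C3 * (J `^ q * V)) by ring.
  rewrite EFinD; apply: leeD.
    (* The q-th power of the norm of u is at most K^q L <= tau L, because K <= tau <= 1 and q >
       1. *)
    apply: le_trans (young_conv q1 K0 mF mH HK (L := L) _) _; first by rewrite Fq.
    rewrite lee_fin ler_wpM2r ?(ltW L0)// (le_trans _ Kt)//.
    by apply: (powR_le_self (ltW q1)); rewrite (ltW K0) (le_trans Kt).
  have mKq : measurable_fun setT (fun x => (`|conv F (Kk r) x| `^ q)%:E).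
    apply/measurable_EFinP; apply: measurable_powR_fun; apply: measurableT_comp => //.
    exact: measurable_conv.
  have mFq : measurable_fun setT (fun x => (`|F x| `^ q)%:E).
    by apply/measurable_EFinP; apply: measurable_powR_fun; exact: measurableT_comp.
  have t0 : 0 <= 1 + tau by rewrite addr_ge0// ltW.
  apply: (@le_trans _ _ (\int[mu]_x ((1 + tau)%:E * (`|F x| `^ q)%:E + C3%:E * (`|conv F (Kk r) x| `^ q)%:E))%E).
    apply: ge0_le_integral => //.
    - apply/measurable_EFinP; apply: measurable_powR_fun; apply: measurableT_comp => //; by case: bf.
    - by apply: emeasurable_funD; exact: emeasurable_funM.
    move=> x _; rewrite -!EFinM -EFinD lee_fin; apply: le_trans (HC3 _ _ _ _) => //.
    by rewrite ge0_ler_powR ?nnegrE ?(ltW q0) ?addr_ge0// ler_normD.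
  rewrite ge0_integralD//; last 4 first.
  - by move=> x _; rewrite -EFinM lee_fin mulr_ge0// powR_ge0.
  - exact: emeasurable_funM.
  - by move=> x _; rewrite -EFinM lee_fin mulr_ge0 ?powR_ge0 ?(ltW C30).
  - exact: emeasurable_funM.
  rewrite !ge0_integralZl ?lee_fin ?(ltW C30)//.
  rewrite Fq [X in (_ <= X)%E]EFinD; apply: leeD; first by rewrite EFinM.
  rewrite [X in (_ <= X)%E]EFinM; apply: lee_wpmul2l; first by rewrite lee_fin ltW.
  apply: (@le_trans _ _ (\int[mu]_x (J `^ q * \1_(cube R1) x)%:E)%E).
    apply: ge0_le_integral => //.
    - by apply/measurable_EFinP; apply: measurable_funM => //; exact: measurable_indic (measurable_cube _).
    move=> x _; rewrite lee_fin indicE; have [_|] := boolP (x \in cube R1).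
      rewrite mulr1 ge0_ler_powR ?nnegrE ?(ltW q0)//.
      apply: conv_sup => //; [by move=> y; exact: HC2|exact: HC1].
    rewrite notin_setE /cube/= => /negP; rewrite -ltNge => xR.
    rewrite (conv_eq0 F0 (s := s3) _ xR); first by rewrite normr0 powR0 ?gt_eqF// mulr0.
    move=> y ys; apply: Kker0 => //; apply: ltW; apply: hnorm_gt_hmax ys.
    by rewrite mulr_ge0// ltW.
  rewrite integral_indic_mul; last exact: measurable_cube.
  by rewrite integral_cst ?VE//; exact: measurable_cube.
- move=> x xR; apply: (conv_eq0 F0 (s := s2) _ xR) => y ys.
  by apply: Hker0 => //; apply: ltW; apply: hnorm_gt_hmax ys; rewrite mulr_ge0// ltW.
split; first exact: measurable_hball.
- have de0 : 0 < delta * eps by exact: mulr_gt0.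
  apply: le_trans (Hcb _ de0); rewrite lee_fin -mulrA ler_wpM2l ?(ltW cb0)//.
  have -> : delta * eps = delta * rho * expR (- (L / (A * Qr))) by rewrite /eps mulrA.
  rewrite [X in _ <= X]exprMn; apply: ler_wpM2l; first exact: exprn_ge0 _ (mulr_ge0 (ltW d0) (ltW rho0)).
  rewrite -expRM_natl ler_expR le_eqVlt; apply/orP; left; apply/eqP; field.
  by rewrite (gt_eqF A0) (gt_eqF (Qr_gt0 halpha0)).
move=> y yE; have := Hd eps rho r y e0 er; rewrite rhoE lexx LE => /(_ isT yE).
by rewrite ler_distl mulrBl mulrDl mul1r.
Qed.

End concentrating_family.

(** * Growth comparisons *)

Section growth.
Context {R : realType}.
Implicit Types (b gam K L lam m s t tau : R).

Lemma exp_beats_power gam b K L0 : 0 < gam -> 0 <= b -> 0 <= K ->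
  exists L, [/\ L0 <= L, 1 <= L & K * (1 + (2 * L) `^ b) < expR (gam * L)].
Proof.
move=> g0 b0 K0; pose m := Num.bound b; have bm : b <= m%:R by apply/ltW; exact: archi_boundP.
pose c := gam ^+ m.+1 / m.+1`!%:R; have c0 : 0 < c by rewrite divr_gt0 ?exprn_gt0// ltr0n fact_gt0.
pose L := Num.max (Num.max L0 1) (2 * K * 2 ^+ m / c).
have L1 : 1 <= L by rewrite !le_max lexx orbT.
have Lc : 2 * K * 2 ^+ m <= c * L by rewrite [c * L]mulrC -ler_pdivrMr// le_max lexx orbT.
exists L; split => //; first by rewrite !le_max lexx.
have L0' : 0 <= L by rewrite (le_trans ler01).
have L2 : 1 <= 2 * L by rewrite (le_trans L1)// ler_peMl// ler1n.
have P1 : (2 * L) `^ b <= (2 * L) ^+ m.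
  by rewrite -powR_mulrn ?mulr_ge0//; exact: ler_powR.
have P2 : 1 <= (2 * L) ^+ m by exact: exprn_ege1.
apply: (@le_lt_trans _ _ (K * (2 * (2 * L) ^+ m))).
  by apply: ler_wpM2l => //; move: P1 P2; lra.
have := @expR_ge1Dxn R (gam * L) m (mulr_ge0 (ltW g0) L0').
apply: lt_le_trans; rewrite ltr_pwDl//.
have -> : (gam * L) ^+ m.+1 / m.+1`!%:R = L ^+ m * (c * L) 
  by rewrite exprMn /c [L ^+ m.+1]exprSr; move: (gam ^+ m.+1) (m.+1`!%:R^-1) (L ^+ m) => x y z; ring.
have -> : K * (2 * (2 * L) ^+ m) = L ^+ m * (2 * K * 2 ^+ m) by rewrite exprMn; ring.
by rewrite ler_wpM2l// exprn_ge0.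
Qed.

Lemma near_one_powers m s t : 0 < m < 1 -> 0 < s -> 0 < t ->
  exists tau, [/\ 0 < tau <= 1, m <= (1 - tau) `^ s & (1 + 3 * tau) `^ t <= m^-1].
Proof.
move=> /andP[m0 m1] s0 t0; have mi : 1 < m^-1 by rewrite invf_gt1.
pose t1 := 1 - m `^ s^-1; pose t2 := ((m^-1) `^ t^-1 - 1) / 3.
have a1 : m `^ s^-1 < 1.
  by have := @gt0_ltr_powR R s^-1 _ m 1; rewrite powR1 !nnegrE invr_gt0 (ltW m0); apply.
have a2 : 1 < (m^-1) `^ t^-1.
  have := @gt0_ltr_powR R t^-1 _ 1 m^-1; rewrite powR1 !nnegrE invr_gt0 invr_ge0 (ltW m0); exact.
pose tau := Num.min t1 t2.
have le1 : tau <= t1 by rewrite ge_min lexx.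
have le2 : tau <= t2 by rewrite ge_min lexx orbT.
have tau0 : 0 < tau by rewrite lt_min subr_gt0 a1 divr_gt0// subr_gt0.
exists tau; split.
- by rewrite tau0 (le_trans le1)// gerBl powR_ge0.
- have h : m `^ s^-1 <= 1 - tau by rewrite lerBrDr -lerBrDl.
  have E : m = (m `^ s^-1) `^ s by rewrite -powRrM mulVf ?gt_eqF// powRr1// ltW.
  rewrite {1}E ge0_ler_powR ?nnegrE ?(ltW s0) ?powR_ge0//.
  by rewrite (le_trans (powR_ge0 _ _) h).
- have h : 1 + 3 * tau <= (m^-1) `^ t^-1.
    by rewrite -lerBrDl mulrC -ler_pdivlMr.
  have E : m^-1 = ((m^-1) `^ t^-1) `^ t by rewrite -powRrM mulVf ?gt_eqF// powRr1// invr_ge0 ltW.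
  rewrite [leRHS]E ge0_ler_powR ?nnegrE ?(ltW t0) ?powR_ge0//.
  by rewrite addr_ge0// mulr_ge0// ltW.
Qed.

(** For t > 1 the power is dominated by the single term of index M of the exponential series, which
    survives the truncation as N < M; smaller t are covered by the 1. *)
Lemma pow_le_expN (N M : nat) (a t s p : R) : 0 < a -> (N < M)%N -> 0 <= p <= s * M%:R -> 0 <= t ->
  t `^ p <= 1 + a ^+ M * M`!%:R * expN N (a^-1 * t `^ s).
Proof.
move=> a0 NM /andP[p0 ps] t0; set x := a^-1 * t `^ s.
have x0 : 0 <= x by rewrite mulr_ge0 ?powR_ge0// invr_ge0 ltW.
have aM : 0 <= a ^+ M * M`!%:R by rewrite mulr_ge0 ?exprn_ge0 ?(ltW a0).
have [t1|t1] := leP t 1.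
  rewrite ler_wpDr//; first exact: mulr_ge0 aM (expN_ge0 N x0).
  by have := @ge0_ler_powR R p p0 t 1; rewrite powR1 !nnegrE; apply.
rewrite ler_wpDl//; apply: (@le_trans _ _ (t `^ (s * M%:R))).
  by apply: ler_powR => //; exact: ltW.
have E : t `^ (s * M%:R) = a ^+ M * M`!%:R * (x ^+ M / M`!%:R).
  rewrite powRrM powR_mulrn ?powR_ge0// /x exprMn exprVn.
  have a0' : a ^+ M != 0 by rewrite expf_neq0// gt_eqF.
  have f0 : M`!%:R != 0 :> R by rewrite pnatr_eq0 -lt0n fact_gt0.
  by move: (a ^+ M) a0' => y y0; field; rewrite f0.
rewrite E; apply: ler_wpM2l => //.
apply: le_trans (expN_ge_sum N M.+1 x0); rewrite big_nat_recr//= lerDr.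
by apply: sumr_ge0 => j _; rewrite divr_ge0 ?exprn_ge0.
Qed.

End growth.

(** * Sharpness of both inequalities *)

Section sharpness.
Context {R : realType} {n alpha : nat}.
Local Notation H := (heis R n).
Local Notation mu := (heis_measure R n).
Local Notation Q := (hdim n).
Local Notation k := (alpha./2).
Variables (g : R -> R) (sigma : {measure set H -> \bar R}).
Hypotheses (halpha : ~~ odd alpha) (halpha0 : (0 < alpha < Q)%N).
Hypothesis hsigma : is_polar_measure sigma.
Hypothesis hg : is_fundamental n alpha g.
Implicit Types (x y : H) (r : R) (u f v h : H -> R).
Local Notation G := (@fundG R n alpha g).
Local Notation Hk := (@Hker R n alpha g).
Local Notation Kk := (@Kker R n alpha g).
Local Notation a := (alpha%:R : R).
Local Notation Qr := (Q%:R : R).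
Local Notation q := (Qr / a).
Local Notation q' := (Qr / (Qr - a)).
Local Notation A := (adams_const sigma alpha g).

Opaque Z sublap fundG Hker Kker adams_const.

Let aQ0 : 0 < Qr - a. Proof. by rewrite subr_gt0 (aQ_lt halpha0). Qed.
Let q1 : 1 < q. Proof. exact: (q_gt1 halpha0). Qed.
Let q0 : 0 < q. Proof. exact: (q_gt0 halpha0). Qed.
Let q'0 : 0 < q'. Proof. exact: (q'_gt0 halpha0). Qed.
Let A0 : 0 < A. Proof. exact: adams_const_gt0 halpha0 hsigma hg. Qed.

Lemma scaled_pair (Mq : R) u f : 0 < Mq -> bounded_bsupp u -> bounded_bsupp f -> weak_sublap k u f ->
  (\int[mu]_x (`|u x| `^ q)%:E + \int[mu]_x (`|f x| `^ q)%:E <= Mq%:E)%E ->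
  let s := Mq `^ (- q^-1) in
  [/\ bounded_bsupp (fun x => s * u x), bounded_bsupp (fun x => s * f x),
      weak_sublap k (fun x => s * u x) (fun x => s * f x) &
      (\int[mu]_x (`|s * u x| `^ q)%:E + \int[mu]_x (`|s * f x| `^ q)%:E <= 1)%E].
Proof.
move=> M0 bu bf wu ufM s; have s0 : 0 <= s by exact: powR_ge0.
have sq : s `^ q = Mq^-1 by rewrite /s -powRrM mulNr mulVf ?gt_eqF// powR_inv1// ltW.
split; [exact: bounded_bsuppZ|exact: bounded_bsuppZ| |].
  by apply: weak_sublap_scale => //; exact: bounded_bsupp_locint.
have E w : bounded_bsupp w -> (\int[mu]_x (`|s * w x| `^ q)%:E = (Mq^-1)%:E * \int[mu]_x (`|w x| `^ q)%:E)%E.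
  move=> [mw _ _]; have mwq : measurable_fun setT (fun x => (`|w x| `^ q)%:E).
    by apply/measurable_EFinP; apply: measurable_powR_fun; exact: measurableT_comp.
  rewrite -ge0_integralZl//; last by rewrite lee_fin invr_ge0 ltW.
  by apply: eq_integral => x _; rewrite powR_scale// sq EFinM.
rewrite !E// -ge0_muleDr; last 2 first.
- by apply: integral_ge0 => x _; rewrite lee_fin powR_ge0.
- by apply: integral_ge0 => x _; rewrite lee_fin powR_ge0.
apply: (@le_trans _ _ ((Mq^-1)%:E * Mq%:E)%E).
  by rewrite lee_wpmul2l// lee_fin invr_ge0 ltW.
by rewrite -EFinM mulVf ?gt_eqF.
Qed.

(** After normalisation |v|^q' is at least m^2 L on E: one factor m comes from the value of u, the
    other from the norm, and q' - q'/q = 1 produces the first power of L. As B m^2 = gam + 1/A with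
    gam > 0, the exponential beats the measure c e^(-L/A) of E by e^(gam L), which outgrows the
    polynomial weight. Ro comes before K, so all these functions live in one cube. *)
Lemma blow_up (B b : R) (N : nat) : A^-1 < B -> 0 <= b -> exists Ro, forall K : R, exists v h,
  [/\ bounded_bsupp v /\ bounded_bsupp h, weak_sublap k v h,
    (\int[mu]_x (`|v x| `^ q)%:E + \int[mu]_x (`|h x| `^ q)%:E <= 1)%E,
    (forall x, Ro < hmax x -> v x = 0) &
    (K%:E < \int[mu]_x (expN N (B * `|v x| `^ q') / (1 + `|v x| `^ b))%:E)%E].
Proof.
move=> AB b0; have Ai0 : 0 < A^-1 by rewrite invr_gt0.
have B0 : 0 < B := lt_trans Ai0 AB.
pose lam := A^-1 / B; have lam0 : 0 < lam by rewrite divr_gt0.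
have lam1 : lam < 1 by rewrite ltr_pdivrMr// mul1r.
(* Here m^2 - lam = ((1 - lam)/2)^2 > 0, so the loss m^2 still leaves B m^2 above 1/A. *)
pose m := (1 + lam) / 2.
have m01 : 0 < m < 1 by rewrite /m; apply/andP; split; lra.
have [m0 m1] := andP m01.
have m2 : lam < m * m.
  by have : 0 < (1 - lam) * (1 - lam) by [rewrite mulr_gt0// subr_gt0]; rewrite /m; lra.
pose gam := B * (m * m) - A^-1.
have g0 : 0 < gam by rewrite subr_gt0 mulrC -ltr_pdivrMr.
have [tau [/andP[tau0 tau1] mt1 mt2]] := near_one_powers m01 q'0 (divr_gt0 q'0 q0).
have [c [D [Ro [c0 D0 HL]]]] := concentrating halpha halpha0 hsigma hg (introT andP (conj tau0 tau1)).
exists Ro => K; pose Kp := `|K| + 1; have Kp0 : 0 < Kp by rewrite ltr_wpDl.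
(* L >= D / tau lets D be absorbed in (1 + 3 tau) L, and L >= 2 A (N + 1) makes the exponent large
   enough for [expN_ge]. *)
have [|L [LL L1 HLe]] := @exp_beats_power R gam b (2 * Kp / c) (Num.max (D / tau) (2 * A * N.+1%:R)) g0 b0.
  by rewrite divr_ge0 ?mulr_ge0 ?(ltW c0) ?(ltW Kp0).
move: LL; rewrite ge_max => /andP[LD LN].
have L0 : 0 < L := lt_le_trans ltr01 L1.
have [u [f [E [[bu bf] wu ufM u0 [mE Ec uE]]]]] := HL L L0.
pose Mq := (1 + 2 * tau) * L + D.
have Mq1 : 1 <= Mq.
  apply: (le_trans L1); apply: ler_wpDr => //; apply: ler_peMl; first exact: ltW.
  by rewrite lerDl mulr_ge0// ltW.
have Mq0 : 0 < Mq := lt_le_trans ltr01 Mq1.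
have MqL : Mq <= (1 + 3 * tau) * L.
  by move: LD; rewrite ler_pdivrMr// /Mq; lra.
have [bv bh wv vh1] := scaled_pair Mq0 bu bf wu ufM.
set s := Mq `^ (- q^-1) in bv bh wv vh1.
exists (fun x => s * u x), (fun x => s * f x); split => //.
  by move=> x xR; rewrite u0// mulr0.
have s0 : 0 < s by exact: powR_gt0.
have s1 : s <= 1.
  have -> : s = (Mq `^ q^-1)^-1 by rewrite /s powRN.
  rewrite invf_le1 ?powR_gt0//; have := @ge0_ler_powR R q^-1 _ 1 Mq.
  by rewrite powR1 !nnegrE invr_ge0 (ltW q0) (ltW Mq0); apply.
pose T := (gam + A^-1) * L.
have vE y : E y -> T <= B * `|s * u y| `^ q' /\ `|s * u y| <= 2 * L.
  move=> /uE /andP[u1 u2].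
  have u00 : 0 <= u y by rewrite (le_trans _ u1)// mulr_ge0 ?(ltW L0)// subr_ge0.
  rewrite ger0_norm; last by rewrite mulr_ge0// ltW.
  split; last first.
    apply: (@le_trans _ _ (u y)); first by rewrite ler_piMl.
    by apply: le_trans u2 _; rewrite ler_wpM2r ?(ltW L0)// lerD2l.
  have -> : T = B * (m * m * L) by rewrite /T /gam; ring.
  rewrite ler_wpM2l ?(ltW B0)// powRM ?(ltW s0)//.
  have S1 : m * L `^ (- (q' / q)) <= s `^ q'.
    rewrite /s -powRrM mulNr [q^-1 * _]mulrC powRN powRN.
    have Lp : 0 < L `^ (q' / q) by exact: powR_gt0.
    rewrite ler_pdivrMr// [leRHS]mulrC ler_pdivlMr ?powR_gt0//.
    apply: (@le_trans _ _ (m * ((1 + 3 * tau) * L) `^ (q' / q))).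
      apply: ler_wpM2l; first exact: ltW.
      exact: (ge0_ler_powR (divr_ge0 (ltW q'0) (ltW q0)) (ltW Mq0) (le_trans (ltW Mq0) MqL) MqL).
    rewrite powRM ?(ltW L0) ?addr_ge0 ?mulr_ge0 ?(ltW tau0)// mulrA.
    by rewrite ler_piMl ?(ltW Lp)// mulrC -ler_pdivlMr// mul1r.
  have S2 : m * L `^ q' <= u y `^ q'.
    apply: (@le_trans _ _ (((1 - tau) * L) `^ q')).
      by rewrite powRM ?subr_ge0 ?(ltW L0)// ler_wpM2r// powR_ge0.
    by rewrite ge0_ler_powR ?nnegrE ?(ltW q'0) ?mulr_ge0 ?subr_ge0 ?(ltW L0).
  have -> : m * m * L = (m * L `^ (- (q' / q))) * (m * L `^ q').
    rewrite [RHS]mulrACA -powRD; last by apply/implyP => _; rewrite gt_eqF.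
    have -> : - (q' / q) + q' = 1.
      by field; rewrite (gt_eqF aQ0) (gt_eqF (Qr_gt0 halpha0)) (gt_eqF (a_gt0 halpha0)).
    by rewrite powRr1// ltW.
  by apply: ler_pM => //; rewrite mulr_ge0 ?powR_ge0 ?(ltW m0).
pose w := expR T / 2 / (1 + (2 * L) `^ b).
have P1 : 0 < 1 + (2 * L) `^ b by rewrite ltr_pwDl// powR_ge0.
have w0 : 0 <= w by rewrite !divr_ge0 ?expR_ge0 ?(ltW P1).
have T0 : 0 <= T by rewrite mulr_ge0 ?(ltW L0)// addr_ge0 ?(ltW g0) ?(ltW Ai0).
have TN : 2 * N.+1%:R <= T.
  apply: (@le_trans _ _ (A^-1 * L)).
    by rewrite [leRHS]mulrC ler_pdivlMr// mulrAC.
  by rewrite ler_wpM2r ?(ltW L0)// lerDr ltW.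
have wle y : E y -> w <= expN N (B * `|s * u y| `^ q') / (1 + `|s * u y| `^ b).
  move=> /vE[v1 v2]; apply: ler_pM; rewrite ?divr_ge0 ?invr_ge0 ?expR_ge0 ?(ltW P1)//.
    have t0 := le_trans T0 v1.
    apply: le_trans (expN_ge t0 _); first by rewrite ler_wpM2r// ler_expR.
    apply: (@le_trans _ _ (expR 1 ^+ N.+1)).
      by rewrite lerXn2r ?nnegrE ?expR_ge0//; have := expR_ge1Dx (1 : R).
    by rewrite -expRM_natl mulr1 ler_expR ler_pdivlMr// mulrC (le_trans TN).
  have P2 : 0 < 1 + `|s * u y| `^ b by rewrite ltr_pwDl// powR_ge0.
  rewrite lef_pV2 ?posrE//.
  by rewrite lerD2l ge0_ler_powR ?nnegrE ?mulr_ge0 ?(ltW L0).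
have mv : measurable_fun setT (fun x => s * u x) by case: bv.
have mI : measurable_fun setT (fun x => expN N (B * `|s * u x| `^ q') / (1 + `|s * u x| `^ b)).
  apply: measurable_funM; last exact: measurable_inv_weight.
  apply: (@measurableT_comp _ _ _ _ _ _ (expN N : R -> R)); first exact: measurable_expN.
  by apply: measurable_funM => //; apply: measurable_powR_fun; exact: measurableT_comp.
have I0 x : 0 <= expN N (B * `|s * u x| `^ q') / (1 + `|s * u x| `^ b).
  by rewrite divr_ge0 ?expN_ge0 ?addr_ge0 ?mulr_ge0 ?powR_ge0 ?(ltW B0).
have IE := integral_ge_cst mu mE mI I0 w0 wle.
apply: (lt_le_trans _ IE).
apply: (@lt_le_trans _ _ (w%:E * (c * expR (- (L / A)))%:E)%E); last first.
  by rewrite lee_wpmul2l// lee_fin.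
rewrite -EFinM lte_fin (le_lt_trans (ler_norm K))//.
apply: (@lt_trans _ _ Kp); first by rewrite ltrDl.
have -> : w * (c * expR (- (L / A))) = c * expR (gam * L) / (2 * (1 + (2 * L) `^ b)).
  have -> : gam * L = T - L / A by rewrite /T; ring.
  by rewrite /w expRD; field; rewrite gt_eqF.
rewrite ltr_pdivlMr ?mulr_gt0// [ltRHS]mulrC -ltr_pdivrMr//.
by apply: le_lt_trans HLe; rewrite le_eqVlt; apply/orP; left; apply/eqP; ring.
Qed.

Lemma LnormE (p : R) u : ('N[mu]_p%:E [EFin \o u] = (\int[mu]_x (`|u x| `^ p)%:E) `^ p^-1)%E.
Proof.
rewrite unlock; congr (_ `^ _)%E; apply: eq_integral => x _ /=; exact: poweR_EFin.
Qed.

Lemma Lfun_bounded_bsupp (p : R) u : 1 <= p -> bounded_bsupp u -> u \in Lfun mu p%:E.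
Proof.
move=> p1 [mu_ [M M0 HM] [r ur]]; have p0 : 0 < p := lt_le_trans ltr01 p1.
apply/andP; split; first by rewrite inE.
rewrite inE /= /finite_norm LnormE; apply: poweR_lty.
apply: (@le_lt_trans _ _ (\int[mu]_x (M `^ p * \1_(cube r) x)%:E)%E).
  apply: ge0_le_integral => //.
  - by apply/measurable_EFinP; apply: measurable_powR_fun; exact: measurableT_comp.
  - by apply/measurable_EFinP; apply: measurable_funM => //; exact: measurable_indic (measurable_cube _).
  move=> x _; rewrite lee_fin indicE; have [_|] := boolP (x \in cube r).
    by rewrite mulr1 ge0_ler_powR ?nnegrE ?(ltW p0) ?(ltW M0).
  rewrite notin_setE /cube/= => /negP; rewrite -ltNge => /ur ->.
  by rewrite normr0 powR0 ?gt_eqF// mulr0.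
rewrite integral_indic_mul; last exact: measurable_cube.
rewrite integral_cst; last exact: measurable_cube.
by rewrite lte_mul_pinfty ?mu_cube_fin// lee_fin powR_ge0.
Qed.

Lemma sobolev_bounded_bsupp (p : R) v h : 1 <= p -> bounded_bsupp v -> bounded_bsupp h ->
  weak_sublap k v h -> sobolev k q p v h.
Proof.
by move=> p1 bv bh wv; split => //; apply: Lfun_bounded_bsupp => //; exact: ltW.
Qed.

Lemma ruf_sharp (B : R) : A^-1 < B -> ~ adams_ineq_ruf n alpha B.
Proof.
move=> AB [C HC].
(* With b = 0 the weight is at least 1, and dropping it only increases the integral. *)
have [Ro /(_ C)[v [h [[bv bh] wv vh1 _ Cv]]]] := blow_up `|Num.ceil (q - 2)|%N AB (lexx 0).
have := HC v h (sobolev_bounded_bsupp (ltW q1) bv bh wv).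
rewrite !LnormX// => /(_ vh1); apply/negP; rewrite -ltNge; apply: lt_le_trans Cv _.
have B0 : 0 < B by apply: lt_trans AB; rewrite invr_gt0.
have mv : measurable_fun setT v by case: bv.
have t0 x : 0 <= B * `|v x| `^ q' by rewrite mulr_ge0 ?powR_ge0 ?(ltW B0).
have mE : measurable_fun setT (fun x => expN `|Num.ceil (q - 2)|%N (B * `|v x| `^ q')).
  apply: (@measurableT_comp _ _ _ _ _ _ (expN _ : R -> R)); first exact: measurable_expN.
  by apply: measurable_funM => //; apply: measurable_powR_fun; exact: measurableT_comp.
apply: ge0_le_integral => //.
- by move=> x _; rewrite lee_fin divr_ge0 ?expN_ge0 ?addr_ge0 ?powR_ge0.
- by apply/measurable_EFinP; apply: measurable_funM => //; exact: measurable_inv_weight.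
- exact/measurable_EFinP.
move=> x _; rewrite lee_fin ler_pdivrMr ?ltr_pwDl ?powR_ge0//.
by rewrite ler_peMr ?expN_ge0// lerDl powR_ge0.
Qed.

(** A blow-up of the left side refutes the first inequality only if the p-norms stay bounded along
    the family. They do, by the second inequality at the admissible constant 1/A: |v|^p is at most 1
    plus a multiple of its integrand, and all the functions are supported in one fixed cube. *)
Lemma Lp_bound (p Ro : R) : 1 <= p -> exists2 C, 0 <= C & forall v h,
  bounded_bsupp v -> bounded_bsupp h -> weak_sublap k v h ->
  (\int[mu]_x (`|v x| `^ q)%:E + \int[mu]_x (`|h x| `^ q)%:E <= 1)%E ->
  (forall x, Ro < hmax x -> v x = 0) -> (\int[mu]_x (`|v x| `^ p)%:E <= C%:E)%E.
Proof.
move=> p1; have [C HC] := ruf halpha halpha0 hsigma hg.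
set N := `|Num.ceil _|%N in HC.
pose M := maxn N.+1 (Num.bound (p / q')).
have NM : (N < M)%N by rewrite leq_maxl.
have pM : 0 <= p <= q' * M%:R.
  rewrite (le_trans ler01 p1)/= mulrC -ler_pdivrMr//.
  apply: (@le_trans _ _ (Num.bound (p / q'))%:R); last by rewrite ler_nat leq_maxr.
  by apply/ltW/archi_boundP; rewrite divr_ge0 ?(ltW q'0)// (le_trans ler01).
pose V := fine (mu (cube Ro)).
have VE : mu (cube Ro) = V%:E by rewrite fineK// ge0_fin_numE// mu_cube_fin.
have V0 : 0 <= V by rewrite fine_ge0.
pose c := A ^+ M * M`!%:R; have c0 : 0 <= c by rewrite mulr_ge0 ?exprn_ge0// ltW.
exists (V + c * `|C|) => [|v h bv bh wv vh1 v0]; first by rewrite addr_ge0// mulr_ge0.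
have HI := HC v h (sobolev_bounded_bsupp (ltW q1) bv bh wv).
rewrite !LnormX// in HI; have {}HI := HI vh1.
have mv : measurable_fun setT v by case: bv.
have mE : measurable_fun setT (fun x => (expN N (A^-1 * `|v x| `^ q'))%:E).
  by apply/measurable_EFinP; exact: measurable_expN_u.
have m1 : measurable_fun setT (fun x : H => (\1_(cube Ro) x : R)%:E).
  by apply/measurable_EFinP; exact: measurable_indic (measurable_cube _).
have E0 x : 0 <= expN N (A^-1 * `|v x| `^ q').
  by rewrite expN_ge0// mulr_ge0 ?powR_ge0// invr_ge0 ltW.
apply: (@le_trans _ _ (\int[mu]_x ((\1_(cube Ro) x)%:E + c%:E * (expN N (A^-1 * `|v x| `^ q'))%:E))%E).
  apply: ge0_le_integral => //.
  - by apply/measurable_EFinP; apply: measurable_powR_fun; exact: measurableT_comp.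
  - by apply: emeasurable_funD => //; exact: emeasurable_funM.
  move=> x _; rewrite -EFinM -EFinD lee_fin indicE; have [_|] := boolP (x \in cube Ro).
    exact: pow_le_expN.
  rewrite notin_setE /cube/= => /negP; rewrite -ltNge => /v0 ->.
  rewrite normr0 powR0 ?gt_eqF// ?(lt_le_trans ltr01)// add0r powR0 ?gt_eqF// mulr0 expN0.
  by rewrite mulr0.
rewrite ge0_integralD//; last 2 first.
- by move=> x _; rewrite -EFinM lee_fin mulr_ge0.
- exact: emeasurable_funM.
rewrite ge0_integralZl//; last by move=> x _; rewrite lee_fin.
rewrite integral_indic ?setIT ?VE//; last exact: measurable_cube.
rewrite EFinD; apply: leeD => //; rewrite [leRHS]EFinM; apply: lee_wpmul2l; first by rewrite lee_fin.
by apply: le_trans HI _; rewrite lee_fin ler_norm.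
Qed.

Lemma masmoudi_sharp (p B : R) : 1 <= p -> A^-1 < B -> ~ adams_ineq_masmoudi n alpha p B.
Proof.
move=> p1 AB [C HC].
have b0 : 0 <= p * a / (Qr - a).
  exact: divr_ge0 (mulr_ge0 (le_trans ler01 p1) (ler0n _ _)) (ltW aQ0).
have [Ro HRo] := blow_up `|Num.ceil (p * ((Qr - a) / Qr) - 1)|%N AB b0.
have [C' C'0 HC'] := Lp_bound Ro p1.
have [v [h [[bv bh] wv vh1 v0 Cv]]] := HRo (`|C| * C').
have p0 : 0 < p := lt_le_trans ltr01 p1.
have h1 : ('N[mu]_q%:E [EFin \o h] <= 1)%E.
  have hq : (\int[mu]_x (`|h x| `^ q)%:E <= 1)%E.
    by apply: le_trans vh1; rewrite leeDr//; apply: integral_ge0 => x _; rewrite lee_fin powR_ge0.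
  have qi : 0 <= q^-1 by rewrite invr_ge0 ltW.
  rewrite LnormE; have := @gt0_ler_poweR R q^-1 qi (\int[mu]_x (`|h x| `^ q)%:E)%E 1%E.
  rewrite poweR1r; apply=> //.
  - by rewrite in_itv/= leey integral_ge0// => x _; rewrite lee_fin powR_ge0.
  - by rewrite in_itv/= leey lee01.
have := HC v h (sobolev_bounded_bsupp p1 bv bh wv) h1.
apply/negP; rewrite -ltNge LnormX//; apply: le_lt_trans Cv.
rewrite EFinM; apply: (@le_trans _ _ (`|C|%:E * \int[mu]_x (`|v x| `^ p)%:E)%E).
  by rewrite lee_wpmul2r ?lee_fin ?ler_norm// integral_ge0// => x _; rewrite lee_fin powR_ge0.
by rewrite lee_wpmul2l ?lee_fin//; exact: HC' vh1 v0.
Qed.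

End sharpness.

Theorem theorem5 (R : realType) (n alpha : nat) (p : R) (g : R -> R)
    (sigma : {measure set (heis R n) -> \bar R})
    (hn : (0 < n)%N) (halpha : ~~ odd alpha) (halpha0 : (0 < alpha < hdim n)%N)
    (hp : 1 <= p) (hsigma : is_polar_measure sigma)
    (hg : is_fundamental n alpha g) :
  let A := adams_const sigma alpha g in
  [/\ adams_ineq_masmoudi n alpha p A^-1,
      adams_ineq_ruf n alpha A^-1,
      forall B : R, A^-1 < B -> ~ adams_ineq_masmoudi n alpha p B &
      forall B : R, A^-1 < B -> ~ adams_ineq_ruf n alpha B].
Proof.
split.
- exact: masmoudi halpha halpha0 hsigma hg _ hp.
- exact: ruf halpha halpha0 hsigma hg.
- by move=> B AB; exact: masmoudi_sharp halpha halpha0 hsigma hg _ _ hp AB.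
- by move=> B AB; exact: ruf_sharp halpha halpha0 hsigma hg _ AB.
Qed.
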